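(* Let $\lambda,\kappa\in\mathbb{R}$. For any given initial data of the regularity $\psi(0,x)=\psi_0(x)\in H^1(\mathbb{R},\Sigma\mathbb{R}^{1,1})$ the equation of the Thirring model $$iD\psi=\lambda\psi+\kappa\big(\langle\psi,\partial_t\cdot\psi\rangle\,\partial_t\cdot\psi-\langle\psi,\partial_x\cdot\psi\rangle\,\partial_x\cdot\psi\big)$$ admits a global weak solution in $H^1(\mathbb{R}^{1,1},\Sigma\mathbb{R}^{1,1})$, which is uniquely determined by the initial data.
   Context: $\mathbb{R}^{1,1}$ is two-dimensional Minkowski space with global coordinates $(t,x)$ and metric $g$ of signature $(+,-)$. $\Sigma\mathbb{R}^{1,1}$ is its spinor bundle, with metric connection $\nabla$ and a Hermitian, indefinite scalar product $\langle\cdot,\cdot\rangle$, linear in the first and anti-linear in the second slot. Clifford multiplication $X\cdot\psi$ satisfies $\langle X\cdot\xi,\psi\rangle=\langle\xi,X\cdot\psi\rangle$ and $X\cdot Y\cdot\psi+Y\cdot X\cdot\psi=-2g(X,Y)\psi$. The scalar product $\langle\partial_t\cdot\,,\,\rangle$ is taken to be positive definite, with norm $|\psi|_\beta^2:=\langle\partial_t\cdot\psi,\psi\rangle$, and this norm is used for the energy estimates. The Dirac operator is $D=\partial_t\cdot\nabla_{\partial_t}-\partial_x\cdot\nabla_{\partial_x}$.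
   Formalization: The Clifford relation is taken as X·Y·ψ+Y·X·ψ=+2g(X,Y)ψ, since the stated sign contradicts positivity of ⟨∂_t·,⟩; and H^1(R^{1,1}) is read as H^1 on every slab (-T,T)×R, since conservation of the L^2 norm excludes nonzero solutions in L^2 of the whole plane. *)

(* Defs.v *)
From HB Require Import structures.
From mathcomp Require Import all_boot all_order all_algebra.
From mathcomp.real_closed Require Import complex.
From mathcomp Require Import all_classical all_reals all_analysis.
From mathcomp Require Import ring lra.

Set Implicit Arguments.
Unset Strict Implicit.
Unset Printing Implicit Defensive.

Import Order.TTheory GRing.Theory Num.Theory.
Import numFieldNormedType.Exports.

Local Open Scope classical_set_scope.
Local Open Scope complex_scope.
Local Open Scope ring_scope.

(** * Minkowski space and spinors *)

(* A point, or a tangent vector, of R^{1,1} is a pair (t, x). *)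
Definition dt {R : realType} : R * R := (1, 0).
Definition dx {R : realType} : R * R := (0, 1).

Definition lorentz {R : realType} (X Y : R * R) : R :=
  X.1 * Y.1 - X.2 * Y.2.

(* The spinor bundle is trivialised by a parallel frame, so that spinor fields
   are functions into C^2, the connection is the componentwise derivative, and
   Clifford multiplication and the scalar product are constant. *)
Notation spinor R := 'cV[R[i]]_2.

(* Sign of [cmul_clifford]: for the signature (+,-), a Hermitian scalar product
   for which Clifford multiplication is symmetric, and positivity of
   <dt . , >, the relation X.Y + Y.X = -2 g(X,Y) cannot hold, see
   [clifford_opposite_sign] below.  The sign used here is the one that makes
   these requirements compatible; then D is Dirac's operator, with D^2 equal to
   the wave operator, and <dx.xi, dx.xi> = - <xi, xi>, so that the scalar
   product is indefinite. *)
Record spinorStructure (R : realType) := SpinorStructure {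
  sprod : spinor R -> spinor R -> R[i] ;
  cmul : R * R -> spinor R -> spinor R ;
  sprod_linear : forall (a : R[i]) (xi eta psi : spinor R),
    sprod (a *: xi + eta) psi = a * sprod xi psi + sprod eta psi ;
  sprod_herm : forall xi psi : spinor R, sprod psi xi = ((sprod xi psi)^*)%C ;
  cmul_linear_vector : forall (a : R) (X Y : R * R) (psi : spinor R),
    cmul (a *: X + Y) psi = a%:C *: cmul X psi + cmul Y psi ;
  cmul_linear : forall (X : R * R) (a : R[i]) (xi psi : spinor R),
    cmul X (a *: xi + psi) = a *: cmul X xi + cmul X psi ;
  cmul_sym : forall (X : R * R) (xi psi : spinor R),
    sprod (cmul X xi) psi = sprod xi (cmul X psi) ;
  cmul_clifford : forall (X Y : R * R) (psi : spinor R),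
    cmul X (cmul Y psi) + cmul Y (cmul X psi) =
      (2 * lorentz X Y)%:C *: psi ;
  sprod_dt_gt0 : forall psi : spinor R, psi != 0 -> 0 < sprod (cmul dt psi) psi
}.

Definition betanorm2 {R : realType} (S : spinorStructure R) (psi : spinor R) :
    R :=
  complex.Re (sprod S (cmul S dt psi) psi).

Lemma clifford_opposite_sign (R : realType)
    (sp : spinor R -> spinor R -> R[i]) (cm : R * R -> spinor R -> spinor R) :
  (forall (a : R[i]) (xi eta psi : spinor R),
    sp (a *: xi + eta) psi = a * sp xi psi + sp eta psi) ->
  (forall X xi psi, sp (cm X xi) psi = sp xi (cm X psi)) ->
  (forall psi : spinor R, psi != 0 -> 0 < sp (cm dt psi) psi) ->
  ~ (forall X Y psi, cm X (cm Y psi) + cm Y (cm X psi) =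
       - (2 * lorentz X Y)%:C *: psi).
Proof.
move=> spl csym pos cliff.
have sp0 psi : sp 0 psi = 0.
  have := spl 1 0 0 psi; rewrite scale1r addr0 mul1r => /eqP.
  by rewrite -subr_eq subrr => /eqP.
have spZ a xi psi : sp (a *: xi) psi = a * sp xi psi.
  by have := spl a xi 0 psi; rewrite addr0 sp0 addr0.
pose e : spinor R := const_mx 1.
have e0 : e != 0.
  by apply/eqP => /matrixP /(_ 0 0); rewrite !mxE => /eqP; rewrite oner_eq0.
have sqE : cm dt (cm dt e) = - e.
  have := cliff dt dt e; rewrite /lorentz /= mulr1 mulr0 subr0 mulr1.
  move=> h; apply: (scalerI (a := 2%:R : R[i])); first by rewrite pnatr_eq0.
  rewrite scaler_nat mulr2n h scalerN scaleNr; congr (- (_ *: _)).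
  by apply/eqP; rewrite eq_complex /= addr0 !eqxx.
have c0 : cm dt e != 0.
  apply/eqP => h; have := pos e e0; by rewrite h sp0 ltxx.
have := pos _ c0; rewrite sqE -scaleN1r spZ mulN1r -csym oppr_gt0 => h.
by have := lt_trans (pos e e0) h; rewrite ltxx.
Qed.

(* The Dirac matrices dt. = diag(1, -1) and dx. = ((0, -1), (1, 0)) acting on
   C^2 with the scalar product of signature (1, 1). *)
Lemma spinorStructure_inhabited (R : realType) : inhabited (spinorStructure R).
Proof.
pose sp (x y : spinor R) := x 0 0 * (y 0 0)^*%C - x 1 0 * (y 1 0)^*%C.
pose cm (X : R * R) (x : spinor R) : spinor R :=
  \col_i (if i == 0 then X.1%:C * x 0 0 - X.2%:C * x 1 0
          else X.2%:C * x 0 0 - X.1%:C * x 1 0).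
have ext (x y : spinor R) : x 0 0 = y 0 0 -> x 1 0 = y 1 0 -> x = y.
  move=> h0 h1; apply/matrixP => i j; rewrite ord1.
  case: i => -[|[|//]] hi.
    by rewrite (_ : Ordinal hi = 0) //; apply: val_inj.
  by rewrite (_ : Ordinal hi = 1) //; apply: val_inj.
constructor; apply: (@SpinorStructure R sp cm).
- by move=> a x y z; rewrite /sp !mxE; ring.
- move=> x y; rewrite /sp.
  case: (x 0 0) (x 1 0) (y 0 0) (y 1 0) => [a b] [c d] [e f] [g h].
  by apply/eqP; rewrite eq_complex /=; apply/andP; split; apply/eqP; ring.
- move=> a X Y x; apply: ext; rewrite !mxE /=;
  case: (x 0 0) (x 1 0) => [p q] [c d];
  by apply/eqP; rewrite eq_complex /= /GRing.scale /=; apply/andP; split;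
     apply/eqP; ring.
- by move=> X a x y; apply: ext; rewrite !mxE /=; ring.
- move=> X x y; rewrite /sp !mxE /=.
  case: (x 0 0) (x 1 0) (y 0 0) (y 1 0) => [a b] [c d] [e f] [g h].
  by apply/eqP; rewrite eq_complex /=; apply/andP; split; apply/eqP; ring.
- move=> X Y x; apply: ext; rewrite !mxE /= /lorentz;
  case: (x 0 0) (x 1 0) => [p q] [c d];
  by apply/eqP; rewrite eq_complex /=; apply/andP; split; apply/eqP; ring.
- move=> x x0; rewrite /sp !mxE /dt /=.
  have : (x 0 0 != 0) || (x 1 0 != 0).
    rewrite -negb_and; apply/negP => /andP[/eqP h0 /eqP h1].
    by move/eqP: x0; apply; apply: ext; rewrite ?h0 ?h1 mxE.
  case: (x 0 0) (x 1 0) => [a b] [c d].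
  have pos (u v : R) : 0 <= u ^+ 2 + v ^+ 2 by rewrite addr_ge0 ?sqr_ge0.
  have pos1 (u v : R) : (u != 0) || (v != 0) -> 0 < u ^+ 2 + v ^+ 2.
    by case/orP => h; [apply: ltr_wpDr|apply: ltr_wpDl];
       rewrite ?sqr_ge0 // exprn_even_gt0.
  rewrite !eq_complex /= ltcE /= !negb_and => h.
  apply/andP; split; first by apply/eqP; ring.
  by case/orP: h => /pos1 h; [have := pos c d|have := pos a b]; lra.
Qed.

(** * Test functions and Sobolev spaces *)

Section Calculus.
Context {R : realType} {V : normedModType R}.

(* All iterated directional derivatives exist and are continuous. *)
Definition smooth (f : V -> R) : Prop :=
  forall (vs : seq V) (x : V),
    differentiable (foldr (fun v (g : V -> R) => 'D_v g) f vs) x.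

(* phi is in C_c^oo(U). *)
Definition test_function (U : set V) (phi : V -> R) : Prop :=
  [/\ smooth phi, compact (closure [set x | phi x != 0]) &
      closure [set x | phi x != 0] `<=` U].

Definition components (P : (V -> R) -> Prop) (psi : V -> spinor R) : Prop :=
  forall i : 'I_2, P (fun x => complex.Re (psi x i 0)) /\
                   P (fun x => complex.Im (psi x i 0)).

Definition spinor_derive (v : V) (psi : V -> spinor R) : V -> spinor R :=
  fun x => \col_i ('D_v (fun y => complex.Re (psi y i 0)) x +i*
                   'D_v (fun y => complex.Im (psi y i 0)) x).

End Calculus.

Definition L2 d (T : measurableType d) (R : realType)
    (mu : {measure set T -> \bar R}) (U : set T) (f : T -> R) : Prop :=
  f \_ U \in Lfun mu 2%:E.

Definition leb2 (R : realType) :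
    {measure set (measurableTypeR R * measurableTypeR R) -> \bar R} :=
  (@lebesgue_measure R \x @lebesgue_measure R)%E.

Section Sobolev.
Context {R : realType}.

Definition weak_derivative1 (U : set R) (f g : R -> R) : Prop :=
  forall phi : R -> R, test_function U phi ->
    (\int[@lebesgue_measure R]_(x in U) (f x * 'D_1 phi x) =
     - \int[@lebesgue_measure R]_(x in U) (g x * phi x))%R.

Definition H1_1 (U : set R) (f : R -> R) : Prop :=
  L2 (@lebesgue_measure R) U f /\
  exists2 g, L2 (@lebesgue_measure R) U g & weak_derivative1 U f g.

Definition weak_derivative2 (U : set (R * R)) (v : R * R) (f g : R * R -> R) :
    Prop :=
  forall phi : R * R -> R, test_function U phi ->
    (\int[leb2 R]_(p in U) (f p * 'D_v phi p) =
     - \int[leb2 R]_(p in U) (g p * phi p))%R.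

Definition H1_2 (U : set (R * R)) (f : R * R -> R) : Prop :=
  L2 (leb2 R) U f /\
  forall v, v = dt \/ v = dx ->
    exists2 g, L2 (leb2 R) U g & weak_derivative2 U v f g.

Definition slab (T : R) : set (R * R) := [set p | - T < p.1 < T].

Definition cintegral2 (f : R * R -> R[i]) : R[i] :=
  (\int[leb2 R]_p complex.Re (f p))%R +i* (\int[leb2 R]_p complex.Im (f p))%R.

End Sobolev.

(** * The Thirring model *)

Section Thirring.
Context {R : realType} (S : spinorStructure R).

Definition dirac (psi : R * R -> spinor R) (p : R * R) : spinor R :=
  cmul S dt (spinor_derive dt psi p) - cmul S dx (spinor_derive dx psi p).

Definition thirring_rhs (lambda kappa : R) (psi : spinor R) : spinor R :=
  lambda%:C *: psi +
  kappa%:C *: (sprod S psi (cmul S dt psi) *: cmul S dt psi -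
               sprod S psi (cmul S dx psi) *: cmul S dx psi).

(* iD is formally self-adjoint for the integral of the scalar product. *)
Definition weak_thirring (lambda kappa : R) (psi : R * R -> spinor R) : Prop :=
  forall eta : R * R -> spinor R, components (test_function setT) eta ->
    cintegral2 (fun p => sprod S (psi p) ('i%C *: dirac eta p)) =
    cintegral2 (fun p => sprod S (thirring_rhs lambda kappa (psi p)) (eta p)).

(* psi is only defined almost everywhere, so its restriction to t = 0 is
   the essential limit of psi(t, .) in L^2(R) for the norm | |_beta. *)
Definition initial_value (psi0 : R -> spinor R) (psi : R * R -> spinor R) :
    Prop :=
  forall eps : R, 0 < eps -> exists2 delta : R, 0 < delta &
    {ae @lebesgue_measure R, forall t, `|t| < delta ->
      (\int[@lebesgue_measure R]_x (betanorm2 S (psi (t, x) - psi0 x))%:E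
        < eps%:E)%E}.

(* The L^2(R)-norm of psi(t, .) does not depend on t, so a nonzero global
   solution is never square integrable over all of R^{1,1}: H^1 regularity is
   required on every slab ]-T, T[ x R of finite duration. *)
Definition global_weak_solution (lambda kappa : R) (psi0 : R -> spinor R)
    (psi : R * R -> spinor R) : Prop :=
  [/\ forall T : R, 0 < T -> components (H1_2 (slab T)) psi,
      weak_thirring lambda kappa psi &
      initial_value psi0 psi].

End Thirring.

(* Main.v *)
(* In a basis of eigenvectors of the chirality operator dt.dx. a spinor is a
   pair (u, v), and the equation says that (dt - dx) u and (dt + dx) v are, up
   to a factor -i, lambda v + 2 kappa n |v|^2 u and lambda u + 2 kappa n |u|^2 v.
   The cubic terms only rotate the phases of u and v, so that |u|^2 and |v|^2
   grow along their characteristics through the mass term alone.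

   Existence.  H^1 data are bounded and continuous.  Cutting the cubic terms off
   in a phase invariant way gives a globally Lipschitz Volterra equation along
   the characteristics, which is solved by iteration; the charge estimate is not
   affected by the cutoff and shows that the cutoff is never reached.  An L^2
   Gronwall estimate bounds the difference quotients in x by those of the data,
   so that Riesz representation yields a weak x-derivative in L^2 of each slab.

   Uniqueness.  Slicing an H^1 function psi of a slab in the direction (1, c)
   gives |psi(t, x)| <= A_c(x - c t) with A_c in L^2(R).  For c = 0 and c = 1
   this implies that psi is in L^4, so that the cubic term is integrable and the
   weak equation can be integrated along almost every characteristic.  There the
   charge is bounded by the data and the integral of A_0^2, so psi is bounded,
   and the L^2 Gronwall estimate applies to the difference of two solutions. *)
Require Import Defs.
From HB Require Import structures.
From mathcomp Require Import all_boot all_order all_algebra.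
From mathcomp.real_closed Require Import complex.
From mathcomp Require Import all_classical all_reals all_analysis.
From mathcomp Require Import measurable_realfun.
From mathcomp Require Import ring lra.

Set Implicit Arguments.
Unset Strict Implicit.
Unset Printing Implicit Defensive.

Import Order.TTheory GRing.Theory Num.Theory.
Import numFieldNormedType.Exports.

Local Open Scope classical_set_scope.
Local Open Scope ring_scope.

(** The obstacle is the gap between two classes of functions. Iteration takes place among bounded
    functions, where a truncated force is Lipschitz; the theorem speaks of $H^1$ on slabs, whose
    members need be neither bounded nor defined at every point. The squared norm [wnorm] with weight
    $e^{-L|t|}$ makes integration along characteristics small for large $L$, so that Gronwall's
    argument becomes the absorption of half of a sum. Absorption requires that sum to be finite, and
    a bounded solution on an unbounded slab is not known to be square integrable. For this reason
    the Picard iterates are estimated first, and Fatou's lemma carries the bound to their limit. The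
    truncation level is a function of time matched to the charge bound, so that one truncated
    problem serves all times and no continuation argument occurs. Integrals from time 0 are
    oriented, which treats past and future by the same estimates. For uniqueness the competing
    solution is replaced by a bounded function that agrees with it almost everywhere in a slab,
    after which both solutions belong to the class of the iteration. *)

Section AlmostEverywhere.
Context d (T : measurableType d) (R : realType).
Context (m : {measure set T -> \bar R}).
Implicit Types P Q : T -> Prop.

Lemma ae_mono P Q : (forall x, P x -> Q x) ->
  {ae m, forall x, P x} -> {ae m, forall x, Q x}.
Proof. by move=> PQ; apply: filterS. Qed.

Lemma ae_mono2 P Q S : (forall x, P x -> Q x -> S x) ->
  {ae m, forall x, P x} -> {ae m, forall x, Q x} -> {ae m, forall x, S x}.
Proof. by move=> PQ; apply: filterS2. Qed.

Lemma ae_all P : (forall x, P x) -> {ae m, forall x, P x}.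
Proof. by move=> hP; apply: filterE. Qed.

Lemma ae_countable (P : nat -> T -> Prop) :
  (forall n, {ae m, forall x, P n x}) -> {ae m, forall x, forall n, P n x}.
Proof. exact: ae_foralln. Qed.

End AlmostEverywhere.

Section RealIntegrable.
Context d (T : measurableType d) (R : realType).
Context (m : {measure set T -> \bar R}) (D : set T) (mD : measurable D).
Implicit Types f g : T -> R.

Lemma intgD f g : m.-integrable D (EFin \o f) -> m.-integrable D (EFin \o g) ->
  m.-integrable D (EFin \o (fun x => f x + g x)).
Proof. exact: integrableD. Qed.

Lemma intgB f g : m.-integrable D (EFin \o f) -> m.-integrable D (EFin \o g) ->
  m.-integrable D (EFin \o (fun x => f x - g x)).
Proof. exact: integrableB. Qed.

Lemma intgZ k f : m.-integrable D (EFin \o f) ->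
  m.-integrable D (EFin \o (fun x => k * f x)).
Proof. exact: integrableZl. Qed.

Lemma intg_cst (k : R) : (m D < +oo)%E -> m.-integrable D (EFin \o (fun=> k)).
Proof.
move=> mDoo; apply: measurable_bounded_integrable => //.
exists `|k|; split; first by rewrite num_real.
by move=> x kx y _; exact: ltW.
Qed.

Lemma intg_le f g : measurable_fun D f -> (forall x, D x -> `|f x| <= g x) ->
  m.-integrable D (EFin \o g) -> m.-integrable D (EFin \o f).
Proof.
move=> mf fg; apply: le_integrable => //; first exact/measurable_EFinP.
by move=> x Dx; rewrite /= lee_fin (le_trans (fg x Dx))// ler_norm.
Qed.

End RealIntegrable.

(** * Change of variables under measure-preserving maps *)

Section MeasurePreserving.
Context d1 d2 (X : measurableType d1) (Y : measurableType d2) (R : realType).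
Context (m1 : {measure set X -> \bar R}) (m2 : {measure set Y -> \bar R}).

Definition mpreserving (f : X -> Y) : Prop :=
  measurable_fun setT f /\
  forall A, measurable A -> m1 (f @^-1` A) = m2 A.

Context (f : X -> Y) (mpf : mpreserving f).

Lemma mpreserving_ge0_integral (D : set Y) (g : Y -> \bar R) : measurable D ->
  measurable_fun setT g -> (forall y, 0 <= g y)%E ->
  (\int[m1]_(x in f @^-1` D) g (f x) = \int[m2]_(y in D) g y)%E.
Proof.
move=> mD mg g0; case: mpf => mf ef.
rewrite -(ge0_integral_pushforward mf) //; last exact: measurable_funS mg.
by apply: eq_measure_integral => A mA _; rewrite -ef.
Qed.

Lemma mpreserving_integrable (D : set Y) (g : Y -> R) : measurable D ->
  measurable_fun setT g -> m2.-integrable D (EFin \o g) ->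
  m1.-integrable (f @^-1` D) (EFin \o (g \o f)).
Proof.
move=> mD mg /integrableP[_ ig]; apply/integrableP; split.
  apply/measurable_EFinP; apply: measurable_funTS.
  by apply: measurableT_comp => //; case: mpf.
have := @mpreserving_ge0_integral D (fun y => `|g y|%:E)%E mD.
rewrite (_ : (\int[m1]_(x in f @^-1` D) `|(EFin \o (g \o f)) x| =
  \int[m1]_(x in f @^-1` D) `|g (f x)|%:E)%E); last by [].
move=> ->//; apply/measurable_EFinP; exact: measurableT_comp.
Qed.

Lemma mpreserving_integral (D : set Y) (g : Y -> R) : measurable D ->
  measurable_fun setT g ->
  \int[m1]_(x in f @^-1` D) g (f x) = \int[m2]_(y in D) g y.
Proof.
move=> mD mg; congr fine; rewrite integralE [RHS]integralE; congr (_ - _)%E.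
  rewrite -[RHS](@mpreserving_ge0_integral D (fun y => (EFin \o g)^\+ y)%E)//.
    by apply: eq_integral => x _; rewrite !funeposE.
  by apply: measurable_funepos; apply/measurable_EFinP.
rewrite -[RHS](@mpreserving_ge0_integral D (fun y => (EFin \o g)^\- y)%E)//.
  by apply: eq_integral => x _; rewrite !funenegE.
by apply: measurable_funeneg; apply/measurable_EFinP.
Qed.

Lemma mpreserving_ae (P : Y -> Prop) :
  {ae m2, forall y, P y} -> {ae m1, forall x, P (f x)}.
Proof.
case=> N [mN N0 sN]; case: mpf => mf ef; exists (f @^-1` N); split.
- by rewrite -[X in measurable X]setTI; exact: mf.
- by rewrite ef.
- by move=> x /= Px; apply: sN.
Qed.

End MeasurePreserving.

(** * Symmetries of Lebesgue measure on the line, and the interval between 0 and a time *)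

Section Seg.
Context {R : realType}.
Notation mu := (@lebesgue_measure R).
Notation mR := (measurableTypeR R).

Lemma mpreserving_translate (h : R) : mpreserving mu mu (fun x : mR => (x + h : mR)).
Proof.
have mf : measurable_fun setT (fun x : mR => (x + h : mR)).
  exact: measurable_funD.
split=> // A mA; rewrite -[LHS]/(pushforward mu _ A).
apply/esym/(@lebesgue_measure_unique R) => //= _ [[a b]] _ <- /=.
rewrite /pushforward /= [X in _ = _ X](_ : _ = `]a - h, b - h]%classic); last first.
  by apply/seteqP; split=> x /=; rewrite !in_itv /= ltrBlDr lerBrDr.
rewrite !lebesgue_measure_itv /= !lte_fin ltrD2r.
by case: ifP => // _; rewrite -!EFinD; congr EFin; ring.
Qed.

Lemma mpreserving_opp : mpreserving mu mu (fun x : mR => (- x : mR)).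
Proof.
split; first exact: measurableT_comp.
by move=> A mA; exact: lebesgue_measureN.
Qed.

(** For a negative $t$ this is $[t,0]$, so that both time directions are handled at once. *)
Definition seg (t : R) : set R := [set s | (0 <= s <= t) || (t <= s <= 0)].

Lemma seg_ge0 t : 0 <= t -> seg t = `[0, t]%classic.
Proof.
move=> t0; apply/seteqP; split=> s; rewrite /seg /= in_itv /=; last by move=> ->.
by case/orP=> // /andP[ts s0]; rewrite (le_trans t0 ts) (le_trans s0 t0).
Qed.

Lemma seg_le0 t : t <= 0 -> seg t = `[t, 0]%classic.
Proof.
move=> t0; apply/seteqP; split=> s; rewrite /seg /= in_itv /=.
  by case/orP=> // /andP[s0 st]; rewrite (le_trans t0 s0) (le_trans st t0).
by move=> ->; rewrite orbT.
Qed.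

Lemma measurable_seg t : measurable (seg t : set mR).
Proof.
by have [t0|/ltW t0] := leP 0 t; rewrite ?(seg_ge0 t0) ?(seg_le0 t0).
Qed.

Lemma lebesgue_seg t : mu (seg t) = `|t|%:E.
Proof.
have [t0|/ltW t0] := leP 0 t; rewrite ?(seg_ge0 t0) ?(seg_le0 t0).
  rewrite lebesgue_measure_itv /= lte_fin oppr0 adde0 ger0_norm//.
  by case: ltP => // t0'; congr EFin; lra.
rewrite lebesgue_measure_itv /= lte_fin add0e ler0_norm//.
by case: ltP => // t0'; congr EFin; lra.
Qed.

Lemma lebesgue_seg_lty t : (mu (seg t) < +oo)%E.
Proof. by rewrite lebesgue_seg ltry. Qed.

Lemma seg_norm s t : seg t s -> `|s| <= `|t|.
Proof.
rewrite /seg /= => /orP[/andP[a b]|/andP[a b]]; rewrite ler_norml.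
  by rewrite (ger0_norm (le_trans a b)); lra.
by rewrite (ler0_norm (le_trans a b)); lra.
Qed.

End Seg.

(** * Fubini's theorem for real-valued integrals *)

Section RealFubini.
Context d1 d2 (X : measurableType d1) (Y : measurableType d2) (R : realType).
Context (m1 : {sigma_finite_measure set X -> \bar R})
  (m2 : {sigma_finite_measure set Y -> \bar R}) (h : X * Y -> R).
Hypothesis ih : (m1 \x m2)%E.-integrable setT (EFin \o h).

(** An inner integral may be infinite on a null set, where [fine] replaces it by 0; this changes
    neither integrability nor the outer integral. *)
Let fineI (d : measure_display) (Z : measurableType d)
    (m : {measure set Z -> \bar R}) (F : Z -> \bar R) :
  m.-integrable setT F ->
  m.-integrable setT (EFin \o (fine \o F)) /\
  (\int[m]_z ((fine \o F) z)%:E = \int[m]_z F z)%E.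
Proof.
move=> iF; have mF := measurable_int m iF.
have mfF : measurable_fun setT (EFin \o (fine \o F)).
  by apply/measurable_EFinP; exact: measurableT_comp.
have aeF : ae_eq m setT (EFin \o (fine \o F)) F.
  have := integrable_ae measurableT iF.
  by apply: filterS => z Fz _ /=; rewrite fineK//; exact: Fz.
split; last exact: ae_eq_integral.
apply/integrableP; split => //.
rewrite (@ae_eq_integral _ _ _ _ _ (fun x => `|F x|)%E).
- by move/integrableP: iF => [].
- by [].
- exact: measurableT_comp.
- exact: measurableT_comp.
- by apply: filterS aeF => z /(_ I) Fz _; rewrite Fz.
Qed.

Let integrable_G : m2.-integrable setT (fubini_G m1 (EFin \o h)).
Proof.
have /integrableP[mh hoo] := ih; apply/integrableP; split.
  exact: (measurable_fubini_G ih).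
apply: le_lt_trans ((integrable21ltyP m1 m2 mh).1 ih).
apply: ge0_le_integral => //.
- by apply: measurableT_comp => //; exact: (measurable_fubini_G ih).
- apply: (measurable_fun_fubini_tonelli_G (fun p => `|(h p)%:E|)%E) => //.
  exact: measurableT_comp.
- move=> y _; apply: le_abse_integral => //.
  exact: (measurableT_comp mh (pair2_measurable y)).
Qed.

Lemma Rfubini2_integrable :
  m2.-integrable setT (EFin \o (fun y => \int[m1]_x h (x, y))).
Proof. exact: (fineI integrable_G).1. Qed.

Lemma Rfubini1 :
  \int[(m1 \x m2)%E]_p h p = \int[m1]_x \int[m2]_y h (x, y).
Proof.
rewrite /Rintegral; congr fine; rewrite -integral12_prod_meas1//.
exact/esym/(fineI (integrable_fubini_F ih)).2.
Qed.

Lemma Rfubini2 :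
  \int[(m1 \x m2)%E]_p h p = \int[m2]_y \int[m1]_x h (x, y).
Proof.
rewrite /Rintegral; congr fine; rewrite -integral21_prod_meas1//.
exact/esym/(fineI integrable_G).2.
Qed.

End RealFubini.

(** * Absolutely continuous functions *)

Section LocallyIntegrable.
Context {R : realType}.
Notation mu := (@lebesgue_measure R).
Notation mR := (measurableTypeR R).
Implicit Types f g F G : R -> R.

Definition locint f := measurable_fun (setT : set mR) f /\
  forall a b, mu.-integrable `[a, b] (EFin \o f).

Lemma itv_lty (a b : R) : (mu `[a, b]%classic < +oo)%E.
Proof. by rewrite lebesgue_measure_itv/=; case: ifP => // _; rewrite ltry. Qed.

Lemma locint_bounded f : measurable_fun (setT : set mR) f ->
  (forall a b, exists M, forall x, a <= x <= b -> `|f x| <= M) -> locint f.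
Proof.
move=> mf bf; split=> // a b; apply: measurable_bounded_integrable => //.
- exact: itv_lty.
- exact: measurable_funTS.
- have [M hM] := bf a b.
  exists M; split; first by rewrite num_real.
  move=> x Mx y /=; rewrite in_itv/= => yab.
  by rewrite (le_trans (hM y yab))// ltW.
Qed.

Lemma locint_le f g : measurable_fun (setT : set mR) f -> locint g ->
  (forall x, `|f x| <= `|g x|) -> locint f.
Proof.
move=> mf [mg ig] fg; split=> // a b.
apply: le_integrable (ig a b) => //.
  by apply/measurable_EFinP; exact: measurable_funTS.
by move=> x _; rewrite /= lee_fin.
Qed.

Lemma locintD f g : locint f -> locint g -> locint (fun x => f x + g x).
Proof.
move=> [mf If] [mg ig]; split; first exact: measurable_funD.
move=> a b.
rewrite (_ : EFin \o _ = (EFin \o f) \+ (EFin \o g))%E; last by apply/funext.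
exact: integrableD.
Qed.

Lemma locintZ c f : locint f -> locint (fun x => c * f x).
Proof.
move=> [mf If]; split; first exact: measurable_funM.
move=> a b.
rewrite (_ : EFin \o _ = (fun x => c%:E * (EFin \o f) x))%E; last by apply/funext.
exact: integrableZl.
Qed.

Lemma locint_norm f : locint f -> locint (fun x => `|f x|).
Proof.
move=> lf; apply: (locint_le _ lf); last by move=> x; rewrite normr_id.
by apply: measurableT_comp => //; case: lf.
Qed.

Lemma locintM_bounded f g : measurable_fun (setT : set mR) g ->
  (forall a b, exists M, forall x, a <= x <= b -> `|g x| <= M) ->
  locint f -> locint (fun x => f x * g x).
Proof.
move=> mg bg [mf If]; split; first exact: measurable_funM.
move=> a b.
rewrite (_ : EFin \o _ = (EFin \o f) \* (EFin \o g))%E; last by apply/funext.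
apply: integrableMl => //; first exact: measurable_funTS.
have [M hM] := bg a b.
exists M; split; first by rewrite num_real.
move=> x Mx y /=; rewrite in_itv/= => yab.
by rewrite (le_trans (hM y yab))// ltW.
Qed.

(** Absolute continuity in integrated form, the density [f] being part of the data. The product rule
    then comes from Fubini's theorem instead of from derivatives almost everywhere. *)
Definition abscont F f := locint f /\
  forall a b, a <= b -> F b - F a = \int[mu]_(x in `[a, b]) f x.

Lemma locint_itvD f (a b c : R) : locint f -> a <= b -> b <= c ->
  \int[mu]_(x in `[a, c]) f x =
  \int[mu]_(x in `[a, b]) f x + \int[mu]_(x in `[b, c]) f x.
Proof.
move=> [mf If] ab bc.
rewrite -(@Rintegral_itv_obnd_cbnd _ b); last first.
  by apply: (integrableS _ _ _ (If b c)) => //; apply: subset_itv_oc_cc.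
by rewrite -(@Rintegral_itvB _ _ (BLeft a) _ b)// ?subrKC// bnd_simp.
Qed.

Lemma abscontB_bound F f a b : abscont F f -> a <= b ->
  `|F b - F a| <= \int[mu]_(x in `[a, b]) `|f x|.
Proof. by move=> [[mf If] hF] ab; rewrite hF// le_normr_Rintegral. Qed.

Lemma abscont_continuous F f : abscont F f -> continuous F.
Proof.
move=> [lf hF] x; have [mf If] := lf.
have := @parameterized_integral_continuous R (x - 1) (x + 1) f.
move=> /(_ _ (If _ _)) H.
have {}H : {within `[x - 1, x + 1], continuous
    (fun y => F (x - 1) + parameterized_integral mu (x - 1) y f)}.
  move=> y; apply: cvgD; first exact: cvg_cst.
  by apply: H; rewrite lerD2l; lra.
have xI : x \in `]x - 1, x + 1[ by rewrite in_itv/=; apply/andP; split; lra.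
have H1 : {for x, continuous
    (fun y => F (x - 1) + parameterized_integral mu (x - 1) y f)}.
  by apply: (within_continuous_continuous _ H xI); lra.
have Fx : F x = F (x - 1) + parameterized_integral mu (x - 1) x f.
  by rewrite /parameterized_integral -hF; lra.
rewrite /continuous_at Fx; apply: cvg_trans H1.
apply: near_eq_cvg; near=> y; rewrite /parameterized_integral -hF; first by lra.
near: y; exists 1 => //= y; rewrite /ball_/= => h.
have : `|y - x| < 1 by rewrite distrC.
by rewrite ltr_norml => /andP[]; lra.
Unshelve. all: by end_near. Qed.

Lemma continuous_mfun F : continuous F -> measurable_fun (setT : set mR) F.
Proof. exact: continuous_measurable_fun. Qed.

Lemma continuous_bounded_itv F : continuous F ->
  forall a b, exists M, forall x, a <= x <= b -> `|F x| <= M.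
Proof.
move=> cF a b; have [ab|ba] := leP a b; last first.
  by exists 0 => x /andP[ax xb]; move: (le_trans ax xb); rewrite leNgt ba.
have := continuous_compact (continuous_subspaceT cF) (@segment_compact R a b).
move=> /compact_bounded [M [_ hM]].
exists (M + 1) => x xab; apply: (hM (M + 1)); first by rewrite ltrDl.
by exists x => //=; rewrite in_itv.
Qed.

Lemma continuous_locint F : continuous F -> locint F.
Proof.
move=> cF; apply: locint_bounded; first exact: continuous_mfun.
exact: continuous_bounded_itv.
Qed.

Lemma abscont_locint F f : abscont F f -> locint F.
Proof. by move=> /abscont_continuous; exact: continuous_locint. Qed.

(** Fubini's theorem on the square $[a,b]^2$, cut along its diagonal into two triangles. This is
    integration by parts for functions that are known only as integrals. *)
Lemma locint_triangle f g a b : locint f -> locint g -> a <= b ->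
  (\int[mu]_(x in `[a, b]) f x) * (\int[mu]_(x in `[a, b]) g x) =
  \int[mu]_(x in `[a, b]) (f x * \int[mu]_(y in `[a, x]) g y) +
  \int[mu]_(x in `[a, b]) (g x * \int[mu]_(y in `[a, x]) f y).
Proof.
move=> lf lg ab; have [mf If] := lf; have [mg ig] := lg.
pose A := `[a, b]%classic : set mR.
have mA : measurable A by exact: measurable_itv.
pose fA := f \_ A; pose gA := g \_ A.
have ifA : mu.-integrable setT (EFin \o fA).
  have := (integrable_mkcond (mu := mu) (EFin \o f) mA).1 (If a b).
  by rewrite restrict_EFin.
have igA : mu.-integrable setT (EFin \o gA).
  have := (integrable_mkcond (mu := mu) (EFin \o g) mA).1 (ig a b).
  by rewrite restrict_EFin.
have mfA : measurable_fun setT fA by apply/measurable_EFinP; case/integrableP: ifA.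
have mgA : measurable_fun setT gA by apply/measurable_EFinP; case/integrableP: igA.
pose K (p : mR * mR) := fA p.1 * gA p.2.
have mK : measurable_fun setT (EFin \o K).
  apply/measurable_EFinP; apply: measurable_funM; exact: measurableT_comp.
have iK : (mu \x mu)%E.-integrable setT (EFin \o K).
  apply/integrable12ltyP => //.
  under eq_integral => x _.
    rewrite /K /= (eq_integral (fun y => `|fA x|%:E * `|gA y|%:E)%E); last first.
      by move=> y _; rewrite normrM EFinM.
    rewrite ge0_integralZl_EFin//; last first.
      by apply/measurable_EFinP; exact: measurableT_comp.
    over.
  rewrite ge0_integralZr//.
  - apply: lte_mul_pinfty => //; first exact: integral_ge0.
      rewrite ge0_fin_numE; last exact: integral_ge0.
      by case/integrableP: ifA.
    by case/integrableP: igA.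
  - by apply/measurable_EFinP; exact: measurableT_comp.
  - exact: integral_ge0.
pose L : set (mR * mR) := [set p | p.2 <= p.1].
have mL : measurable L.
  by rewrite -[X in measurable X]setTI; apply: measurable_fun_le.
have iKL : (mu \x mu)%E.-integrable setT (EFin \o (K \_ L)).
  rewrite -restrict_EFin; apply/(integrable_mkcond _ mL).1.
  by apply: integrableS iK.
have iKL' : (mu \x mu)%E.-integrable setT (EFin \o (K \_ (~` L))).
  rewrite -restrict_EFin; apply/(integrable_mkcond _ (measurableC mL)).1.
  by apply: integrableS iK => //; exact: measurableC.
have KE : \int[(mu \x mu)%E]_p K p =
    \int[(mu \x mu)%E]_p (K \_ L) p + \int[(mu \x mu)%E]_p (K \_ (~` L)) p.
  rewrite -RintegralD//; apply: eq_Rintegral => p _; rewrite !patchE in_setC.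
  by case: (p \in L); rewrite ?addr0 ?add0r.
have fAE (h : R -> R) : \int[mu]_x (h \_ A) x = \int[mu]_(x in A) h x.
  by rewrite [RHS]Rintegral_mkcond.
transitivity (\int[(mu \x mu)%E]_p K p).
  rewrite Rfubini1//.
  transitivity (\int[mu]_x (fA x * \int[mu]_y gA y)).
    by rewrite RintegralZr// !fAE.
  by apply: eq_Rintegral => x _; rewrite -RintegralZl.
have iI (h : R -> R) (I : interval R) : locint h -> [set` I] `<=` A ->
    mu.-integrable setT (EFin \o (h \_ [set` I])).
  move=> [mh ih] IA; rewrite -restrict_EFin.
  have mI : measurable ([set` I] : set mR) by exact: measurable_itv.
  apply/(integrable_mkcond _ mI).1.
  by apply: integrableS (ih a b).
rewrite KE; congr (_ + _).
  rewrite Rfubini1// [RHS]Rintegral_mkcond; apply: eq_Rintegral => x _.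
  rewrite patchE; case: ifPn => xA; last first.
    rewrite -[RHS](@Rintegral_set0 _ _ _ mu (fun=> 0)) [RHS]Rintegral_mkcond.
    apply: eq_Rintegral => y _; rewrite !patchE /K/= /fA patchE (negbTE xA).
    by rewrite mul0r; do 2 case: ifP => _.
  have /andP[ax xb] : a <= x <= b by move: xA; rewrite inE /A/= in_itv.
  rewrite [in RHS]Rintegral_mkcond -RintegralZl//; last first.
    by apply: iI => // y; rewrite /A/= !in_itv/=; lra.
  apply: eq_Rintegral => y _; rewrite !patchE /K/= /fA /gA !patchE xA.
  have -> : ((x, y) \in L) = (y <= x) by apply/idP/idP; rewrite inE.
  have -> : (y \in A) = (a <= y <= b) by apply/idP/idP; rewrite inE /A/= in_itv.
  have -> : (y \in `[a, x]%classic) = (a <= y <= x).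
    by apply/idP/idP; rewrite inE/= in_itv.
  have [yx|yx] := leP y x; last by rewrite andbF mulr0.
  by rewrite (le_trans yx xb) !andbT.
rewrite Rfubini2// [RHS]Rintegral_mkcond; apply: eq_Rintegral => x _.
rewrite patchE; case: ifPn => xA; last first.
  rewrite -[RHS](@Rintegral_set0 _ _ _ mu (fun=> 0)) [RHS]Rintegral_mkcond.
  apply: eq_Rintegral => y _; rewrite !patchE /K/= /gA !patchE (negbTE xA).
  by rewrite mulr0; do 2 case: ifP => _.
have /andP[ax xb] : a <= x <= b by move: xA; rewrite inE /A/= in_itv.
(* The complement of the closed lower triangle is strict, hence a half-open interval here; its
   missing end point is a null set. *)
have sub : `[a, x[ `<=` A by move=> y; rewrite /A/= !in_itv/=; lra.
rewrite -(@Rintegral_itv_bndo_bndc _ (BLeft a) x); last first.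
  by apply: integrableS (If a b).
rewrite [in RHS]Rintegral_mkcond -RintegralZl//; last exact: iI.
apply: eq_Rintegral => y _; rewrite !patchE /K/= /fA /gA !patchE xA in_setC.
have -> : ((y, x) \in L) = (x <= y) by apply/idP/idP; rewrite inE.
have -> : (y \in A) = (a <= y <= b) by apply/idP/idP; rewrite inE /A/= in_itv.
have -> : (y \in `[a, x[%classic) = (a <= y < x).
  by apply/idP/idP; rewrite inE/= in_itv.
rewrite -ltNge; have [yx|yx] := ltP y x; last by rewrite andbF mulr0.
by rewrite (le_trans (ltW yx) xb) !andbT mulrC.
Qed.

(** Each factor is its value at $a$ plus an integral from $a$. After expansion the product of the
    two integrals is the sum of double integrals of [locint_triangle]. *)
Lemma abscont_mul F f G g : abscont F f -> abscont G g ->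
  abscont (fun x => F x * G x) (fun x => f x * G x + g x * F x).
Proof.
move=> aF aG; have [lf hF] := aF; have [lg hG] := aG.
have cF := abscont_continuous aF; have cG := abscont_continuous aG.
have lfG := locintM_bounded (continuous_mfun cG) (continuous_bounded_itv cG) lf.
have lgF := locintM_bounded (continuous_mfun cF) (continuous_bounded_itv cF) lg.
split; first exact: locintD.
move=> a b ab; have [_ i1] := lfG; have [_ i2] := lgF.
rewrite RintegralD//.
have E H h h' : abscont H h -> locint h' ->
    \int[mu]_(x in `[a, b]) (h' x * H x) =
    H a * \int[mu]_(x in `[a, b]) h' x +
    \int[mu]_(x in `[a, b]) (h' x * \int[mu]_(y in `[a, x]) h y).
  move=> aH lh'; have [_ ih'] := lh'.
  have cH := abscont_continuous aH.
  have lh : locint (fun x => h' x * (H x - H a)).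
    have cHa : continuous (fun x => H x - H a).
      by move=> x; apply: cvgB; [exact: cH|exact: cvg_cst].
    exact: (locintM_bounded (continuous_mfun cHa) (continuous_bounded_itv cHa) lh').
  transitivity (\int[mu]_(x in `[a, b]) (H a * h' x + h' x * (H x - H a))).
    by apply: eq_Rintegral => x _; ring.
  rewrite RintegralD//; first last.
  - exact: lh.2.
  - exact: (locintZ (H a) lh').2.
  rewrite RintegralZl//; congr (_ + _).
  apply: eq_Rintegral => x; rewrite inE/= in_itv/= => /andP[ax xb].
  by rewrite -aH.2.
rewrite (E G g f)// (E F f g)//.
have -> : F b = F a + \int[mu]_(x in `[a, b]) f x by rewrite -hF//; lra.
have -> : G b = G a + \int[mu]_(x in `[a, b]) g x by rewrite -hG//; lra.
have := locint_triangle lf lg ab; lra.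
Qed.

Lemma abscont_is_derive F f : (forall x : R, is_derive x (1 : R) F (f x)) -> continuous f ->
  abscont F f.
Proof.
move=> dF cf; have lf := continuous_locint cf; split=> // a b.
have cF : continuous F.
  by move=> x; apply/differentiable_continuous/derivable1_diffP; case: (dF x).
rewrite le_eqVlt => /predU1P[->|ab].
  by rewrite set_itv1 Rintegral_set1 subrr.
rewrite /Rintegral (@continuous_FTC2 _ f F a b)//.
- exact: continuous_subspaceT.
- split.
  + by move=> x _; case: (dF x).
  + by apply: cvg_at_right_filter; exact: cF.
  + by apply: cvg_at_left_filter; exact: cF.
- by move=> x _; rewrite derive1E; case: (dF x).
Qed.

Lemma abscontD F f G g : abscont F f -> abscont G g ->
  abscont (fun x => F x + G x) (fun x => f x + g x).
Proof.
move=> [lf hF] [lg hG]; split; first exact: locintD.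
move=> a b ab; rewrite RintegralD//; [|exact: lf.2|exact: lg.2].
by rewrite -hF// -hG//; ring.
Qed.

Lemma abscontZ c F f : abscont F f -> abscont (fun x => c * F x) (fun x => c * f x).
Proof.
move=> [lf hF]; split; first exact: locintZ.
by move=> a b ab; rewrite RintegralZl//; [rewrite -hF// mulrBr|exact: lf.2].
Qed.

(** The oriented integral $\int_0^t f$. The sign makes it a primitive of [f] on both sides of 0. *)
Definition oint f t := Num.sg t * \int[mu]_(s in seg t) f s.

Lemma oint0 f : oint f 0 = 0.
Proof. by rewrite /oint sgr0 mul0r. Qed.

Lemma abscont_oint f : locint f -> abscont (oint f) f.
Proof.
move=> lf; split=> // a b ab; rewrite /oint.
have sg0 (x : R) (X Y : set mR) : X = Y ->
    \int[mu]_(s in X) f s = \int[mu]_(s in Y) f s by move=> ->.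
have P t : 0 <= t -> Num.sg t * \int[mu]_(s in seg t) f s =
    \int[mu]_(s in `[0, t]) f s.
  move=> t0; rewrite (seg_ge0 t0); move: t0; rewrite le_eqVlt => /predU1P[<-|t0].
    by rewrite sgr0 mul0r set_itv1 Rintegral_set1.
  by rewrite gtr0_sg// mul1r.
have N t : t <= 0 -> Num.sg t * \int[mu]_(s in seg t) f s =
    - \int[mu]_(s in `[t, 0]) f s.
  move=> t0; rewrite (seg_le0 t0); move: t0; rewrite le_eqVlt => /predU1P[->|t0].
    by rewrite sgr0 mul0r set_itv1 Rintegral_set1 oppr0.
  by rewrite ltr0_sg// mulN1r.
have [a0|/ltW a0] := leP 0 a.
  have b0 := le_trans a0 ab.
  by rewrite !P// (locint_itvD lf a0 ab); lra.
have [b0|/ltW b0] := leP 0 b.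
  by rewrite (P b)// (N a)// (locint_itvD lf a0 b0); lra.
by rewrite !N// (locint_itvD lf ab b0); lra.
Qed.

Lemma abscont_ointE F f t : abscont F f -> F t = F 0 + oint f t.
Proof.
move=> aF; have aI := abscont_oint aF.1.
suff : F t - F 0 = oint f t - oint f 0 by rewrite oint0; lra.
have [t0|/ltW t0] := leP 0 t; first by rewrite aF.2// aI.2.
by apply: oppr_inj; rewrite !opprB aF.2// aI.2.
Qed.

Lemma locint_seg f t : locint f -> mu.-integrable (seg t) (EFin \o f).
Proof.
move=> [_ If].
by have [t0|/ltW t0] := leP 0 t; rewrite ?(seg_ge0 t0) ?(seg_le0 t0).
Qed.

(** If the right side is infinite nothing is to be proved, and otherwise [f] is integrable on the
    segment; measurability is therefore enough. *)
Lemma oint_bound f t : measurable_fun (setT : set mR) f ->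
  (`|oint f t|%:E <= \int[mu]_(s in seg t) `|f s|%:E)%E.
Proof.
move=> mf.
have [fi|] := boolP (\int[mu]_(s in seg t) `|f s|%:E < +oo)%E; last first.
  by rewrite -leNgt leye_eq => /eqP ->; rewrite leey.
have iF : mu.-integrable (seg t) (EFin \o f).
  apply/integrableP; split=> //.
  by apply/measurable_EFinP; exact: measurable_funTS.
rewrite /oint normrM; apply: (@le_trans _ _ (`|\int[mu]_(s in seg t) f s|%:E)).
  by rewrite lee_fin ler_piMl// normr_sg; case: eqP.
rewrite EFin_normr_Rintegral//; last exact: measurable_seg.
apply: le_abse_integral; first exact: measurable_seg.
by apply/measurable_EFinP; exact: measurable_funTS.
Qed.

Lemma eq_oint f g t : (forall s, seg t s -> f s = g s) -> oint f t = oint g t.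
Proof.
by move=> fg; congr (_ * _); apply: eq_Rintegral => s; rewrite inE => /fg.
Qed.

Lemma ointB f g t : locint f -> locint g ->
  oint (fun s => f s - g s) t = oint f t - oint g t.
Proof.
move=> lf lg; rewrite /oint -mulrBr RintegralB//; first exact: measurable_seg.
exact: locint_seg. exact: locint_seg.
Qed.

End LocallyIntegrable.

(** * Shears of the plane and exponentially weighted norms *)

Section Shear.
Context {R : realType}.
Notation mu := (@lebesgue_measure R).
Notation mR := (measurableTypeR R).
Notation mu2 := (leb2 R).
Notation P := (mR * mR)%type.

(** Lines with constant second coordinate are mapped to the lines $x=a+ct$. Composition with [sh c]
    thus turns transport in the direction $(1,c)$ into differentiation in time alone. *)
Definition sh (c : R) (p : P) : P := (p.1, p.2 + c * p.1).

Lemma measurable_sh c : measurable_fun setT (sh c).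
Proof.
apply/measurable_fun_pairP; split => /=; first exact: measurable_fst.
by apply: measurable_funD => //; exact: measurable_funM.
Qed.

Lemma shK c : cancel (sh c) (sh (- c)).
Proof. by move=> [t x]; rewrite /sh /=; congr pair; ring. Qed.

Lemma shNK c : cancel (sh (- c)) (sh c).
Proof. by move=> [t x]; rewrite /sh /=; congr pair; ring. Qed.

(** On each slice of constant time the shear is a translation. *)
Lemma mpreserving_sh c : mpreserving mu2 mu2 (sh c).
Proof.
split; first exact: measurable_sh.
move=> A mA; rewrite /leb2 /= /product_measure1; apply: eq_integral => t _ /=.
rewrite -((mpreserving_translate (c * t)).2 (xsection A t)); last first.
  exact: measurable_xsection.
congr (mu _); apply/seteqP; split=> x; rewrite /xsection /= !inE //=.
Qed.

Lemma measurable_slab T : measurable (slab T : set P).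
Proof.
rewrite (_ : slab T = `]- T, T[%classic `*` setT).
  by apply: measurableX => //; exact: measurable_itv.
by apply/seteqP; split=> p /=; rewrite in_itv//= => -[].
Qed.

Definition vert (h : P -> R) (p : P) : R := oint (fun s => h (s, p.2)) p.1.

Lemma measurable_segprod :
  measurable [set q : P * mR | seg q.1.1 q.2].
Proof.
have m1 : measurable_fun setT (fun q : P * mR => q.1.1 : mR).
  exact: measurableT_comp.
have m2 : measurable_fun setT (fun q : P * mR => q.2 : mR) by exact: measurable_snd.
have le (f g : P * mR -> mR) : measurable_fun setT f -> measurable_fun setT g ->
    measurable [set q | f q <= g q].
  by move=> ? ?; rewrite -[X in measurable X]setTI; exact: measurable_fun_le.
rewrite (_ : [set _ | _] =
  ([set q | 0 <= q.2] `&` [set q | q.2 <= q.1.1]) `|`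
  ([set q | q.1.1 <= q.2] `&` [set q | q.2 <= 0])).
  by apply: measurableU; apply: measurableI; exact: le.
apply/seteqP; split=> q; rewrite /seg/=.
  by case/orP=> /andP[? ?]; [left|right].
by case=> -[-> ->]; rewrite ?orbT.
Qed.

(** The domain of integration moves with the point. It is encoded as a measurable set in three
    variables, and Tonelli's theorem is applied to the positive and the negative part of the
    restricted integrand. *)
Lemma measurable_vert h : measurable_fun setT h -> measurable_fun setT (vert h).
Proof.
move=> mh; rewrite /vert /oint; apply: measurable_funM.
  apply: measurableT_comp; last exact: measurable_fst.
  apply: nondecreasing_measurable => // x y xy.
  by case: (sgrP x); case: (sgrP y); lra.
rewrite /Rintegral; apply: measurableT_comp => //=.
pose k (q : P * mR) : \bar R := (h (q.2, q.1.2))%:E.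
pose k' := k \_ [set q : P * mR | seg q.1.1 q.2].
have mk : measurable_fun setT k.
  apply/measurable_EFinP; apply: (measurableT_comp mh).
  apply/measurable_fun_pairP; split; first exact: measurable_snd.
  exact: (measurableT_comp measurable_snd measurable_fst).
have mk' : measurable_fun setT k'.
  apply/(measurable_restrictT _ _).1; first exact: measurable_segprod.
  exact: measurable_funTS.
rewrite (_ : (fun x => _) = fun p => (fubini_F mu (k'^\+)%E p - fubini_F mu (k'^\-)%E p)%E).
  by apply: emeasurable_funB; apply: measurable_fun_fubini_tonelli_F => //;
    [exact: measurable_funepos|exact: measurable_funeneg].
apply/funext => p; rewrite integral_mkcond integralE /fubini_F.
have E s : ((fun s0 => (h (s0, p.2))%:E) \_ (seg p.1)) s = k' (p, s).
  by rewrite /k' !patchE; have -> : ((p, s) \in [set q : P * mR | seg q.1.1 q.2]) =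
    (s \in seg p.1) by apply/idP/idP; rewrite !inE.
by congr (_ - _)%E; apply: eq_integral => s _; rewrite ?funeposE ?funenegE E.
Qed.

(** Cauchy-Schwarz, obtained from the nonnegativity of the variance of [f] about its mean on the
    segment. An infinite right side is treated apart. *)
Lemma oint_sq (f : R -> R) t : measurable_fun (setT : set mR) f ->
  (((oint f t) ^+ 2)%:E <= `|t|%:E * \int[mu]_(s in seg t) (f s ^+ 2)%:E)%E.
Proof.
move=> mf; have mfs : measurable_fun (seg t : set mR) f by exact: measurable_funTS.
have mf2 : measurable_fun (seg t : set mR) (fun s => (f s ^+ 2)%:E).
  by apply/measurable_EFinP; exact: measurable_funX.
have [->|t0] := eqVneq t 0.
  by rewrite oint0 expr0n/= normr0 mul0e.
have t0' : 0 < `|t| by rewrite normr_gt0.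
have [fi|] := boolP (\int[mu]_(s in seg t) (f s ^+ 2)%:E < +oo)%E; last first.
  rewrite -leNgt leye_eq => /eqP ->.
  by rewrite gt0_muley ?lte_fin// leey.
have mseg := @measurable_seg R t.
have i2 : mu.-integrable (seg t) (EFin \o (fun s => f s ^+ 2)).
  apply/integrableP; split=> //.
  under eq_integral => s _ do rewrite /= ger0_norm ?sqr_ge0//.
  exact: fi.
have i1 : mu.-integrable (seg t) (EFin \o f).
  apply: (intg_le mseg (g := fun s => 1 + f s ^+ 2)) => //.
    by move=> s _; rewrite -[X in _ + X]real_normK ?num_real//; nra.
  by apply: intgD => //; apply: intg_cst => //; exact: lebesgue_seg_lty.
pose B := \int[mu]_(s in seg t) (f s ^+ 2).
pose J := \int[mu]_(s in seg t) f s.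
have BE : (\int[mu]_(s in seg t) (f s ^+ 2)%:E = B%:E)%E.
  rewrite /B /Rintegral fineK// ge0_fin_numE//; apply: integral_ge0 => s _.
  by rewrite lee_fin sqr_ge0.
pose m := J / `|t|.
have : 0 <= \int[mu]_(s in seg t) ((f s - m) ^+ 2).
  by apply: Rintegral_ge0 => s _; exact: sqr_ge0.
have -> : \int[mu]_(s in seg t) ((f s - m) ^+ 2) =
    \int[mu]_(s in seg t) (f s ^+ 2 - (2 * m) * f s + m ^+ 2).
  by apply: eq_Rintegral => s _; ring.
have iZ : mu.-integrable (seg t) (EFin \o (fun s => 2 * m * f s)).
  exact: intgZ.
have iB : mu.-integrable (seg t) (EFin \o (fun s => f s ^+ 2 - 2 * m * f s)).
  exact: intgB.
have ic : mu.-integrable (seg t) (EFin \o (fun=> m ^+ 2)).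
  by apply: intg_cst => //; exact: lebesgue_seg_lty.
have cE : \int[mu]_(s in seg t) (m ^+ 2) = m ^+ 2 * `|t|.
  by rewrite Rintegral_cst//; congr (_ * _); exact: (congr1 fine (lebesgue_seg t)).
rewrite RintegralD// RintegralB// RintegralZl// cE -/B -/J => /= h.
rewrite BE -EFinM lee_fin /oint exprMn -/J.
have -> : Num.sg t ^+ 2 = 1 by rewrite sqr_sg t0.
have JE : J = m * `|t| by rewrite /m divfK// gt_eqF.
move: h; rewrite JE; nra.
Qed.

(** The square of a weighted $L^2$ norm. The weight decays in both time directions, and a large [L]
    makes integration in time a small operator. *)
Definition wnorm (L T : R) (h : P -> R) : \bar R :=
  (\int[mu2]_(p in slab T) (expR (- (L * `|p.1|)) * h p ^+ 2)%:E)%E.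

Lemma measurable_wnorm L (h : P -> R) D : measurable_fun setT h ->
  measurable_fun D (fun p : P => (expR (- (L * `|p.1|)) * h p ^+ 2)%:E).
Proof.
move=> mh; apply/measurable_EFinP; apply: measurable_funTS.
apply: measurable_funM; last exact: measurable_funX.
apply: measurableT_comp => //; apply: measurableT_comp => //.
by apply: measurable_funM => //; apply: measurableT_comp.
Qed.

Lemma wnorm_sh L T c (h : P -> R) : measurable_fun setT h ->
  wnorm L T (h \o sh c) = wnorm L T h.
Proof.
move=> mh; rewrite /wnorm.
rewrite -[RHS](mpreserving_ge0_integral (mpreserving_sh c))//.
- exact: measurable_slab.
- exact: measurable_wnorm.
- by move=> y; rewrite lee_fin mulr_ge0 ?expR_ge0 ?sqr_ge0.
Qed.

(** Each of the two signs of $t$ contributes at most the tail $e^{-La}/L$. *)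
Lemma exp_tail (L T a : R) : 0 < L -> 0 <= a ->
  (\int[mu]_(t in [set t : mR | (a <= `|t| < T)%R]) (expR (- (L * `|t|)))%:E <=
   (2 / L * expR (- (L * a)))%:E)%E.
Proof.
move=> L0 a0.
pose e (t : R) := expR (- (L * t)).
have dE (x : R) : is_derive x (1 : R) (fun t => - L^-1 * e t) (e x).
  apply: is_derive_eq; rewrite /e /GRing.scale/= mulr1; field.
  by rewrite gt_eqF.
have de (x : R) : is_derive x (1 : R) e (- L * e x).
  by apply: is_derive_eq; rewrite /e /GRing.scale/= mulr1; ring.
have ce : continuous e.
  by move=> x; apply/differentiable_continuous/derivable1_diffP; case: (de x).
have aE := abscont_is_derive dE ce.
have me : measurable_fun (setT : set mR) e by exact: continuous_mfun.
have E0 : (\int[mu]_(t in `[a, T]) (e t)%:E <= (L^-1 * e a)%:E)%E.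
  have [Ta|aT] := ltP T a.
    rewrite set_itv_ge ?bnd_simp -?ltNge// integral_set0 lee_fin.
    by rewrite mulr_ge0 ?expR_ge0// invr_ge0 ltW.
  rewrite -[X in (X <= _)%E]fineK.
    have := aE.2 _ _ aT; rewrite /Rintegral => <-; rewrite lee_fin.
    have : 0 <= L^-1 * e T by rewrite mulr_ge0 ?expR_ge0// invr_ge0 ltW.
    lra.
  exact: (integrable_fin_num _ (aE.1.2 a T)).
pose k := (EFin \o e) \_ (`[a, T]%classic : set mR).
have mk : measurable_fun setT k.
  apply/(measurable_restrictT _ _).1; first exact: measurable_itv.
  by apply: measurable_funTS; apply/measurable_EFinP.
have k0 x : (0 <= k x)%E by rewrite /k patchE; case: ifP; rewrite ?lee_fin ?expR_ge0.
have ik : (\int[mu]_t k t <= (L^-1 * e a)%:E)%E by rewrite -integral_mkcond.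
apply: (@le_trans _ _ (\int[mu]_t (k t + k (- t)%R))%E); last first.
  rewrite ge0_integralD//; last by apply: measurableT_comp => //; exact: measurableT_comp.
  have := mpreserving_ge0_integral (@mpreserving_opp R) measurableT mk k0.
  rewrite preimage_setT => ->.
  apply: le_trans (leeD ik ik) _; rewrite -EFinD lee_fin /e.
  by rewrite le_eqVlt; apply/orP; left; apply/eqP; ring.
have mn : measurable_fun setT (fun x : mR => `|x| : mR) by exact: measurableT_comp.
rewrite integral_mkcond; apply: ge0_le_integral => //.
- by move=> t _; rewrite patchE; case: ifP; rewrite ?lee_fin ?expR_ge0.
- apply/(measurable_restrictT _ _).1.
    have -> : [set t : mR | a <= `|t| < T] =
      Num.Def.normr @^-1` `[a, T[%classic by apply/seteqP; split=> x /=; rewrite in_itv.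
    by rewrite -[X in measurable X]setTI; apply: mn.
  apply: measurable_funTS; apply/measurable_EFinP.
  exact: (measurableT_comp me mn).
- apply: emeasurable_funD => //.
  by apply: measurableT_comp => //; exact: measurableT_comp.
- move=> t _; rewrite patchE; case: ifPn => [|_]; last exact: adde_ge0.
  rewrite inE/= => /andP[at' tT].
  have kE (x : R) : a <= x -> x < T -> k x = (e x)%:E.
    by move=> ax xT; rewrite /k patchE mem_set//= in_itv/= ax ltW.
  have [t0|/ltW t0] := leP 0 t.
    rewrite (ger0_norm t0) in at' tT *.
    by rewrite kE// leeDl.
  rewrite (ler0_norm t0) in at' tT *.
  by rewrite (kE (- t))// leeDr.
Qed.

(** Cauchy-Schwarz bounds the square of the time integral by $|t|\int h^2$ over the segment, with
    $|t|\le T$. After exchanging the integrals the slice at time $s$ carries the weight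
    $\int_{|s|\le|t|<T}e^{-L|t|}dt\le\frac2Le^{-L|s|}$, which gives back the original weight and the
    small factor. *)
Lemma wnorm_vert L T (h : P -> R) : 0 < L -> 0 < T -> measurable_fun setT h ->
  (wnorm L T (vert h) <= (2 * T / L)%:E * wnorm L T h)%E.
Proof.
move=> L0 T0 mh.
pose I (t : R) : R := if `|t| < T then 1 else 0.
pose J (s t : R) : R := if `|s| <= `|t| then 1 else 0.
pose E (t : R) : R := expR (- (L * `|t|)).
have I0 t : 0 <= I t by rewrite /I; case: ifP.
have J0 s t : 0 <= J s t by rewrite /J; case: ifP.
have E0 t : 0 <= E t by exact: expR_ge0.
have K0 t z : 0 <= I t * (E t * z ^+ 2).
  by rewrite mulr_ge0// mulr_ge0// sqr_ge0.
have mn (X : measurableType _) (f : X -> R) : measurable_fun setT f ->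
  measurable_fun setT (fun x => `|f x|) by move=> mf; exact: measurableT_comp.
have mI : measurable_fun (setT : set mR) I.
  apply: measurable_fun_if => //; apply: measurable_fun_ltr => //; exact: mn.
have mE : measurable_fun (setT : set mR) E.
  apply: (measurableT_comp (f := @expR R)) => //; apply: measurableT_comp => //.
  by apply: measurable_funM => //; exact: mn.
have mJ : measurable_fun (setT : set P) (fun p => J p.1 p.2).
  apply: measurable_fun_if => //; apply: measurable_fun_ler; apply: mn.
    exact: measurable_fst.
  exact: measurable_snd.
have m1 (f : R -> R) : measurable_fun (setT : set mR) f ->
    measurable_fun (setT : set P) (fun p => f p.1).
  by move=> mf; apply: (measurableT_comp mf); exact: measurable_fst.
have m2 (f : R -> R) : measurable_fun (setT : set mR) f ->
    measurable_fun (setT : set P) (fun p => f p.2).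
  by move=> mf; apply: (measurableT_comp mf); exact: measurable_snd.
have slabE (g : P -> R) : measurable_fun setT g ->
    wnorm L T g = (\int[mu]_t \int[mu]_x (I t * (E t * g (t, x) ^+ 2))%:E)%E.
  move=> mg; rewrite /wnorm integral_mkcond.
  transitivity (\int[mu2]_p (I p.1 * (E p.1 * g p ^+ 2))%:E)%E.
    apply: eq_integral => p _; rewrite patchE /I.
    have -> : (p \in slab T) = (`|p.1| < T) by rewrite ltr_norml; apply/idP/idP; rewrite inE.
    by case: ifP; rewrite ?mul1r ?mul0r.
  rewrite /leb2 fubini_tonelli1//.
    apply/measurable_EFinP; apply: measurable_funM; first exact: m1.
    by apply: measurable_funM; [exact: m1|exact: measurable_funX].
  by move=> p; rewrite lee_fin mulr_ge0// mulr_ge0// sqr_ge0.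
pose H (s : R) : \bar R := (\int[mu]_x (h (s, x) ^+ 2)%:E)%E.
have H0 s : (0 <= H s)%E by apply: integral_ge0 => x _; rewrite lee_fin sqr_ge0.
have mh2 : measurable_fun setT (fun p : P => (h p ^+ 2)%:E).
  by apply/measurable_EFinP; exact: measurable_funX.
have mH : measurable_fun (setT : set mR) H.
  by apply: (measurable_fun_fubini_tonelli_F (fun p : P => (h p ^+ 2)%:E)) => // p;
    rewrite lee_fin sqr_ge0.
have mhs s : measurable_fun (setT : set mR) (fun x => h (s, x)).
  exact: (measurableT_comp mh (pair1_measurable s)).
have mht x : measurable_fun (setT : set mR) (fun s => h (s, x)).
  exact: (measurableT_comp mh (pair2_measurable x)).
have mv := measurable_vert mh.
rewrite !slabE//.
(* The kernel of the double integral: membership of $s$ in [seg t] is relaxed to $|s|\le|t|$, and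
   the factor $|t|$ to $T$. *)
pose W (t s : R) : R := T * (I t * (E t * J s t)).
have W0 t s : 0 <= W t s by rewrite /W !mulr_ge0// ltW.
have mWs t : measurable_fun (setT : set mR) (W t).
  apply: measurable_funM => //; apply: measurable_funM => //.
  apply: measurable_funM => //.
  exact: (measurableT_comp mJ (pair2_measurable t)).
have mW : measurable_fun (setT : set P) (fun p => W p.1 p.2).
  apply: measurable_funM => //; apply: measurable_funM; first exact: m1.
  apply: measurable_funM; first exact: m1.
  apply: (measurableT_comp mJ (f := fun p : P => J p.1 p.2) (g := fun p => (p.2, p.1))).
  by apply/measurable_fun_pairP; split; [exact: measurable_snd|exact: measurable_fst].
apply: (@le_trans _ _ (\int[mu]_t \int[mu]_s ((W t s)%:E * H s))%E).
  apply: ge0_le_integral => //.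
  - by move=> t _; apply: integral_ge0 => x _; rewrite lee_fin K0.
  - apply: (measurable_fun_fubini_tonelli_F (fun p : P => (I p.1 * (E p.1 * vert h p ^+ 2))%:E)).
      apply/measurable_EFinP; apply: measurable_funM; first exact: m1.
      by apply: measurable_funM; [exact: m1|exact: measurable_funX].
    by move=> p; rewrite lee_fin K0.
  - apply: (measurable_fun_fubini_tonelli_F (fun p : P => ((W p.1 p.2)%:E * H p.2)%E)).
      apply: emeasurable_funM; first exact/measurable_EFinP.
      by apply: (measurableT_comp mH); exact: measurable_snd.
    by move=> p; rewrite mule_ge0// lee_fin.
  move=> t _.
  apply: (@le_trans _ _ (\int[mu]_x \int[mu]_s (W t s * h (s, x) ^+ 2)%:E)%E).
    apply: ge0_le_integral => //.
    - by move=> x _; rewrite lee_fin K0.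
    - apply/measurable_EFinP; apply: measurable_funM => //.
      apply: measurable_funM => //; apply: measurable_funX.
      exact: (measurableT_comp mv (pair1_measurable t)).
    - apply: (measurable_fun_fubini_tonelli_G (fun p : P => (W t p.1 * h p ^+ 2)%:E)).
        apply/measurable_EFinP; apply: measurable_funM; first exact: m1.
        exact: measurable_funX.
      by move=> p; rewrite lee_fin mulr_ge0// sqr_ge0.
    move=> x _.
    rewrite /W /I; case: ifPn => tT; last first.
      rewrite mul0r; apply: integral_ge0 => s _.
      by rewrite lee_fin mul0r mulr0 mul0r.
    rewrite mul1r EFinM.
    apply: (@le_trans _ _ ((E t)%:E * (`|t|%:E * \int[mu]_(s in seg t) (h (s, x) ^+ 2)%:E))%E).
      by apply: lee_pmul => //; rewrite ?lee_fin ?sqr_ge0//; exact: (oint_sq t (mht x)).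
    have i0 : (0 <= \int[mu]_(s in seg t) (h (s, x) ^+ 2)%:E)%E.
      by apply: integral_ge0 => s _; rewrite lee_fin sqr_ge0.
    rewrite muleA -EFinM.
    apply: (@le_trans _ _ ((T * E t)%:E * \int[mu]_(s in seg t) (h (s, x) ^+ 2)%:E)%E).
      apply: lee_wpmul2r => //; rewrite lee_fin mulrC ler_wpM2r// ltW//.
    rewrite -ge0_integralZl_EFin//; first last.
    - by rewrite mulr_ge0// ltW.
    - by apply/measurable_EFinP; apply: measurable_funX; apply: measurable_funTS; exact: mht.
    - by move=> s _; rewrite lee_fin sqr_ge0.
    - exact: measurable_seg.
    rewrite integral_mkcond; apply: ge0_le_integral => //.
    - by move=> s _; rewrite patchE; case: ifP => // _; rewrite -EFinM lee_fin mulr_ge0 ?sqr_ge0// mulr_ge0// ltW.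
    - apply/(measurable_restrictT _ _).1; first exact: measurable_seg.
      apply: measurable_funTS; apply: emeasurable_funM => //; apply/measurable_EFinP.
      by apply: measurable_funX; exact: mht.
    - apply/measurable_EFinP; apply: measurable_funM; last by apply: measurable_funX; exact: mht.
      by have := mWs t; rewrite /W /I tT.
    move=> s _; rewrite patchE; case: ifPn => [|_]; last first.
      by rewrite lee_fin mulr_ge0 ?sqr_ge0//; have := W0 t s; rewrite /W /I tT.
    rewrite inE => /seg_norm st; rewrite -EFinM lee_fin /J st.
    by rewrite mul1r mulr1.
  rewrite -(fubini_tonelli (fun p : P => (W t p.1 * h p ^+ 2)%:E)) /fubini_F; first last.
  - by move=> p; rewrite lee_fin mulr_ge0// sqr_ge0.
  - apply/measurable_EFinP; apply: measurable_funM; first exact: m1.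
    exact: measurable_funX.
  rewrite le_eqVlt; apply/orP; left; apply/eqP; apply: eq_integral => s _ /=.
  rewrite -ge0_integralZl_EFin//.
  - by move=> x _; rewrite lee_fin sqr_ge0.
  - by apply/measurable_EFinP; apply: measurable_funX; exact: mhs.
rewrite (fubini_tonelli (fun p : P => ((W p.1 p.2)%:E * H p.2)%E)) /fubini_G; first last.
- by move=> p; rewrite mule_ge0// lee_fin.
- apply: emeasurable_funM; first exact/measurable_EFinP.
  by apply: (measurableT_comp mH); exact: measurable_snd.
rewrite -ge0_integralZl_EFin//; first last.
- by rewrite divr_ge0// ?mulr_ge0// ltW.
- apply: (measurable_fun_fubini_tonelli_F (fun p : P => (I p.1 * (E p.1 * h p ^+ 2))%:E)).
    apply/measurable_EFinP; apply: measurable_funM; first exact: m1.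
    by apply: measurable_funM; [exact: m1|exact: measurable_funX].
  by move=> p; rewrite lee_fin K0.
- by move=> t _; apply: integral_ge0 => x _; rewrite lee_fin K0.
apply: ge0_le_integral => //.
- by move=> s _; apply: integral_ge0 => t _; rewrite mule_ge0// lee_fin.
- apply: (measurable_fun_fubini_tonelli_G (fun p : P => ((W p.1 p.2)%:E * H p.2)%E)).
    apply: emeasurable_funM; first exact/measurable_EFinP.
    by apply: (measurableT_comp mH); exact: measurable_snd.
  by move=> p; rewrite mule_ge0// lee_fin.
- apply: emeasurable_funM => //.
  apply: (measurable_fun_fubini_tonelli_F (fun p : P => (I p.1 * (E p.1 * h p ^+ 2))%:E)).
    apply/measurable_EFinP; apply: measurable_funM; first exact: m1.
    by apply: measurable_funM; [exact: m1|exact: measurable_funX].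
  by move=> p; rewrite lee_fin K0.
move=> s _ /=.
have mWt : measurable_fun (setT : set mR) (fun t => (W t s)%:E).
  by apply/measurable_EFinP; exact: (measurableT_comp mW (pair2_measurable s)).
rewrite ge0_integralZr//; last by move=> t _; rewrite lee_fin.
have -> : (\int[mu]_x (I s * (E s * h (s, x) ^+ 2))%:E)%E = ((I s * E s)%:E * H s)%E.
  rewrite -ge0_integralZl_EFin//.
  - by apply: eq_integral => x _; rewrite -EFinM mulrA.
  - by move=> x _; rewrite lee_fin sqr_ge0.
  - by apply/measurable_EFinP; apply: measurable_funX; exact: mhs.
  - by rewrite mulr_ge0.
rewrite muleA; apply: lee_wpmul2r => //.
rewrite -EFinM.
have mIEJ : measurable_fun (setT : set mR) (fun t => (I t * (E t * J s t))%:E).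
  apply/measurable_EFinP; apply: measurable_funM => //; apply: measurable_funM => //.
  exact: (measurableT_comp mJ (pair1_measurable s)).
have -> : (\int[mu]_x (W x s)%:E = T%:E * \int[mu]_t (I t * (E t * J s t))%:E)%E.
  rewrite -ge0_integralZl_EFin//; last by rewrite ltW.
  by move=> t _; rewrite lee_fin !mulr_ge0.
rewrite /I; case: ifPn => sT; last first.
  rewrite mul0r mulr0 integral0_eq ?mule0// => t _.
  case: ifPn; rewrite ?mul0r// mul1r /J => tT.
  by rewrite ifF ?mulr0//; apply/negbTE; rewrite -ltNge (lt_le_trans tT)// leNgt.
rewrite mul1r; have := @exp_tail L T `|s| L0 (normr_ge0 _).
rewrite -/(E s) => Hs.
have -> : (2 * T / L * E s)%:E = (T%:E * (2 / L * E s)%:E)%E.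
  by rewrite -EFinM; congr EFin; ring.
apply: lee_pmul => //; first by rewrite lee_fin ltW.
  by apply: integral_ge0 => t _; rewrite lee_fin !mulr_ge0//; case: ifP.
apply: le_trans Hs; rewrite le_eqVlt; apply/orP; left; apply/eqP.
rewrite [RHS]integral_mkcond; apply: eq_integral => t _; rewrite patchE.
have -> : (t \in [set t0 : mR | `|s| <= `|t0| < T]) = (`|s| <= `|t| < T).
  by apply/idP/idP; rewrite inE.
rewrite /J; case: (`|t| < T); case: (`|s| <= `|t|) => /=;
  by rewrite ?mul1r ?mulr1 ?mul0r ?mulr0.
Qed.

End Shear.

(** * Sequences that converge at a geometric rate *)

Section GeometricSequence.
Context {R : realType}.

(** The intervals of radius $2C\,2^{-n}$ about $u_n$ are nested, and the limit is the supremum of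
    their left ends. *)
Lemma geometric_limit (u : nat -> R) (C : R) :
  (forall n, `|u n.+1 - u n| <= C * 2^-1 ^+ n) ->
  exists l, forall n, `|u n - l| <= 2 * C * 2^-1 ^+ n.
Proof.
move=> hu.
have C0 : 0 <= C by have := hu 0; rewrite expr0 mulr1; apply: le_trans.
pose e n : R := 2 * C * 2^-1 ^+ n.
have eS n : e n.+1 = e n - C * 2^-1 ^+ n by rewrite /e exprS; field.
have e0 n : 0 <= e n by rewrite /e !mulr_ge0// exprn_ge0// invr_ge0.
have up n m : (n <= m)%N -> u n - e n <= u m - e m.
  elim: m => [|m IH]; first by rewrite leqn0 => /eqP ->.
  rewrite leq_eqVlt => /predU1P[->//|/IH h]; apply: (le_trans h).
  by rewrite eS; have := hu m; rewrite ler_norml => /andP[]; lra.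
have dn n m : (n <= m)%N -> u m + e m <= u n + e n.
  elim: m => [|m IH]; first by rewrite leqn0 => /eqP ->.
  rewrite leq_eqVlt => /predU1P[->//|/IH h]; apply: le_trans h.
  by rewrite eS; have := hu m; rewrite ler_norml => /andP[]; lra.
have ud n m : u n - e n <= u m + e m.
  have [nm|/ltnW mn] := leqP n m.
    by apply: (le_trans (up _ _ nm)); have := e0 m; lra.
  by apply: le_trans (dn _ _ mn); have := e0 n; lra.
pose A : set R := range (fun n => u n - e n).
have hA : has_sup A.
  split; first by exists (u 0 - e 0), 0.
  by exists (u 0 + e 0) => _ [n _ <-]; exact: ud.
exists (sup A) => n; rewrite ler_distlC -/(e n); apply/andP; split.
  by apply: ub_le_sup; [exact: hA.2|exists n].
by apply: ge_sup; [exact: hA.1|move=> _ [m _ <-]; exact: ud].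
Qed.

Lemma geometric_cvg (u : nat -> R) (l C : R) :
  (forall n, `|u n - l| <= C * 2^-1 ^+ n) -> u n @[n --> \oo] --> l.
Proof.
move=> hu; apply/cvgrPdist_le => e e0.
have : (fun n => C * (2^-1 : R) ^+ n) n @[n --> \oo] --> C * 0.
  apply: cvgM; first exact: cvg_cst.
  by apply: cvg_expr; rewrite ger0_norm ?invr_ge0// invf_lt1// ltr1n.
rewrite mulr0 => /cvgrPdist_le /(_ e e0) h.
near=> n; rewrite distrC; apply: (le_trans (hu n)).
have : `|0 - C * 2^-1 ^+ n| <= e by near: n.
by rewrite sub0r normrN; apply: le_trans; rewrite ler_norm.
Unshelve. all: by end_near. Qed.

Lemma geometric_unique (u : nat -> R) (l l' C C' : R) :
  (forall n, `|u n - l| <= C * 2^-1 ^+ n) ->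
  (forall n, `|u n - l'| <= C' * 2^-1 ^+ n) -> l = l'.
Proof.
move=> /geometric_cvg ul /geometric_cvg ul'.
by rewrite -(cvg_lim (@Rhausdorff R) ul) (cvg_lim (@Rhausdorff R) ul').
Qed.

End GeometricSequence.

(** * Volterra equations along characteristics *)

Section Volterra.
Context {R : realType}.
Notation mu := (@lebesgue_measure R).
Notation mR := (measurableTypeR R).
Notation mu2 := (leb2 R).
Notation P := (mR * mR)%type.

(** The Duhamel operator of $\partial_t-c\,\partial_x$: the line through the point on which $x+ct$
    is constant is straightened by a shear, and [g] is integrated along it from time 0. *)
Definition Vc (c : R) (g : P -> R) : P -> R := vert (g \o sh (- c)) \o sh c.

Lemma VcE c g p :
  Vc c g p = oint (fun s => g (s, p.2 + c * p.1 - c * s)) p.1.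
Proof. by rewrite /Vc /vert /sh /=; apply: eq_oint => s _; rewrite mulNr. Qed.

Lemma measurable_Vc c g : measurable_fun setT g -> measurable_fun setT (Vc c g).
Proof.
move=> mg; apply: measurableT_comp; last exact: measurable_sh.
by apply: measurable_vert; apply: measurableT_comp => //; exact: measurable_sh.
Qed.

Lemma wnorm_Vc L T c g : 0 < L -> 0 < T -> measurable_fun setT g ->
  (wnorm L T (Vc c g) <= (2 * T / L)%:E * wnorm L T g)%E.
Proof.
move=> L0 T0 mg.
have mg' : measurable_fun setT (g \o sh (- c)).
  by apply: measurableT_comp => //; exact: measurable_sh.
rewrite /Vc wnorm_sh; last exact: measurable_vert.
by rewrite -[in X in (_ <= X)%E](@wnorm_sh _ L T (- c) g)//; exact: wnorm_vert.
Qed.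

Definition slab_bounded (g : P -> R) : Prop :=
  measurable_fun setT g /\
  forall T, exists B, forall p, `|p.1| <= T -> `|g p| <= B.

Lemma measurable_line (g : P -> R) (a c : R) : measurable_fun setT g ->
  measurable_fun (setT : set mR) (fun s => g (s, a - c * s)).
Proof.
move=> mg; apply: (measurableT_comp mg) => /=.
apply/measurable_fun_pairP; split; first exact: measurable_id.
by apply: measurable_funB => //; exact: measurable_funM.
Qed.

Lemma slab_bounded_line g a c : slab_bounded g -> locint (fun s => g (s, a - c * s)).
Proof.
move=> [mg bg]; apply: locint_bounded; first exact: measurable_line.
move=> b d; have [B hB] := bg (`|b| + `|d|).
exists B => x /andP[bx xd]; apply: hB => /=; rewrite ler_norml.
by have := ler_norm d; have := ler_norm (- b); rewrite normrN;
  have := normr_ge0 b; have := normr_ge0 d; lra.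
Qed.

(** Integration of an exponential gains the factor $1/L$. This is the pointwise counterpart of
    [wnorm_vert]; it drives both the Picard iteration and the bound on the charge. *)
Lemma oint_exp_bound (f : R -> R) (B L t : R) : 0 < L ->
  measurable_fun (setT : set mR) f ->
  (forall s, seg t s -> `|f s| <= B * expR (L * `|s|)) ->
  `|oint f t| <= B / L * expR (L * `|t|).
Proof.
move=> L0 mf fB.
have B0 : 0 <= B.
  have seg0 : seg t 0 by rewrite /seg/= !lexx/=; case: (leP 0 t) => //= /ltW ->.
  by have := le_trans (normr_ge0 _) (fB _ seg0); rewrite pmulr_lge0// expR_gt0.
pose e (s : R) : R := expR (L * `|s|).
have ce : continuous e.
  move=> x; apply: (@continuous_comp _ _ _ (fun t : R => L * `|t|) (@expR R)).
    by apply: cvgM; [exact: cvg_cst|exact: norm_continuous].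
  exact: continuous_expR.
have le := continuous_locint ce.
have mseg := @measurable_seg R t.
have key : \int[mu]_(s in seg t) e s <= L^-1 * e t.
  have [t0|/ltW t0] := leP 0 t.
    rewrite (seg_ge0 t0).
    pose E (s : R) := L^-1 * expR (L * s).
    have dE (x : R) : is_derive x (1 : R) E (expR (L * x)).
      by apply: is_derive_eq; rewrite /GRing.scale/= mulr1; field; rewrite gt_eqF.
    have cE : continuous (fun x : R => expR (L * x)).
      move=> x; apply: (@continuous_comp _ _ _ (fun t : R => L * t) (@expR R)).
        by apply: cvgM; [exact: cvg_cst|exact: cvg_id].
      exact: continuous_expR.
    have := (abscont_is_derive dE cE).2 _ _ t0; rewrite /E mulr0 expR0 mulr1.
    rewrite (_ : \int[mu]_(x in `[0, t]) expR (L * x) = \int[mu]_(s in `[0, t]) e s).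
      by rewrite /e (ger0_norm t0) => <-; rewrite gerBl invr_ge0 ltW.
    apply: eq_Rintegral => x; rewrite inE/= in_itv/= => /andP[x0 _].
    by rewrite /e ger0_norm.
  rewrite (seg_le0 t0).
  pose E (s : R) := - L^-1 * expR (- (L * s)).
  have dE (x : R) : is_derive x (1 : R) E (expR (- (L * x))).
    by apply: is_derive_eq; rewrite /GRing.scale/= mulr1; field; rewrite gt_eqF.
  have cE : continuous (fun x : R => expR (- (L * x))).
    move=> x; apply: (@continuous_comp _ _ _ (fun t : R => - (L * t)) (@expR R)).
      by apply: cvgN; apply: cvgM; [exact: cvg_cst|exact: cvg_id].
    exact: continuous_expR.
  have := (abscont_is_derive dE cE).2 _ _ t0; rewrite /E mulr0 oppr0 expR0 mulr1.
  rewrite (_ : \int[mu]_(x in `[t, 0]) expR (- (L * x)) = \int[mu]_(s in `[t, 0]) e s).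
    rewrite /e (ler0_norm t0) mulrN => <-; rewrite mulNr opprK gerDr.
    by rewrite oppr_le0 invr_ge0 ltW.
  apply: eq_Rintegral => x; rewrite inE/= in_itv/= => /andP[_ x0].
  by rewrite /e ler0_norm// mulrN.
rewrite -lee_fin; apply: le_trans (oint_bound t mf) _.
apply: (@le_trans _ _ (\int[mu]_(s in seg t) (B * e s)%:E)%E).
  apply: ge0_le_integral => //.
  - by apply/measurable_EFinP; apply: measurableT_comp => //; exact: measurable_funTS.
  - by apply/measurable_EFinP; apply: measurable_funTS; case: (locintZ B le).
have := locint_seg t (locintZ B le) => iB.
rewrite -[X in (X <= _)%E]fineK; last exact: (integrable_fin_num mseg iB).
rewrite -/(Rintegral mu (seg t) (fun s => B * e s)) RintegralZl//; last exact: locint_seg.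
by rewrite lee_fin -mulrA ler_wpM2l.
Qed.

Lemma Vc_exp_bound c (g : P -> R) (B L : R) (p : P) : 0 < L ->
  measurable_fun setT g ->
  (forall q, `|q.1| <= `|p.1| -> `|g q| <= B * expR (L * `|q.1|)) ->
  `|Vc c g p| <= B / L * expR (L * `|p.1|).
Proof.
move=> L0 mg gB; rewrite VcE; apply: oint_exp_bound => //.
  exact: measurable_line.
by move=> s /seg_norm st; exact: gB.
Qed.

Lemma slab_bounded_Vc c g : slab_bounded g -> slab_bounded (Vc c g).
Proof.
move=> [mg bg]; split; first exact: measurable_Vc.
move=> T; have [B hB] := bg T; exists (`|B| * expR T) => p pT.
have := @Vc_exp_bound c g `|B| 1 p ltr01 mg; rewrite divr1 mul1r => h.
apply: le_trans (h _) _.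
  move=> q qp; apply: (le_trans (hB q (le_trans qp pT))).
  apply: (le_trans (ler_norm B)); rewrite ler_peMr// -expR0 ler_expR mulr_ge0//.
by rewrite ler_wpM2l// ler_expR.
Qed.

Lemma VcB c g h p : slab_bounded g -> slab_bounded h ->
  Vc c (fun q => g q - h q) p = Vc c g p - Vc c h p.
Proof. by move=> bg bh; rewrite !VcE ointB//; exact: slab_bounded_line. Qed.

(** The right side carries an absolute value because for negative times the oriented integral of a
    nonnegative function is nonpositive. *)
Lemma le_Vc c g h p : slab_bounded g -> slab_bounded h ->
  (forall q, `|q.1| <= `|p.1| -> `|g q| <= h q) ->
  `|Vc c g p| <= `|Vc c h p|.
Proof.
move=> bg bh gh; rewrite !VcE; have lh := slab_bounded_line (p.2 + c * p.1) c bh.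
rewrite -lee_fin; apply: le_trans (oint_bound _ _) _.
  by case: (slab_bounded_line (p.2 + c * p.1) c bg).
rewrite /oint normrM normr_sg.
have [->|p0] := eqVneq p.1 0.
  by rewrite seg_ge0// set_itv1 integral_set1 mul0r.
rewrite mul1r; set k := fun s => h _ in lh *.
have ih := locint_seg p.1 lh; have mseg := @measurable_seg R p.1.
apply: (@le_trans _ _ (\int[mu]_(s in seg p.1) (k s)%:E)%E).
  apply: ge0_le_integral => //.
  - apply/measurable_EFinP; apply: measurableT_comp => //; apply: measurable_funTS.
    by case: (slab_bounded_line (p.2 + c * p.1) c bg).
  - by apply/measurable_EFinP; apply: measurable_funTS; case: lh.
  - by move=> s /seg_norm st; rewrite lee_fin; exact: gh.
rewrite -[X in (X <= _)%E]fineK; last exact: (integrable_fin_num mseg ih).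
by rewrite lee_fin ler_norm.
Qed.


Context (I : finType).
Notation n := (#|I|%:R : R).

Lemma sqr_sum_le (a : I -> R) : (\sum_k a k) ^+ 2 <= n * \sum_k a k ^+ 2.
Proof.
have -> : (\sum_k a k) ^+ 2 = \sum_j \sum_k a j * a k.
  by rewrite expr2 mulr_suml; apply: eq_bigr => j _; rewrite mulr_sumr.
apply: (@le_trans _ _ (\sum_j \sum_k (a j ^+ 2 / 2 + a k ^+ 2 / 2))).
  apply: ler_sum => j _; apply: ler_sum => k _; rewrite -subr_ge0.
  have -> : a j ^+ 2 / 2 + a k ^+ 2 / 2 - a j * a k = (a j - a k) ^+ 2 / 2 by field.
  by rewrite divr_ge0 ?sqr_ge0.
rewrite (eq_bigr (fun j => n * (a j ^+ 2 / 2) + \sum_k a k ^+ 2 / 2)); last first.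
  by move=> j _; rewrite big_split/= sumr_const mulr_natl.
rewrite big_split/= sumr_const -mulr_natl -mulr_sumr -mulr_suml.
by rewrite le_eqVlt; apply/orP; left; apply/eqP; field.
Qed.

Lemma wnorm_ge0 L T (h : P -> R) : (0 <= wnorm L T h)%E.
Proof.
by apply: integral_ge0 => p _; rewrite lee_fin mulr_ge0 ?expR_ge0 ?sqr_ge0.
Qed.

Lemma ae_le_wnorm L T (g h : P -> R) :
  measurable_fun setT g -> measurable_fun setT h ->
  {ae mu2, forall p, slab T p -> `|g p| <= `|h p|} ->
  (wnorm L T g <= wnorm L T h)%E.
Proof.
move=> mg mh gh; apply: ae_ge0_le_integral => //.
- exact: measurable_slab.
- by move=> p _; rewrite lee_fin mulr_ge0 ?expR_ge0 ?sqr_ge0.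
- exact: measurable_wnorm.
- by move=> p _; rewrite lee_fin mulr_ge0 ?expR_ge0 ?sqr_ge0.
- exact: measurable_wnorm.
apply: ae_mono gh => p gh Tp; rewrite lee_fin ler_wpM2l ?expR_ge0//.
by rewrite -[X in X <= _]real_normK ?num_real// -[X in _ <= X]real_normK ?num_real// lerXn2r ?nnegrE ?gh.
Qed.

Lemma wnormD L T (g h : P -> R) :
  measurable_fun setT g -> measurable_fun setT h ->
  (wnorm L T (fun p => g p + h p)%R <= 2%:E * wnorm L T g + 2%:E * wnorm L T h)%E.
Proof.
move=> mg mh; have mS := @measurable_slab R T.
have pos (f : P -> R) p : (0 <= (expR (- (L * `|p.1|)) * f p ^+ 2)%:E)%E.
  by rewrite lee_fin mulr_ge0 ?expR_ge0 ?sqr_ge0.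
rewrite /wnorm -!ge0_integralZl_EFin//; try exact: measurable_wnorm.
rewrite -ge0_integralD//; first last.
- by apply: emeasurable_funM => //; exact: measurable_wnorm.
- by move=> p _; rewrite mule_ge0.
- by apply: emeasurable_funM => //; exact: measurable_wnorm.
- by move=> p _; rewrite mule_ge0.
apply: ge0_le_integral => //.
- by move=> p _; exact: (pos (fun p => g p + h p)%R).
- by apply: measurable_wnorm; exact: measurable_funD.
- apply: emeasurable_funD; apply: emeasurable_funM => //; exact: measurable_wnorm.
move=> p _; rewrite -!EFinM -EFinD lee_fin.
have := mulr_ge0 (expR_ge0 (- (L * `|p.1|))) (sqr_ge0 (g p - h p)).
by set e := expR _; rewrite !expr2; nra.
Qed.

Lemma wnormZ L T (k : R) (h : P -> R) : measurable_fun setT h ->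
  wnorm L T (fun p => k * h p)%R = ((k ^+ 2)%:E * wnorm L T h)%E.
Proof.
move=> mh; rewrite /wnorm -ge0_integralZl_EFin//.
- by apply: eq_integral => p _; rewrite -EFinM; congr EFin; ring.
- exact: measurable_slab.
- by move=> p _; rewrite lee_fin mulr_ge0 ?expR_ge0 ?sqr_ge0.
- exact: measurable_wnorm.
- exact: sqr_ge0.
Qed.

Lemma wnorm_sum L T (h : I -> P -> R) : (forall k, measurable_fun setT (h k)) ->
  (wnorm L T (fun p => \sum_k h k p)%R <= n%:E * \sum_k wnorm L T (h k))%E.
Proof.
move=> mh; have mS := @measurable_slab R T.
have pos (f : P -> R) p : (0 <= (expR (- (L * `|p.1|)) * f p ^+ 2)%:E)%E.
  by rewrite lee_fin mulr_ge0 ?expR_ge0 ?sqr_ge0.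
rewrite /wnorm -ge0_integral_sum//; last by move=> k; exact: measurable_wnorm.
rewrite -ge0_integralZl_EFin//; first last.
- by apply: emeasurable_sum => k; exact: measurable_wnorm.
- by move=> p _; apply: sume_ge0.
apply: ge0_le_integral => //.
- by move=> p _; exact: (pos (fun p => \sum_k h k p)%R).
- by apply: measurable_wnorm; exact: measurable_sum.
- apply: emeasurable_funM => //.
  by apply: emeasurable_sum => k; exact: measurable_wnorm.
move=> p _; rewrite sumEFin -EFinM lee_fin -mulr_sumr [X in _ <= X]mulrCA.
apply: ler_wpM2l; first exact: expR_ge0.
exact: sqr_sum_le.
Qed.

(** With this weight $L$ the factor $4n^2TK^2/L$ that arises in [wnorm_step] is at most $1/2$; the
    summand 1 keeps $L$ positive when $K=0$. *)
Definition gronwall_weight (K T : R) : R := 8 * n ^+ 2 * T * K ^+ 2 + 1.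

Lemma gronwall_weight_gt0 K T : 0 < T -> 0 < gronwall_weight K T.
Proof.
move=> T0; rewrite /gronwall_weight ltr_wpDl// mulr_ge0 ?sqr_ge0//.
by rewrite mulr_ge0 ?(ltW T0)// mulr_ge0 ?sqr_ge0.
Qed.

(** Combines $(a+b)^2\le2a^2+2b^2$, the small norm of [Vc], and Cauchy-Schwarz over the components.
    Since [w] and [w'] may differ, it applies to consecutive Picard iterates as well as to a single
    family. *)
Lemma wnorm_step (c : I -> R) (w w' r : I -> P -> R) (K T : R) : 0 < T ->
  (forall j, measurable_fun setT (w j)) ->
  (forall j, measurable_fun setT (w' j)) ->
  (forall j, measurable_fun setT (r j)) ->
  (forall j, {ae mu2, forall p, slab T p ->
     `|w' j p| <= `|r j p| + `|Vc (c j) (fun q => K * \sum_k `|w k q|) p|}) ->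
  (\sum_j wnorm (gronwall_weight K T) T (w' j) <=
   2%:E * \sum_j wnorm (gronwall_weight K T) T (r j) +
   (2^-1)%:E * \sum_j wnorm (gronwall_weight K T) T (w j))%E.
Proof.
move=> T0 mw mw' mr h; set L := gronwall_weight K T.
have L0 : 0 < L := gronwall_weight_gt0 K T0.
have mn (f : P -> R) : measurable_fun setT f ->
  measurable_fun setT (fun x => `|f x|) by move=> mf; exact: measurableT_comp.
have mq : measurable_fun setT (fun q : P => K * \sum_k `|w k q|).
  by apply: measurable_funM => //; apply: measurable_sum => k; exact: mn.
pose S := (\sum_j wnorm L T (w j))%E.
have S0 : (0 <= S)%E by apply: sume_ge0 => j _; exact: wnorm_ge0.
have wn (f : P -> R) : measurable_fun setT f -> wnorm L T (fun p => `|f p|) = wnorm L T f.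
  by move=> mf; apply: eq_integral => p _; rewrite real_normK ?num_real.
have one j : (wnorm L T (w' j) <= 2%:E * wnorm L T (r j) +
    (2 * (2 * T / L) * (K ^+ 2 * n))%:E * S)%E.
  have mV := measurable_Vc (c j) mq.
  apply: (@le_trans _ _ (wnorm L T (fun p => `|r j p| +
      `|Vc (c j) (fun q => K * \sum_k `|w k q|) p|))%R).
    apply: ae_le_wnorm => //; first by apply: measurable_funD; exact: mn.
    apply: ae_mono (h j) => p hp Tp; apply: (le_trans (hp Tp)).
    exact: ler_norm.
  apply: (le_trans (wnormD _ _ _ _)); [exact: mn|exact: mn|].
  rewrite !wn//; apply: leeD => //.
  apply: (@le_trans _ _ (2%:E * ((2 * T / L)%:E * ((K ^+ 2)%:E * (n%:E * S))))%E).
    apply: lee_wpmul2l => //.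
    apply: (le_trans (wnorm_Vc _ _ _ _)) => //.
    apply: lee_wpmul2l; first by rewrite lee_fin divr_ge0 ?mulr_ge0// ltW.
    rewrite wnormZ; last by apply: measurable_sum => k; exact: mn.
    apply: lee_wpmul2l; first by rewrite lee_fin sqr_ge0.
    apply: (le_trans (wnorm_sum _ _ _)); first by move=> k; exact: mn.
    by rewrite /S (eq_bigr (fun k => wnorm L T (w k)))// => k _; rewrite wn.
  by rewrite !muleA -!EFinM !mulrA.
apply: (le_trans (lee_sum _ (fun j _ => one j))).
rewrite big_split/=; apply: leeD.
  by rewrite ge0_sume_distrr// => j _; exact: wnorm_ge0.
rewrite -ge0_sume_distrl; last first.
  move=> j _; rewrite lee_fin; apply: mulr_ge0.
    apply: mulr_ge0 => //; apply: divr_ge0; last exact: ltW.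
    by apply: mulr_ge0 => //; exact: ltW.
  by apply: mulr_ge0 => //; exact: sqr_ge0.
apply: lee_wpmul2r => //; rewrite sumEFin lee_fin sumr_const.
have key : n * (2 * (2 * T / L) * (K ^+ 2 * n)) <= 2^-1.
  rewrite -(ler_pM2r L0).
  have -> : n * (2 * (2 * T / L) * (K ^+ 2 * n)) * L = 4 * n ^+ 2 * T * K ^+ 2.
    by field; rewrite gt_eqF.
  by rewrite /L /gronwall_weight; lra.
by rewrite mulr_natl in key.
Qed.

Lemma wnorm_le0 L T (f : P -> R) : 0 <= L -> measurable_fun setT f ->
  (wnorm L T f <= wnorm 0 T f)%E.
Proof.
move=> L0 mf; apply: ge0_le_integral.
- exact: measurable_slab.
- by move=> p _; rewrite lee_fin mulr_ge0 ?expR_ge0 ?sqr_ge0.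
- exact: measurable_wnorm.
- exact: measurable_wnorm.
- move=> p _; rewrite lee_fin ler_wpM2r ?sqr_ge0// ler_expR mul0r oppr0.
  by rewrite oppr_le0 mulr_ge0.
Qed.

Lemma wnorm0_le L T (f : P -> R) : 0 <= L -> measurable_fun setT f ->
  (wnorm 0 T f <= (expR (L * T))%:E * wnorm L T f)%E.
Proof.
move=> L0 mf; rewrite /wnorm -ge0_integralZl_EFin ?expR_ge0//; try exact: measurable_slab;
  try exact: measurable_wnorm;
  try by move=> p _; rewrite lee_fin mulr_ge0 ?expR_ge0 ?sqr_ge0.
apply: ge0_le_integral.
- exact: measurable_slab.
- by move=> p _; rewrite lee_fin mulr_ge0 ?expR_ge0 ?sqr_ge0.
- exact: measurable_wnorm.
- by apply: emeasurable_funM => //; exact: measurable_wnorm.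
- move=> p Tp; have pT : `|p.1| < T by rewrite ltr_norml; exact: Tp.
  rewrite -EFinM lee_fin [X in _ <= X]mulrA; apply: ler_wpM2r; first exact: sqr_ge0.
  rewrite -expRD ler_expR mul0r oppr0.
  by rewrite subr_ge0 ler_wpM2l// ltW.
Qed.

Lemma slab_bounded_sum_norm (K : R) (w : I -> P -> R) :
  (forall k, slab_bounded (w k)) ->
  slab_bounded (fun q => K * \sum_k `|w k q|).
Proof.
move=> bw; split.
  apply: measurable_funM => //; apply: measurable_sum => k.
  by apply: measurableT_comp => //; case: (bw k).
move=> T; have /choice [B hB] : forall k, exists B, forall p, `|p.1| <= T -> `|w k p| <= B.
  by move=> k; case: (bw k) => _ /(_ T).
exists (`|K| * \sum_k B k) => p pT; rewrite normrM ler_wpM2l//.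
rewrite ger0_norm; last by apply: sumr_ge0 => k _.
by apply: ler_sum => k _; exact: hB.
Qed.

(** In [wnorm_step] with [w' = w] half of the left side is absorbed, which is where its finiteness
    enters and where $4=2/(1-\frac12)$ comes from. The exponential is the price of removing the
    weight. *)
Lemma wnorm_gronwall (c : I -> R) (w r : I -> P -> R) (K T : R) : 0 < T ->
  (forall j, measurable_fun setT (w j)) ->
  (forall j, measurable_fun setT (r j)) ->
  (forall j, {ae mu2, forall p, slab T p ->
     `|w j p| <= `|r j p| + `|Vc (c j) (fun q => K * \sum_k `|w k q|) p|}) ->
  (forall j, (wnorm 0 T (w j) < +oo)%E) ->
  (\sum_j wnorm 0 T (w j) <=
   (4 * expR (gronwall_weight K T * T))%:E * \sum_j wnorm 0 T (r j))%E.
Proof.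
move=> T0 mw mr h wfin; set L := gronwall_weight K T.
have L0 : 0 <= L := ltW (gronwall_weight_gt0 K T0).
have := wnorm_step T0 mw mw mr h; rewrite -/L.
set S := (\sum_j wnorm L T (w j))%E; set Q := (\sum_j wnorm L T (r j))%E => SQ.
have Sfin : S \is a fin_num.
  apply/sum_fin_numP => j _ _; rewrite ge0_fin_numE; last exact: wnorm_ge0.
  exact: le_lt_trans (wnorm_le0 T L0 (mw j)) (wfin j).
have S4 : (S <= 4%:E * Q)%E.
  have Q0 : (0 <= Q)%E by apply: sume_ge0 => j _; exact: wnorm_ge0.
  move: SQ Q0; rewrite -(fineK Sfin); case: Q => [q| |]//.
    by rewrite -!EFinM -EFinD !lee_fin => *; lra.
  by move=> _ _; rewrite gt0_muley ?lte_fin// leey.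
apply: (@le_trans _ _ ((expR (L * T))%:E * S)%E).
  rewrite ge0_sume_distrr; last by move=> j _; exact: wnorm_ge0.
  by apply: lee_sum => j _; exact: wnorm0_le.
rewrite [4 * _]mulrC EFinM -muleA; apply: lee_wpmul2l; first by rewrite lee_fin expR_ge0.
apply: (le_trans S4); apply: lee_wpmul2l => //.
by apply: lee_sum => j _; exact: wnorm_le0.
Qed.


(** * Picard iteration for a globally Lipschitz nonlinearity *)

Section Picard.
Context (c : I -> R) (d : I -> R -> R) (G : I -> R -> (I -> R) -> R).
Context (K : R -> R) (M : R).
Hypothesis mG : forall f : I -> P -> R, (forall k, measurable_fun setT (f k)) ->
  forall j, measurable_fun setT (fun p : P => G j p.1 (fun k => f k p)).
Hypothesis G0 : forall j t, G j t (fun=> 0) = 0.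
Hypothesis K0 : forall T, 0 <= K T.
Hypothesis GL : forall j t T y z, `|t| <= T ->
  `|G j t y - G j t z| <= K T * \sum_k `|y k - z k|.
Hypothesis md : forall j, measurable_fun (setT : set mR) (d j).
Hypothesis dM : forall j x, `|d j x| <= M.

Definition nonlin (f : I -> P -> R) (j : I) (p : P) : R :=
  G j p.1 (fun k => f k p).

Definition free_wave (j : I) (p : P) : R := d j (p.2 + c j * p.1).

Definition volterra (f : I -> P -> R) (j : I) (p : P) : R :=
  free_wave j p + Vc (c j) (nonlin f j) p.

Fixpoint picard (m : nat) : I -> P -> R :=
  if m is m'.+1 then volterra (picard m') else fun=> fun=> 0.

Lemma measurable_free j : measurable_fun setT (free_wave j).
Proof.
apply: (measurableT_comp (md j)).
by apply: measurable_funD => //; exact: measurable_funM.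
Qed.

Lemma slab_bounded_nonlin f : (forall k, slab_bounded (f k)) ->
  forall j, slab_bounded (nonlin f j).
Proof.
move=> bf j; split; first by apply: mG => k; case: (bf k).
move=> T.
have /choice [B hB] : forall k, exists B, forall p, `|p.1| <= T -> `|f k p| <= B.
  by move=> k; case: (bf k) => _ /(_ T).
exists (K T * \sum_k B k) => p pT.
have := @GL j p.1 T (fun k => f k p) (fun=> 0) pT; rewrite G0 subr0 => h.
apply: (le_trans h); apply: ler_wpM2l => //; apply: ler_sum => k _.
by rewrite subr0 hB.
Qed.

Lemma slab_bounded_volterra f : (forall k, slab_bounded (f k)) ->
  forall j, slab_bounded (volterra f j).
Proof.
move=> bf j; have [mV bV] := slab_bounded_Vc (c j) (slab_bounded_nonlin bf j).
split; first by apply: measurable_funD => //; exact: measurable_free.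
move=> T; have [B hB] := bV T; exists (M + B) => p pT.
by apply: (le_trans (ler_normD _ _)); rewrite lerD ?hB// dM.
Qed.

Lemma slab_bounded_picard m j : slab_bounded (picard m j).
Proof.
elim: m j => [|m IH] j; last exact: slab_bounded_volterra.
by split=> [|T]; [exact: measurable_cst|exists 0 => p _; rewrite normr0].
Qed.

(** Ensures $nK/L\le1/2$: the Volterra map halves distances in the supremum norm weighted by
    $e^{-L|t|}$ on $|t|\le T$. *)
Let L T := 2 * n * K T + 1.

Let L_gt0 T : 0 < L T.
Proof. by rewrite ltr_wpDl// mulr_ge0// mulr_ge0. Qed.

Lemma volterra_contraction f g T B : (forall k, slab_bounded (f k)) ->
  (forall k, slab_bounded (g k)) -> 0 <= B ->
  (forall k p, `|p.1| <= T -> `|f k p - g k p| <= B * expR (L T * `|p.1|)) ->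
  forall j p, `|p.1| <= T ->
    `|volterra f j p - volterra g j p| <= B / 2 * expR (L T * `|p.1|).
Proof.
move=> bf bg B0 fg j p pT.
have bF := slab_bounded_nonlin bf j; have bG := slab_bounded_nonlin bg j.
have -> : volterra f j p - volterra g j p =
    Vc (c j) (fun q => nonlin f j q - nonlin g j q) p.
  by rewrite VcB// /volterra; ring.
apply: (@le_trans _ _ (K T * n * B / L T * expR (L T * `|p.1|))).
  apply: Vc_exp_bound => //.
    by case: bF => mF _; case: bG => mG' _; exact: measurable_funB.
  move=> q qp; have qT := le_trans qp pT.
  apply: (le_trans (GL _ _ _ qT)).
  rewrite -!mulrA; apply: ler_wpM2l => //.
  rewrite mulr_natl -sumr_const; apply: ler_sum => k _; exact: fg.
rewrite ler_wpM2r ?expR_ge0// ler_pdivrMr// /L.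
have := mulr_ge0 (mulr_ge0 (K0 T) (ler0n R #|I|)) B0; nra.
Qed.

Lemma picard_step T m j p : `|p.1| <= T ->
  `|picard m.+1 j p - picard m j p| <= M * 2^-1 ^+ m * expR (L T * `|p.1|).
Proof.
have M0 : 0 <= M by apply: le_trans (dM j 0).
elim: m j p => [|m IH] j p pT.
  rewrite expr0 mulr1 /= subr0 /volterra /nonlin.
  have -> : Vc (c j) (fun p0 : P => G j p0.1 (fun=> 0)) p = 0.
    rewrite VcE (eq_oint (g := fun=> 0)); last by move=> s _; rewrite G0.
    by rewrite /oint /Rintegral integral0_eq ?mulr0.
  rewrite addr0; apply: (le_trans (dM _ _)); rewrite ler_peMr//.
  by rewrite -expR0 ler_expR mulr_ge0// ltW.
have -> : M * 2^-1 ^+ m.+1 = M * 2^-1 ^+ m / 2 :> R by rewrite exprSr mulrA.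
have B0 : 0 <= M * 2^-1 ^+ m by rewrite mulr_ge0// exprn_ge0// invr_ge0.
have H := volterra_contraction (fun k => slab_bounded_picard m.+1 k)
  (fun k => slab_bounded_picard m k) B0 IH j pT.
refine H.
Qed.

Lemma picard_limit : exists f : I -> P -> R,
  (forall k, slab_bounded (f k)) /\
  (forall j p, picard m j p @[m --> \oo] --> f j p) /\
  forall j p, f j p = volterra f j p.
Proof.
have M0 (j : I) : 0 <= M by apply: le_trans (dM j 0).
(* At each point the limit is taken with $T=|t|$. The rate for a larger $T$, needed to compare
   different points, then follows from uniqueness of limits. *)
have ex (jp : I * P) : exists l, forall m, `|picard m jp.1 jp.2 - l| <=
    2 * (M * expR (L `|jp.2.1| * `|jp.2.1|)) * 2^-1 ^+ m.
  apply: geometric_limit => m; rewrite mulrAC; exact: picard_step.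
have [l hl] := choice ex; pose f j p := l (j, p).
have fT T j p m : `|p.1| <= T -> `|picard m j p - f j p| <=
    2 * M * 2^-1 ^+ m * expR (L T * `|p.1|).
  move=> pT.
  have [l' hl'] : exists l', forall m, `|picard m j p - l'| <=
      2 * (M * expR (L T * `|p.1|)) * 2^-1 ^+ m.
    by apply: geometric_limit => m'; rewrite mulrAC; exact: picard_step.
  have := hl' m; suff -> : f j p = l' by move/le_trans; apply; rewrite le_eqVlt; apply/orP; left; apply/eqP; ring.
  exact: (geometric_unique (u := fun m => picard m j p) (hl (j, p)) hl').
have fcvg j p : picard m j p @[m --> \oo] --> f j p.
  exact: (geometric_cvg (u := fun m => picard m j p) (hl (j, p))).
have bf k : slab_bounded (f k).
  split.
    apply: (@measurable_fun_cvg _ _ _ _ (fun m => picard m k)) => //.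
    by move=> m; case: (slab_bounded_picard m k).
  move=> T; exists (2 * M * expR (L T * T)) => p pT.
  have := fT T k p 0%N pT; rewrite /= sub0r normrN expr0 mulr1 => /le_trans; apply.
  by rewrite ler_wpM2l ?mulr_ge0 ?M0// ler_expR ler_wpM2l// ltW.
exists f; split=> //; split=> // j p.
(* Both sides are limits of the iterates shifted by one: the left one by construction, the right one
   by contraction. *)
apply: (geometric_unique (u := fun m => picard m.+1 j p)
  (C := M * expR (L `|p.1| * `|p.1|)) (C' := M * expR (L `|p.1| * `|p.1|))) => m.
  apply: le_trans (fT _ j p m.+1 (lexx _)) _; rewrite exprS.
  by rewrite le_eqVlt; apply/orP; left; apply/eqP; field.
apply: le_trans (volterra_contraction (fun k => slab_bounded_picard m k) bf
  (B := 2 * M * 2^-1 ^+ m) (T := `|p.1|) _ _ j (lexx _)) _.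
- by rewrite mulr_ge0 ?exprn_ge0 ?invr_ge0// mulr_ge0 ?(M0 j).
- by move=> k q; exact: fT.
- by rewrite le_eqVlt; apply/orP; left; apply/eqP; field.
Qed.

End Picard.

End Volterra.

(** * Smooth functions with compact support *)

Section SmoothClasses.
Context {R : realType}.

(** A coinduction principle: smoothness is proved by exhibiting a class of differentiable functions
    that directional derivatives do not leave. *)
Lemma smooth_class (V : normedModType R) (S : set (V -> R)) (f : V -> R) :
  S f ->
  (forall g, S g -> (forall x, differentiable g x) /\ forall v, S ('D_v g)) ->
  smooth f.
Proof.
move=> Sf HS vs x; apply: (HS _ _).1.
by elim: vs => [//|v vs IH]; exact: (HS _ IH).2.
Qed.

(** Smoothness witnessed by a class invariant under differentiation, so that no formula for higher
    derivatives is ever written down. *)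
Definition smooth1 (f : R -> R) : Prop :=
  exists S : set (R -> R), S f /\
    forall g, S g -> exists2 g', S g' & forall x : R, is_derive x (1 : R) g (g' x).

Lemma smooth1_derive f : smooth1 f ->
  exists2 f', smooth1 f' & forall x : R, is_derive x (1 : R) f (f' x).
Proof.
move=> [S [Sf HS]]; have [g Sg dg] := HS _ Sf.
by exists g => //; exists S.
Qed.

Lemma smooth1_continuous f : smooth1 f -> continuous f.
Proof.
move=> /smooth1_derive[f' _ df] x.
by apply/differentiable_continuous/derivable1_diffP; case: (df x).
Qed.

Lemma smooth1_affine f a b : smooth1 f -> smooth1 (fun x => f (a * x + b)).
Proof.
move=> [S [Sf HS]].
exists [set h | exists2 g, S g & exists k : R, h = fun x => k * g (a * x + b)].
split; first by exists f => //; exists 1; apply/funext => x; rewrite mul1r.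
move=> _ [g Sg [k ->]]; have [g' Sg' dg] := HS _ Sg.
exists (fun x => (k * a) * g' (a * x + b)); first by exists g' => //; exists (k * a).
move=> x.
have d1 : is_derive x (1 : R) (fun x : R => a * x + b) a.
  by apply: is_derive_eq; rewrite /GRing.scale/= mulr1 addr0.
have d2 := is_derive1_comp (f := g) (g := fun x => a * x + b) (dg _) d1.
have h := is_deriveZ k d2; apply: is_derive_eq h _.
by rewrite /GRing.scale/=; ring.
Qed.

(** Sums are included because Leibniz' rule leads from a product to a sum of products. *)
Inductive products (S T : set (R -> R)) : (R -> R) -> Prop :=
| products_mul f g : S f -> T g -> products S T (fun x => f x * g x)
| products_add f g : products S T f -> products S T g ->
    products S T (fun x => f x + g x).

Lemma smooth1M f g : smooth1 f -> smooth1 g -> smooth1 (fun x => f x * g x).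
Proof.
move=> [S [Sf HS]] [T [Tg HT]]; exists (products S T).
split; first exact: products_mul.
move=> h hh; elim: hh => {h} [f0 g0 Sf0 Tg0|f0 g0 _ [f' Sf' df] _ [g' Sg' dg]].
  have [f' Sf' df] := HS _ Sf0; have [g' Tg' dg] := HT _ Tg0.
  exists (fun x => f0 x * g' x + f' x * g0 x).
    by apply: products_add; exact: products_mul.
  move=> x; have h := is_deriveM (df x) (dg x); apply: is_derive_eq h _.
  by rewrite /GRing.scale/=; ring.
exists (fun x => f' x + g' x); first exact: products_add.
by move=> x; have h := is_deriveD (df x) (dg x); apply: is_derive_eq h _.
Qed.

Lemma smooth1_primitive f F : smooth1 f ->
  (forall x : R, is_derive x (1 : R) F (f x)) -> smooth1 F.
Proof.
move=> [S [Sf HS]] dF; exists (S `|` [set F]); split; first by right.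
move=> g [/HS[g' Sg' dg]|->]; last by exists f => //; left.
by exists g' => //; left.
Qed.

Lemma smooth1D f g : smooth1 f -> smooth1 g -> smooth1 (fun x => f x + g x).
Proof.
move=> [S [Sf HS]] [T [Tg HT]].
exists [set h | exists a b, [/\ S a, T b & h = fun x => a x + b x]].
split; first by exists f, g.
move=> _ [a [b [Sa Tb ->]]].
have [a' Sa' da] := HS _ Sa; have [b' Tb' db] := HT _ Tb.
exists (fun x => a' x + b' x); first by exists a', b'.
by move=> x; have h := is_deriveD (da x) (db x); apply: is_derive_eq h _.
Qed.

Lemma smooth1_cst (c : R) : smooth1 (fun=> c).
Proof.
exists [set h | exists k : R, h = fun=> k]; split; first by exists c.
move=> _ [k ->]; exists (fun=> 0); first by exists 0.
by move=> x; exact: is_derive_cst.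
Qed.

Lemma smooth1_smooth f : smooth1 f -> smooth (V := R) f.
Proof.
move=> [S [Sf HS]].
pose C := [set h : R -> R | exists2 g, S g & exists k : R, h = fun x => k * g x].
apply: (@smooth_class _ C); first by exists f => //; exists 1; apply/funext => x; rewrite mul1r.
move=> _ [g Sg [k ->]]; have [g' Sg' dg] := HS _ Sg.
have dh (x : R) : differentiable (fun x => k * g x : R) x.
  by apply/derivable1_diffP; case: (is_deriveZ k (dg x)).
split=> // v; exists g' => //; exists (v * k); apply/funext => x.
rewrite deriveE// -[v]mulr1 -[v * 1]/(v *: (1 : R)) linearZ/= -deriveE//.
case: (is_deriveZ k (dg x)) => _ ->.
by rewrite /GRing.scale/= ?mulr1; ring.
Qed.

(** For $a=-c$ and $b=1$ this is $x-ct$, which is constant in the direction $(1,c)$. *)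
Definition lform (a b : R) (p : R * R) : R := a * p.1 + b * p.2.

Lemma lform_linear a b : linear (lform a b : R * R -> R^o).
Proof.
move=> k p q; rewrite /lform/= /GRing.scale/=; ring.
Qed.

HB.instance Definition _ a b :=
  GRing.isLinear.Build R (R * R)%type R^o _ (lform a b) (lform_linear a b).

Lemma lform_continuous a b : continuous (lform a b).
Proof.
move=> p; apply: cvgD; apply: cvgM; try exact: cvg_cst.
  exact: cvg_fst.
exact: cvg_snd.
Qed.

Lemma lform_diff a b (p : R * R) : is_diff p (lform a b) (lform a b).
Proof.
apply: DiffDef; first exact/linear_differentiable/lform_continuous.
by rewrite diff_lin//; exact: lform_continuous.
Qed.

Inductive tensors (a b : R) (S T : set (R -> R)) : (R * R -> R) -> Prop :=
| tensors_mul k f g : S f -> T g ->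
    tensors a b S T (fun p => k * (f p.1 * g (lform a b p)))
| tensors_add f g : tensors a b S T f -> tensors a b S T g ->
    tensors a b S T (fun p => f p + g p).

Lemma is_diff_tensor (k a b : R) (f f' g g' : R -> R) (p : R * R) :
  (forall x : R, is_derive x (1 : R) f (f' x)) ->
  (forall x : R, is_derive x (1 : R) g (g' x)) ->
  is_diff p (fun p => k * (f p.1 * g (lform a b p)))
    (fun v => k * (f' p.1 * v.1 * g (lform a b p) +
      f p.1 * (g' (lform a b p) * lform a b v))).
Proof.
move=> df dg.
have D (h h' : R -> R) (x : R) : (forall x : R, is_derive x (1 : R) h (h' x)) ->
    is_diff x h (fun v => v *: h' x).
  move=> dh; have hx : differentiable h x by apply/derivable1_diffP; case: (dh x).
  apply: DiffDef => //; rewrite diff1E// derive1E; by case: (dh x) => _ ->.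
have E1 : (fun p : R * R => p.1) = lform 1 0.
  by apply/funext => q; rewrite /lform mul1r mul0r addr0.
have h1 : is_diff p (f \o lform 1 0) ((fun v => v *: f' (lform 1 0 p)) \o lform 1 0).
  exact: (is_diff_comp (lform_diff 1 0 p) (D _ _ _ df)).
have h2 : is_diff p (g \o lform a b) ((fun v => v *: g' (lform a b p)) \o lform a b).
  exact: (is_diff_comp (lform_diff a b p) (D _ _ _ dg)).
have h3 := is_diffM h1 h2.
have h4 := is_diffZ k h3.
have -> : (fun p => k * (f p.1 * g (lform a b p))) =
  k *: ((f \o lform 1 0) * (g \o lform a b)).
  apply/funext => q; rewrite -[in LHS](_ : lform 1 0 q = q.1)//.
  by rewrite /lform mul1r mul0r addr0.
apply: is_diff_eq h4 _; apply/funext => v.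
rewrite /= /GRing.scale/= /GRing.scale/=.
rewrite !fctE/= /lform !mul1r !mul0r !addr0.
by rewrite /GRing.scale/=; ring.
Qed.

Lemma smooth_tensor (a b : R) (f g : R -> R) : smooth1 f -> smooth1 g ->
  smooth (V := (R * R)%type) (fun p => f p.1 * g (lform a b p)).
Proof.
move=> [S [Sf HS]] [T [Tg HT]].
apply: (@smooth_class _ (tensors a b S T)).
  rewrite (_ : (fun p => _) = (fun p => 1 * (f p.1 * g (lform a b p)))).
    exact: tensors_mul.
  by apply/funext => p; rewrite mul1r.
move=> h hh; elim: hh => {h} [k f0 g0 Sf0 Tg0|f0 g0 _ [df Df] _ [dg Dg]].
  have [f' Sf' df] := HS _ Sf0; have [g' Tg' dg] := HT _ Tg0.
  have D p := is_diff_tensor k a b p df dg.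
  split=> [p|v]; first by case: (D p).
  rewrite (_ : 'D_v _ = (fun p => (k * v.1) * (f' p.1 * g0 (lform a b p)) +
      (k * lform a b v) * (f0 p.1 * g' (lform a b p)))).
    by apply: tensors_add; exact: tensors_mul.
  apply/funext => p; rewrite deriveE; last by case: (D p).
  by case: (D p) => _ ->; ring.
split=> [p|v].
  exact: differentiableD.
rewrite (_ : 'D_v _ = (fun p => 'D_v f0 p + 'D_v g0 p)); first exact: tensors_add.
by apply/funext => p; rewrite deriveD//; apply: diff_derivable.
Qed.

(** The factor that depends on $x-ct$ is constant in the direction $(1,c)$, so that only [f] is
    differentiated. *)
Lemma derive_tensor (f f' g : R -> R) (c : R) (p : R * R) : smooth1 g ->
  (forall x : R, is_derive x (1 : R) f (f' x)) ->
  'D_((1, c) : R * R) (fun p : R * R => f p.1 * g (lform (- c) 1 p)) p =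
  f' p.1 * g (lform (- c) 1 p).
Proof.
move=> sg df; have [g' _ dg] := smooth1_derive sg.
have := is_diff_tensor 1 (- c) 1 p df dg.
rewrite (_ : (fun p => 1 * _) = (fun p => f p.1 * g (lform (- c) 1 p))); last first.
  by apply/funext => q; rewrite mul1r.
move=> [D E]; rewrite deriveE// E /lform/=; ring.
Qed.

Lemma support_sub_compact (V : normedModType R) (K : set V) (f : V -> R) :
  hausdorff_space V -> compact K -> (forall x, ~ K x -> f x = 0) ->
  compact (closure [set x | f x != 0]) /\ closure [set x | f x != 0] `<=` K.
Proof.
move=> hV cK fK.
have sub : closure [set x | f x != 0] `<=` K.
  rewrite (closure_id K).1; last exact: compact_closed.
  apply: closure_subset => x /= fx; apply: contrapT => /fK fx0.
  by rewrite fx0 eqxx in fx.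
by split=> //; apply: subclosed_compact sub => //; exact: closed_closure.
Qed.

Lemma tensor_test_function (U : set (R * R)) (f g : R -> R) (a b a' b' c : R) :
  smooth1 f -> smooth1 g ->
  (forall x, ~ (a <= x <= b) -> f x = 0) ->
  (forall x, ~ (a' <= x <= b') -> g x = 0) ->
  (forall p, a <= p.1 <= b -> U p) ->
  test_function (V := (R * R)%type) U (fun p => f p.1 * g (lform (- c) 1 p)).
Proof.
move=> sf sg fab gab abU.
pose B := `|c| * (`|a| + `|b|).
pose K : set (R * R) := `[a, b]%classic `*` `[a' - B, b' + B]%classic.
have [|||cs sK] := @support_sub_compact (R * R)%type K (fun p => f p.1 * g (lform (- c) 1 p)).
- exact: norm_hausdorff.
- by apply: compact_setX; exact: segment_compact.
- move=> p Kp; have [f0|/eqP f0] := eqVneq (f p.1) 0; first by rewrite f0 mul0r.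
  rewrite gab ?mulr0// /lform mul1r => h; apply: Kp.
  have pab : a <= p.1 <= b by apply: contrapT => /fab.
  split; rewrite /= in_itv//=.
  have : `|c * p.1| <= B.
    rewrite normrM ler_wpM2l// ler_norml.
    have := ler_norm b; have := ler_norm (- a); rewrite normrN.
    by have := normr_ge0 a; have := normr_ge0 b; lra.
  by rewrite ler_norml; move: h; lra.
split=> //; first exact: smooth_tensor.
by move=> p /sK [/= + _]; rewrite in_itv/= => /abU.
Qed.

Lemma smooth1_test_function (U : set R) (f : R -> R) (a b : R) : smooth1 f ->
  (forall x, ~ (a <= x <= b) -> f x = 0) -> `[a, b]%classic `<=` U ->
  test_function (V := R) U f.
Proof.
move=> sf fab abU.
have [|||cs sK] := @support_sub_compact R `[a, b]%classic f.
- exact: norm_hausdorff.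
- exact: segment_compact.
- by move=> x; rewrite /= in_itv/=; exact: fab.
split=> //; first exact: smooth1_smooth.
exact: subset_trans abU.
Qed.

(* This class of flat functions is closed under differentiation. *)
Definition flat (p : {poly R}) (x : R) : R :=
  if 0 < x then p.[x^-1] * expR (- x^-1) else 0.

(** With $y=1/x$ and $k$ the size of [p], the bound $e^y\ge y^{k+2}/(k+2)!$ beats the polynomial and
    leaves $y^{-2}=x^2$. Order two is what makes the derivative at 0 vanish. *)
Lemma flat_bound p : exists2 C, 0 <= C &
  forall x, 0 < x -> x <= 1 -> `|flat p x| <= C * x ^+ 2.
Proof.
pose k := size p.
pose A := \sum_(i < k) `|p`_i|.
exists (A * (k.+2)`!%:R); first by rewrite mulr_ge0// sumr_ge0.
move=> x x0 x1; rewrite /flat x0 normrM [X in _ * X]ger0_norm ?expR_ge0//.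
set y := x^-1; have y1 : 1 <= y by rewrite invf_ge1.
have y0 : 0 < y by rewrite invr_gt0.
have pA : `|p.[y]| <= A * y ^+ k.
  rewrite horner_coef; apply: le_trans (ler_norm_sum _ _ _) _.
  rewrite /A mulr_suml; apply: ler_sum => i _.
  rewrite normrM ler_wpM2l// normrX (ger0_norm (ltW y0)).
  by rewrite ler_weXn2l// ltnW.
have ey : expR (- y) <= (k.+2)`!%:R / y ^+ k.+2.
  rewrite expRN -[X in _ <= X]invrK lef_pV2 ?posrE ?expR_gt0 ?invr_gt0 ?divr_gt0 ?exprn_gt0 ?ltr0n ?fact_gt0//.
  rewrite invf_div; apply: le_trans (expR_ge1Dxn k.+1 (ltW y0)).
  by rewrite lerDr.
apply: (@le_trans _ _ (A * y ^+ k * ((k.+2)`!%:R / y ^+ k.+2))).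
  by apply: ler_pM => //; exact: expR_ge0.
rewrite le_eqVlt; apply/orP; left; apply/eqP.
rewrite -addn2 exprD.
have xE : x = y^-1 by rewrite invrK.
rewrite xE; field.
by rewrite expf_neq0 ?gt_eqF.
Qed.

(** For $x>0$ the derivative of $p(1/x)e^{-1/x}$ is $x^{-2}(p-p')(1/x)\,e^{-1/x}$, whence the new
    polynomial. At 0 the difference quotient vanishes on the left and is at most $Ch$ on the
    right. *)
Lemma flat_derive p (x : R) :
  is_derive x (1 : R) (flat p) (flat ('X^2 * (p - p^`())) x).
Proof.
have [x0|x0|<-] := ltgtP 0 x.
- have hn : \forall z \near x, p.[z^-1] * expR (- z^-1) = flat p z.
    by near=> z; rewrite /flat ifT//; near: z; exact: lt_nbhsr.
  rewrite {2}/flat x0.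
  have xn : x != 0 by rewrite gt_eqF.
  have dV : is_derive x (1 : R) (fun y : R => y^-1) (- x ^- 2).
    have h := is_deriveV (f := @id R) xn (is_derive_id x (1 : R)).
    by apply: is_derive_eq h _; rewrite /GRing.scale/= mulr1.
  have d1 : is_derive x (1 : R) (horner p \o (fun y : R => y^-1)) (p^`().[x^-1] * (- x ^- 2)).
    exact: is_derive1_comp.
  have dN : is_derive x (1 : R) (fun y : R => - y^-1) (x ^- 2).
    by apply: (is_derive_eq (is_deriveN dV)); rewrite opprK.
  have d2 : is_derive x (1 : R) (@expR R \o (fun y : R => - y^-1)) (expR (- x^-1) * x ^- 2).
    exact: is_derive1_comp.
  have dM := is_deriveM d1 d2.
  apply: (is_derive_eq (near_eq_is_derive hn dM)).
  rewrite !hornerE /GRing.scale/=; field.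
  exact: xn.
- have hn : \forall z \near x, 0 = flat p z.
    near=> z; rewrite /flat ifF//; apply/negbTE; rewrite -leNgt ltW//.
    by near: z; exact: lt_nbhsl.
  rewrite {2}/flat ifF; last by apply/negbTE; rewrite -leNgt ltW.
  exact: (near_eq_is_derive hn (is_derive_cst _ _ _)).
have [C C0 hC] := flat_bound p.
rewrite {2}/flat ltxx.
have H : (fun h : R => h^-1 *: ((flat p \o shift 0) (h *: (1 : R)) - flat p 0)) @ 0^' --> (0 : R).
  apply/cvgrPdist_le => e e0.
  near=> h.
  have h0 : h != 0 by near: h; exact: nbhs_dnbhs_neq.
  rewrite sub0r normrN /= addr0 /GRing.scale/= mulr1 {2}/flat ltxx subr0 normrM normfV.
  have [hp|hn] := ltP 0 h; last first.
    by rewrite /flat ifF ?normr0 ?mulr0 ?(ltW e0)//; apply/negbTE; rewrite -leNgt.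
  have h1 : `|h| < 1.
    by near: h; apply: nbhs_dnbhs; exists 1 => //= z; rewrite /ball_/= sub0r normrN.
  have h2 : `|h| < e / (C + 1).
    near: h; apply: nbhs_dnbhs; exists (e / (C + 1)) => /=.
      by rewrite divr_gt0// ltr_wpDl.
    by move=> z; rewrite /ball_/= sub0r normrN.
  rewrite (gtr0_norm hp) in h1 h2 *.
  apply: (@le_trans _ _ (h^-1 * (C * h ^+ 2))).
    apply: ler_wpM2l; first by rewrite invr_ge0 ltW.
    by apply: hC => //; exact: ltW.
  have -> : h^-1 * (C * h ^+ 2) = C * h by field.
  move: h2; rewrite ltr_pdivlMr ?ltr_wpDl//; nra.
have D : derivable (flat p) 0 1 by apply/cvg_ex; exists 0.
split=> //; exact: cvg_lim H.
Unshelve. all: by end_near. Qed.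

Lemma smooth1_flat : smooth1 (flat 1).
Proof.
exists (range flat); split; first by exists 1.
move=> _ [p _ <-]; exists (flat ('X^2 * (p - p^`()))); first by exists ('X^2 * (p - p^`())).
exact: flat_derive.
Qed.

Lemma flat1E (x : R) : 0 < x -> flat 1 x = expR (- x^-1).
Proof. by move=> x0; rewrite /flat x0 hornerE mul1r. Qed.

Lemma flat_le0 p (x : R) : x <= 0 -> flat p x = 0.
Proof. by move=> x0; rewrite /flat ifF//; apply/negbTE; rewrite -leNgt. Qed.

Lemma flat1_itv (x : R) : 0 <= flat 1 x <= 1.
Proof.
have [x0|x0] := ltP 0 x; last by rewrite flat_le0// lexx ler01.
by rewrite flat1E// expR_ge0/= -expR0 ler_expR oppr_le0 invr_ge0 ltW.
Qed.

(** Smooth approximations of the indicator of $]l,r[$: the factors are $e^{-1/((n+1)(x-l))}$ and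
    $e^{-1/((n+1)(r-x))}$ inside the interval, and both tend to 1 there. *)
Definition plateau (l r : R) (n : nat) (x : R) : R :=
  flat 1 (n.+1%:R * x + - (n.+1%:R * l)) * flat 1 (- n.+1%:R * x + n.+1%:R * r).

Lemma smooth1_plateau l r n : smooth1 (plateau l r n).
Proof. by apply: smooth1M; apply: (smooth1_affine _ _ smooth1_flat). Qed.

Lemma plateau_itv l r n x : 0 <= plateau l r n x <= 1.
Proof.
rewrite /plateau; set a := flat 1 _; set b := flat 1 _.
have /andP[a0 a1] : 0 <= a <= 1 by exact: flat1_itv.
have /andP[b0 b1] : 0 <= b <= 1 by exact: flat1_itv.
by rewrite mulr_ge0//= mulr_ile1.
Qed.

Lemma plateau_out l r n x : ~ (l < x < r) -> plateau l r n x = 0.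
Proof.
move=> h; rewrite /plateau; have n0 : 0 < n.+1%:R :> R by rewrite ltr0n.
have [lx|lx] := ltP l x; last first.
  by rewrite flat_le0 ?mul0r// subr_le0 ler_wpM2l// ltW.
have [xr|xr] := ltP x r; first by case: h; rewrite lx xr.
by rewrite [X in _ * X]flat_le0 ?mulr0// mulNr addrC subr_le0 ler_wpM2l// ltW.
Qed.

Lemma plateau_cvg l r x : plateau l r n x @[n --> \oo] --> (\1_`]l, r[%classic x : R).
Proof.
rewrite indicE.
have -> : (x \in `]l, r[%classic) = (l < x < r) by apply/idP/idP; rewrite inE/= in_itv.
have [/andP[lx xr]|/negP h] := boolP (l < x < r).
  have key (d : R) : 0 < d -> flat 1 (n.+1%:R * d) @[n --> \oo] --> (1 : R).
    move=> d0.
    have -> : (fun n => flat 1 (n.+1%:R * d)) = (fun n => expR (- (n.+1%:R^-1 * d^-1))).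
      by apply/funext => n; rewrite flat1E ?invfM// mulr_gt0// ltr0n.
    have h : - (n.+1%:R^-1 * d^-1) @[n --> \oo] --> (0 : R).
      rewrite -oppr0 -(mul0r d^-1); apply: cvgN; apply: cvgM; last exact: cvg_cst.
      exact: cvg_harmonic.
    have ce : expR x @[x --> (0 : R)] --> (1 : R).
      by rewrite -[X in _ --> X]expR0; exact: continuous_expR.
    exact: (cvg_comp _ _ h ce).
  have -> : (fun n => plateau l r n x) =
      (fun n => flat 1 (n.+1%:R * (x - l)) * flat 1 (n.+1%:R * (r - x))).
    by apply/funext => n; rewrite /plateau; congr (flat 1 _ * flat 1 _); ring.
  by rewrite -[X in _ --> X]mulr1; apply: cvgM; apply: key; rewrite subr_gt0.
rewrite (_ : (fun n => _) = fun=> 0); first exact: cvg_cst.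
by apply/funext => n; rewrite plateau_out.
Qed.

Lemma plateau_gt0 l r n x : l < x < r -> 0 < plateau l r n x.
Proof.
move=> /andP[lx xr]; rewrite /plateau mulr_gt0// flat1E ?expR_gt0//.
  by rewrite subr_gt0 ltr_pM2l// ltr0n.
by rewrite mulNr addrC subr_gt0 ltr_pM2l// ltr0n.
Qed.

End SmoothClasses.

Section Support.
Context d (X : measurableType d) (R : realType) (m : {measure set X -> \bar R}).

Lemma Rintegral_support (A : set X) (k : X -> R) :
  (forall x, ~ A x -> k x = 0) -> \int[m]_x k x = \int[m]_(x in A) k x.
Proof.
move=> kA; rewrite [RHS]Rintegral_mkcond; apply: eq_Rintegral => x _.
by rewrite patchE; case: ifPn => //; rewrite notin_setE => /kA.
Qed.

Lemma integrable_support (A : set X) (k : X -> R) : measurable A ->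
  (forall x, ~ A x -> k x = 0) -> m.-integrable A (EFin \o k) ->
  m.-integrable setT (EFin \o k).
Proof.
move=> mA kA /(integrable_mkcond _ mA).1.
rewrite (_ : (EFin \o k) \_ A = EFin \o k)//.
apply/funext => x; rewrite patchE; case: ifPn => //; rewrite notin_setE => /kA/=.
by move=> ->.
Qed.

End Support.

(** * Locally integrable functions of the plane *)

Section LocallyIntegrable2.
Context {R : realType}.
Notation mu := (@lebesgue_measure R).
Notation mR := (measurableTypeR R).
Notation mu2 := (leb2 R).
Notation P := (mR * mR)%type.

Implicit Types f g b : P -> R.

Definition sq (r : R) : set P := [set p | `|p.1| <= r /\ `|p.2| <= r].

Lemma sqE r : sq r = (`[- r, r]%classic : set mR) `*` (`[- r, r]%classic : set mR).
Proof. by apply/seteqP; split=> p; rewrite /sq/= !in_itv/= !ler_norml. Qed.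

Lemma measurable_sq r : measurable (sq r).
Proof. by rewrite sqE; apply: measurableX; exact: measurable_itv. Qed.

Lemma sq_lty r : (mu2 (sq r) < +oo)%E.
Proof.
rewrite sqE /leb2 /= product_measure1E; try exact: measurable_itv.
apply: lte_mul_pinfty => //; last exact: itv_lty.
by rewrite ge0_fin_numE//; exact: itv_lty.
Qed.

Definition locint2 (f : P -> R) : Prop :=
  measurable_fun setT f /\ forall r, mu2.-integrable (sq r) (EFin \o f).

Lemma locint2_le f g : measurable_fun setT f -> locint2 g ->
  (forall p, `|f p| <= `|g p|) -> locint2 f.
Proof.
move=> mf [mg ig] fg; split=> // r; have mr := measurable_sq r.
apply: le_integrable (ig r) => //.
  by apply/measurable_EFinP; exact: measurable_funTS.
by move=> x _; rewrite /= lee_fin.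
Qed.

Lemma locint2D f g : locint2 f -> locint2 g -> locint2 (fun x => f x + g x).
Proof.
move=> [mf If] [mg ig]; split; first exact: measurable_funD.
by move=> r; apply: intgD => //; exact: measurable_sq.
Qed.

Lemma locint2Z c f : locint2 f -> locint2 (fun x => c * f x).
Proof.
move=> [mf If]; split; first exact: measurable_funM.
by move=> r; apply: intgZ => //; exact: measurable_sq.
Qed.

Lemma locint2B f g : locint2 f -> locint2 g -> locint2 (fun x => f x - g x).
Proof.
move=> [mf If] [mg ig]; split; first exact: measurable_funB.
by move=> r; apply: intgB => //; exact: measurable_sq.
Qed.

Lemma locint2_norm f : locint2 f -> locint2 (fun x => `|f x|).
Proof.
move=> lf; apply: (locint2_le _ lf); last by move=> x; rewrite normr_id.
by apply: measurableT_comp => //; case: lf.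
Qed.

Lemma locint2_cst k : locint2 (fun=> k).
Proof.
split; first exact: measurable_cst.
by move=> r; apply: intg_cst; [exact: measurable_sq|exact: sq_lty].
Qed.

Lemma locint2_integrable f b r B : locint2 f -> measurable_fun setT b ->
  (forall p, `|b p| <= B) -> (forall p, ~ sq r p -> b p = 0) ->
  mu2.-integrable setT (EFin \o (fun p => f p * b p)).
Proof.
move=> [mf If] mb bB b0; have mr := measurable_sq r.
apply: (integrable_support mr).
  by move=> p /b0 ->; rewrite mulr0.
apply: (intg_le mr (g := fun p => B * `|f p|)).
- by apply: measurable_funTS; exact: measurable_funM.
- by move=> p _; rewrite normrM mulrC ler_wpM2r.
- apply: intgZ => //; have /integrable_norm := If r; exact.
Qed.

Lemma locint2_bounded f (B : R -> R) : measurable_fun setT f ->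
  (forall r p, sq r p -> `|f p| <= B r) -> locint2 f.
Proof.
move=> mf fB; split=> // r; have mr := measurable_sq r.
apply: (intg_le mr (g := fun=> B r)); first exact: measurable_funTS.
  by move=> p; exact: fB.
by apply: intg_cst => //; exact: sq_lty.
Qed.

Lemma ae_section (Q : P -> Prop) : {ae mu2, forall p, Q p} ->
  {ae mu, forall x, {ae mu, forall t, Q (t, x)}}.
Proof.
move=> [N [mN N0 sN]].
have N0' : (\int[mu2]_p (\1_N p)%:E = 0)%E by rewrite integral_indic// setIT.
have mi : measurable_fun setT (fun p : P => (\1_N p)%:E : \bar R).
  by apply/measurable_EFinP; exact: measurable_indic.
have i0 (p : P) : (0 <= (\1_N p)%:E :> \bar R)%E by rewrite lee_fin.
move: N0'; rewrite /leb2/= fubini_tonelli2// /fubini_G => N0'.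
have mG := measurable_fun_fubini_tonelli_G _ mi i0 (m1 := mu).
have /(ae_eq_integral_abs mu measurableT mG).1 : (\int[mu]_x `|fubini_G mu (fun p : P => (\1_N p)%:E) x| = 0)%E.
  rewrite -[RHS]N0'; apply: eq_integral => x _; rewrite gee0_abs//.
  exact: integral_ge0.
apply: ae_mono => x /(_ I) hx.
exists (ysection N x); split.
- exact: measurable_ysection.
- move: hx; rewrite /fubini_G (_ : (fun t => (\1_N (t, x))%:E) = (fun t => (\1_(ysection N x) t)%:E)).
    by rewrite integral_indic ?setIT//; exact: measurable_ysection.
  apply/funext => t; rewrite !indicE.
  suff -> : (t \in ysection N x) = ((t, x) \in N) by [].
  by apply/idP/idP; rewrite /ysection ?inE/= ?inE.
- by move=> t nQ; rewrite /ysection/= inE; exact: sN.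
Qed.

(** The converse of [ae_section]. Tonelli's theorem is applied to the indicator of a measurable set,
    so a measurable [N] has to be supplied that contains all exceptional points. *)
Lemma ae_section_inv (Q : P -> Prop) (N : set P) : measurable N ->
  (forall p, ~ N p -> Q p) ->
  {ae mu, forall x, {ae mu, forall t, ~ N (t, x)}} ->
  {ae mu2, forall p, Q p}.
Proof.
move=> mN NQ h; exists N; split=> //; last first.
  by move=> p /= nQ; apply: contrapT => nN; apply: nQ; exact: NQ.
have mi : measurable_fun setT (fun p : P => (\1_N p)%:E : \bar R).
  by apply/measurable_EFinP; exact: measurable_indic.
have i0 (p : P) : (0 <= (\1_N p)%:E :> \bar R)%E by rewrite lee_fin.
rewrite -[LHS](_ : (\int[mu2]_p (\1_N p)%:E = _)%E); last by rewrite integral_indic// setIT.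
rewrite /leb2/= fubini_tonelli2// /fubini_G.
rewrite (@ae_eq_integral _ _ _ _ _ (cst 0%E))//; first by rewrite integral0.
  exact: (measurable_fun_fubini_tonelli_G _ mi i0 (m1 := mu)).
apply: ae_mono h => x hx _ /=.
rewrite (@ae_eq_integral _ _ _ _ _ (cst 0%E))//; first by rewrite integral0.
  by apply/measurable_EFinP; apply: (measurableT_comp (measurable_indic mN)); exact: pair2_measurable.
by apply: ae_mono hx => t nN _ /=; rewrite indicE memNset.
Qed.

Lemma locint2_section f : locint2 f -> {ae mu, forall x, locint (fun t => f (t, x))}.
Proof.
move=> [mf If].
have h (k : nat) : {ae mu, forall x, mu.-integrable setT
    (fun t => (EFin \o (f \_ (sq k%:R))) (t, x))}.
  have mk := measurable_sq k%:R.
  apply: ae_integrable2; rewrite -restrict_EFin.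
  exact: ((integrable_mkcond _ mk).1 (If k%:R)).
apply: ae_mono (ae_countable h) => x hx.
split; first exact: (measurableT_comp mf (pair2_measurable x)).
move=> a b.
pose k := Num.bound (`|x| + `|a| + `|b|).
have kb : `|x| + `|a| + `|b| <= k%:R.
  by rewrite ltW// archi_boundP// !addr_ge0.
have mab : measurable (`[a, b]%classic : set mR) by exact: measurable_itv.
have := integrableS measurableT mab (@subsetT _ _) (hx k).
apply: eq_integrable => //.
move=> t; rewrite inE/= in_itv/= => /andP[a1 b1]; rewrite patchE mem_set//.
have := normr_ge0 a; have := normr_ge0 b; have := normr_ge0 x => *.
have := ler_norm b; have := ler_norm (- a); rewrite normrN => *.
by split=> /=; [rewrite ler_norml; lra|lra].
Qed.

(** On a square the time integral is dominated by the integral of $|g|$ over the whole vertical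
    side, an integrable function of $x$ alone. *)
Lemma locint2_vert g : locint2 g -> locint2 (vert g).
Proof.
move=> lg; have [mg ig] := lg; have mv := measurable_vert mg.
split=> // r; have mr := measurable_sq r.
have [r0|r0] := ltP r 0.
  rewrite (_ : sq r = set0); first exact: integrable_set0.
  by apply/seteqP; split=> // p [/le_lt_trans /(_ r0)]; rewrite normr_lt0.
pose k (p : P) : R := `|(g \_ (sq r)) p|.
have mk : measurable_fun setT k.
  have mgr : measurable_fun setT (g \_ (sq r)).
    exact: ((measurable_restrictT g mr).1 (measurable_funS measurableT (@subsetT _ _) mg)).
  exact: measurableT_comp.
have k0 p : (0 <= (k p)%:E)%E by rewrite lee_fin /k.
have mkE : measurable_fun setT (fun p => (k p)%:E) by exact/measurable_EFinP.
pose H (x : R) : \bar R := (\int[mu]_s (k (s, x))%:E)%E.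
have mH : measurable_fun (setT : set mR) H.
  exact: (measurable_fun_fubini_tonelli_G _ mkE k0).
have H0 x : (0 <= H x)%E by exact: integral_ge0.
have Hfin : (\int[mu]_x H x < +oo)%E.
  rewrite -(fubini_tonelli2 _ mkE k0 (m1 := mu) (m2 := mu)).
  have /integrableP[_] := ig r; rewrite integral_mkcond; apply: le_lt_trans.
  rewrite le_eqVlt; apply/orP; left; apply/eqP; apply: eq_integral => p _.
  by rewrite /k !patchE; case: ifP; rewrite ?normr0.
apply/integrableP; split.
  by apply/measurable_EFinP; exact: measurable_funTS.
have bound p : sq r p -> (`|(EFin \o vert g) p| <= H p.2)%E.
  move=> [p1 p2]; rewrite /= /vert.
  apply: le_trans (oint_bound _ _) _.
    exact: (measurableT_comp mg (pair2_measurable p.2)).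
  rewrite integral_mkcond; apply: ge0_le_integral => //.
  - by move=> s _; rewrite patchE; case: ifP.
  - apply/(measurable_restrictT _ _).1; first exact: measurable_seg.
    apply: measurable_funTS; apply/measurable_EFinP; apply: measurableT_comp => //.
    exact: (measurableT_comp mg (pair2_measurable p.2)).
  - apply: (measurableT_comp mkE); exact: (pair2_measurable p.2).
  - move=> s _; rewrite patchE; case: ifPn => // /set_mem /seg_norm s1.
    rewrite /k patchE mem_set//; split => //=; exact: le_trans s1 p1.
apply: (@le_lt_trans _ _ (\int[mu2]_p ((\1_(`[- r, r]%classic) p.1)%:E * H p.2))%E).
  rewrite integral_mkcond; apply: ge0_le_integral => //.
  - by move=> p _; rewrite patchE; case: ifP.
  - have mav : measurable_fun (sq r) (fun p : P => `|(vert g p)%:E|%E).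
      by apply: measurableT_comp => //; apply/measurable_EFinP; exact: measurable_funTS.
    exact: ((measurable_restrictT _ mr).1 mav).
  - apply: emeasurable_funM.
      apply/measurable_EFinP; apply: measurableT_comp; last exact: measurable_fst.
      by apply: measurable_indic; exact: measurable_itv.
    by apply: (measurableT_comp mH); exact: measurable_snd.
  - move=> p _; rewrite patchE; case: ifPn => [/set_mem rp|_]; last first.
      by rewrite mule_ge0// lee_fin.
    apply: (le_trans (bound _ rp)); rewrite indicE mem_set ?mul1e//=.
    by rewrite in_itv/= -ler_norml; case: rp.
rewrite /leb2 fubini_tonelli2//; first last.
- by move=> p; rewrite mule_ge0// lee_fin.
- apply: emeasurable_funM.
    apply/measurable_EFinP; apply: measurableT_comp; last exact: measurable_fst.
    by apply: measurable_indic; exact: measurable_itv.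
  by apply: (measurableT_comp mH); exact: measurable_snd.
rewrite /fubini_G/=.
apply: (@le_lt_trans _ _ (\int[mu]_x (mu `[(- r)%R, r]%classic * H x))%E).
  rewrite le_eqVlt; apply/orP; left; apply/eqP; apply: eq_integral => x _.
  rewrite ge0_integralZr//.
  - by rewrite integral_indic ?setIT//; exact: measurable_itv.
  - apply/measurable_EFinP; apply: measurable_indic; exact: measurable_itv.
rewrite ge0_integralZl//; apply: lte_mul_pinfty => //.
by rewrite ge0_fin_numE//; exact: itv_lty.
Qed.

Lemma locint2_sh c f : locint2 f -> locint2 (f \o sh c).
Proof.
move=> [mf If]; split; first by apply: measurableT_comp => //; exact: measurable_sh.
move=> r; have mr := measurable_sq r.
have := mpreserving_integrable (mpreserving_sh c) (measurable_sq (r + `|c| * r)) mf (If _).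
apply: integrableS => //.
  by rewrite -[X in measurable X]setTI; apply: measurable_sh => //; exact: measurable_sq.
move=> p [p1 p2]; rewrite /sh; split => /=.
  by apply: (le_trans p1); rewrite lerDl mulr_ge0// (le_trans _ p1).
by apply: (le_trans (ler_normD _ _)); rewrite lerD// normrM ler_wpM2l.
Qed.

Lemma locint2_snd (C : R -> R) : locint C -> locint2 (fun p => C p.2).
Proof.
move=> [mC iC]; have mC2 : measurable_fun setT (fun p : P => C p.2).
  by apply: (measurableT_comp mC); exact: measurable_snd.
split=> // r; apply/integrableP; split.
  by apply/measurable_EFinP; exact: measurable_funTS.
have mI : measurable (`[- r, r]%classic : set mR) by exact: measurable_itv.
have m1 : measurable_fun setT (fun x : mR => (\1_(`[- r, r]%classic : set mR) x)%:E : \bar R).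
  by apply/measurable_EFinP; exact: measurable_indic.
have mCI : measurable_fun setT (fun x : mR => `|C x|%:E * (\1_(`[- r, r]%classic : set mR) x)%:E)%E.
  by apply: emeasurable_funM => //; apply/measurable_EFinP; exact: measurableT_comp.
rewrite integral_mkcond.
rewrite (eq_integral (fun p : P => (\1_(`[- r, r]%classic : set mR) p.1)%:E *
    (`|C p.2|%:E * (\1_(`[- r, r]%classic : set mR) p.2)%:E))%E); last first.
  move=> p _; rewrite patchE sqE in_setX !indicE.
  by do 2 case: (_ \in _) => /=; rewrite ?mul1e ?mul0e ?mule1 ?mule0.
rewrite /leb2 fubini_tonelli2//; first last.
- apply: emeasurable_funM.
    by apply: (measurableT_comp m1); exact: measurable_fst.
  by apply: (measurableT_comp mCI); exact: measurable_snd.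
rewrite /fubini_G/=.
apply: (@le_lt_trans _ _ (\int[mu]_x (mu `[(- r)%R, r]%classic *
    (`|C x|%:E * (\1_(`[(- r)%R, r]%classic : set mR) x)%:E)))%E).
  rewrite le_eqVlt; apply/orP; left; apply/eqP; apply: eq_integral => x _.
  rewrite ge0_integralZr//.
  by rewrite integral_indic ?setIT.
have Cfin : (\int[mu]_x (`|C x|%:E * (\1_(`[(- r)%R, r]%classic : set mR) x)%:E) < +oo)%E.
  have /integrableP[_] := iC (- r) r; rewrite integral_mkcond; apply: le_lt_trans.
  rewrite le_eqVlt; apply/orP; left; apply/eqP; apply: eq_integral => x _.
  by rewrite patchE indicE; case: ifP; rewrite ?mule1 ?mule0.
rewrite ge0_integralZl//.
by apply: lte_mul_pinfty => //; rewrite ge0_fin_numE//; exact: itv_lty.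
Qed.

Lemma cvg_indic_dominated (D : P -> R) r (b : nat -> P -> R) (A : set P) :
  locint2 D -> measurable A -> A `<=` sq r ->
  (forall n, measurable_fun setT (b n)) ->
  (forall n p, `|b n p| <= 1) -> (forall n p, ~ sq r p -> b n p = 0) ->
  (forall p, b n p @[n --> \oo] --> (\1_A p : R)) ->
  (forall n, \int[mu2]_p (D p * b n p) = 0) ->
  \int[mu2]_(p in A) D p = 0.
Proof.
move=> lD mA Ar mb b1 b0 bA ib; have [mD iD] := lD; have mr := measurable_sq r.
pose g (p : P) : R := `|D p| * \1_(sq r) p.
have ig : mu2.-integrable setT (EFin \o g).
  apply: (@locint2_integrable (fun p => `|D p|) (\1_(sq r)) r 1).
  - exact: locint2_norm.
  - exact: measurable_indic.
  - by move=> p; rewrite indicE; case: (_ \in _); rewrite ?normr1 ?normr0.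
  - by move=> p sp; rewrite indicE memNset.
have [] := @dominated_convergence _ _ _ mu2 setT measurableT
   (fun n p => (D p * b n p)%:E) (fun p => (D p * \1_A p)%:E) (EFin \o g).
- by move=> n; apply/measurable_EFinP; exact: measurable_funM.
- by apply/measurable_EFinP; apply: measurable_funM => //; exact: measurable_indic.
- apply: ae_all => p _; apply: cvg_EFin; first exact: nearW.
  by apply: cvgM; [exact: cvg_cst|exact: bA].
- exact: ig.
- apply: ae_all => p n _; rewrite /= lee_fin /g normrM indicE.
  case: (boolP (p \in sq r)) => sp; first by rewrite mulr1 ler_piMr.
  by rewrite mulr0 b0 ?normr0 ?mulr0//; move: sp; rewrite notin_setE.
move=> _ _; rewrite (_ : [sequence _]_n = fun=> 0%E); last first.
  apply/funext => n; have ii : mu2.-integrable setT (EFin \o (fun p => D p * b n p)).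
    exact: (locint2_integrable (b := b n) lD (mb n) (b1 n) (b0 n)).
  have := integrable_fin_num measurableT ii => fi.
  transitivity ((fine (\int[mu2]_p (D p * b n p)%:E))%:E)%E; first by rewrite fineK.
  by congr EFin; exact: ib.
move=> cv; have h := cvg_unique (@ereal_hausdorff R) cv (cvg_cst _).
rewrite /Rintegral integral_mkcond.
rewrite (eq_integral (fun p => (D p * \1_A p)%:E)) ?h//.
by move=> p _; rewrite patchE indicE; case: (_ \in _); rewrite ?mulr1 ?mulr0.
Qed.

(** By Lebesgue's differentiation theorem [h] is almost everywhere the derivative of its primitive,
    which is constant on $]-T,T[$. *)
Lemma oint_zero_ae (h : R -> R) (T : R) : locint h ->
  (forall t, `|t| < T -> oint h t = 0) ->
  {ae mu, forall t, `|t| < T -> h t = 0}.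
Proof.
move=> lh h0; have [mh ih] := lh.
have := @FTC1 R h (BLeft (- T)).
move=> /(_ (fun y => ih _ _)) /=.
have locl : locally_integrable setT h.
  split=> //; first exact: openT.
  move=> K _ cK.
  have [M [_ /(_ (M + 1))]] := compact_bounded cK.
  rewrite ltrDl ltr01 => /(_ isT) KM.
  have /integrableP[_] := ih (- (M + 1)) (M + 1); apply: le_lt_trans.
  apply: ge0_subset_integral => //.
  - exact: compact_measurable.
  - by apply/measurable_EFinP; apply: measurableT_comp => //; exact: measurable_funTS.
  - by move=> x /KM; rewrite /= in_itv/= ler_norml.
move=> /(_ locl); apply: ae_mono => t /= H tT.
have [Tt tT'] : - T < t /\ t < T by move: tT; rewrite ltr_norml => /andP[].
have [|_ <-] := H; first by rewrite lte_fin.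
rewrite derive1E.
pose F (z : R) : R := \int[mu]_(x in `[- T, z]) h x.
have hn : \forall z \near t, F t = F z.
  near=> z.
  have Tz : - T < z by near: z; exact: lt_nbhsr.
  have zT : z < T by near: z; exact: lt_nbhsl.
  have E (u v : R) : - T < u -> u <= v -> v < T -> F u = F v.
    move=> Ta ab bT; rewrite /F (locint_itvD lh (ltW Ta) ab).
    rewrite -((abscont_oint lh).2 u v ab) !h0 ?subrr ?addr0// ltr_norml; apply/andP; split; lra.
  by have [tz|/ltW zt] := leP t z; [apply: E|rewrite (E z t)].
have h2 := near_eq_is_derive hn (is_derive_cst (F t) t (1 : R)).
by case: h2.
Unshelve. all: by end_near. Qed.

End LocallyIntegrable2.

(** * Smooth functions of one variable with compact support, and integration by parts *)

Section CompactlySupported.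
Context {R : realType}.
Notation mu := (@lebesgue_measure R).
Notation mR := (measurableTypeR R).
Implicit Types f g : R -> R.

Definition cc_smooth (a b : R) f : Prop :=
  smooth1 f /\ forall x, ~ (a <= x <= b) -> f x = 0.

Lemma cc_smooth_continuous a b f : cc_smooth a b f -> continuous f.
Proof. by move=> [/smooth1_continuous]. Qed.

Lemma cc_smooth_measurable a b f : cc_smooth a b f -> measurable_fun (setT : set mR) f.
Proof. by move=> /cc_smooth_continuous; exact: continuous_mfun. Qed.

Lemma cc_smooth_bounded a b f : cc_smooth a b f -> exists B, forall x, `|f x| <= B.
Proof.
move=> cf; have [M hM] := continuous_bounded_itv (cc_smooth_continuous cf) a b.
exists (Num.max M 0) => x; rewrite le_max; have [xab|xab] := pselect (a <= x <= b).
  by rewrite hM.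
by rewrite cf.2// normr0 lexx orbT.
Qed.

Lemma cc_smooth_integrable a b f : cc_smooth a b f -> mu.-integrable setT (EFin \o f).
Proof.
move=> cf; apply: (integrable_support (A := (`[a, b]%classic : set mR))).
- exact: measurable_itv.
- by move=> x; rewrite /= in_itv/=; exact: cf.2.
- exact: (continuous_locint (cc_smooth_continuous cf)).2.
Qed.

(** The primitive is taken from $-\infty$: it vanishes to the left of $a$, and to the right of $b$
    because the total integral is 0. *)
Lemma cc_smooth_primitive a b f : cc_smooth a b f -> \int[mu]_x f x = 0 ->
  exists2 F, cc_smooth a b F & forall x : R, is_derive x (1 : R) F (f x).
Proof.
move=> cf If; have intf := cc_smooth_integrable cf.
pose F (x : R) : R := \int[mu]_(t in `]-oo, x]) f t.
have dF (x : R) : is_derive x (1 : R) F (f x).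
  have [||||D E] := @continuous_FTC1 R f -oo%O x (x + 1).
  - by rewrite ltrDl.
  - by apply: integrableS intf => //; exact: measurable_itv.
  - by rewrite ltNyr.
  - exact: (cc_smooth_continuous cf).
  by apply: DeriveDef; [exact: D|rewrite -derive1E; exact: E].
exists F => //; split; first exact: smooth1_primitive cf.1 dF.
move=> x xab; have [xa|ax] := ltP x a.
  rewrite /F (eq_Rintegral mu (g := fun=> 0)); first by rewrite /Rintegral integral0.
  move=> t; rewrite inE/= in_itv/= => tx; rewrite cf.2// => /andP[at' _].
  by have := lt_le_trans xa at'; rewrite ltNge tx.
have bx : b < x by rewrite ltNge; apply/negP => xb; apply: xab; rewrite ax.
rewrite /F -[RHS]If; apply/esym/Rintegral_support => t; rewrite /= in_itv/= => /negP.
rewrite -ltNge => xt; rewrite cf.2// => /andP[_ tb].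
by have := le_lt_trans tb (lt_trans bx xt); rewrite ltxx.
Qed.

Lemma cc_smoothB a b f g k : cc_smooth a b f -> cc_smooth a b g -> cc_smooth a b (fun x => f x + k * g x).
Proof.
move=> [sf fab] [sg gab]; split.
  by apply: smooth1D => //; apply: smooth1M => //; exact: smooth1_cst.
by move=> x xab; rewrite fab// gab// mulr0 addr0.
Qed.

Lemma cc_smoothS a b a' b' f : a' <= a -> b <= b' -> cc_smooth a b f -> cc_smooth a' b' f.
Proof.
move=> aa bb [sf fab]; split=> // x xab; apply: fab => /andP[ax xb].
by apply: xab; rewrite (le_trans aa ax) (le_trans xb bb).
Qed.

Lemma cc_smooth_plateau l r n : cc_smooth l r (plateau l r n).
Proof.
split; first exact: smooth1_plateau.
move=> x xlr; apply: plateau_out => /andP[/ltW lx /ltW xr]; apply: xlr.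
by rewrite lx xr.
Qed.

Lemma abscont_ibp F f a b h h' : abscont F f -> cc_smooth a b h -> cc_smooth a b h' ->
  (forall x : R, is_derive x (1 : R) h (h' x)) ->
  \int[mu]_x (F x * h' x) = - \int[mu]_x (f x * h x).
Proof.
move=> aF ch ch' dh.
have aH : abscont h h' by apply: abscont_is_derive => //; exact: cc_smooth_continuous ch'.
(* The summand 1 puts both $\pm r$ strictly outside $[a,b]$, where the boundary terms vanish without
   any appeal to continuity at $a$ and $b$. *)
pose r := `|a| + `|b| + 1.
have out x : ~ (- r <= x <= r) -> ~ (a <= x <= b).
  move=> xr /andP[ax xb]; apply: xr; rewrite /r.
  have := ler_norm b; have := ler_norm (- a); rewrite normrN.
  by have := normr_ge0 a; have := normr_ge0 b; lra.
have supp (k : R -> R) : (forall x, ~ (a <= x <= b) -> k x = 0) ->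
    \int[mu]_x k x = \int[mu]_(x in `[- r, r]) k x.
  move=> k0; apply: Rintegral_support => x; rewrite /= in_itv/= => /negP xr.
  by apply: k0; apply: out; exact/negP.
rewrite !supp; first last.
- by move=> x /ch'.2 ->; rewrite mulr0.
- by move=> x /ch.2 ->; rewrite mulr0.
have rr : - r <= r.
  by rewrite /r; have := normr_ge0 a; have := normr_ge0 b; lra.
have := (abscont_mul aF aH).2 _ _ rr.
have h0 x : `|x| = r -> h x = 0.
  move=> xr; apply: ch.2 => /andP[ax xb].
  have : `|x| <= `|a| + `|b|.
    rewrite ler_norml; have := ler_norm b; have := ler_norm (- a); rewrite normrN.
    by have := normr_ge0 a; have := normr_ge0 b; lra.
  by rewrite xr /r; lra.
have r0 : 0 <= r by rewrite /r !addr_ge0.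
rewrite (h0 r) ?ger0_norm// (h0 (- r)) ?normrN ?ger0_norm// !mulr0 subrr.
have [mf If] := aF.1.
have cF := abscont_continuous aF.
rewrite RintegralD//; first last.
- have lF := abscont_locint aF.
  have := locintM_bounded (continuous_mfun (cc_smooth_continuous ch')) (continuous_bounded_itv (cc_smooth_continuous ch')) lF.
  by move=> [_ /(_ (- r) r)]; apply: eq_integrable => // x _ /=; rewrite mulrC.
- by have [] := locintM_bounded (continuous_mfun (cc_smooth_continuous ch)) (continuous_bounded_itv (cc_smooth_continuous ch)) aF.1.
have -> : \int[mu]_(x in `[- r, r]) (F x * h' x) = \int[mu]_(x in `[- r, r]) (h' x * F x).
  by apply: eq_Rintegral => x _; rewrite mulrC.
lra.
Qed.

End CompactlySupported.

(** * The du Bois-Reymond lemma *)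

Section Slicing.
Context {R : realType}.
Notation mu := (@lebesgue_measure R).
Notation mR := (measurableTypeR R).
Notation mu2 := (leb2 R).
Notation P := (mR * mR)%type.

Lemma ae_natP d (X : measurableType d) (m : {measure set X -> \bar R})
    (w : X -> R) (Q : X -> Prop) :
  (forall T : R, {ae m, forall x, `|w x| < T -> Q x}) -> {ae m, forall x, Q x}.
Proof.
move=> h; have := ae_countable (fun n : nat => h n%:R).
apply: ae_mono => x hx; apply: (hx (Num.bound (w x))).
have := archi_boundP (normr_ge0 (w x)); rewrite /Num.bound.
by rewrite normr_id.
Qed.

Lemma eq_Rintegral_ae d (X : measurableType d) (m : {measure set X -> \bar R})
    (f g : X -> R) : measurable_fun setT f -> measurable_fun setT g ->
  {ae m, forall x, f x = g x} -> \int[m]_x f x = \int[m]_x g x.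
Proof.
move=> mf mg fg; congr fine; apply: ae_eq_integral => //; try exact/measurable_EFinP.
by apply: ae_mono fg => x -> _.
Qed.

Lemma Rintegral_itvoo (f : R -> R) (l r : R) : measurable_fun (setT : set mR) f ->
  \int[mu]_(x in `]l, r[) f x = \int[mu]_(x in `[l, r]) f x.
Proof.
move=> mf; congr fine; rewrite -(integral_itv_bndoo true false)//.
by apply/measurable_EFinP; exact: measurable_funTS.
Qed.

(** As $n$ grows, the products of plateaus tend to the indicator of the open rectangle; dominated
    convergence applies on a square that contains it. *)
Lemma density_rectangle (D : P -> R) (l r l' r' : R) : locint2 D ->
  (forall n, \int[mu2]_p (D p * (plateau l r n p.1 * plateau l' r' n p.2)) = 0) ->
  \int[mu]_(x in `[l', r']) \int[mu]_(s in `[l, r]) D (s, x) = 0.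
Proof.
move=> lD H; have [mD iD] := lD.
pose A : set P := `]l, r[%classic `*` `]l', r'[%classic.
have mA : measurable A by apply: measurableX; exact: measurable_itv.
pose N := `|l| + `|r| + `|l'| + `|r'|.
have AN : A `<=` sq N.
  move=> p [] /=; rewrite !in_itv/= => /andP[? ?] /andP[? ?].
  have := ler_norm (- l); have := ler_norm r; have := ler_norm (- l'); have := ler_norm r'.
  rewrite !normrN => *.
  have := normr_ge0 l; have := normr_ge0 r; have := normr_ge0 l'; have := normr_ge0 r' => *.
  by split; rewrite ler_norml /N; apply/andP; split; lra.
have mpl (u v : R) n : measurable_fun (setT : set mR) (plateau u v n).
  exact: cc_smooth_measurable (cc_smooth_plateau u v n).
have IA : \int[mu2]_(p in A) D p = 0.
  apply: (@cvg_indic_dominated _ D N (fun n p => plateau l r n p.1 * plateau l' r' n p.2)) => //.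
  - move=> n; apply: measurable_funM; apply: measurableT_comp => //.
  - move=> n p; have /andP[? ?] := plateau_itv l r n p.1.
    have /andP[? ?] := plateau_itv l' r' n p.2.
    by rewrite ger0_norm; [apply: mulr_ile1|apply: mulr_ge0].
  - move=> n p Np; have [h1|h1] := pselect (l < p.1 < r); last by rewrite plateau_out// mul0r.
    have [h2|h2] := pselect (l' < p.2 < r'); last by rewrite [X in _ * X]plateau_out// mulr0.
    by case: Np; apply: AN; split; rewrite /= in_itv.
  - move=> p; have -> : \1_A p = \1_(`]l, r[%classic) p.1 * \1_(`]l', r'[%classic) p.2 :> R.
      rewrite !indicE /A in_setX/=.
      by case: (p.1 \in _); case: (p.2 \in _); rewrite ?mulr1 ?mulr0.
    by apply: cvgM; exact: plateau_cvg.
have mDx x : measurable_fun (setT : set mR) (fun s => D (s, x)).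
  exact: (measurableT_comp mD (pair2_measurable x)).
have iDA : mu2.-integrable setT (EFin \o (D \_ A)).
  rewrite -restrict_EFin; apply/(integrable_mkcond _ mA).1.
  by apply: integrableS (iD N) => //; exact: measurable_sq.
have H2 : \int[mu]_x \int[mu]_s (D \_ A) (s, x) = 0.
  by rewrite -Rfubini2// -IA [RHS]Rintegral_mkcond.
have E x : \int[mu]_s (D \_ A) (s, x) =
    ((fun x => \int[mu]_(s in `[l, r]) D (s, x)) \_ (`]l', r'[%classic : set mR)) x.
  rewrite [RHS]patchE; case: ifPn => xA; last first.
    rewrite /Rintegral integral0_eq// => s _; rewrite patchE in_setX/=.
    by rewrite (negbTE xA) andbF.
  rewrite -Rintegral_itvoo// [RHS]Rintegral_mkcond; apply: eq_Rintegral => s _.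
  by rewrite !patchE in_setX/= xA andbT.
have mV : measurable_fun (`]l', r'[%classic : set mR) (fun x => \int[mu]_(s in `[l, r]) D (s, x)).
  have := Rfubini2_integrable iDA => /integrableP[/measurable_EFinP mI _].
  apply: (eq_measurable_fun (fun x => \int[mu]_s (D \_ A) (s, x))).
    by move=> x xI; rewrite E patchE xI.
  exact: measurable_funTS.
rewrite -[RHS]H2.
rewrite (eq_Rintegral mu (D := setT) (g := (fun x => \int[mu]_(s in `[l, r]) D (s, x)) \_ (`]l', r'[%classic : set mR))); last by move=> x _; exact: E.
rewrite -Rintegral_mkcond; congr fine.
by rewrite -(integral_itv_bndoo true false)//; apply/measurable_EFinP.
Qed.

Lemma locint_vert_section (D : P -> R) (t : R) : locint2 D -> locint (fun x => vert D (t, x)).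
Proof.
move=> [mD iD]; have mv := measurable_vert mD.
split; first exact: (measurableT_comp mv (pair1_measurable t)).
move=> a b; pose N := `|a| + `|b| + `|t|.
pose A : set P := (seg t : set mR) `*` (`[a, b]%classic : set mR).
have mA : measurable A by apply: measurableX; [exact: measurable_seg|exact: measurable_itv].
have AN : A `<=` sq N.
  move=> p [] /= /seg_norm p1; rewrite in_itv/= => /andP[? ?].
  have := ler_norm (- a); have := ler_norm b; rewrite !normrN => *.
  have := normr_ge0 a; have := normr_ge0 b; have := normr_ge0 t => *.
  by split; [rewrite /N; lra|rewrite ler_norml /N; apply/andP; split; lra].
have iDA : mu2.-integrable setT (EFin \o (D \_ A)).
  rewrite -restrict_EFin; apply/(integrable_mkcond _ mA).1.
  by apply: integrableS (iD N) => //; exact: measurable_sq.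
have mI : measurable (`[a, b]%classic : set mR) by exact: measurable_itv.
have := integrableS measurableT mI (@subsetT _ _) (Rfubini2_integrable iDA).
move=> /(intgZ mI (Num.sg t)); apply: eq_integrable => // x xI /=.
congr (_%:E); rewrite /vert /oint/=; congr (_ * _).
rewrite [RHS]Rintegral_mkcond; apply: eq_Rintegral => s _.
by rewrite !patchE in_setX/= xI andbT.
Qed.

Lemma continuous_ae_rat (f : R -> R) (T : R) : continuous f ->
  (forall q : rat, `|ratr q| < T -> f (ratr q) = 0) ->
  forall t, `|t| < T -> f t = 0.
Proof.
move=> cf fq t tT; apply: contrapT => /eqP nz.
have h1 : \forall s \near t, f s != 0 by exact: cvgr_neq0 (cf t) nz.
have h2 : \forall s \near t, `|s| < T.
  exists (T - `|t|); first by rewrite /= subr_gt0.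
  move=> s; rewrite /ball_/= distrC => hs.
  have := ler_normD t (s - t); rewrite addrC subrK; lra.
have : \forall s \near t, f s != 0 /\ `|s| < T by near=> s; split; near: s.
move=> /nbhs_ballP[e /= e0 he].
have te : t < t + e by rewrite ltrDl.
have [q] := rat_in_itvoo te; rewrite in_itv/= => /andP[tq qe].
have [] : f (ratr q) != 0 /\ `|ratr q : R| < T.
  by apply: he; rewrite /ball/= ltr_distlC; apply/andP; split; lra.
by move=> /eqP nq /fq.
Unshelve. all: by end_near. Qed.

(** Testing with products of plateaus is enough. The integrals of [D] over rectangles vanish, so for
    each fixed time [vert D] vanishes at almost every $x$. Rational times share one null set,
    continuity in time extends the conclusion to all times, and differentiation in time gives
    [D]. *)
Lemma density (D : P -> R) (T : R) : locint2 D ->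
  (forall l r l' r' n, - T < l -> l < r -> r < T -> l' < r' ->
    \int[mu2]_p (D p * (plateau l r n p.1 * plateau l' r' n p.2)) = 0) ->
  {ae mu2, forall p, slab T p -> D p = 0}.
Proof.
move=> lD H; have [mD iD] := lD.
have q0 t : `|t| < T -> {ae mu, forall x, vert D (t, x) = 0}.
  move=> tT; have lq := locint_vert_section t lD.
  apply: (@ae_natP _ _ mu id) => B; apply: oint_zero_ae => // x _.
  have T0 : 0 < T by apply: le_lt_trans tT.
  have [t0|t0] := eqVneq t 0.
    rewrite (eq_oint (g := fun=> 0)); last by move=> s _; rewrite t0 /vert oint0.
    by rewrite /oint /Rintegral integral0_eq// mulr0.
  have key l' r' : l' < r' -> \int[mu]_(x in `[l', r']) vert D (t, x) = 0.
    move=> lr; pose l := Num.min 0 t; pose r := Num.max 0 t.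
    have sE : seg t = `[l, r]%classic.
      rewrite /l /r; case: (ltgtP 0 t) t0 => // t0 _; first by rewrite seg_ge0// ltW.
      by rewrite seg_le0// ltW.
    have := @density_rectangle D l r l' r' lD.
    have Hn n : \int[mu2]_p (D p * (plateau l r n p.1 * plateau l' r' n p.2)) = 0.
      apply: H => //; rewrite /l /r; move: tT; rewrite ltr_norml => /andP[? ?];
        by case: (ltgtP 0 t) t0 => // ? _; lra.
    move=> /(_ Hn) E0.
    rewrite -[RHS](mulr0 (Num.sg t)) -E0 -sE.
    have mI : measurable (`[l', r']%classic : set mR) by exact: measurable_itv.
    rewrite -RintegralZl//.
    have := intgZ mI (Num.sg t) (lq.2 l' r'); apply: eq_integrable => // y _ /=.
    congr (_%:E); rewrite /vert /oint/= mulrA.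
    by rewrite -[_ * Num.sg t]expr2 sqr_sg t0 mul1r.
  rewrite /oint; have [x0|x0|<-] := ltgtP 0 x.
  - by rewrite (seg_ge0 (ltW x0)) key// mulr0.
  - by rewrite (seg_le0 (ltW x0)) key// mulr0.
  - by rewrite sgr0 mul0r.
(* The rational times are enumerated by [unpickle], so that the null sets form a sequence. *)
pose Q (n : nat) (x : R) := forall t, unpickle n = Some t -> `|ratr t| < T -> vert D (ratr t, x) = 0.
have aeQ n : {ae mu, forall x, Q n x}.
  case E : (unpickle n : option rat) => [t|]; last first.
    by apply: ae_all => x s; rewrite E.
  have [tT|tT] := ltP `|ratr t : R| T; last first.
    by apply: ae_all => x s; rewrite E => -[<-]; rewrite ltNge tT.
  by apply: ae_mono (q0 _ tT) => x qx s; rewrite E => -[<-] _.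
have ax : {ae mu, forall x, {ae mu, forall t, `|t| < T -> D (t, x) = 0}}.
  apply: ae_mono2 (ae_countable aeQ) (locint2_section lD) => x Qx lx.
  apply: oint_zero_ae => // t tT.
  apply: (@continuous_ae_rat (oint (fun t => D (t, x))) T) => //.
    exact: abscont_continuous (abscont_oint lx).
  by move=> q qT; apply: (Qx (pickle q) q) => //; exact: pickleK.
apply: (@ae_section_inv _ _ [set p | slab T p /\ D p != 0]).
- rewrite (_ : [set p | _] = slab T `&` (D @^-1` [set~ 0])).
    apply: measurableI; first exact: measurable_slab.
    by rewrite -[X in measurable X]setTI; apply: mD => //; apply: measurableC.
  by apply/seteqP; split=> p /= [? /eqP].
- by move=> p Np Tp; apply: contrapT => /eqP Dp; apply: Np.
- apply: ae_mono ax => x; apply: ae_mono => t h [/= Tt]; rewrite h ?eqxx//.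
  by rewrite ltr_norml.
Qed.

Lemma locint2_cc_smooth_integrable (D : P -> R) a b a' b' (f g : R -> R) : locint2 D ->
  cc_smooth a b f -> cc_smooth a' b' g ->
  mu2.-integrable setT (EFin \o (fun p => D p * (f p.1 * g p.2))).
Proof.
move=> lD cf cg; have [B hB] := cc_smooth_bounded cf; have [B' hB'] := cc_smooth_bounded cg.
apply: (@locint2_integrable _ D (fun p => f p.1 * g p.2) (`|a| + `|b| + `|a'| + `|b'|) (B * B')) => //.
- apply: measurable_funM.
    by apply: (measurableT_comp (cc_smooth_measurable cf)); exact: measurable_fst.
  by apply: (measurableT_comp (cc_smooth_measurable cg)); exact: measurable_snd.
- by move=> p; rewrite normrM ler_pM.
- move=> p Np; have [h1|/cf.2 ->] := pselect (a <= p.1 <= b); last by rewrite mul0r.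
  have [h2|/cg.2 ->] := pselect (a' <= p.2 <= b'); last by rewrite mulr0.
  case: Np; move: h1 h2 => /andP[? ?] /andP[? ?].
  have := ler_norm (- a); have := ler_norm b; have := ler_norm (- a'); have := ler_norm b'.
  rewrite !normrN => *.
  have := normr_ge0 a; have := normr_ge0 b; have := normr_ge0 a'; have := normr_ge0 b' => *.
  by split; rewrite ler_norml; apply/andP; split; lra.
Qed.

Lemma measurable_Rintegral_section (k : P -> R) : measurable_fun setT k ->
  measurable_fun (setT : set mR) (fun x => \int[mu]_t k (t, x)).
Proof.
move=> mk; apply: measurableT_comp => //=.
have mkE : measurable_fun setT (EFin \o k) by exact/measurable_EFinP.
rewrite (_ : (fun x => _) = fun x =>
    (fubini_G mu (EFin \o k)^\+%E x - fubini_G mu (EFin \o k)^\-%E x)%E).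
  by apply: emeasurable_funB; apply: measurable_fun_fubini_tonelli_G => //;
    [exact: measurable_funepos|exact: measurable_funeneg].
apply/funext => x; rewrite integralE /fubini_G.
by congr (_ - _)%E; apply: eq_integral => s _; rewrite ?funeposE ?funenegE.
Qed.

(** On almost every vertical line [vert g] is absolutely continuous with density [g], and
    [abscont_ibp] applies there. *)
Lemma vert_ibp (g : P -> R) a b a' b' (h h' k : R -> R) : locint2 g ->
  cc_smooth a b h -> (forall x : R, is_derive x (1 : R) h (h' x)) -> cc_smooth a b h' ->
  cc_smooth a' b' k ->
  \int[mu2]_p (vert g p * (h' p.1 * k p.2)) = - \int[mu2]_p (g p * (h p.1 * k p.2)).
Proof.
move=> lg ch dh ch' ck; have lv := locint2_vert lg.
have i1 := locint2_cc_smooth_integrable lv ch' ck; have i2 := locint2_cc_smooth_integrable lg ch ck.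
rewrite /leb2/= (Rfubini2 i1) (Rfubini2 i2).
rewrite -mulN1r -RintegralZl//; last exact: Rfubini2_integrable i2.
apply: eq_Rintegral_ae.
- by apply/measurable_EFinP; have /integrableP[] := Rfubini2_integrable i1.
- apply: measurable_funM => //.
  by apply/measurable_EFinP; have /integrableP[] := Rfubini2_integrable i2.
apply: ae_mono (locint2_section lg) => x lx.
have := abscont_ibp (abscont_oint lx) ch ch' dh => E.
have lo := abscont_locint (abscont_oint lx).
have cs (u v : R -> R) : locint u -> cc_smooth a b v -> mu.-integrable setT (EFin \o (fun t => u t * v t)).
  move=> lu cv; apply: (integrable_support (A := (`[a, b]%classic : set mR))).
  - exact: measurable_itv.
  - by move=> z; rewrite /= in_itv/= => /negP/negP h0; rewrite cv.2 ?mulr0//; exact/negP.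
  - by have [] := locintM_bounded (cc_smooth_measurable cv) (continuous_bounded_itv (cc_smooth_continuous cv)) lu.
transitivity (k x * \int[mu]_t (oint (fun s => g (s, x)) t * h' t)).
  rewrite -RintegralZl//; last exact: cs.
  by apply: eq_Rintegral => t _; rewrite /vert/=; ring.
rewrite E mulrN mulN1r; congr (- _).
rewrite -RintegralZl//; last exact: cs.
by apply: eq_Rintegral => t _ /=; ring.
Qed.

Lemma ae_exists (Q : R -> Prop) (a b : R) : a < b -> {ae mu, forall x, Q x} ->
  exists2 x, a < x < b & Q x.
Proof.
move=> ab [N [mN N0 sN]]; apply: contrapT => nex.
have sub : `]a, b[%classic `<=` N.
  move=> x; rewrite /= in_itv/= => xab; apply: sN => /= Qx; apply: nex; exists x => //.
have : (mu `]a, b[%classic <= mu N)%E.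
  by apply: le_measure => //; rewrite inE//; exact: measurable_itv.
by rewrite N0 lebesgue_measure_itv/= lte_fin ab -EFinD lee_fin leNgt subr_gt0 ab.
Qed.

Lemma Rintegral_plateau_neq0 (l r : R) n : l < r -> \int[mu]_x plateau l r n x != 0.
Proof.
move=> lr; have c0 := cc_smooth_plateau l r n; have i0 := cc_smooth_integrable c0; apply/eqP => m0.
have : (\int[mu]_t `|(plateau l r n t)%:E| = 0)%E.
  have ge0 t : 0 <= plateau l r n t by case/andP: (plateau_itv l r n t).
  under eq_integral => t _ do rewrite gee0_abs ?lee_fin//.
  have := integrable_fin_num measurableT i0 => fi.
  by rewrite -(fineK fi) -/(Rintegral mu setT _) m0.
have mr : measurable_fun (setT : set mR) (EFin \o plateau l r n).
  by apply/measurable_EFinP; exact: cc_smooth_measurable c0.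
move=> /(ae_eq_integral_abs mu measurableT mr).1 h.
have [x lxr] := ae_exists lr h; move=> /(_ I) /= -[].
by apply/eqP; rewrite gt_eqF// plateau_gt0.
Qed.

(** The function $K=F-\mathrm{vert}\,g$ has vanishing weak time derivative, hence depends on $x$
    alone. The candidate [C] is the average of $K$ in time against a fixed bump [r2] of integral
    1. *)
Lemma slicing (F g : P -> R) (T : R) : 0 < T -> locint2 F -> locint2 g ->
  (forall a b a' b' (h h' k : R -> R), - T < a -> b < T -> cc_smooth a b h ->
    (forall x : R, is_derive x (1 : R) h (h' x)) -> cc_smooth a b h' ->
    cc_smooth a' b' k ->
    \int[mu2]_p (F p * (h' p.1 * k p.2)) = - \int[mu2]_p (g p * (h p.1 * k p.2))) ->
  exists2 C : R -> R, locint C & {ae mu2, forall p, slab T p -> F p = C p.2 + vert g p}.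
Proof.
move=> T0 lF lg H.
pose K p := F p - vert g p.
have lK : locint2 K := locint2B lF (locint2_vert lg).
have HK a b a' b' (h h' k : R -> R) : - T < a -> b < T -> cc_smooth a b h ->
    (forall x : R, is_derive x (1 : R) h (h' x)) -> cc_smooth a b h' -> cc_smooth a' b' k ->
    \int[mu2]_p (K p * (h' p.1 * k p.2)) = 0.
  move=> Ta bT ch dh ch' ck.
  rewrite (eq_Rintegral mu2 (g := fun p => F p * (h' p.1 * k p.2) - vert g p * (h' p.1 * k p.2))); last first.
    by move=> p _; rewrite /K; ring.
  rewrite RintegralB//; first last.
  - exact: locint2_cc_smooth_integrable (locint2_vert lg) ch' ck.
  - exact: locint2_cc_smooth_integrable lF ch' ck.
  by rewrite (H a b a' b' h h' k)// (vert_ibp lg ch dh ch' ck) subrr.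
pose T2 := T / 2.
have T2b : - T < - T2 /\ T2 < T by rewrite /T2; split; lra.
pose r0 := plateau (- T2) T2 0.
have c0 : cc_smooth (- T2) T2 r0 := cc_smooth_plateau _ _ _.
have i0 := cc_smooth_integrable c0.
pose m := \int[mu]_t r0 t.
have m0 : m != 0 by apply: Rintegral_plateau_neq0; rewrite /T2; lra.
pose r2 t := m^-1 * r0 t.
have c2 : cc_smooth (- T2) T2 r2.
  split; first by apply: smooth1M => //; [exact: smooth1_cst|exact: c0.1].
  by move=> x /c0.2; rewrite /r2 => ->; rewrite mulr0.
have ir2 : \int[mu]_t r2 t = 1 by rewrite /r2 RintegralZl// -/m mulVf.
pose C x := \int[mu]_t (K (t, x) * r2 t).
have mK : measurable_fun setT K by case: lK.
have mr2 := cc_smooth_measurable c2.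
have lC : locint C.
  split.
    apply: (measurable_Rintegral_section (k := fun p => K p * r2 p.1)).
    by apply: measurable_funM => //; apply: (measurableT_comp mr2); exact: measurable_fst.
  move=> a b; pose N := `|a| + `|b|.
  pose J : set mR := `[a, b]%classic.
  have mJ : measurable J by exact: measurable_itv.
  have [B hB] := cc_smooth_bounded c2.
  have iK : mu2.-integrable setT (EFin \o (fun p => K p * (r2 p.1 * \1_J p.2))).
    apply: (@locint2_integrable _ K (fun p => r2 p.1 * \1_J p.2) (N + T) B) => //.
    - apply: measurable_funM; first by apply: (measurableT_comp mr2); exact: measurable_fst.
      by apply: measurableT_comp; [exact: measurable_indic|exact: measurable_snd].
    - move=> p; rewrite normrM indicE; case: (_ \in _).
        by rewrite normr1 mulr1.
      by rewrite normr0 mulr0; apply: le_trans (hB 0).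
    - move=> p Np; have [h1|/c2.2 ->] := pselect (- T2 <= p.1 <= T2); last by rewrite mul0r.
      rewrite indicE; case: (boolP (_ \in _)) => [/set_mem|]; last by rewrite mulr0.
      rewrite /J/= in_itv/= => h2; case: Np; move: h1 h2 => /andP[? ?] /andP[? ?].
      have := ler_norm (- a); have := ler_norm b; rewrite normrN => *.
      have := normr_ge0 a; have := normr_ge0 b => *.
      by move: T2b => [? ?]; split; rewrite ler_norml /N; apply/andP; split; lra.
  have := integrableS measurableT mJ (@subsetT _ _) (Rfubini2_integrable iK).
  apply: eq_integrable => // x xJ /=; congr (_%:E); apply: eq_Rintegral => t _ /=.
  by rewrite indicE xJ mulr1.
exists C => //.
suff : {ae mu2, forall p, slab T p -> K p - C p.2 = 0}.
  by apply: ae_mono => p Hp /Hp; rewrite /K; lra.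
apply: density; first exact: locint2B lK (locint2_snd lC).
move=> l r l' r' n Tl lr rT lr'.
set r1 := plateau l r n; set k := plateau l' r' n.
have c1 : cc_smooth l r r1 := cc_smooth_plateau _ _ _.
have ck : cc_smooth l' r' k := cc_smooth_plateau _ _ _.
pose a := Num.min l (- T2); pose b := Num.max r T2.
have Ta : - T < a by rewrite /a lt_min Tl; case: T2b.
have bT : b < T by rewrite /b gt_max rT; case: T2b.
have c1' : cc_smooth a b r1 by apply: cc_smoothS c1; rewrite /a /b ?ge_min ?le_max lexx.
have c2' : cc_smooth a b r2 by apply: cc_smoothS c2; rewrite /a /b ?ge_min ?le_max lexx orbT.
pose M := \int[mu]_t r1 t.
(* Subtracting the multiple of the bump with the same integral leaves a function of integral 0, that
   is, the derivative of an admissible test function. This exchanges [r1] for [r2] in integrals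
   against [K]. *)
pose h' t := r1 t + (- M) * r2 t.
have ch' : cc_smooth a b h' by exact: cc_smoothB.
have i1 := cc_smooth_integrable c1; have i2 := cc_smooth_integrable c2.
have Ih' : \int[mu]_x h' x = 0.
  have iM : mu.-integrable setT (EFin \o (fun t => - M * r2 t)) by exact: intgZ.
  have -> : \int[mu]_x h' x = \int[mu]_x r1 x + \int[mu]_x (- M * r2 x).
    by rewrite -RintegralD.
  by rewrite RintegralZl// ir2 mulr1 subrr.
have [h ch dh] := cc_smooth_primitive ch' Ih'.
have := HK a b l' r' h h' k Ta bT ch dh ch' ck.
have iK1 := locint2_cc_smooth_integrable lK c1' ck; have iK2 := locint2_cc_smooth_integrable lK c2' ck.
have iC1 := locint2_cc_smooth_integrable (locint2_snd lC) c1' ck.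
have E1 : \int[mu2]_p (K p * (h' p.1 * k p.2)) =
    \int[mu2]_p (K p * (r1 p.1 * k p.2)) - M * \int[mu2]_p (K p * (r2 p.1 * k p.2)).
  rewrite -RintegralZl// -RintegralB//; last exact: intgZ.
  by apply: eq_Rintegral => p _; rewrite /h'; ring.
have E2 : \int[mu2]_p (C p.2 * (r1 p.1 * k p.2)) = M * \int[mu2]_p (K p * (r2 p.1 * k p.2)).
  rewrite /leb2/= (Rfubini2 iC1) (Rfubini2 iK2).
  rewrite -RintegralZl//; last exact: Rfubini2_integrable iK2.
  apply: eq_Rintegral_ae.
  - by apply/measurable_EFinP; have /integrableP[] := Rfubini2_integrable iC1.
  - apply: measurable_funM => //.
    by apply/measurable_EFinP; have /integrableP[] := Rfubini2_integrable iK2.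
  apply: ae_mono (locint2_section lK) => x lx.
  have iKx : mu.-integrable setT (EFin \o (fun t => K (t, x) * r2 t)).
    apply: (integrable_support (A := (`[- T2, T2]%classic : set mR))).
    - exact: measurable_itv.
    - by move=> z; rewrite /= in_itv/= => /negP/negP h0; rewrite c2.2 ?mulr0//; exact/negP.
    - by have [] := locintM_bounded mr2 (continuous_bounded_itv (cc_smooth_continuous c2)) lx.
  transitivity (C x * k x * M).
    rewrite /M -RintegralZl//.
    by apply: eq_Rintegral => t _ /=; ring.
  rewrite [LHS]mulrC; congr (_ * _).
  rewrite mulrC /C -RintegralZl//.
  by apply: eq_Rintegral => t _ /=; ring.
rewrite E1 -E2 => E3.
rewrite (eq_Rintegral mu2 (g := fun p => K p * (r1 p.1 * k p.2) - C p.2 * (r1 p.1 * k p.2))).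
  by rewrite RintegralB.
by move=> p _; ring.
Qed.

End Slicing.

(** * The Riesz representation theorem in L^2 *)

Section SquareIntegrable.
Context d (X : measurableType d) (R : realType) (m : {measure set X -> \bar R}).
Implicit Types f g : X -> R.

Definition L2i f : Prop := measurable_fun setT f /\
  m.-integrable setT (EFin \o (fun x => f x ^+ 2)).

Lemma L2i_le f g : measurable_fun setT f -> (forall x, `|f x| <= `|g x|) ->
  L2i g -> L2i f.
Proof.
move=> mf fg [mg ig]; split=> //; apply: (intg_le measurableT _ _ ig).
  exact: measurable_funX.
move=> x _; rewrite ger0_norm ?sqr_ge0//.
by rewrite -[f x ^+ 2]real_normK ?num_real// -[g x ^+ 2]real_normK ?num_real// lerXn2r ?nnegrE.
Qed.

Lemma L2i_lty f : L2i f -> (\int[m]_x (f x ^+ 2)%:E < +oo)%E.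
Proof.
move=> [_ /integrableP[_]]; apply: le_lt_trans; rewrite le_eqVlt; apply/orP; left; apply/eqP.
by apply: eq_integral => x _ /=; rewrite ger0_norm ?sqr_ge0.
Qed.

Lemma L2iM f g : L2i f -> L2i g ->
  m.-integrable setT (EFin \o (fun x => f x * g x)).
Proof.
move=> [mf If] [mg ig].
apply: (intg_le measurableT (g := fun x => f x ^+ 2 + g x ^+ 2)).
- exact: measurable_funM.
- move=> x _; rewrite ler_norml; have := sqr_ge0 (f x + g x); have := sqr_ge0 (f x - g x).
  by move=> *; apply/andP; split; nra.
- exact: intgD.
Qed.

Lemma L2iD f g k : L2i f -> L2i g -> L2i (fun x => f x + k * g x).
Proof.
move=> Lf Lg; have [mf If] := Lf; have [mg ig] := Lg.
split; first by apply: measurable_funD => //; exact: measurable_funM.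
rewrite (_ : (fun x => _) = (fun x => f x ^+ 2 + ((2 * k) * (f x * g x) + k ^+ 2 * g x ^+ 2))).
  by do 2 (apply: intgD => //); apply: intgZ => //; exact: L2iM.
by apply/funext => x; ring.
Qed.

Definition L2ip f g : R := \int[m]_x (f x * g x).

Lemma L2ipC f g : L2ip f g = L2ip g f.
Proof. by apply: eq_Rintegral => x _; rewrite mulrC. Qed.

Lemma L2ipDl f g h k : L2i f -> L2i g -> L2i h ->
  L2ip (fun x => f x + k * g x) h = L2ip f h + k * L2ip g h.
Proof.
move=> Lf Lg Lh; have i1 := L2iM Lf Lh; have i2 := L2iM Lg Lh.
rewrite /L2ip -RintegralZl// -RintegralD//; last exact: intgZ.
by apply: eq_Rintegral => x _; ring.
Qed.

Lemma L2ip_sqD f g k : L2i f -> L2i g ->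
  L2ip (fun x => f x + k * g x) (fun x => f x + k * g x) =
  L2ip f f + 2 * k * L2ip f g + k ^+ 2 * L2ip g g.
Proof.
move=> Lf Lg; have Lh := L2iD k Lf Lg.
rewrite L2ipDl// (L2ipC f) (L2ipC g) !L2ipDl// (L2ipC g f); ring.
Qed.

Lemma L2ip_ge0 f : 0 <= L2ip f f.
Proof. by apply: Rintegral_ge0 => x _; rewrite -expr2 sqr_ge0. Qed.

(** Young's inequality. The free weight [a] allows a small first factor to be balanced against a
    fixed second one. *)
Lemma L2ip_bound f g a : 0 < a -> L2i f -> L2i g ->
  `|L2ip f g| <= a * L2ip f f + a^-1 * L2ip g g.
Proof.
move=> a0 Lf Lg.
have h1 := L2ip_ge0 (fun x => f x + a^-1 * g x).
have h2 := L2ip_ge0 (fun x => f x + (- a^-1) * g x).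
rewrite !L2ip_sqD// in h1 h2.
have f0 := L2ip_ge0 f; have g0 := L2ip_ge0 g.
have E1 : a * (L2ip f f + 2 * a^-1 * L2ip f g + a^-1 ^+ 2 * L2ip g g) =
  a * L2ip f f + 2 * L2ip f g + a^-1 * L2ip g g by field; rewrite gt_eqF.
have E2 : a * (L2ip f f + 2 * (- a^-1) * L2ip f g + (- a^-1) ^+ 2 * L2ip g g) =
  a * L2ip f f - 2 * L2ip f g + a^-1 * L2ip g g by field; rewrite gt_eqF.
have := mulr_ge0 (ltW a0) h1; have := mulr_ge0 (ltW a0) h2; rewrite E1 E2.
have := mulr_ge0 (ltW a0) f0; have ai : 0 <= a^-1 by rewrite invr_ge0 ltW.
have := mulr_ge0 ai g0.
by rewrite ler_norml => *; apply/andP; split; lra.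
Qed.

Lemma ge0_of_geometric (x c : R) : (forall n, - (c * 2^-1 ^+ n) <= x) -> 0 <= x.
Proof.
move=> h; have h0 : (fun n => - (c * (2^-1 : R) ^+ n)) n @[n --> \oo] --> - (c * 0).
  apply: cvgN; apply: cvgM; first exact: cvg_cst.
  by apply: cvg_expr; rewrite ger0_norm ?invr_ge0// invf_lt1// ltr1n.
rewrite mulr0 oppr0 in h0.
rewrite -(cvg_lim (@Rhausdorff R) h0); apply: limr_le.
  by apply/cvg_ex; exists 0.
by apply: nearW => n; exact: h.
Qed.

Section Riesz.
Context (V : set (X -> R)) (l : (X -> R) -> R) (C : R).
Hypothesis V0 : V !=set0.
Hypothesis VD : forall f g k, V f -> V g -> V (fun x => f x + k * g x).
Hypothesis VL : forall f, V f -> L2i f.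
Hypothesis lD : forall f g k, V f -> V g -> l (fun x => f x + k * g x) = l f + k * l g.
Hypothesis lC : forall f, V f -> l f ^+ 2 <= C * L2ip f f.

Let J f := L2ip f f / 2 - l f.

(** Boundedness of the functional and the inequality of arithmetic and geometric means give
    $l(f)\le\sqrt{cq}\le(c+q)/2$ with $c=|C|$ and $q=\|f\|^2$. *)
Let J_lb f : V f -> - (`|C| / 2) <= J f.
Proof.
move=> Vf; have := lC Vf; rewrite /J; have := L2ip_ge0 f; have := ler_norm C.
have := normr_ge0 C; set q := L2ip f f; set c := `|C| => c0 Cc q0 h.
have h' : l f ^+ 2 <= c * q by apply: (le_trans h); exact: ler_wpM2r.
have [lf|lf] := leP (l f) ((c + q) / 2); first by lra.
have p0 : 0 <= (c + q) / 2 by lra.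
have := sqr_ge0 (c - q); have := ltr_pM p0 p0 lf lf; rewrite -expr2; nra.
Qed.

Let J0 : R := inf [set J f | f in V].

Let hasinf : has_inf [set J f | f in V].
Proof.
split; first by case: V0 => f Vf; exists (J f), f.
by exists (- (`|C| / 2)) => _ [f Vf <-]; exact: J_lb.
Qed.

Let J0_le f : V f -> J0 <= J f.
Proof. by move=> Vf; apply: ge_inf; [exact: hasinf.2|exists f]. Qed.

(** The rate $8^{-n}$ is fast enough to leave a summable series after multiplication by $4^n$, as
    pointwise convergence below requires. *)
Let minimizing : exists phi : nat -> X -> R,
  forall n, V (phi n) /\ J (phi n) <= J0 + 8^-1 ^+ n.
Proof.
suff /choice[phi] : forall n, exists f, V f /\ J f <= J0 + 8^-1 ^+ n by exists phi.
move=> n; have e0 : 0 < (8^-1 : R) ^+ n by rewrite exprn_gt0// invr_gt0.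
have [_ [f Vf <-] Jf] := inf_adherent e0 hasinf.
by exists f; split=> //; exact: ltW.
Qed.

(** The parallelogram identity at the midpoint [h] of [f] and [g], where the functional is at least
    its infimum. *)
Let parallelogram f g : V f -> V g ->
  L2ip (fun x => f x + (-1) * g x) (fun x => f x + (-1) * g x) <=
  4 * (J f - J0 + (J g - J0)).
Proof.
move=> Vf Vg; have Lf := VL Vf; have Lg := VL Vg.
pose h x := f x + (- 2^-1) * (f x + (-1) * g x).
have Vfg : V (fun x => f x + (-1) * g x) by exact: VD.
have Vh : V h by exact: VD.
have := J0_le Vh; rewrite /J /h L2ip_sqD//; last exact: VL.
rewrite lD// lD// (L2ipC f) L2ipDl// (L2ipC g f) L2ip_sqD//.
by set ff := L2ip f f; set fg := L2ip f g; set gg := L2ip g g; lra.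
Qed.

(** The representing function minimises $\frac12\|f\|^2-l(f)$. The class [V] is not assumed to be
    closed, so the minimiser is built as an almost everywhere limit outside [V], and its variational
    equation is derived along the minimising sequence. *)
Lemma riesz : exists2 g, L2i g & forall f, V f -> l f = L2ip g f.
Proof.
have [phi hphi] := minimizing.
have Vphi n : V (phi n) by case: (hphi n).
have Lphi n := VL (Vphi n).
have mphi n : measurable_fun setT (phi n) by case: (Lphi n).
have e8 n : (8^-1 : R) ^+ n.+1 <= 8^-1 ^+ n.
  by rewrite exprS; have : (0 : R) <= 8^-1 ^+ n by [rewrite exprn_ge0// invr_ge0]; lra.
pose dl n x := (phi n.+1 x + (-1) * phi n x) ^+ 2.
have Ldl n : L2i (fun x => phi n.+1 x + (-1) * phi n x) by exact: L2iD.
have dq n : \int[m]_x dl n x <= 8 * 8^-1 ^+ n.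
  have := parallelogram (Vphi n.+1) (Vphi n).
  have := (hphi n).2; have := (hphi n.+1).2; have := e8 n.
  have -> : L2ip (fun x => phi n.+1 x + (-1) * phi n x) (fun x => phi n.+1 x + (-1) * phi n x) =
    \int[m]_x dl n x by apply: eq_Rintegral => x _; rewrite -expr2.
  lra.
(* The integrals of these terms are at most $8\cdot2^{-n}$, with sum 16. Where the sum [S] is
   finite, consecutive functions differ by at most $\sqrt S\,2^{-n}$, and the limit exists. *)
pose tm n x : \bar R := (4 ^+ n * dl n x)%:E.
have mtm n : measurable_fun setT (tm n).
  apply/measurable_EFinP; apply: measurable_funM => //; apply: measurable_funX.
  by case: (Ldl n).
have tm0 n x : (0 <= tm n x)%E by rewrite /tm /dl lee_fin; apply: mulr_ge0; [exact: exprn_ge0|exact: sqr_ge0].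
pose S x := (\sum_(n <oo) tm n x)%E.
have mS : measurable_fun setT S.
  by apply: ge0_emeasurable_sum => // n x _.
have S0 x : (0 <= S x)%E by exact: nneseries_ge0.
have intS : (\int[m]_x S x <= 16%:E)%E.
  rewrite integral_nneseries//.
  apply: (@le_trans _ _ (\sum_(n <oo) (16 / (2 ^ n.+1)%:R)%:E)%E).
    apply: lee_nneseries => [n _ _|n _]; first exact: integral_ge0.
    have idl : m.-integrable setT (EFin \o dl n) by case: (Ldl n).
    rewrite (_ : (\int[m]_x tm n x)%E = (4 ^+ n * \int[m]_x dl n x)%:E); last first.
      have := integrable_fin_num measurableT (intgZ measurableT (4 ^+ n) idl) => fi.
      by rewrite -RintegralZl// /Rintegral fineK.
    rewrite lee_fin; apply: (@le_trans _ _ (4 ^+ n * (8 * 8^-1 ^+ n))).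
      by rewrite ler_wpM2l// exprn_ge0.
    rewrite le_eqVlt; apply/orP; left; apply/eqP.
    have -> : (8 : R) = 2 * 4 by ring.
    rewrite natrX exprS invfM exprMn.
    have n2 : (2 : R) ^+ n != 0 by rewrite expf_neq0.
    have n4 : (4 : R) ^+ n != 0 by rewrite expf_neq0.
    by rewrite !exprVn; field; rewrite n2 n4.
  exact: (epsilon_trick0 xpredT (ler0n R 16)).
pose A := [set x | (S x < +oo)%E].
have mA : measurable A.
  rewrite -[A]setTI; exact: emeasurable_fun_infty_o.
have aeA : {ae m, forall x, A x}.
  have iS : m.-integrable setT S.
    apply/integrableP; split=> //.
    under eq_integral => x _ do rewrite gee0_abs//.
    exact: le_lt_trans intS (ltry _).
  have := integrable_ae measurableT iS.
  by apply: ae_mono => x /(_ I); rewrite ge0_fin_numE.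
have stepA x n : A x -> `|phi n.+1 x - phi n x| <= Num.sqrt (fine (S x)) * 2^-1 ^+ n.
  move=> Ax; have fS : S x = (fine (S x))%:E by rewrite fineK// ge0_fin_numE.
  have : (tm n x <= S x)%E.
    apply: (@le_trans _ _ (\sum_(0 <= i < n.+1) tm i x)%E).
      by rewrite big_nat_recr//= leeDr// sume_ge0.
    by apply: nneseries_lim_ge => i _ _.
  rewrite fS lee_fin => h.
  have -> : (2^-1 : R) ^+ n = Num.sqrt ((4^-1) ^+ n).
    have -> : (4^-1 : R) = 2^-1 ^+ 2 by field.
    by rewrite -exprM mulnC exprM sqrtr_sqr ger0_norm// exprn_ge0// invr_ge0.
  have fS0 : 0 <= fine (S x) by apply: fine_ge0; exact: S0.
  rewrite -(sqrtrM _ fS0) -sqrtr_sqr; apply: ler_wsqrtr.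
  rewrite exprVn ler_pdivlMr ?exprn_gt0//.
  by move: h; rewrite /dl mulN1r mulrC.
have /choice[g0 hg0] : forall x, exists y, A x -> forall n,
    `|phi n x - y| <= 2 * Num.sqrt (fine (S x)) * 2^-1 ^+ n.
  move=> x; have [Ax|nA] := pselect (A x); last by exists 0.
  by have [y hy] := geometric_limit (fun n => stepA x n Ax); exists y.
(* The value 0 off [A] makes [g] an everywhere limit of measurable functions. *)
pose g x := g0 x * \1_A x.
have mg : measurable_fun setT g.
  apply: (@measurable_fun_cvg _ _ _ _ (fun n x => phi n x * \1_A x)).
  - by move=> n; apply: measurable_funM => //; exact: measurable_indic.
  - move=> x _; rewrite /g indicE; case: (boolP (x \in A)) => [/set_mem Ax|_].
      rewrite !mulr1; under eq_fun do rewrite mulr1.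
      exact: (geometric_cvg (u := fun n => phi n x) (hg0 x Ax)).
    by rewrite !mulr0; under eq_fun do rewrite mulr0; exact: cvg_cst.
have gphi n : {ae m, forall x, (((g x + (-1) * phi n x) ^+ 2)%:E <= (4 * 4^-1 ^+ n)%:E * S x)%E}.
  apply: ae_mono aeA => x Ax; rewrite /g indicE mem_set// mulr1.
  have fS : S x = (fine (S x))%:E by rewrite fineK// ge0_fin_numE.
  rewrite fS -EFinM lee_fin mulN1r -[X in X <= _]real_normK ?num_real// distrC.
  apply: (@le_trans _ _ ((2 * Num.sqrt (fine (S x)) * 2^-1 ^+ n) ^+ 2)).
    by rewrite lerXn2r ?nnegrE// ?hg0// !mulr_ge0 ?sqrtr_ge0// exprn_ge0// invr_ge0.
  have -> : (2 * Num.sqrt (fine (S x)) * 2^-1 ^+ n) ^+ 2 =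
      4 * (2^-1 ^+ n) ^+ 2 * Num.sqrt (fine (S x)) ^+ 2 by ring.
  rewrite sqr_sqrtr ?fine_ge0// -exprM mulnC exprM.
  by have -> : (2^-1 : R) ^+ 2 = 4^-1 by field.
have mgphi n : measurable_fun setT (fun x => g x + (-1) * phi n x).
  by apply: measurable_funD => //; exact: measurable_funM.
have igphi n : (\int[m]_x ((g x + (-1) * phi n x) ^+ 2)%:E <= (64 * 4^-1 ^+ n)%:E)%E.
  have c0 : 0 <= 4 * (4^-1 : R) ^+ n by rewrite mulr_ge0// exprn_ge0// invr_ge0.
  apply: (@le_trans _ _ (\int[m]_x ((4 * 4^-1 ^+ n)%:E * S x))%E).
    apply: ae_ge0_le_integral => //.
    - by move=> x _; rewrite lee_fin sqr_ge0.
    - by apply/measurable_EFinP; exact: measurable_funX.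
    - by move=> x _; rewrite mule_ge0// lee_fin.
    - exact: emeasurable_funM.
    - by apply: ae_mono (gphi n) => x hx _.
  rewrite ge0_integralZl_EFin//.
  apply: (@le_trans _ _ ((4 * 4^-1 ^+ n)%:E * 16%:E)%E).
    by apply: lee_wpmul2l; rewrite ?lee_fin.
  by rewrite -EFinM lee_fin; lra.
have Lgphi n : L2i (fun x => g x + (-1) * phi n x).
  split=> //; apply/integrableP; split.
    by apply/measurable_EFinP; exact: measurable_funX.
  under eq_integral => x _ do rewrite /= ger0_norm ?sqr_ge0//.
  exact: le_lt_trans (igphi n) (ltry _).
have Lg : L2i g.
  have := L2iD 1 (Lgphi 0%N) (Lphi 0%N).
  rewrite (_ : (fun x => _ + 1 * _) = g)//.
  by apply/funext => x; ring.
exists g => // f Vf.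
have Lf := VL Vf; set Q := L2ip f f.
have Q0 : 0 <= Q := L2ip_ge0 f.
pose D := L2ip g f - l f.
(* Minimality up to $8^{-n}$, tested at [phi n] plus $s$ times [f], in the limit of large $n$. *)
have D_ge s : 0 <= s * D + s ^+ 2 * Q / 2.
  apply: (@ge0_of_geometric _ (1 + `|s| * (64 + Q))) => n.
  have h1 := J0_le (VD s (Vphi n) Vf).
  have := (hphi n).2; rewrite /J L2ip_sqD// lD// in h1 * => h2.
  have i2 : L2ip (fun x => g x + (-1) * phi n x) (fun x => g x + (-1) * phi n x) <= 64 * 4^-1 ^+ n.
    have := igphi n; have [_ ii] := Lgphi n.
    have fi := integrable_fin_num measurableT ii.
    rewrite -(fineK fi) lee_fin; apply: le_trans; rewrite le_eqVlt; apply/orP; left; apply/eqP.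
    by apply: eq_Rintegral => x _; rewrite expr2.
  (* With weight $2^n$ in Young's inequality, $\|g-\phi_n\|^2\le64\cdot4^{-n}$ and the fixed $Q$
     both contribute terms of order $2^{-n}$. *)
  have p2 : 0 < (2 : R) ^+ n by rewrite exprn_gt0.
  have := L2ip_bound p2 (Lgphi n) Lf; rewrite L2ipDl// -/Q => h3.
  have e4 : 2 ^+ n * (64 * (4^-1 : R) ^+ n) = 64 * 2^-1 ^+ n.
    have -> : (4 : R) = 2 * 2 by ring.
    by rewrite invfM exprMn !exprVn; field; rewrite gt_eqF.
  have h4 : 2 ^+ n * L2ip (fun x => g x + (-1) * phi n x) (fun x => g x + (-1) * phi n x) <= 64 * 2^-1 ^+ n.
    by rewrite -e4; apply: ler_wpM2l => //; exact: ltW.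
  have h5 : (8^-1 : R) ^+ n <= 2^-1 ^+ n.
    by rewrite lerXn2r ?nnegrE ?invr_ge0// lef_pV2 ?posrE// ler_nat.
  have h6 : `|L2ip g f - L2ip (phi n) f| <= (64 + Q) * 2^-1 ^+ n.
    rewrite -exprVn in h3.
    move: h3; rewrite mulN1r; set k := (2^-1 : R) ^+ n in h4 *; lra.
  have h7 : `|s * (L2ip g f - L2ip (phi n) f)| <= `|s| * ((64 + Q) * 2^-1 ^+ n).
    by rewrite normrM ler_wpM2l.
  move: h7; rewrite ler_norml => /andP[h7 _].
  rewrite /D -/Q in h1 *; move: h1 h2 h5 h7.
  set k := (2^-1 : R) ^+ n; set k8 := (8^-1 : R) ^+ n.
  set pp := L2ip (phi n) (phi n); set pf := L2ip (phi n) f; set gf := L2ip g f.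
  rewrite mulrA; set w := `|s| * (64 + Q); move=> h1 h2 h5 h7.
  lra.
have [D0|D0] := eqVneq D 0; first by move: D0; rewrite /D; lra.
(* The quadratic expression is negative here unless $D=0$; the denominator is $Q+1$ because $Q$ may
   vanish. *)
have := D_ge (- D / (Q + 1)).
have Q1 : 0 < Q + 1 by lra.
have -> : - D / (Q + 1) * D + (- D / (Q + 1)) ^+ 2 * Q / 2 =
    - (D ^+ 2 * (Q + 2) / (2 * (Q + 1) ^+ 2)).
  by field; rewrite gt_eqF.
rewrite oppr_ge0 leNgt divr_gt0//.
  by rewrite mulr_gt0 ?exprn_even_gt0//; lra.
by rewrite mulr_gt0// exprn_gt0.
Qed.

End Riesz.

End SquareIntegrable.

(** * The chiral system with a truncated cubic term *)

Section Truncation.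
Context {R : realType} {I : finType}.
Implicit Types (m a b s : R) (y z : I -> R).

Definition bounded_lipschitz (B K : R) (phi : (I -> R) -> R) : Prop :=
  (forall y, `|phi y| <= B) /\
  forall y z, `|phi y - phi z| <= K * \sum_k `|y k - z k|.

Lemma bounded_lipschitzM B K B' K' phi psi :
  bounded_lipschitz B K phi -> bounded_lipschitz B' K' psi ->
  bounded_lipschitz (B * B') (B * K' + B' * K) (fun y => phi y * psi y).
Proof.
move=> [b1 l1] [b2 l2]; split=> [y|y z]; first by rewrite normrM ler_pM.
have -> : phi y * psi y - phi z * psi z =
  phi y * (psi y - psi z) + psi z * (phi y - phi z) by ring.
by apply: (le_trans (ler_normD _ _)); rewrite !normrM mulrDl -!mulrA lerD// ler_pM.
Qed.

Lemma bounded_lipschitzD B K B' K' phi psi :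
  bounded_lipschitz B K phi -> bounded_lipschitz B' K' psi ->
  bounded_lipschitz (B + B') (K + K') (fun y => phi y + psi y).
Proof.
move=> [b1 l1] [b2 l2]; split=> [y|y z].
  by apply: (le_trans (ler_normD _ _)); rewrite lerD.
have -> : phi y + psi y - (phi z + psi z) =
  (phi y - phi z) + (psi y - psi z) by ring.
by apply: (le_trans (ler_normD _ _)); rewrite mulrDl lerD.
Qed.

(** For $m\ge0$ this is the projection onto $[-m,m]$; absolute values turn its properties into
    linear arithmetic. *)
Definition clip m a : R := (`|a + m| - `|a - m|) / 2.

Lemma clip_id m a : `|a| <= m -> clip m a = a.
Proof.
rewrite ler_norml /clip => /andP[h1 h2].
by rewrite ger0_norm ?ler0_norm; lra.
Qed.

Lemma clip_bound m a : 0 <= m -> `|clip m a| <= m.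
Proof.
move=> m0; have := ler_dist_dist (a + m) (a - m).
have -> : a + m - (a - m) = 2 * m by ring.
rewrite (ger0_norm (x := 2 * m)); last lra.
by rewrite /clip !ler_norml => /andP[h1 h2]; apply/andP; split; lra.
Qed.

Lemma clip_lipschitz m a b : `|clip m a - clip m b| <= `|a - b|.
Proof.
have := ler_dist_dist (a + m) (b + m); have := ler_dist_dist (a - m) (b - m).
have -> : a + m - (b + m) = a - b by ring.
have -> : a - m - (b - m) = a - b by ring.
rewrite /clip !(ler_norml (_ - _) `|a - b|) => /andP[h1 h2] /andP[h3 h4].
by apply/andP; split; lra.
Qed.

(** The piecewise linear function that falls from 1 at $s=m$ to 0 at $s=m+1$. *)
Definition cutoff m s : R := (`|m + 1 - s| - `|m - s| + 1) / 2.

Lemma cutoff1 m s : s <= m -> cutoff m s = 1.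
Proof. by move=> h; rewrite /cutoff !ger0_norm; lra. Qed.

Lemma cutoff0 m s : m + 1 <= s -> cutoff m s = 0.
Proof. by move=> h; rewrite /cutoff !ler0_norm; lra. Qed.

Lemma cutoff_bound m s : `|cutoff m s| <= 1.
Proof.
have := ler_dist_dist (m + 1 - s) (m - s).
have -> : m + 1 - s - (m - s) = 1 by ring.
rewrite normr1 /cutoff !ler_norml => /andP[h1 h2].
by apply/andP; split; lra.
Qed.

Lemma cutoff_lipschitz m a b : `|cutoff m a - cutoff m b| <= `|a - b|.
Proof.
have := ler_dist_dist (m + 1 - a) (m + 1 - b); have := ler_dist_dist (m - a) (m - b).
have -> : m + 1 - a - (m + 1 - b) = - (a - b) by ring.
have -> : m - a - (m - b) = - (a - b) by ring.
rewrite normrN /cutoff !(ler_norml (_ - _) `|a - b|) => /andP[h1 h2] /andP[h3 h4].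
by apply/andP; split; lra.
Qed.

Lemma le_sum_dist y z k : `|y k - z k| <= \sum_i `|y i - z i|.
Proof. by rewrite (bigD1 k)//= lerDl sumr_ge0. Qed.

Lemma bounded_lipschitz_clip m k : 0 <= m ->
  bounded_lipschitz m 1 (fun y => clip m (y k)).
Proof.
move=> m0; split=> [y|y z]; first exact: clip_bound.
by rewrite mul1r; apply: (le_trans (clip_lipschitz _ _ _)); exact: le_sum_dist.
Qed.

Lemma bounded_lipschitz_cutoff m k l :
  bounded_lipschitz 1 2 (fun y => cutoff m (`|y k| + `|y l|)).
Proof.
split=> [y|y z]; first exact: cutoff_bound.
apply: (le_trans (cutoff_lipschitz _ _ _)).
have -> : `|y k| + `|y l| - (`|z k| + `|z l|) =
  (`|y k| - `|z k|) + (`|y l| - `|z l|) by ring.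
apply: (le_trans (ler_normD _ _)).
have := ler_dist_dist (y k) (z k); have := ler_dist_dist (y l) (z l).
have := le_sum_dist y z k; have := le_sum_dist y z l; lra.
Qed.

End Truncation.

(* The four real components of the spinor u e+ + v e- are indexed by a pair of
   booleans: chirality (true for u), and true for the imaginary part. *)
Section RealSystem.
Context {R : realType} (lam kap : R).
Notation mu := (@lebesgue_measure R).
Notation mR := (measurableTypeR R).
Notation mu2 := (leb2 R).
Notation P := (mR * mR)%type.
Notation I := (bool * bool)%type.
Implicit Types (j k : I) (y z : I -> R) (m t : R).

Definition speed j : R := if j.1 then 1 else -1.
Definition psign j : R := if j.2 then -1 else 1.
Definition other j : I := (j.1, ~~ j.2).
Definition cross j : I := (~~ j.1, ~~ j.2).
Definition chir j : I := (~~ j.1, j.2).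

(** Real and imaginary parts of $-i(\lambda v+\kappa|v|^2u)$, and of the mirror image for $v$.
    Multiplication by $-i$ exchanges the two parts and produces [psign]; [cross] and [chir] together
    give the modulus of the opposite chirality. *)
Definition force j y : R := psign j * (lam * y (cross j) +
  kap * (y (cross j) ^+ 2 + y (chir j) ^+ 2) * y (other j)).

(* The cutoff keeps the rotational symmetry of each chirality, so that the
   cubic term still does not contribute to the growth of the charge density. *)
Definition force_trunc m j y : R := psign j * (lam * y (cross j) +
  kap * ((clip m (y (cross j)) * clip m (y (cross j)) +
          clip m (y (chir j)) * clip m (y (chir j))) *
         (cutoff m (`|y j| + `|y (other j)|) * clip (m + 1) (y (other j))))).

Lemma force_trunc_id m j y : `|y (cross j)| <= m -> `|y (chir j)| <= m ->
  `|y j| + `|y (other j)| <= m -> force_trunc m j y = force j y.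
Proof.
move=> h1 h2 h3; rewrite /force_trunc /force !clip_id// ?cutoff1//.
  by rewrite mul1r !expr2 -[X in _ = psign j * (_ + X)]mulrA.
by have := normr_ge0 (y j); lra.
Qed.

(** The cubic contributions of the two parts cancel exactly, also beyond the cutoff. Where the
    cutoff does not vanish both parts are at most $m+1$, so that the clip at $m+1$, not at $m$, acts
    as the identity. *)
Lemma force_trunc_gauge m j y :
  y j * force_trunc m j y + y (other j) * force_trunc m (other j) y =
  psign j * lam * (y j * y (cross j) - y (other j) * y (chir j)).
Proof.
have clip0 : cutoff m (`|y j| + `|y (other j)|) * (y j * clip (m + 1) (y (other j)) -
    y (other j) * clip (m + 1) (y j)) = 0.
  have [h|h] := leP (`|y j| + `|y (other j)|) (m + 1); last first.
    by rewrite cutoff0 ?mul0r// ltW.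
  rewrite !clip_id; first by ring.
    by have := normr_ge0 (y (other j)); lra.
  by have := normr_ge0 (y j); lra.
move: clip0; case: j => [b1 b2]; rewrite /force_trunc /other /cross /chir /psign /= !negbK.
rewrite [X in cutoff m X * clip (m + 1) (y (b1, b2))]addrC.
set th := cutoff _ _; set c1 := clip m _; set c2 := clip m _.
set d1 := clip _ _; set d2 := clip _ _ => h.
have e : th * (y (b1, b2) * d1) = th * (y (b1, ~~ b2) * d2) by lra.
have e1 : y (b1, b2) * (kap * ((c1 * c1 + c2 * c2) * (th * d1))) =
   kap * (c1 * c1 + c2 * c2) * (th * (y (b1, b2) * d1)) by ring.
have e2 : y (b1, ~~ b2) * (kap * ((c1 * c1 + c2 * c2) * (th * d2))) =
   kap * (c1 * c1 + c2 * c2) * (th * (y (b1, ~~ b2) * d2)) by ring.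
by case: b2 th c1 c2 d1 d2 h e e1 e2 => /= th c1 c2 d1 d2 h e e1 e2; rewrite -e in e2; lra.
Qed.

(** Kept unsimplified, in the form in which [bounded_lipschitzM] and [bounded_lipschitzD] produce
    it. *)
Definition trunc_lip m : R := `|lam| + `|kap| *
  ((m * m + m * m) * (1 * 1 + (m + 1) * 2) +
   1 * (m + 1) * (m * 1 + m * 1 + (m * 1 + m * 1))).

Lemma force_trunc_lipschitz m j y z : 0 <= m ->
  `|force_trunc m j y - force_trunc m j z| <= trunc_lip m * \sum_k `|y k - z k|.
Proof.
move=> m0; have m1 : 0 <= m + 1 by lra.
have bc k := bounded_lipschitz_clip k m0; have bo := bounded_lipschitz_clip (other j) m1.
have [_ h] := bounded_lipschitzM (bounded_lipschitzD (bounded_lipschitzM (bc (cross j)) (bc (cross j)))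
  (bounded_lipschitzM (bc (chir j)) (bc (chir j))))
  (bounded_lipschitzM (bounded_lipschitz_cutoff m j (other j)) bo).
have := h y z; rewrite /force_trunc.
set A := _ * (_ * _); set B := _ * (_ * _) => hAB.
rewrite -mulrBr normrM (_ : `|psign j| = 1) ?mul1r; last first.
  by rewrite /psign; case: ifP; rewrite ?normrN normr1.
have -> : lam * y (cross j) + kap * A - (lam * z (cross j) + kap * B) =
  lam * (y (cross j) - z (cross j)) + kap * (A - B) by ring.
apply: (le_trans (ler_normD _ _)); rewrite !normrM /trunc_lip mulrDl -[X in _ <= _ + X]mulrA.
by apply: lerD; apply: ler_wpM2l => //; exact: le_sum_dist.
Qed.

Lemma trunc_lip_le m m' : 0 <= m -> m <= m' -> trunc_lip m <= trunc_lip m'.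
Proof.
move=> m0 mm; rewrite /trunc_lip lerD2l ler_wpM2l// !mul1r !mulr1.
have h : m * m <= m' * m' by apply: ler_pM.
have h1 : (m * m + m * m) * (1 + (m + 1) * 2) <= (m' * m' + m' * m') * (1 + (m' + 1) * 2).
  by have p := mulr_ge0 m0 m0; apply: ler_pM; lra.
have h2 : (m + 1) * (m + m + (m + m)) <= (m' + 1) * (m' + m' + (m' + m')).
  by apply: ler_pM; lra.
exact: lerD.
Qed.

Lemma trunc_lip_ge0 m : 0 <= m -> 0 <= trunc_lip m.
Proof.
by move=> m0; rewrite /trunc_lip; do ?[apply: addr_ge0|apply: mulr_ge0].
Qed.

Lemma measurable_force_trunc (M : R -> R) (f : I -> P -> R) j :
  measurable_fun (setT : set mR) M -> (forall k, measurable_fun setT (f k)) ->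
  measurable_fun setT (fun p : P => force_trunc (M p.1) j (fun k => f k p)).
Proof.
move=> mM mf.
have mM1 : measurable_fun setT (fun p : P => M p.1) by exact: measurableT_comp.
have mclip (g N : P -> R) : measurable_fun setT g -> measurable_fun setT N ->
    measurable_fun setT (fun p => clip (N p) (g p)).
  move=> mg mN; apply: measurable_funM => //; apply: measurable_funB;
    apply: measurableT_comp => //; [exact: measurable_funD|exact: measurable_funB].
apply: measurable_funM => //; apply: measurable_funD; first exact: measurable_funM.
apply: measurable_funM => //; apply: measurable_funM.
  by apply: measurable_funD; apply: measurable_funM; exact: mclip.
apply: measurable_funM; last by apply: mclip => //; exact: measurable_funD.
have ms : measurable_fun setT (fun p => `|f j p| + `|f (other j) p|).
  by apply: measurable_funD; exact: measurableT_comp.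
apply: measurable_funM => //; apply: measurable_funD => //; apply: measurable_funB;
  apply: measurableT_comp => //; apply: measurable_funB => //; exact: measurable_funD.
Qed.

Lemma measurable_force (f : I -> P -> R) j : (forall k, measurable_fun setT (f k)) ->
  measurable_fun setT (fun p : P => force j (fun k => f k p)).
Proof.
move=> mf; apply: measurable_funM => //; apply: measurable_funD; first exact: measurable_funM.
apply: measurable_funM => //; apply: measurable_funM => //.
by apply: measurable_funD; exact: measurable_funX.
Qed.

(** * Global bounded solutions of the real system *)

Section Existence.
Context (d : I -> R -> R) (M : R).
Hypothesis md : forall j, measurable_fun (setT : set mR) (d j).
Hypothesis dM : forall j x, `|d j x| <= M.

(** Makes the growth factor $2|\lambda|/L$ of the charge at most $1/2$. *)
Let L : R := 4 * `|lam| + 1.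
Let L0 : 0 < L. Proof. by have := normr_ge0 lam; rewrite /L; lra. Qed.
Let M0 : 0 <= M. Proof. exact: le_trans (normr_ge0 _) (dM (true, true) 0). Qed.
(** The charge bound $4M^2e^{L|t|}$ limits each component to $2Me^{L|t|}$, and the cutoff looks at
    the sum of two components. *)
Let size t : R := 4 * M * expR (L * `|t|).
Let size0 t : 0 <= size t. Proof. by rewrite /size mulr_ge0 ?expR_ge0// mulr_ge0. Qed.
Let G j t y : R := force_trunc (size t) j y.
Let K T : R := trunc_lip (size T).

Let GL j (t T : R) y z : `|t| <= T -> `|G j t y - G j t z| <= K T * \sum_k `|y k - z k|.
Proof.
move=> tT; apply: (le_trans (force_trunc_lipschitz _ _ _ (size0 t))).
rewrite ler_wpM2r ?sumr_ge0//; apply: trunc_lip_le => //.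
rewrite /size ler_wpM2l ?mulr_ge0// ler_expR ler_wpM2l ?(ltW L0)//.
exact: le_trans tT (ler_norm _).
Qed.

Let mG (f : I -> P -> R) : (forall k, measurable_fun setT (f k)) ->
  forall j, measurable_fun setT (fun p : P => G j p.1 (fun k => f k p)).
Proof.
move=> mf j; apply: measurable_force_trunc => //.
apply: continuous_mfun => x; apply: cvgM; first exact: cvg_cst.
apply: continuous_comp; last exact: continuous_expR.
by apply: cvgM; [exact: cvg_cst|exact: norm_continuous].
Qed.

Let G0 j t : G j t (fun=> 0) = 0.
Proof.
have c0 m : 0 <= m -> clip m 0 = 0 by move=> m0; rewrite clip_id// normr0.
have := size0 t => s0.
by rewrite /G /force_trunc (c0 (size t + 1)) ?addr_ge0// !mulr0 addr0 mulr0.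
Qed.

Let K0 T : 0 <= K T. Proof. exact: trunc_lip_ge0. Qed.

Section Solution.
Context (f : I -> P -> R).
Hypothesis bf : forall k, slab_bounded (f k).
Hypothesis fE : forall j p, f j p = volterra speed d G f j p.
Let W j (p : P) := f j p ^+ 2 + f (other j) p ^+ 2.

(** A bootstrap: the data contribute at most $2M^2$ and the mass term at most $B/2$. The map
    $B\mapsto2M^2+B/2$ has the fixed point $4M^2$. *)
Let charge_step T B : (forall j p, `|p.1| <= T -> W j p <= B * expR (L * `|p.1|)) ->
  forall j p, `|p.1| <= T -> W j p <= (2 * M ^+ 2 + B / 2) * expR (L * `|p.1|).
Proof.
move=> hB j p pT; set c := speed j; set a := p.2 + c * p.1.
pose F k s : R := f k (s, a - c * s); pose g k s : R := nonlin G f k (s, a - c * s).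
have B0 : 0 <= B.
  have := hB j p pT; have := expR_gt0 (L * `|p.1|).
  have : 0 <= W j p by rewrite addr_ge0 ?sqr_ge0.
  move=> h1 h2 h3; rewrite leNgt; apply/negP => h4.
  by have := nmulr_rlt0 (expR (L * `|p.1|)) h4; rewrite h2; lra.
have lig k : locint (g k).
  exact: (slab_bounded_line a c (slab_bounded_nonlin mG G0 K0 GL bf k)).
have FE k s : speed k = c -> F k s = d k a + oint (g k) s.
  move=> kc; rewrite /F fE /volterra /free_wave VcE kc /=; congr (d k _ + _); first by ring.
  by apply: eq_oint => s' _; rewrite /g; congr (nonlin _ _ _ (_, _)); ring.
have acF k : speed k = c -> abscont (F k) (g k).
  move=> kc; split=> // x y xy; rewrite !FE//.
  by have [_ <-//] := abscont_oint (lig k); ring.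
have acY := abscontD (abscont_mul (acF j erefl) (acF j erefl))
  (abscont_mul (acF (other j) erefl) (acF (other j) erefl)).
have := abscont_ointE p.1 acY.
have pE : (p.1, a - c * p.1) = p by rewrite [RHS]surjective_pairing /a; congr (_, _); ring.
rewrite /= !(FE _ 0)// !oint0 !addr0 {1 2 3 4}/F pE => YE.
rewrite /W !expr2 YE.
have hd k : d k a * d k a <= M ^+ 2.
  by rewrite -expr2 -[d k a ^+ 2]real_normK ?num_real// lerXn2r ?nnegrE.
have e1 : 1 <= expR (L * `|p.1|) by rewrite -expR0 ler_expR mulr_ge0// ltW.
set y' := (fun x => _) in YE *.
have mf k : measurable_fun (setT : set mR) (F k).
  by apply: measurable_line; case: (bf k).
have mg k : measurable_fun (setT : set mR) (g k) by case: (lig k).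
have : `|oint y' p.1| <= (2 * `|lam| * B) / L * expR (L * `|p.1|).
  apply: oint_exp_bound => //; first by case: acY => -[].
  move=> s sp; have sT : `|s| <= T by exact: le_trans (seg_norm sp) pT.
  have := hB j (s, a - c * s) sT; have := hB (cross j) (s, a - c * s) sT.
  rewrite /= => h1 h2.
  (* The derivative of the charge along the characteristic; by the gauge identity only the mass term
     is left. *)
  have -> : y' s = 2 * (psign j * lam * (F j s * F (cross j) s - F (other j) s * F (chir j) s)).
    rewrite -[psign j * lam * _](force_trunc_gauge (size s) j (fun k => F k s)).
    by rewrite /y' /g /nonlin /G /F /=; ring.
  rewrite 2!normrM (normrM _ lam) (_ : `|psign j| = 1) ?mul1r; last first.
    by rewrite /psign; case: ifP; rewrite ?normrN normr1.
  rewrite (ger0_norm (x := 2))// -!mulrA ler_wpM2l// ler_wpM2l//.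
  (* These squares bound twice the absolute value of the difference of products by the sum of the
     four squared components, that is, by the charges of both chiralities. *)
  have [q1 q2] : 0 <= (F j s - F (cross j) s) ^+ 2 + (F (other j) s + F (chir j) s) ^+ 2 /\
     0 <= (F j s + F (cross j) s) ^+ 2 + (F (other j) s - F (chir j) s) ^+ 2.
    by split; rewrite addr_ge0 ?sqr_ge0.
  have e : other (cross j) = chir j by rewrite /other /cross /chir /= negbK.
  move: h1 h2 q1 q2; rewrite /W e /F ler_norml.
  set x1 := f j _; set x2 := f (other j) _; set x3 := f (cross j) _; set x4 := f (chir j) _.
  by move=> h1 h2 q1 q2; apply/andP; split; nra.
rewrite ler_norml => /andP[_ hy].
have h4 : 2 * `|lam| * B / L <= B / 2.
  rewrite ler_pdivrMr// /L; have := mulr_ge0 (normr_ge0 lam) B0; lra.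
have := hd j; have := hd (other j); move: hy.
have := ler_wpM2r (ltW (expR_gt0 (L * `|p.1|))) h4.
have := ler_wpM2l (sqr_ge0 M) e1; rewrite mulr1 mulrDl -mulrA; lra.
Qed.

(** Starting from any crude bound, $n$ applications of [charge_step] leave an error that decays like
    $2^{-n}$; the crude bound exists because [f] is bounded on slabs. *)
Let charge_bound j (p : P) : W j p <= 4 * M ^+ 2 * expR (L * `|p.1|).
Proof.
have [B0 B0_ge0 hB0] : exists2 B0, 0 <= B0 & forall j q, `|q.1| <= `|p.1| -> W j q <= B0.
  have /choice [B hB] : forall k, exists B, forall q, `|q.1| <= `|p.1| -> `|f k q| <= B.
    by move=> k; case: (bf k) => _ /(_ `|p.1|).
  have Bk k : 0 <= B k by exact: le_trans (normr_ge0 _) (hB k p (lexx _)).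
  have B2 k q : `|q.1| <= `|p.1| -> f k q ^+ 2 <= B k ^+ 2.
    by move=> h; rewrite -[f k q ^+ 2]real_normK ?num_real// lerXn2r ?nnegrE// hB.
  exists (\sum_k B k ^+ 2); first by apply: sumr_ge0 => k _; exact: sqr_ge0.
  move=> k q qp; rewrite (bigD1 k)//= (bigD1 (other k))//=.
    rewrite addrA; apply: ler_wpDr; first by apply: sumr_ge0 => i _; exact: sqr_ge0.
    by rewrite lerD// B2.
  by case: k => [b1 []]; rewrite /other xpair_eqE eqxx.
have step n : forall j q, `|q.1| <= `|p.1| ->
    W j q <= (4 * M ^+ 2 + B0 * 2^-1 ^+ n) * expR (L * `|q.1|).
  elim: n => [|n IH] k q qp.
    rewrite expr0 mulr1; apply: (le_trans (hB0 _ _ qp)).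
    have e1 : 1 <= expR (L * `|q.1|) by rewrite -expR0 ler_expR mulr_ge0// ltW.
    by have := sqr_ge0 M; nra.
  have := charge_step IH k qp; rewrite (exprS 2^-1 n).
  by rewrite (_ : 2 * M ^+ 2 + _ = 4 * M ^+ 2 + B0 * (2^-1 * 2^-1 ^+ n)); last by field.
rewrite -subr_ge0; apply: (@ge0_of_geometric _ _ (B0 * expR (L * `|p.1|))) => n.
by have := step n j p (lexx _); rewrite mulrDl; set e := expR _; set x := _ ^+ n; lra.
Qed.

Let force_truncE j (q : P) : nonlin G f j q = force j (fun k => f k q).
Proof.
have b k : `|f k q| <= 2 * M * expR (L * `|q.1|).
  have e1 : 1 <= expR (L * `|q.1|) by rewrite -expR0 ler_expR mulr_ge0// ltW.
  have e0 := expR_ge0 (L * `|q.1|).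
  rewrite -ler_sqr ?nnegrE ?mulr_ge0// real_normK ?num_real//.
  apply: (@le_trans _ _ (W k q)); first by rewrite lerDl sqr_ge0.
  apply: (le_trans (charge_bound k q)).
  have -> : (2 * M * expR (L * `|q.1|)) ^+ 2 = 4 * M ^+ 2 * (expR (L * `|q.1|) * expR (L * `|q.1|)) by ring.
  apply: ler_wpM2l; first by rewrite mulr_ge0 ?sqr_ge0.
  by rewrite ler_peMl.
have e0 := expR_ge0 (L * `|q.1|); have := mulr_ge0 M0 e0 => h.
apply: force_trunc_id; rewrite /size.
- by apply: (le_trans (b _)); lra.
- by apply: (le_trans (b _)); lra.
- by have := b j; have := b (other j); lra.
Qed.

Lemma volterra_force j (p : P) :
  f j p = free_wave speed d j p + Vc (speed j) (fun q => force j (fun k => f k q)) p.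
Proof. by rewrite fE /volterra; congr (_ + Vc _ _ _); apply/funext. Qed.

End Solution.

Let free_le_picard (T : R) j (i : nat) (p : P) : slab T p ->
  `|picard speed d G i.+1 j p| <= `|free_wave speed d j p| +
    `|Vc (speed j) (fun q => K T * \sum_k `|picard speed d G i k q|) p|.
Proof.
move=> Tp; apply: (le_trans (ler_normD _ _)); rewrite lerD2l.
have bp := slab_bounded_picard speed mG G0 K0 GL md dM i.
apply: le_Vc; first exact: (slab_bounded_nonlin mG G0 K0 GL bp).
  exact: slab_bounded_sum_norm.
move=> q qp; have qT : `|q.1| <= T by apply: le_trans qp _; apply: ltW; rewrite ltr_norml.
have := GL j (fun k => picard speed d G i k q) (fun=> 0) qT.
by rewrite G0 subr0; under eq_bigr do rewrite subr0.
Qed.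

(** The last clause cannot be read off the limit, which is only known to be bounded. The Picard
    iterates have uniformly bounded weighted norms by [wnorm_step], and Fatou's lemma passes to the
    limit. *)
Lemma real_system_solution : exists f : I -> P -> R,
  [/\ forall k, slab_bounded (f k),
      forall j p, f j p = free_wave speed d j p +
        Vc (speed j) (fun q => force j (fun k => f k q)) p &
      forall T, 0 < T -> (forall j, wnorm 0 T (free_wave speed d j) < +oo)%E ->
        forall j, (wnorm 0 T (f j) < +oo)%E].
Proof.
have [f [bf [fcvg fE]]] := picard_limit speed mG G0 K0 GL md dM.
exists f; split=> //; first exact: volterra_force.
move=> T T0 hT j.
pose g (m : nat) k := picard speed d G m k.
have mg (m : nat) k : measurable_fun setT (g m k).
  by case: (slab_bounded_picard speed mG G0 K0 GL md dM m k).
have mfree k : measurable_fun setT (free_wave speed d k) := measurable_free speed md k.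
pose A := gronwall_weight (bool * bool)%type (K T) T.
have A0 : 0 <= A := ltW (gronwall_weight_gt0 _ _ T0).
pose Q := (\sum_k wnorm A T (free_wave speed d k))%E.
have Q0 : (0 <= Q)%E by apply: sume_ge0 => k _; exact: wnorm_ge0.
have Qfin : (Q < +oo)%E.
  apply: lte_sum_pinfty => k _; exact: le_lt_trans (wnorm_le0 T A0 (mfree k)) (hT k).
(* The bound [wnorm_step] maps $4Q$ to $2Q+\frac12\cdot4Q=4Q$, and the iteration starts from 0. *)
have S4 (m : nat) : (\sum_k wnorm A T (g m k) <= 4%:E * Q)%E.
  elim: m => [|m IH].
    rewrite big1 ?mule_ge0// => k _; apply: integral0_eq => p _.
    by rewrite expr0n mulr0.
  apply: le_trans (wnorm_step (c := speed) (w := g m) (r := free_wave speed d) (K := K T) T0 _ _ _ _) _ => //.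
    by move=> k; apply: ae_all => p; exact: free_le_picard.
  apply: (@le_trans _ _ (2%:E * Q + (2^-1)%:E * (4%:E * Q))%E).
    by apply: leeD => //; apply: lee_wpmul2l.
  rewrite -(fineK (x := Q)) ?ge0_fin_numE// -!EFinM -EFinD lee_fin; lra.
apply: (le_lt_trans (wnorm0_le T A0 _)); first by case: (bf j).
apply: lte_mul_pinfty; rewrite ?lee_fin ?expR_ge0//.
apply: (@le_lt_trans _ _ (4%:E * Q)%E); last exact: lte_mul_pinfty.
pose h (m : nat) (p : P) := (expR (- (A * `|p.1|)) * g m j p ^+ 2)%:E : \bar R.
have -> : wnorm A T (f j) = (\int[mu2]_(p in slab T) limn_einf (h ^~ p))%E.
  apply: eq_integral => p _; apply/esym; rewrite is_cvg_limn_einfE.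
    apply: cvg_lim => //; apply: cvg_EFin; first exact: nearW.
    by apply: cvgM; [exact: cvg_cst|rewrite expr2; apply: cvgM; exact: fcvg].
  apply/cvg_ex; exists (expR (- (A * `|p.1|)) * f j p ^+ 2)%:E.
  apply: cvg_EFin; first exact: nearW.
  by apply: cvgM; [exact: cvg_cst|rewrite expr2; apply: cvgM; exact: fcvg].
apply: (le_trans (fatou _ _ _ _)).
- exact: measurable_slab.
- by move=> m; exact: measurable_wnorm.
- by move=> m p _; rewrite lee_fin mulr_ge0 ?expR_ge0 ?sqr_ge0.
rewrite limn_einf_lim; apply: lime_le; first exact: is_cvg_einfs.
apply: nearW => m; apply: (@le_trans _ _ (\int[mu2]_(p in slab T) h m p)%E).
  by apply: ereal_inf_lbound; exists m => //=.
apply: le_trans (S4 m); rewrite (bigD1 j)//= leeDl// sume_ge0// => k _; exact: wnorm_ge0.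
Qed.

End Existence.

End RealSystem.

(** * Weak derivatives *)

Section TestFunctions.
Context {R : realType} {V : normedModType R}.
Implicit Types (f g : V -> R) (U : set V).

Lemma smooth_differentiable f : smooth f -> forall x, differentiable f x.
Proof. by move=> sf x; exact: (sf [::] x). Qed.

Lemma smooth_derive v f : smooth f -> smooth ('D_v f).
Proof. by move=> sf vs x; have := sf (rcons vs v) x; rewrite foldr_rcons. Qed.

Lemma derive_combine f g k v x : differentiable f x -> differentiable g x ->
  'D_v (fun y => f y + k * g y) x = 'D_v f x + k * 'D_v g x.
Proof.
move=> df dg; have df' : derivable f x v by exact: diff_derivable.
have dg' : derivable g x v by exact: diff_derivable.
rewrite (_ : (fun y => _) = f + k \*: g)// deriveD//; last exact: derivableZ.
by rewrite deriveZ.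
Qed.

Lemma smooth_combine f g k : smooth f -> smooth g -> smooth (fun x => f x + k * g x).
Proof.
move=> sf sg vs.
suff -> : foldr (fun v (g : V -> R) => 'D_v g) (fun x => f x + k * g x) vs =
    (fun x => foldr (fun v (g : V -> R) => 'D_v g) f vs x +
       k * foldr (fun v (g : V -> R) => 'D_v g) g vs x).
  move=> x; apply: differentiableD; first exact: sf.
  by apply: differentiableZ; exact: sg.
elim: vs => //= v vs ->; apply/funext => x.
by have a := sf vs x; have b := sg vs x; rewrite derive_combine.
Qed.

Lemma test_function0 U : test_function U (fun=> 0).
Proof.
have s0 : [set x : V | (0 : R) != 0] = set0 by apply/seteqP; split=> // x /=; rewrite eqxx.
split.
- suff h vs : foldr (fun v (g : V -> R) => 'D_v g) (fun=> 0) vs = (fun=> 0).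
    by move=> vs x; rewrite h; exact: differentiable_cst.
  by elim: vs => //= v vs ->; apply/funext => x; rewrite derive_cst.
- by rewrite s0 closure0; exact: compact0.
- by rewrite s0 closure0.
Qed.

Lemma test_function_combine U f g k : hausdorff_space V -> test_function U f ->
  test_function U g -> test_function U (fun x => f x + k * g x).
Proof.
move=> hV [sf cf Uf] [sg cg Ug].
have cK := compactU cf cg.
have [|c1 c2] := support_sub_compact (f := fun x => f x + k * g x) hV cK.
  move=> x /not_orP[nf ng].
  have -> : f x = 0 by apply/eqP; apply/negPn/negP => h; apply: nf; exact: subset_closure.
  have -> : g x = 0 by apply/eqP; apply/negPn/negP => h; apply: ng; exact: subset_closure.
  by rewrite mulr0 addr0.
split=> //; first exact: smooth_combine.
by move=> x /c2 [/Uf|/Ug].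
Qed.

Lemma derive_off_support v f x : ~ closure [set x | f x != 0] x -> 'D_v f x = 0.
Proof.
move=> nx; rewrite (near_eq_derive (g := fun=> 0)) ?derive_cst//.
have := open_nbhs_nbhs (conj (closed_openC (@closed_closure _ [set x | f x != 0])) nx).
apply: filterS => y ny; apply/eqP; apply/negPn/negP => h; apply: ny; exact: subset_closure.
Qed.

Lemma test_function_derive U v f : hausdorff_space V -> test_function U f ->
  test_function U ('D_v f).
Proof.
move=> hV [sf cf Uf].
have [|c1 c2] := support_sub_compact (f := 'D_v f) hV cf.
  by move=> x; exact: derive_off_support.
split=> //; first exact: smooth_derive.
by move=> x /c2 /Uf.
Qed.

Lemma test_function_out U f x : test_function U f -> ~ U x -> f x = 0.
Proof.
move=> [_ _ Uf] nU; apply/eqP; apply/negPn/negP => h; apply/nU/Uf; exact: subset_closure.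
Qed.

Lemma test_function_continuous U f : test_function U f -> continuous f.
Proof. by move=> [sf _ _] x; exact: differentiable_continuous (smooth_differentiable sf x). Qed.

Lemma test_function_bounded U f : test_function U f -> exists B, forall x, `|f x| <= B.
Proof.
move=> tf; have cf := test_function_continuous tf; have [sf cK _] := tf.
have ci : compact (f @` closure [set x | f x != 0]).
  by apply: continuous_compact => //; apply: continuous_subspaceT.
have [M [Mr MP]] := compact_bounded ci.
exists (`|M| + 1) => x.
have [->|fx] := eqVneq (f x) 0; first by rewrite normr0 addr_ge0.
apply: (MP (`|M| + 1)); first by have := ler_norm M; lra.
by exists x => //; exact: subset_closure.
Qed.

Lemma test_functionW U U' f : U `<=` U' -> test_function U f -> test_function U' f.
Proof. by move=> UU [sf cf Uf]; split=> //; exact: subset_trans UU. Qed.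

End TestFunctions.

Section TestFunctions2.
Context {R : realType}.
Notation mu := (@lebesgue_measure R).
Notation mR := (measurableTypeR R).
Notation mu2 := (leb2 R).
Notation P := (mR * mR)%type.

Lemma hausdorff_plane : hausdorff_space (R * R)%type.
Proof. exact: norm_hausdorff. Qed.

(** The plane carries the product sigma-algebra, so an open set is written as the countable union of
    the rational boxes that it contains. *)
Lemma open_measurable_plane (U : set (R * R)) : open U -> measurable (U : set P).
Proof.
move=> oU.
pose box (i : rat * rat * nat) : set P :=
  (`](ratr i.1.1 - i.2.+1%:R^-1)%R, (ratr i.1.1 + i.2.+1%:R^-1)%R[%classic : set mR) `*`
  (`](ratr i.1.2 - i.2.+1%:R^-1)%R, (ratr i.1.2 + i.2.+1%:R^-1)%R[%classic : set mR).
pose F i := if `[< box i `<=` U >] then box i else set0.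
have -> : U = \bigcup_i F i.
  apply/seteqP; split=> [p Up|p [i _]]; last by rewrite /F; case: asboolP => // h /h.
  have /nbhs_ballP[e /= e0 he] := open_nbhs_nbhs (conj oU Up).
  have [n hn] : exists n : nat, n.+1%:R^-1 < e / 2.
    by have /archi_boundP := ltW (divr_gt0 (ltr0n R 1) (divr_gt0 e0 (ltr0n R 2)));
      set k := Num.bound _ => hk; exists k; rewrite invf_plt ?posrE ?divr_gt0//;
      rewrite -[_^-1]mul1r; apply: lt_trans hk _; rewrite ltr_nat.
  have n0 : 0 < n.+1%:R^-1 :> R by rewrite invr_gt0.
  have ex (x : R) : exists q : rat, x - n.+1%:R^-1 < ratr q < x + n.+1%:R^-1.
    have xn : x - n.+1%:R^-1 < x + n.+1%:R^-1 by rewrite ltrBlDr -addrA ltrDl addr_gt0.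
    by have [q] := rat_in_itvoo xn; rewrite in_itv/=; exists q.
  have [q1 /andP[h1 h2]] := ex p.1; have [q2 /andP[h3 h4]] := ex p.2.
  have bU : box (q1, q2, n) `<=` U.
    move=> y [/=]; rewrite !in_itv/= => /andP[y1 y2] /andP[y3 y4]; apply: he.
    move: hn h1 h2 h3 h4 y1 y2 y3 y4; set k := n.+1%:R^-1; move: k => k *.
    by split; rewrite /ball/= ltr_norml; apply/andP; split; lra.
  exists (q1, q2, n) => //; rewrite /F asboolT//; 
  split; rewrite /= in_itv/=; move: h1 h2 h3 h4; set k := n.+1%:R^-1; move: k => k *;
  by apply/andP; split; lra.
apply: countable_bigcupT_measurable => // i; rewrite /F; case: ifP => // _.
by apply: measurableX; exact: measurable_itv.
Qed.

Lemma continuous_measurable_plane (f : R * R -> R) : continuous f ->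
  measurable_fun setT (f : P -> R).
Proof.
move=> /continuousP cf; apply: (measurability _ (RGenOpens.measurableE R)).
move=> _ [_ [a [b ->] <-]]; rewrite setTI; apply: open_measurable_plane.
exact/cf/interval_open.
Qed.

Lemma test_function_measurable U (f : R * R -> R) : test_function U f ->
  measurable_fun setT (f : P -> R).
Proof. by move=> tf; apply: continuous_measurable_plane; exact: test_function_continuous tf. Qed.

Lemma test_function_sq U (f : R * R -> R) : test_function U f ->
  exists2 r, 0 <= r & forall p : P, ~ sq r p -> f p = 0.
Proof.
move=> tf; have [_ cK _] := tf; have [M [Mr MP]] := compact_bounded cK.
exists (`|M| + 1); first by rewrite addr_ge0.
move=> p np; apply/eqP; apply/negPn/negP => h; apply: np.
have hc : closure [set x | f x != 0] p by exact: subset_closure.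
have := MP (`|M| + 1) _ p hc; rewrite /= prod_normE.
have -> : M < `|M| + 1 by have := ler_norm M; lra.
by move=> /(_ isT); rewrite ge_max => /andP[].
Qed.

Lemma is_derive_line (f : R * R -> R) (p v : R * R) (s : R) : differentiable f (p + s *: v) ->
  is_derive s (1 : R) (fun s : R => f (p + s *: v)) ('D_v f (p + s *: v)).
Proof.
move=> dfp; have df : derivable f (p + s *: v) v by exact: diff_derivable.
have E : (fun h : R => h^-1 *: (((fun s : R => f (p + s *: v)) \o shift s) (h *: (1 : R)) -
   f (p + s *: v))) =
  (fun h : R => h^-1 *: ((f \o shift (p + s *: v)) (h *: v) - f (p + s *: v))).
  apply/funext => h /=; congr (_ *: (f _ - _)).
  have -> : h *: (1 : R) = h by exact: mulr1.
  by rewrite /shift/= scalerDl addrCA.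
by split; [rewrite /derivable E|rewrite /derive E].
Qed.

Lemma smooth1_line (f : R * R -> R) (p v : R * R) : smooth f ->
  smooth1 (fun s : R => f (p + s *: v)).
Proof.
move=> sf; exists [set h | exists2 g, smooth g & h = (fun s : R => g (p + s *: v))].
split; first by exists f.
move=> _ [g sg ->]; exists (fun s : R => 'D_v g (p + s *: v)).
  by exists ('D_v g) => //; exact: smooth_derive.
by move=> x; apply: is_derive_line; exact: smooth_differentiable.
Qed.

Lemma slab_bounded_locint2 (f : P -> R) : slab_bounded f -> locint2 f.
Proof.
move=> [mf bf]; have /choice[B hB] : forall T, exists B, forall p, `|p.1| <= T -> `|f p| <= B by [].
by apply: (locint2_bounded (B := B)) => // r p [pr _]; exact: hB.
Qed.

Lemma locint2_test_integrable (f : P -> R) U (phi : R * R -> R) : locint2 f -> test_function U phi ->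
  mu2.-integrable setT (EFin \o (fun p => f p * phi p)).
Proof.
move=> lf tp; have [r r0 hr] := test_function_sq tp; have [B hB] := test_function_bounded tp.
exact: (locint2_integrable lf (test_function_measurable tp) hB hr).
Qed.

Lemma Rintegral_test (f : P -> R) U (phi : R * R -> R) : test_function U phi ->
  \int[mu2]_(p in U) (f p * phi p) = \int[mu2]_p (f p * phi p).
Proof.
move=> tp; apply/esym; apply: Rintegral_support => p nU.
by rewrite (test_function_out tp nU) mulr0.
Qed.

Lemma derive_plane (f : R * R -> R) (a b : R) (p : R * R) : differentiable f p ->
  'D_((a, b) : R * R) f p = a * 'D_dt f p + b * 'D_dx f p.
Proof.
move=> df; rewrite !deriveE//.
have -> : ((a, b) : R * R) = a *: dt + b *: dx.
  by apply: injective_projections; rewrite /= /GRing.scale /= ?mulr1 ?mulr0 ?addr0 ?add0r.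
by rewrite linearD !linearZ.
Qed.

(** A shear makes the characteristics vertical. On each of them [f] is absolutely continuous with
    density [g] and the test function is smooth with compact support, so that one integrates by
    parts line by line. *)
Lemma weak_transport (c : R) (d : R -> R) (f g : P -> R) (phi : R * R -> R) :
  slab_bounded f -> slab_bounded g -> (forall p, f p = d (p.2 + c * p.1) + Vc c g p) ->
  test_function setT phi ->
  \int[mu2]_p (f p * 'D_((1, - c) : R * R) phi p) = - \int[mu2]_p (g p * phi p).
Proof.
move=> bf bg fE tp; pose D : R * R -> R := 'D_((1, - c) : R * R) phi; rewrite -/D.
have tD : test_function setT D by apply: test_function_derive => //; exact: hausdorff_plane.
have mp := @mpreserving_sh R (- c).
have msf := slab_bounded_locint2 bf; have msg := slab_bounded_locint2 bg.
have i1 := locint2_test_integrable msf tD; have i2 := locint2_test_integrable msg tp.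
have m1 : measurable_fun setT (fun p : P => f p * D p).
  by apply/measurable_EFinP; have /integrableP[] := i1.
have m2 : measurable_fun setT (fun p : P => g p * phi p).
  by apply/measurable_EFinP; have /integrableP[] := i2.
have j1 := mpreserving_integrable mp measurableT m1 i1.
have j2 := mpreserving_integrable mp measurableT m2 i2.
have := mpreserving_integral mp measurableT m1; have := mpreserving_integral mp measurableT m2.
rewrite !preimage_setT => <- <-; rewrite preimage_setT in j1 j2.
rewrite /leb2/= (Rfubini2 j1) (Rfubini2 j2).
rewrite -[RHS]mulN1r -RintegralZl//; last exact: Rfubini2_integrable j2.
apply: eq_Rintegral => a _; rewrite mulN1r.
have [r r0 hr] := test_function_sq tp; have [r' r0' hr'] := test_function_sq tD.
pose h (t : R) := phi ((0, a) + t *: (1, - c)); pose h' (t : R) := D ((0, a) + t *: (1, - c)).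
have ptE (t : R) : ((0, a) + t *: (1, - c) : R * R) = (t, a - c * t).
  by congr (_, _); rewrite /=; [rewrite add0r [_ *: _]mulr1|rewrite /GRing.scale/=; ring].
pose q := r + r'.
have ch : cc_smooth (- q) q h.
  split; first by apply: smooth1_line; case: tp.
  move=> t nt; rewrite /h ptE hr// => -[/= /[!ler_norml] /andP[t1 t2] _]; apply: nt.
  by apply/andP; split; rewrite /q; lra.
have ch' : cc_smooth (- q) q h'.
  split; first by apply: smooth1_line; case: tD.
  move=> t nt; rewrite /h' ptE hr'// => -[/= /[!ler_norml] /andP[t1 t2] _]; apply: nt.
  by apply/andP; split; rewrite /q; lra.
have lg : locint (fun s => g (s, a - c * s)) by exact: slab_bounded_line.
have acf : abscont (fun s => f (s, a - c * s)) (fun s => g (s, a - c * s)).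
  split=> // x y xy; rewrite !fE /= !VcE /= !subrK.
  have [_ <-//] := abscont_oint lg; set o1 := oint _ _; set o2 := oint _ _.
  by rewrite opprD addrACA subrr add0r.
transitivity (\int[mu]_t (f (t, a - c * t) * h' t)).
  by apply: eq_Rintegral => t _; rewrite /sh /h' /= ptE mulNr.
have der (t : R) : is_derive t (1 : R) h (h' t).
  by apply: is_derive_line; apply: smooth_differentiable; case: tp.
rewrite (abscont_ibp acf ch ch' der).
by congr (- _); apply: eq_Rintegral => t _; rewrite /sh /h /= ptE mulNr.
Qed.

End TestFunctions2.

(** * Square integrability and the Cauchy-Schwarz inequality *)

Section SquareIntegrable2.
Context d (X : measurableType d) (R : realType) (m : {measure set X -> \bar R}).
Implicit Types f g : X -> R.

Lemma L2iP f : f \in Lfun m 2%:E <-> L2i m f.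
Proof.
split=> [lf|[mf fi]].
  split; last exact: Lfun2_integrable_sqr.
  by move: lf; rewrite inE => /andP[/[!inE]].
rewrite inE; apply/andP; split; rewrite inE//= /finite_norm unlock.
apply: poweR_lty; have /integrableP[_] := fi; apply: le_lt_trans.
rewrite le_eqVlt; apply/orP; left; apply/eqP; apply: eq_integral => x _ /=.
by rewrite -[2%R]/(2%:R) powR_mulrn// normrX.
Qed.

Lemma L2i_patch f (D : set X) : measurable D -> L2i m f -> L2i m (f \_ D).
Proof.
move=> mD lf; have [mf _] := lf; apply: (L2i_le _ _ lf).
  by apply/(measurable_restrictT f mD); exact: measurable_funTS.
by move=> x; rewrite patchE; case: ifP => //; rewrite normr0.
Qed.

Lemma L2ip_cauchy_schwarz f g : L2i m f -> L2i m g ->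
  L2ip m f g ^+ 2 <= L2ip m f f * L2ip m g g.
Proof.
move=> lf lg; have H k : 0 <= L2ip m f f + 2 * k * L2ip m f g + k ^+ 2 * L2ip m g g.
  by rewrite -L2ip_sqD//; exact: L2ip_ge0.
move: (L2ip_ge0 m f) (L2ip_ge0 m g) H.
set a := L2ip m f f; set b := L2ip m f g; set c := L2ip m g g => a0 c0 H.
have [c1|c1] := eqVneq c 0.
  have [->|b0] := eqVneq b 0; first by rewrite c1 mulr0 expr0n.
  (* For $c=0$ the quadratic form is affine in $k$ and would take the value $-1$ here. *)
  have := H (- (a + 1) / (2 * b)); rewrite c1 mulr0 addr0.
  have -> : 2 * (- (a + 1) / (2 * b)) * b = - (a + 1) by field.
  lra.
have cp : 0 < c by rewrite lt0r c1.
have := mulr_ge0 c0 (H (- b / c)).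
have -> : c * (a + 2 * (- b / c) * b + (- b / c) ^+ 2 * c) = a * c - b ^+ 2 by field.
by rewrite subr_ge0.
Qed.

End SquareIntegrable2.

Section WeakDerivative.
Context {R : realType}.
Notation mu := (@lebesgue_measure R).
Notation mR := (measurableTypeR R).
Notation mu2 := (leb2 R).
Notation P := (mR * mR)%type.

Lemma wnorm_patch T (h : P -> R) :
  wnorm 0 T h = (\int[mu2]_p (((h \_ (slab T)) p) ^+ 2)%:E)%E.
Proof.
rewrite /wnorm integral_mkcond; apply: eq_integral => p _; rewrite !patchE.
by case: ifP => _; rewrite ?expr0n// mul0r oppr0 expR0 mul1r.
Qed.

Lemma wnorm_L2i T (h : P -> R) : measurable_fun setT h -> (wnorm 0 T h < +oo)%E ->
  L2i mu2 (h \_ (slab T)).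
Proof.
move=> mh hfin; have mp : measurable_fun setT (h \_ (slab T)).
  apply/(measurable_restrictT h (measurable_slab T)); exact: measurable_funTS.
split=> //; apply/integrableP; split.
  by apply/measurable_EFinP; exact: measurable_funX.
under eq_integral => x _ do rewrite /= ger0_norm ?sqr_ge0//.
by rewrite -wnorm_patch.
Qed.

Lemma wnorm_L2ip T (h : P -> R) : measurable_fun setT h -> (wnorm 0 T h < +oo)%E ->
  wnorm 0 T h = (L2ip mu2 (h \_ (slab T)) (h \_ (slab T)))%:E.
Proof.
move=> mh hfin; have [_ ii] := wnorm_L2i mh hfin.
rewrite wnorm_patch -(fineK (integrable_fin_num measurableT ii)) /=; congr EFin.
Qed.

Lemma mpreserving_shift (h : R) : mpreserving mu2 mu2 (fun p : P => (p.1, p.2 + h) : P).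
Proof.
split.
  apply/measurable_fun_pairP; split => /=; first exact: measurable_fst.
  exact: measurable_funD.
move=> A mA; rewrite /leb2 /= /product_measure1; apply: eq_integral => t _ /=.
rewrite -((mpreserving_translate h).2 (xsection A t)); last exact: measurable_xsection.
by congr (mu _); apply/seteqP; split=> x; rewrite /xsection /= !inE.
Qed.

Lemma line_mvt (phi : R * R -> R) (p v : R * R) (h : R) : smooth phi -> 0 < h ->
  exists2 s, 0 < s < h & phi (p + h *: v) - phi p = 'D_v phi (p + s *: v) * h.
Proof.
move=> sp h0; pose F (s : R) := phi (p + s *: v).
have dF (s : R) : is_derive s (1 : R) F ('D_v phi (p + s *: v)).
  by apply: is_derive_line; exact: smooth_differentiable.
have cF : continuous F by exact: smooth1_continuous (smooth1_line p v sp).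
have [|s] := @MVT R F _ 0 h h0 (fun x _ => dF x); first exact: continuous_subspaceT.
rewrite in_itv/= => sh E; exists s => //.
by move: E; rewrite /F scale0r addr0 subr0.
Qed.

Lemma dx_shift (p : R * R) (h : R) : p + h *: dx = (p.1, p.2 + h).
Proof. by apply: injective_projections; rewrite /= /GRing.scale /= ?mulr0 ?mulr1 ?addr0. Qed.

Lemma test_function_L2i U (phi : R * R -> R) : test_function U phi -> L2i mu2 phi.
Proof.
move=> tp; have mp := test_function_measurable tp; have [B hB] := test_function_bounded tp.
split=> //; have lp : locint2 (phi : P -> R) by apply: (locint2_bounded (B := fun=> B)).
exact: (locint2_test_integrable lp tp).
Qed.

(** * Weak x-derivatives from bounds on translations *)

Section DifferenceQuotient.
Context (T C : R) (f : P -> R).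
Hypothesis lf : locint2 f.
Hypothesis fC : forall h : R,
  (wnorm 0 T (fun p : P => f (p.1, p.2 + h) - f p)%R <= (C * h ^+ 2)%:E)%E.

Let mf : measurable_fun setT f. Proof. by case: lf. Qed.

Let quotient (phi : R * R -> R) (h : R) (p : P) : R := (phi (p.1, p.2 + h) - phi p) / h.

Let quotient_sq phi r (h : R) p : 0 < h <= 1 -> (forall p : P, ~ sq r p -> phi p = 0) ->
  ~ sq (r + 1) p -> quotient phi h p = 0.
Proof.
move=> /andP[h0 h1] hr np; rewrite /quotient !hr ?subrr ?mul0r// => -[/= a b]; apply: np; split.
- by apply: le_trans a _; rewrite lerDl.
- by apply: le_trans b _; rewrite lerDl.
- by apply: le_trans a _; rewrite lerDl.
- move: b; rewrite !ler_norml => /andP[b1 b2]; apply/andP; split; lra.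
Qed.

(** The translation is moved from the test function to [f]; since it acts in $x$ only, the slab is
    preserved, and Cauchy-Schwarz applies together with [fC]. *)
Let quotient_bound phi (h : R) : 0 < h -> test_function (slab T) phi ->
  (\int[mu2]_p (f p * quotient phi h p)) ^+ 2 <= C * L2ip mu2 phi phi.
Proof.
move=> h0 tp; have mphi := test_function_measurable tp.
have [r r0 hr] := test_function_sq tp; have [B hB] := test_function_bounded tp.
have ms (k : R) (g : P -> R) : measurable_fun setT g -> measurable_fun setT (fun p : P => g (p.1, p.2 + k)).
  by move=> mg; exact: (measurableT_comp mg (mpreserving_shift k).1).
have i0 := locint2_test_integrable lf tp.
have i1 : mu2.-integrable setT (EFin \o (fun p : P => f p * phi (p.1, p.2 + h))).
  apply: (locint2_integrable (r := r + h) (B := B)) => //; first exact: (ms h phi mphi).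
  move=> p np; apply: hr => -[/= a b]; apply: np; split.
    by apply: le_trans a _; rewrite lerDl ltW.
  by move: b; rewrite !ler_norml => /andP[b1 b2]; apply/andP; split; lra.
have m1 : measurable_fun setT (fun p : P => f p * phi (p.1, p.2 + h)).
  by apply/measurable_EFinP; have /integrableP[] := i1.
have j1 := mpreserving_integrable (mpreserving_shift (- h)) measurableT m1 i1.
have e1 := mpreserving_integral (mpreserving_shift (- h)) measurableT m1.
rewrite preimage_setT in j1 e1.
pose w (p : P) : R := f (p.1, p.2 + - h) - f p.
have mw : measurable_fun setT w by apply: measurable_funB => //; exact: ms.
have wfin : (wnorm 0 T w < +oo)%E by apply: le_lt_trans (fC (- h)) (ltry _).
have -> : \int[mu2]_p (f p * quotient phi h p) = h^-1 * L2ip mu2 (w \_ (slab T)) phi.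
  transitivity (h^-1 * \int[mu2]_p (f p * phi (p.1, p.2 + h) - f p * phi p)).
    rewrite -RintegralZl//; last exact: intgB.
    by apply: eq_Rintegral => p _; rewrite /quotient; ring.
  congr (_ * _); rewrite RintegralB// -e1 -RintegralB//; apply: eq_Rintegral => p _ /=.
  rewrite subrK -surjective_pairing patchE /w.
  case: (boolP (p \in slab T)) => [_|/negP np]; first by ring.
  by rewrite (test_function_out tp) ?mulr0 ?subr0// => Tp; apply: np; rewrite inE.
rewrite exprMn; have := L2ip_cauchy_schwarz (wnorm_L2i mw wfin) (test_function_L2i tp).
have := fC (- h); rewrite -/w wnorm_L2ip// lee_fin sqrrN => hw cs.
have q0 := L2ip_ge0 mu2 phi; have h2 : 0 < h ^+ 2 by rewrite exprn_gt0.
rewrite exprVn ler_pdivrMl//; apply: (le_trans cs).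
by rewrite mulrA [h ^+ 2 * C]mulrC ler_wpM2r.
Qed.

(** The estimate for difference quotients passes to the limit $h\to0$: the quotients of a test
    function converge uniformly, with supports in one fixed square on which [f] is integrable. *)
Let functional_bound phi : test_function (slab T) phi ->
  (- \int[mu2]_p (f p * 'D_dx phi p)) ^+ 2 <= C * L2ip mu2 phi phi.
Proof.
move=> tp; pose D : R * R -> R := 'D_dx phi; rewrite -/D.
have tD : test_function (slab T) D by apply: test_function_derive => //; exact: hausdorff_plane.
have tD2 := test_function_derive dx hausdorff_plane tD.
have [B hB] := test_function_bounded tD2.
have [r r0 hr] := test_function_sq tp; have [r' r0' hr'] := test_function_sq tD.
pose q := r + r'.
have B0 : 0 <= B by exact: le_trans (normr_ge0 _) (hB (0, 0)).
pose b (p : P) : R := B * \1_(sq (q + 1)) p.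
have mb : measurable_fun setT b.
  by apply: measurable_funM => //; exact: measurable_indic (measurable_sq _).
have bB p : `|b p| <= B.
  by rewrite /b indicE; case: (_ \in _); rewrite ?mulr1 ?mulr0 ?normr0// ger0_norm.
have bq p : ~ sq (q + 1) p -> b p = 0.
  by move=> np; rewrite /b indicE memNset ?mulr0.
have ib := locint2_integrable (locint2_norm lf) mb bB bq.
pose A := \int[mu2]_p (`|f p| * b p).
have [sp cp _] := tp; have [sD cD _] := tD.
have mquot h : measurable_fun setT (quotient phi h).
  apply: measurable_funM => //; apply: measurable_funB; last exact: test_function_measurable tp.
  exact: (measurableT_comp (test_function_measurable tp) (mpreserving_shift h).1).
have close (h : R) (p : P) : 0 < h <= 1 -> `|quotient phi h p - D p| <= h * b p.
  move=> hh; have /andP[h0 h1] := hh.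
  have [Sp|nSp] := pselect (sq (q + 1) p); last first.
    rewrite bq// (@quotient_sq _ q)//; last first.
      by move=> z nz; apply: hr => -[a c]; apply: nz; split; rewrite /q;
        [apply: le_trans a _|apply: le_trans c _]; rewrite lerDl.
    rewrite hr' ?subrr ?normr0 ?mulr0// => -[a c]; apply: nSp; split;
      [apply: le_trans a _|apply: le_trans c _]; rewrite /q; lra.
  rewrite /b indicE mem_set// mulr1.
  have [s /andP[s0 sh] e1] := line_mvt p dx sp h0.
  have [u /andP[u0 us] e2] := line_mvt p dx sD s0.
  have -> : quotient phi h p - D p = 'D_dx D (p + u *: dx) * s.
    by rewrite -e2 /quotient -dx_shift e1 /D mulfK ?gt_eqF.
  rewrite normrM mulrC (ger0_norm (ltW s0)).
  by apply: ler_pM => //; exact: ltW.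
have iD := locint2_test_integrable lf tD.
have mfq h : measurable_fun setT (fun p => f p * quotient phi h p) by exact: measurable_funM.
have idif (h : R) : 0 < h <= 1 ->
    mu2.-integrable setT (EFin \o (fun p => f p * quotient phi h p - f p * D p)).
  move=> hh; have /andP[h0 h1] := hh.
  apply: (intg_le measurableT (g := fun p => h * (`|f p| * b p))).
  - by apply: measurable_funB => //; apply/measurable_EFinP; have /integrableP[] := iD.
  - move=> p _; rewrite -mulrBr normrM mulrCA ler_wpM2l//; exact: close.
  - exact: intgZ.
have iq (h : R) : 0 < h <= 1 -> mu2.-integrable setT (EFin \o (fun p => f p * quotient phi h p)).
  move=> hh; have := intgD measurableT (idif h hh) iD.
  by congr (mu2.-integrable _ (EFin \o _)); apply/funext => p; rewrite subrK.
set l := \int[mu2]_p (f p * D p).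
have est (h : R) : 0 < h <= 1 -> `|\int[mu2]_p (f p * quotient phi h p) - l| <= h * A.
  move=> hh; rewrite /l -RintegralB//; last exact: iq.
  apply: (le_trans (le_normr_Rintegral _ (idif h hh))); first exact: measurableT.
  rewrite /A -RintegralZl//; apply: le_Rintegral => //.
  - by have := integrable_norm (idif h hh).
  - exact: intgZ.
  - move=> p _; rewrite -mulrBr normrM mulrCA ler_wpM2l//; exact: close.
set Q := C * L2ip mu2 phi phi.
have Q0 : 0 <= Q by apply: le_trans (quotient_bound ltr01 tp); exact: sqr_ge0.
rewrite sqrrN -[l ^+ 2]real_normK ?num_real// -[Q]sqr_sqrtr// lerXn2r ?nnegrE ?sqrtr_ge0//.
(* Only $h=2^{-n}$ is used. *)
rewrite -subr_ge0; apply: (@ge0_of_geometric _ _ A) => n.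
have hn : 0 < (2^-1 : R) ^+ n <= 1.
  by rewrite exprn_gt0 ?invr_gt0//= exprn_ile1 ?invr_ge0// invf_le1// ler1n.
have [h0 _] := andP hn.
have := est _ hn; have := quotient_bound h0 tp; rewrite -/Q.
set J := \int[mu2]_p _ => JQ Jl.
have JQ' : `|J| <= Num.sqrt Q by rewrite -sqrtr_sqr; exact: ler_wsqrtr.
have := ler_distD J 0 l; rewrite !sub0r !normrN => tri.
rewrite mulrC; move: Jl JQ' tri; set k := _ * A; set y := Num.sqrt Q; lra.
Qed.

Lemma weak_dx : exists2 g : P -> R, L2i mu2 g &
  forall phi, test_function (slab T) phi ->
    \int[mu2]_p (f p * 'D_dx phi p) = - \int[mu2]_p (g p * phi p).
Proof.
pose V : set (P -> R) := test_function (slab T).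
pose l (phi : P -> R) : R := - \int[mu2]_p (f p * 'D_dx (phi : R * R -> R) p).
have tD phi : V phi -> test_function (slab T) ('D_dx (phi : R * R -> R)).
  by move=> tp; apply: test_function_derive => //; exact: hausdorff_plane.
have [||||g Lg hg] := @riesz _ _ _ mu2 V l C _ _ _ _ functional_bound.
- by exists (fun=> 0); exact: test_function0.
- by move=> g h k; apply: test_function_combine; exact: hausdorff_plane.
- by move=> phi; exact: test_function_L2i.
- move=> g h k Vg Vh; have i1 := locint2_test_integrable lf (tD _ Vg).
  have i2 := locint2_test_integrable lf (tD _ Vh).
  have [sg _ _] := Vg; have [sh _ _] := Vh.
  rewrite /l mulrN -opprD; congr (- _); rewrite -RintegralZl// -RintegralD//; last exact: intgZ.
  apply: eq_Rintegral => p _; rewrite derive_combine; first by ring.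
    exact: smooth_differentiable.
  exact: smooth_differentiable.
by exists g => // phi Vphi; have := hg _ Vphi; rewrite /l /L2ip => <-; rewrite opprK.
Qed.

End DifferenceQuotient.

Lemma H1_2_intro T (f gt gx : P -> R) : L2i mu2 (f \_ (slab T)) ->
  L2i mu2 gt -> L2i mu2 gx ->
  (forall phi, test_function (slab T) phi ->
    \int[mu2]_p (f p * 'D_dt phi p) = - \int[mu2]_p (gt p * phi p)) ->
  (forall phi, test_function (slab T) phi ->
    \int[mu2]_p (f p * 'D_dx phi p) = - \int[mu2]_p (gx p * phi p)) ->
  H1_2 (slab T) f.
Proof.
move=> Lf Lt Lx ht hx; split; first exact/L2iP.
have K (g : P -> R) v : L2i mu2 g -> (forall phi, test_function (slab T) phi ->
    \int[mu2]_p (f p * 'D_v phi p) = - \int[mu2]_p (g p * phi p)) ->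
    exists2 g, L2 mu2 (slab T) g & weak_derivative2 (slab T) v f g.
  move=> Lg hg; exists g; first by apply/L2iP; exact: L2i_patch (measurable_slab T) Lg.
  move=> phi tp; have tD := test_function_derive v hausdorff_plane tp.
  by rewrite (Rintegral_test _ tD) (Rintegral_test _ tp); exact: hg.
by move=> v [->|->]; [exact: K Lt ht|exact: K Lx hx].
Qed.

End WeakDerivative.

(** * Regularity of the solution *)

Section SliceNorms.
Context {R : realType}.
Notation mu := (@lebesgue_measure R).
Notation mR := (measurableTypeR R).
Notation mu2 := (leb2 R).
Notation P := (mR * mR)%type.

Lemma measurable_slice_sq (k : P -> R) : measurable_fun setT k ->
  measurable_fun (setT : set mR) (fun s => (\int[mu]_x (k (s, x) ^+ 2)%:E)%E).
Proof.
move=> mk; apply: (measurable_fun_fubini_tonelli_F (fun p : P => (k p ^+ 2)%:E)) => //.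
  by apply/measurable_EFinP; exact: measurable_funX.
by move=> p; rewrite lee_fin sqr_ge0.
Qed.

Lemma wnorm0_slices T (g : P -> R) : measurable_fun setT g ->
  wnorm 0 T g = (\int[mu]_(t in (`](- T)%R, T[%classic : set mR)) \int[mu]_x (g (t, x) ^+ 2)%:E)%E.
Proof.
move=> mg; rewrite /wnorm integral_mkcond /leb2/= fubini_tonelli1; last 2 first.
- apply/(measurable_restrictT _ (measurable_slab T)); exact: measurable_wnorm.
- move=> p; rewrite patchE; case: ifP => // _.
  by rewrite lee_fin mulr_ge0 ?expR_ge0 ?sqr_ge0.
rewrite [RHS]integral_mkcond; apply: eq_integral => t _; rewrite patchE.
have E x : ((t, x) \in slab T) = (t \in (`]- T, T[%classic : set mR)).
  by apply/idP/idP; rewrite !inE /= ?in_itv.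
rewrite /fubini_F; case: ifP => ht.
  by apply: eq_integral => x _; rewrite patchE E ht mul0r oppr0 expR0 mul1r.
by apply: integral0_eq => x _; rewrite patchE E ht.
Qed.

(** After Cauchy-Schwarz in $s$ and Tonelli's theorem, the shift [b s] is undone at each fixed $s$
    by translation invariance. Different choices of [b] give translations of a function of $x$,
    integrals along characteristics and vertical integrals. *)
Lemma oint_shift_slice (k : P -> R) (b : R -> R) (t : R) : measurable_fun setT k ->
  measurable_fun (setT : set mR) b ->
  (\int[mu]_x ((oint (fun s => k (s, x + b s)) t) ^+ 2)%:E <=
   `|t|%:E * \int[mu]_(s in seg t) \int[mu]_x (k (s, x) ^+ 2)%:E)%E.
Proof.
move=> mk mb; pose k' (p : P) := k (p.1, p.2 + b p.1).
have mk' : measurable_fun setT k'.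
  apply: (measurableT_comp mk); apply/measurable_fun_pairP; split => /=; first exact: measurable_fst.
  by apply: measurable_funD => //; exact: measurableT_comp.
have msec x : measurable_fun (setT : set mR) (fun s => k' (s, x)).
  exact: (measurableT_comp mk' (pair2_measurable x)).
have mseg := @measurable_seg R t.
pose F (p : P) : \bar R := (\1_(seg t) p.1 * k' p ^+ 2)%:E.
have F0 p : (0 <= F p)%E by rewrite lee_fin mulr_ge0 ?sqr_ge0.
have mF : measurable_fun setT F.
  apply/measurable_EFinP; apply: measurable_funM; last exact: measurable_funX.
  apply: (measurableT_comp (f := \1_(seg t) : mR -> R)) => //; exact: measurable_indic.
have FE x : (\int[mu]_(s in seg t) (k' (s, x) ^+ 2)%:E = \int[mu]_s F (s, x))%E.
  rewrite integral_mkcond; apply: eq_integral => s _; rewrite patchE /F indicE /=.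
  by case: ifP => _; rewrite ?mul1r ?mul0r.
have mG : measurable_fun (setT : set mR) (fun x => \int[mu]_s F (s, x))%E.
  exact: (measurable_fun_fubini_tonelli_G F).
apply: (@le_trans _ _ (\int[mu]_x (`|t|%:E * \int[mu]_s F (s, x)))%E).
  apply: ge0_le_integral => //.
  - by move=> x _; rewrite lee_fin sqr_ge0.
  - apply/measurable_EFinP; apply: measurable_funX.
    exact: (measurableT_comp (measurable_vert mk') (pair1_measurable t)).
  - exact: emeasurable_funM.
  - by move=> x _; rewrite -FE; apply: oint_sq; exact: (msec x).
rewrite ge0_integralZl_EFin//; last by move=> x _; exact: integral_ge0.
apply: lee_wpmul2l; first by rewrite lee_fin.
rewrite -fubini_tonelli// [X in (_ <= X)%E]integral_mkcond.
rewrite le_eqVlt; apply/orP; left; apply/eqP; apply: eq_integral => s _; rewrite patchE /F.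
case: ifP => hs; last by apply: integral0_eq => x _; rewrite indicE/= hs mul0r.
have mks : measurable_fun (setT : set mR) (fun x => (k (s, x) ^+ 2)%:E).
  apply/measurable_EFinP; apply: measurable_funX.
  exact: (measurableT_comp mk (pair1_measurable s)).
rewrite -(mpreserving_ge0_integral (mpreserving_translate (b s)) measurableT mks); last first.
  by move=> x; rewrite lee_fin sqr_ge0.
by rewrite preimage_setT; apply: eq_integral => x _; rewrite indicE/= hs mul1r.
Qed.

Lemma abscont_shift (F f : R -> R) (a : R) : abscont F f ->
  abscont (fun s => F (a + s)) (fun s => f (a + s)).
Proof.
move=> [[mf fi] fE]; have mt := mpreserving_translate a.
have pre x y : (fun s : mR => (s + a : mR)) @^-1` `[x + a, y + a]%classic = (`[x, y]%classic : set mR).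
  by apply/seteqP; split=> s /=; rewrite !in_itv/= !lerD2r.
have e : (fun s => f (a + s)) = f \o (fun s : mR => (s + a : mR)).
  by apply/funext => s /=; rewrite addrC.
split; first split.
- by rewrite e; exact: (measurableT_comp mf mt.1).
- move=> x y; rewrite -(pre x y) e.
  by apply: (mpreserving_integrable mt) => //; exact: measurable_itv.
- move=> x y xy; rewrite ![a + _]addrC fE ?lerD2r// e -(pre x y).
  by rewrite -(mpreserving_integral mt)//; exact: measurable_itv.
Qed.

(** Since $F(x+h)-F(x)=\int_0^hf(x+s)\,ds$, this is [oint_shift_slice] with an integrand independent
    of time and the identity as shift. *)
Lemma translation_L2 (F f : R -> R) (h : R) : abscont F f ->
  (\int[mu]_x ((F (x + h) - F x) ^+ 2)%:E <= (h ^+ 2)%:E * \int[mu]_x (f x ^+ 2)%:E)%E.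
Proof.
move=> acF; have [[mf _] _] := acF.
have mk : measurable_fun setT (fun p : P => f p.2) by exact: measurableT_comp.
have E : (\int[mu]_(s in seg h) \int[mu]_x (f x ^+ 2)%:E =
    `|h|%:E * \int[mu]_x (f x ^+ 2)%:E)%E.
  by rewrite (integral_cst mu (measurable_seg h)) muleC; congr (_ * _)%E; exact: lebesgue_seg.
apply: le_trans (le_trans (oint_shift_slice h mk (@measurable_id _ _ setT)) _); last first.
  by rewrite /= E muleA -EFinM -normrM -expr2 ger0_norm ?sqr_ge0.
rewrite le_eqVlt; apply/orP; left; apply/eqP; apply: eq_integral => x _; congr ((_ ^+ 2)%:E).
by rewrite (abscont_ointE h (abscont_shift x acF)) addr0 addrC addKr.
Qed.

Lemma wnorm_free (I : finType) (c : I -> R) (d : I -> R -> R) j T : 0 < T ->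
  measurable_fun (setT : set mR) (d j) ->
  wnorm 0 T (free_wave c d j) = ((2 * T)%:E * \int[mu]_x (d j x ^+ 2)%:E)%E.
Proof.
move=> T0 md; have m2 : measurable_fun setT (fun p : P => d j p.2) by exact: measurableT_comp.
have -> : free_wave c d j = (fun p : P => d j p.2) \o sh (c j) by [].
have mI : measurable (`](- T)%R, T[%classic : set mR) by exact: measurable_itv.
have -> : (2 * T)%:E = mu (`](- T)%R, T[%classic : set mR).
  rewrite lebesgue_measure_itv/= lte_fin ifT; last by lra.
  by rewrite -EFinD; congr EFin; ring.
by rewrite wnorm_sh// wnorm0_slices//= (integral_cst mu mI) muleC.
Qed.

Lemma Vc_slice (c T t : R) (g : P -> R) : measurable_fun setT g -> `|t| < T ->
  (\int[mu]_x ((Vc c g (t, x)) ^+ 2)%:E <= `|t|%:E * wnorm 0 T g)%E.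
Proof.
move=> mg tT.
have mb : measurable_fun (setT : set mR) (fun s => c * t - c * s).
  by apply: measurable_funB => //; exact: measurable_funM.
apply: le_trans (le_trans (oint_shift_slice t mg mb) _).
  rewrite le_eqVlt; apply/orP; left; apply/eqP; apply: eq_integral => x _; rewrite VcE.
  by congr ((_ ^+ 2)%:E); apply: eq_oint => s _ /=; rewrite addrA.
apply: lee_wpmul2l; first by rewrite lee_fin.
rewrite wnorm0_slices//; apply: ge0_subset_integral.
- exact: measurable_seg.
- exact: measurable_itv.
- by apply: measurable_funTS; exact: measurable_slice_sq.
- by move=> s _; apply: integral_ge0 => x _; rewrite lee_fin sqr_ge0.
- move=> s /seg_norm st; rewrite /= in_itv/= -ltr_norml; exact: le_lt_trans tT.
Qed.

Lemma wnorm_shift L T (h : R) (g : P -> R) : measurable_fun setT g ->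
  wnorm L T (fun p : P => g (p.1, p.2 + h)) = wnorm L T g.
Proof.
move=> mg; have := mpreserving_ge0_integral (mpreserving_shift h) (measurable_slab T) (measurable_wnorm (D := setT) L mg).
rewrite /wnorm => <-//.
by move=> p; rewrite lee_fin mulr_ge0 ?expR_ge0 ?sqr_ge0.
Qed.

Lemma wnorm_norm L T (g : P -> R) : wnorm L T (fun p => `|g p|) = wnorm L T g.
Proof. by apply: eq_integral => p _; rewrite real_normK ?num_real. Qed.

End SliceNorms.

Section Regularity.
Context {R : realType} (lam kap : R).
Notation mu := (@lebesgue_measure R).
Notation mR := (measurableTypeR R).
Notation mu2 := (leb2 R).
Notation P := (mR * mR)%type.
Notation I := (bool * bool)%type.

(** Where all components are at most $B$ the force equals its truncation at level $2B$, which is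
    globally Lipschitz. The factor 2 comes from the sum of two components in the cutoff. *)
Lemma force_lipschitz (B : R) j (y z : I -> R) : 0 <= B ->
  (forall k, `|y k| <= B) -> (forall k, `|z k| <= B) ->
  `|force lam kap j y - force lam kap j z| <= trunc_lip lam kap (2 * B) * \sum_k `|y k - z k|.
Proof.
move=> B0 hy hz; have B2 : 0 <= 2 * B by lra.
have e (u : I -> R) : (forall k, `|u k| <= B) -> force lam kap j u = force_trunc lam kap (2 * B) j u.
  move=> hu; rewrite force_trunc_id//; have := hu j; have := hu (other j);
    have := hu (cross j); have := hu (chir j); lra.
by rewrite !e//; exact: force_trunc_lipschitz.
Qed.

Lemma force0 j : force lam kap j (fun=> 0) = 0.
Proof. by rewrite /force !mulr0 addr0 mulr0. Qed.

Section Solution.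
Context (f0 g0 : I -> R -> R) (f : I -> P -> R).
Hypothesis acf : forall j, abscont (f0 j) (g0 j).
Hypothesis L2f : forall j, L2i mu (f0 j).
Hypothesis L2g : forall j, L2i mu (g0 j).
Hypothesis bf : forall j, slab_bounded (f j).
Hypothesis fE : forall j p, f j p = free_wave speed f0 j p +
  Vc (speed j) (fun q => force lam kap j (fun k => f k q)) p.
Hypothesis ffin : forall T, 0 < T -> forall j, (wnorm 0 T (f j) < +oo)%E.

Let mf j : measurable_fun setT (f j). Proof. by case: (bf j). Qed.
Let F j (q : P) : R := force lam kap j (fun k => f k q).
Let mF j : measurable_fun setT (F j). Proof. exact: measurable_force. Qed.

Lemma slab_bounded_family T : exists2 B : R, 0 <= B & forall j (p : P), `|p.1| <= T -> `|f j p| <= B.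
Proof.
have /choice [B hB] : forall k, exists B, forall q, `|q.1| <= T -> `|f k q| <= B.
  by move=> k; case: (bf k) => _ /(_ T).
exists (\sum_k `|B k|); first by rewrite sumr_ge0.
move=> j p pT; apply: (le_trans (hB j p pT)); apply: (le_trans (ler_norm _)).
by rewrite (bigD1 j)//= lerDl sumr_ge0.
Qed.

Let F_bound T B : 0 <= B -> (forall j p, `|p.1| <= T -> `|f j p| <= B) ->
  forall j p, `|p.1| <= T ->
  `|F j p| <= trunc_lip lam kap (2 * B) * \sum_k `|f k p|.
Proof.
move=> B0 hB j p pT.
have := @force_lipschitz B j (fun k => f k p) (fun=> 0) B0 (fun k => hB k p pT).
rewrite force0 subr0; under eq_bigr do rewrite subr0; apply=> k.
by rewrite normr0.
Qed.

Lemma slab_bounded_force j : slab_bounded (fun q => force lam kap j (fun k => f k q)).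
Proof.
split=> [|T]; first exact: mF.
have [B B0 hB] := slab_bounded_family T.
exists (trunc_lip lam kap (2 * B) * \sum_(k : I) B) => p pT.
apply: (le_trans (F_bound B0 hB j pT)); apply: ler_wpM2l; first by apply: trunc_lip_ge0; lra.
by apply: ler_sum => k _; exact: hB.
Qed.

Let F_fin T j : 0 < T -> (wnorm 0 T (F j) < +oo)%E.
Proof.
move=> T0; have [B B0 hB] := slab_bounded_family T; set K := trunc_lip lam kap (2 * B).
have ms : measurable_fun setT (fun p => \sum_k `|f k p|).
  by apply: measurable_sum => k; exact: measurableT_comp.
have mKs : measurable_fun setT (fun p => K * \sum_k `|f k p|) by exact: measurable_funM.
apply: (@le_lt_trans _ _ (wnorm 0 T (fun p => K * \sum_k `|f k p|))).
  apply: ae_le_wnorm => //; apply: ae_all => p Tp.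
  have pT : `|p.1| <= T by apply: ltW; rewrite ltr_norml.
  by apply: le_trans (F_bound B0 hB j pT) (ler_norm _).
rewrite wnormZ//; apply: lte_mul_pinfty; rewrite ?lee_fin ?sqr_ge0//.
apply: le_lt_trans (wnorm_sum _ _ _) _; first by move=> k; exact: measurableT_comp.
apply: lte_mul_pinfty; rewrite ?lee_fin//; apply: lte_sum_pinfty => k _.
by rewrite wnorm_norm; exact: ffin.
Qed.

(** The equation is invariant under translations in $x$, so the difference of the solution and its
    translate obeys a Volterra inequality whose source is the difference of the data;
    [translation_L2] bounds the latter by $h^2$. *)
Lemma solution_translation T : 0 < T -> exists C : R, forall j h,
  (wnorm 0 T (fun p : P => f j (p.1, p.2 + h) - f j p)%R <= (C * h ^+ 2)%:E)%E.
Proof.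
move=> T0; have [B B0 hB] := slab_bounded_family T; set K := trunc_lip lam kap (2 * B).
have K0 : 0 <= K by apply: trunc_lip_ge0; lra.
pose G j := (\int[mu]_x (g0 j x ^+ 2)%:E)%E.
have G0 j : (0 <= G j)%E by apply: integral_ge0 => x _; rewrite lee_fin sqr_ge0.
have Gf j : (G j < +oo)%E by exact: L2i_lty.
pose A := 4 * expR (gronwall_weight I K T * T).
have A0 : 0 <= A by rewrite mulr_ge0// expR_ge0.
exists (A * (\sum_j 2 * T * fine (G j))) => j h.
pose w j (p : P) := f j (p.1, p.2 + h) - f j p.
pose r := free_wave speed (fun k x => f0 k (x + h) - f0 k x).
have ms (g : P -> R) : measurable_fun setT g -> measurable_fun setT (fun p : P => g (p.1, p.2 + h)).
  by move=> mg; exact: (measurableT_comp mg (mpreserving_shift h).1).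
have mf0 k : measurable_fun (setT : set mR) (f0 k) by case: (L2f k).
have md k : measurable_fun (setT : set mR) (fun x => f0 k (x + h) - f0 k x).
  apply: measurable_funB => //; apply: (measurableT_comp (mf0 k)); exact: measurable_funD.
have mw k : measurable_fun setT (w k) by exact: (measurable_funB (ms _ (mf k)) (mf k)).
have mr k : measurable_fun setT (r k) by exact: measurable_free.
have sbs (g : P -> R) : slab_bounded g -> slab_bounded (fun p : P => g (p.1, p.2 + h)).
  by move=> [mg bg]; split; [exact: ms|move=> T'; have [D hD] := bg T'; exists D => p pT; exact: hD].
have sbw k : slab_bounded (w k).
  split=> // T'; have [D _ hD] := slab_bounded_family T'; exists (D + D) => p pT.
  by apply: (le_trans (ler_normB _ _)); apply: lerD; exact: hD.
have pw k (p : P) : slab T p -> `|w k p| <= `|r k p| +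
    `|Vc (speed k) (fun q => K * \sum_i `|w i q|) p|.
  move=> Tp; have pT : `|p.1| <= T by apply: ltW; rewrite ltr_norml.
  have -> : w k p = r k p + Vc (speed k) (fun q => F k (q.1, q.2 + h) - F k q) p.
    rewrite (VcB _ _ (sbs _ (slab_bounded_force k)) (slab_bounded_force k)).
    have -> : Vc (speed k) (fun q => F k (q.1, q.2 + h)) p = Vc (speed k) (F k) (p.1, p.2 + h).
      by rewrite !VcE; apply: eq_oint => s _ /=; congr (F k (_, _)); ring.
    rewrite /w !fE /r /free_wave /= -/(F k); rewrite (_ : p.2 + h + _ = p.2 + speed k * p.1 + h); last ring.
    ring.
  apply: (le_trans (ler_normD _ _)); rewrite lerD2l; apply: le_Vc.
  - have [m1 b1] := sbs _ (slab_bounded_force k); have [m2 b2] := slab_bounded_force k.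
    split; first exact: measurable_funB.
    move=> T'; have [D1 h1] := b1 T'; have [D2 h2] := b2 T'; exists (D1 + D2) => q qT.
    by apply: (le_trans (ler_normB _ _)); apply: lerD; [exact: h1|exact: h2].
  - exact: slab_bounded_sum_norm.
  - move=> q qp; have qT := le_trans qp pT.
    by apply: force_lipschitz => // i; exact: hB.
have wfin k : (wnorm 0 T (w k) < +oo)%E.
  have -> : w k = (fun p => f k (p.1, p.2 + h) + (-1) * f k p).
    by apply/funext => p; rewrite mulN1r.
  apply: le_lt_trans (wnormD _ _ _ _) _; [exact: ms|exact: measurable_funM|].
  rewrite wnorm_shift// wnormZ//.
  apply: lte_add_pinfty; apply: lte_mul_pinfty; rewrite ?lee_fin//; first exact: ffin.
  by apply: lte_mul_pinfty; rewrite ?lee_fin ?sqr_ge0//; exact: ffin.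
have := wnorm_gronwall (c := speed) (K := K) T0 mw mr (fun k => ae_all mu2 (pw k)) wfin.
rewrite -/A => hg; apply: (@le_trans _ _ (\sum_k wnorm 0 T (w k))%E).
  by rewrite [X in (_ <= X)%E](bigD1 j)//= leeDl// sume_ge0// => k _; exact: wnorm_ge0.
apply: (le_trans hg); rewrite -(mulrA A) (EFinM A).
have lA (a b : \bar R) : (a <= b -> A%:E * a <= A%:E * b)%E by apply: lee_wpmul2l; rewrite lee_fin.
apply: lA.
rewrite mulr_suml -sumEFin; apply: lee_sum => k _.
rewrite wnorm_free// -(mulrA (2 * T)) (EFinM (2 * T)).
apply: lee_wpmul2l; first by rewrite lee_fin; lra.
apply: (le_trans (translation_L2 h (acf k))).
by rewrite (mulrC (fine _)) (EFinM (h ^+ 2)) fineK// ge0_fin_numE.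
Qed.

Lemma solution_H1 T j : 0 < T -> H1_2 (slab T) (f j).
Proof.
move=> T0; have [C hC] := solution_translation T0.
have lf := slab_bounded_locint2 (bf j).
have [g Lg hg] := weak_dx lf (hC j).
have LF := wnorm_L2i (mF j) (F_fin j T0).
have mS := measurable_slab T.
(* The weak time derivative is read off the equation $\partial_tf=F+c\,\partial_xf$. *)
apply: (H1_2_intro (gt := fun p => (F j \_ (slab T)) p + speed j * g p) (gx := g)) => //.
- exact: wnorm_L2i (ffin T0 j).
- exact: L2iD.
move=> phi tp; have tS : test_function setT phi by exact: test_functionW tp.
have tv v := test_function_derive v hausdorff_plane tp.
have [sp _ _] := tp.
have [mg _] := Lg.
have ig : mu2.-integrable setT (EFin \o (fun p => g p * phi p)).
  by apply: L2iM => //; exact: test_function_L2i tp.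
have iF : mu2.-integrable setT (EFin \o (fun p => (F j \_ (slab T)) p * phi p)).
  by apply: L2iM => //; exact: test_function_L2i tp.
have := weak_transport (bf j) (slab_bounded_force j) (fE j) tS; have := hg phi tp.
have i1 := locint2_test_integrable lf (tv dt); have i2 := locint2_test_integrable lf (tv dx).
have -> : \int[mu2]_p (f j p * 'D_((1, - speed j) : R * R) phi p) =
    \int[mu2]_p (f j p * 'D_dt phi p) - speed j * \int[mu2]_p (f j p * 'D_dx phi p).
  rewrite -RintegralZl// -RintegralB//; last exact: intgZ.
  apply: eq_Rintegral => p _; rewrite derive_plane; first by ring.
  exact: smooth_differentiable.
have -> : \int[mu2]_p (F j p * phi p) = \int[mu2]_p ((F j \_ (slab T)) p * phi p).
  apply: eq_Rintegral => p _; rewrite patchE; case: (boolP (p \in slab T)) => // /negP np.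
  by rewrite (test_function_out tp) ?mulr0// => Tp; apply: np; rewrite inE.
have -> : \int[mu2]_p (((F j \_ (slab T)) p + speed j * g p) * phi p) =
    \int[mu2]_p ((F j \_ (slab T)) p * phi p) + speed j * \int[mu2]_p (g p * phi p).
  rewrite -RintegralZl// -RintegralD//; last exact: intgZ.
  by apply: eq_Rintegral => p _; ring.
set a := Rintegral _ _ _; set b := Rintegral _ _ _; set c := Rintegral _ _ _; set d := Rintegral _ _ _.
by move=> -> h; rewrite mulrN opprK in h; lra.
Qed.

(** The deviation splits into a translation of the data by $ct$ and a Duhamel integral over a time
    of length $|t|$; both are small in $L^2$. *)
Lemma solution_initial j (eps : R) : 0 < eps -> exists2 delta : R, 0 < delta &
  forall t, `|t| < delta -> (\int[mu]_x ((f j (t, x) - f0 j x) ^+ 2)%:E < eps%:E)%E.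
Proof.
move=> e0; pose G := (\int[mu]_x (g0 j x ^+ 2)%:E)%E.
have G0 : (0 <= G)%E by apply: integral_ge0 => x _; rewrite lee_fin sqr_ge0.
have Gf : (G < +oo)%E by exact: L2i_lty.
have Af := F_fin j (@ltr01 R); set A := wnorm 0 1 (F j) in Af.
have A0 : (0 <= A)%E by exact: wnorm_ge0.
have GE : G = (fine G)%:E by rewrite fineK// ge0_fin_numE.
have AE : A = (fine A)%:E by rewrite fineK// ge0_fin_numE.
pose a := fine A; pose g := fine G.
have a0 : 0 <= a by exact: fine_ge0.
have g_ge0 : 0 <= g by exact: fine_ge0.
have k0 : 0 < 2 * g + 2 * a + 1 by lra.
(* For $|t|\le1$ the bound $2gt^2+2a|t|$ is at most $(2g+2a)|t|$. *)
exists (Num.min 1 (eps / (2 * g + 2 * a + 1))); first by rewrite lt_min ltr01 divr_gt0.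
move=> t; rewrite lt_min => /andP[t1 te].
have mf0 : measurable_fun (setT : set mR) (f0 j) by case: (L2f j).
have msh : measurable_fun (setT : set mR) (fun x => f0 j (x + speed j * t) - f0 j x).
  apply: measurable_funB => //; apply: (measurableT_comp mf0); exact: measurable_funD.
have mV : measurable_fun (setT : set mR) (fun x => Vc (speed j) (F j) (t, x)).
  exact: (measurableT_comp (measurable_Vc (speed j) (mF j)) (pair1_measurable t)).
apply: (@le_lt_trans _ _ (2%:E * ((speed j * t) ^+ 2)%:E * G + 2%:E * (`|t|%:E * A))%E).
  apply: (@le_trans _ _ (\int[mu]_x (2%:E * ((f0 j (x + speed j * t) - f0 j x) ^+ 2)%:E +
     2%:E * (Vc (speed j) (F j) (t, x) ^+ 2)%:E))%E).
    apply: ge0_le_integral => //.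
    - by move=> x _; rewrite lee_fin sqr_ge0.
    - apply/measurable_EFinP; apply: measurable_funX; apply: measurable_funB => //.
      exact: (measurableT_comp (mf j) (pair1_measurable t)).
    - apply: emeasurable_funD; apply: emeasurable_funM => //; apply/measurable_EFinP; exact: measurable_funX.
    - move=> x _; rewrite -!EFinM -EFinD lee_fin fE /free_wave /= -/(F j).
      set u := f0 j _; set v := f0 j x; set z := Vc _ _ _.
      by have := sqr_ge0 (u - v - z); nra.
  rewrite ge0_integralD//; last 4 first.
  - by move=> x _; rewrite -EFinM lee_fin mulr_ge0// sqr_ge0.
  - by apply: emeasurable_funM => //; apply/measurable_EFinP; exact: measurable_funX.
  - by move=> x _; rewrite -EFinM lee_fin mulr_ge0// sqr_ge0.
  - by apply: emeasurable_funM => //; apply/measurable_EFinP; exact: measurable_funX.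
  rewrite !ge0_integralZl_EFin//; last 4 first.
  - by move=> x _; rewrite lee_fin sqr_ge0.
  - by apply/measurable_EFinP; exact: measurable_funX.
  - by move=> x _; rewrite lee_fin sqr_ge0.
  - by apply/measurable_EFinP; exact: measurable_funX.
  apply: leeD; last by apply: lee_wpmul2l => //; exact: Vc_slice.
  by rewrite -muleA; apply: lee_wpmul2l => //; exact: translation_L2.
rewrite GE AE -/a -/g -!EFinM -EFinD lte_fin.
have -> : (speed j * t) ^+ 2 = `|t| * `|t|.
  by rewrite exprMn -[t ^+ 2]real_normK ?num_real// /speed; case: ifP => _; ring.
move: te; rewrite ltr_pdivlMr//; have := normr_ge0 t; set s := `|t| in t1 * => s0 te.
have h1 : s * s <= s by rewrite -[X in _ <= X]mulr1 ler_wpM2l// ltW.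
have := ler_wpM2l g_ge0 h1; lra.
Qed.

End Solution.

End Regularity.

(** * H^1 functions on lines *)

Section Slices.
Context {R : realType}.
Notation mu := (@lebesgue_measure R).
Notation mR := (measurableTypeR R).
Notation mu2 := (leb2 R).
Notation P := (mR * mR)%type.

Lemma ae_section_fst (Q : P -> Prop) : {ae mu2, forall p, Q p} ->
  {ae mu, forall t, {ae mu, forall x, Q (t, x)}}.
Proof.
move=> [N [mN N0 sN]]; rewrite /leb2/= /product_measure1 in N0.
have mF : measurable_fun (setT : set mR) (fun t => mu (xsection N t)).
  exact: measurable_fun_xsection.
have /(ae_eq_integral_abs mu measurableT mF).1 : (\int[mu]_t `|mu (xsection N t)| = 0)%E.
  by rewrite -[RHS]N0; apply: eq_integral => t _; rewrite gee0_abs.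
apply: ae_mono => t /(_ I) /= h; exists (xsection N t); split=> //.
  exact: measurable_xsection.
by move=> x /= nQ; rewrite /xsection /= inE; apply: sN.
Qed.

Lemma ae_snd (Q : R -> Prop) (T : R) : 0 < T ->
  {ae mu2, forall p, slab T p -> Q p.2} -> {ae mu, forall x, Q x}.
Proof.
move=> T0 /ae_section_fst h.
have [t tT] := ae_exists (a := - T) (b := T) ltac:(lra) h.
by apply: ae_mono => x /=; apply.
Qed.

Lemma L2i_locint (f : R -> R) : L2i mu f -> locint f.
Proof.
move=> [mf fi]; split=> // a b; have mI : measurable (`[a, b]%classic : set mR) by exact: measurable_itv.
apply: (intg_le mI (g := fun x => 1 + f x ^+ 2)).
- exact: measurable_funTS.
- by move=> x _; rewrite -[X in _ + X]real_normK ?num_real//; nra.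
- apply: intgD => //; first by apply: intg_cst => //; exact: itv_lty.
  exact: integrableS fi.
Qed.

Lemma L2i_locint2 (f : P -> R) : L2i mu2 f -> locint2 f.
Proof.
move=> [mf fi]; split=> // r; have mI := @measurable_sq R r.
apply: (intg_le mI (g := fun x => 1 + f x ^+ 2)).
- exact: measurable_funTS.
- by move=> x _; rewrite -[X in _ + X]real_normK ?num_real//; nra.
- apply: intgD => //; first by apply: intg_cst => //; exact: sq_lty.
  exact: integrableS fi.
Qed.

Lemma wnorm_lty_L2i (T : R) (C : R -> R) : 0 < T -> measurable_fun (setT : set mR) C ->
  (wnorm 0 T (fun p : P => C p.2) < +oo)%E -> L2i mu C.
Proof.
move=> T0 mC h; split=> //; apply/integrableP; split.
  by apply/measurable_EFinP; exact: measurable_funX.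
have := @wnorm_free R unit (fun=> 0) (fun=> C) tt T T0 mC.
rewrite (_ : free_wave _ _ _ = (fun p : P => C p.2)); last first.
  by apply/funext => p; rewrite /free_wave mul0r addr0.
under [in X in _ -> X]eq_integral => x _ do rewrite /= ger0_norm ?sqr_ge0//.
move=> e; rewrite e in h; rewrite ltey; apply/eqP => E; move: h; rewrite E gt0_muley ?ltxx//.
by rewrite lte_fin; lra.
Qed.

(** The difference of [f] and a primitive of its weak derivative is a constant by the lemma of du
    Bois-Reymond. Boundedness follows because $F^2$ has an integrable derivative. *)
Lemma H1_1_abscont (f : R -> R) : H1_1 setT f -> exists F g : R -> R,
  [/\ abscont F g, L2i mu F, L2i mu g, {ae mu, forall x, f x = F x} &
      exists M, forall x, `|F x| <= M].
Proof.
have pT (u : R -> R) : u \_ (setT : set mR) = u by apply/funext => x; rewrite patchE in_setT.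
move=> [/L2iP Lf [g /L2iP Lg wg]]; rewrite !pT in Lf Lg.
have lf := L2i_locint Lf; have lg := L2i_locint Lg; have aco := abscont_oint lg.
pose D x := f x - oint g x.
have lD : locint D.
  rewrite (_ : D = (fun x => f x + (-1) * oint g x)); last by apply/funext => x; rewrite mulN1r.
  by apply: locintD => //; apply: locintZ; exact: abscont_locint aco.
have [mD _] := lD.
have cint (u : R -> R) a b (v : R -> R) : locint u -> cc_smooth a b v ->
    mu.-integrable setT (EFin \o (fun t => u t * v t)).
  move=> lu cv; apply: (integrable_support (A := (`[a, b]%classic : set mR))).
  - exact: measurable_itv.
  - by move=> z; rewrite /= in_itv/= => h0; rewrite cv.2 ?mulr0.
  - by have [] := locintM_bounded (cc_smooth_measurable cv) (continuous_bounded_itv (cc_smooth_continuous cv)) lu.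
have Dz a b (h : R -> R) : cc_smooth a b h -> \int[mu]_x h x = 0 -> \int[mu]_x (D x * h x) = 0.
  move=> ch h0; have [H cH dH] := cc_smooth_primitive ch h0.
  have tH : test_function (V := R) setT H by apply: (smooth1_test_function cH.1 cH.2).
  have := wg _ tH.
  have -> : \int[mu]_(x in setT) (f x * 'D_1 H x) = \int[mu]_x (f x * h x).
    by apply: eq_Rintegral => x _; case: (dH x) => _ ->.
  move=> e1; have e2 := abscont_ibp aco cH ch dH.
  rewrite (_ : \int[mu]_x (D x * h x) = \int[mu]_x (f x * h x) - \int[mu]_x (oint g x * h x)).
    by rewrite e1 e2 subrr.
  rewrite -RintegralB//; [|exact: cint lf ch|exact: cint (abscont_locint aco) ch].
  by apply: eq_Rintegral => x _; rewrite /D mulrBl.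
pose th : R -> R := plateau (-1) 1 0; have cth : cc_smooth (-1) 1 th := cc_smooth_plateau (-1) 1 0.
have th0 : \int[mu]_x th x != 0 by apply: Rintegral_plateau_neq0; lra.
(* If [D] is constant, testing it with the bump [th] determines the constant. *)
pose c := \int[mu]_x (D x * th x) / \int[mu]_x th x.
have Dk a b (k : R -> R) : cc_smooth a b k -> \int[mu]_x ((D x - c) * k x) = 0.
  move=> ck; pose m := \int[mu]_x k x / \int[mu]_x th x.
  pose a' := Num.min a (-1); pose b' := Num.max b 1.
  have ck' : cc_smooth a' b' k by apply: cc_smoothS ck; rewrite ?ge_min ?le_max lexx.
  have cth' : cc_smooth a' b' th by apply: cc_smoothS cth; rewrite ?ge_min ?le_max lexx ?orbT.
  have ch := cc_smoothB (- m) ck' cth'.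
  have ik := cc_smooth_integrable ck; have ith := cc_smooth_integrable cth.
  have h0 : \int[mu]_x (k x + - m * th x) = 0.
    rewrite RintegralD//; last exact: intgZ.
    by rewrite RintegralZl// /m mulNr divfK ?subrr.
  have iD := cint _ _ _ _ lD ck; have iDth := cint _ _ _ _ lD cth.
  have := Dz _ _ _ ch h0.
  have -> : \int[mu]_x (D x * (k x + - m * th x)) =
      \int[mu]_x (D x * k x) - m * \int[mu]_x (D x * th x).
    rewrite -RintegralZl// -RintegralB//; last exact: intgZ.
    by apply: eq_Rintegral => x _; ring.
  move=> e; have -> : \int[mu]_x ((D x - c) * k x) = \int[mu]_x (D x * k x) - c * \int[mu]_x k x.
    rewrite -RintegralZl// -RintegralB//; last exact: intgZ.
    by apply: eq_Rintegral => x _; ring.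
  rewrite -e /c /m; congr (_ - _); field.
  exact: th0.
(* The statement on the line is an instance of [density] in the plane, for a function that does not
   depend on time. *)
have lDc : locint2 (fun p : P => D p.2 - c) by apply: locint2B; [exact: locint2_snd|exact: locint2_cst].
have Dc : {ae mu, forall x, D x = c}.
  have : {ae mu2, forall p, slab 1 p -> D p.2 - c = 0}.
    apply: density => // l r l' r' n _ _ _ _.
    have i := locint2_cc_smooth_integrable lDc (cc_smooth_plateau l r n) (cc_smooth_plateau l' r' n).
    rewrite /leb2/= (Rfubini2 i) -[RHS](mulr0 (\int[mu]_t plateau l r n t)).
    rewrite -[in RHS](Dk _ _ _ (cc_smooth_plateau l' r' n)) -RintegralZl//; last first.
      have := intgB measurableT (cint _ _ _ _ lD (cc_smooth_plateau l' r' n))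
        (intgZ measurableT c (cc_smooth_integrable (cc_smooth_plateau l' r' n))).
      by apply: eq_integrable => // x _ /=; rewrite (mulrBl _ (D x)).
    apply: eq_Rintegral => x _ /=; rewrite mulrC -RintegralZl//; last exact: cc_smooth_integrable (cc_smooth_plateau l r n).
    by apply: eq_Rintegral => t _; ring.
  by move=> /(ae_snd (Q := fun x => D x - c = 0) ltr01); apply: ae_mono => x /eqP; rewrite subr_eq0 => /eqP.
pose F x := c + oint g x.
have acF : abscont F g by split=> // a b ab; rewrite /F -(aco.2 a b ab); ring.
have fF : {ae mu, forall x, f x = F x}.
  by apply: ae_mono Dc => x; rewrite /F /D; lra.
have mF : measurable_fun (setT : set mR) F := (abscont_locint acF).1.
have LF : L2i mu F.
  split=> //; have [mf fi] := Lf; apply/integrableP; split.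
    by apply/measurable_EFinP; exact: measurable_funX.
  have /integrableP[_] := fi; apply: le_lt_trans; rewrite le_eqVlt; apply/orP; left; apply/eqP.
  apply: ae_eq_integral => //.
  - by apply: measurableT_comp => //; apply/measurable_EFinP; exact: measurable_funX.
  - by apply: measurableT_comp => //; apply/measurable_EFinP; exact: measurable_funX.
  - by apply: ae_mono fF => x fx _ /=; rewrite fx.
exists F, g; split=> //.
have iFF : mu.-integrable setT (EFin \o (fun x => F x ^+ 2)) by case: LF.
have acFF := abscont_mul acF acF.
have iFg : mu.-integrable setT (EFin \o (fun x => `|g x * F x + g x * F x|)).
  have := integrable_norm (intgD measurableT (L2iM Lg LF) (L2iM Lg LF)).
  by apply: eq_integrable.
(* The density of $F^2$ is $2gF$, a product of two square-integrable functions; its $L^1$ norm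
   bounds the oscillation of $F^2$. *)
pose K := \int[mu]_x `|g x * F x + g x * F x|.
have mab (a b : R) : measurable (`[a, b]%classic : set mR) by exact: measurable_itv.
have Kb a b : a <= b -> `|F b * F b - F a * F a| <= K.
  move=> ab; apply: (le_trans (abscontB_bound acFF ab)).
  rewrite -lee_fin /K /Rintegral !fineK; last 2 first.
  - exact: integrable_fin_num iFg.
  - by apply: integrable_fin_num => //; exact: integrableS iFg.
  by apply: ge0_subset_integral => //; have /integrableP[] := iFg.
have K2 x y : F y ^+ 2 <= F x ^+ 2 + K.
  rewrite !expr2; have [xy|/ltW xy] := leP x y.
    by have := Kb _ _ xy; rewrite ler_norml => /andP[]; lra.
  by have := Kb _ _ xy; rewrite ler_norml => /andP[]; lra.
(* The average over $x$ in $[0,1]$ of the inequality $F(y)^2\le F(x)^2+K$. *)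
pose N := \int[mu]_(x in `[0, 1]) (F x ^+ 2) + K.
have N2 y : F y ^+ 2 <= N.
  have mu1 : mu (`[0, 1]%classic : set mR) = 1%E.
    by rewrite lebesgue_measure_itv/= lte_fin ltr01 -EFinD subr0.
  have i01 : mu.-integrable (`[0, 1]%classic : set mR) (EFin \o (fun x => F x ^+ 2)).
    exact: integrableS iFF.
  have ic k : mu.-integrable (`[0, 1]%classic : set mR) (EFin \o (fun=> k : R)).
    by apply: intg_cst => //; exact: itv_lty.
  have c1 k : \int[mu]_(x in `[0, 1]) k = k :> R.
    by rewrite Rintegral_cst// [X in fine X](_ : _ = 1%E) ?mulr1//; exact: mu1.
  rewrite -[X in X <= _]c1 /N -[K in X in _ <= X]c1 -RintegralD//.
  by apply: le_Rintegral => //; exact: intgD.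
exists (Num.sqrt N) => y; rewrite -sqrtr_sqr; exact: ler_wsqrtr.
Qed.

End Slices.

Section Directional.
Context {R : realType}.
Notation mu := (@lebesgue_measure R).
Notation mR := (measurableTypeR R).
Notation mu2 := (leb2 R).
Notation P := (mR * mR)%type.

Lemma ae_of_snd (Q : R -> Prop) : {ae mu, forall x, Q x} ->
  {ae mu2, forall p : P, Q p.2}.
Proof.
move=> [N [mN N0 sN]]; apply: (@ae_section_inv _ _ (snd @^-1` N)).
- by rewrite -[X in measurable X]setTI; exact: measurable_snd.
- by move=> p /= np; apply: contrapT => h; apply: np; apply: sN.
- by exists N; split=> // x /= nx; apply: contrapT => h; apply: nx; apply: ae_all.
Qed.

Lemma Rintegral_patch_test (U : set P) (u : P -> R) (psi : R * R -> R) : test_function U psi ->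
  \int[mu2]_p ((u \_ U) p * psi p) = \int[mu2]_p (u p * psi p).
Proof.
move=> ts; apply: eq_Rintegral => p _; rewrite patchE.
case: (boolP (p \in U)) => // /negP np.
by rewrite (test_function_out ts) ?mulr0// => Tp; apply: np; rewrite inE.
Qed.

(** In sheared coordinates the direction $(1,c)$ is the time direction and the test functions
    $h(t)k(x-ct)$ are products, so that [slicing] applies. The sign in [Vc (- c)] reflects that
    $x-ct$ is constant on these lines. *)
Lemma directional_slicing (c T : R) (F g : P -> R) : 0 < T -> locint2 F -> locint2 g ->
  (forall phi, test_function (slab T) phi ->
    \int[mu2]_p (F p * 'D_((1, c) : R * R) phi p) = - \int[mu2]_p (g p * phi p)) ->
  exists2 C : R -> R, locint C &
    {ae mu2, forall p, slab T p -> F p = C (p.2 - c * p.1) + Vc (- c) g p}.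
Proof.
move=> T0 lF lg H; have [mF _] := lF; have [mg _] := lg.
have [|C lC hC] := slicing T0 (locint2_sh c lF) (locint2_sh c lg).
  move=> a b a' b' h h' k Ta bT ch dh ch' ck.
  have tphi : test_function (slab T) (fun p : R * R => h p.1 * k (lform (- c) 1 p)).
    apply: (tensor_test_function c ch.1 ck.1 ch.2 ck.2) => p /andP[h1 h2].
    by rewrite /slab /= (lt_le_trans Ta h1) (le_lt_trans h2 bT).
  have := H _ tphi.
  have mk : measurable_fun setT (fun p : P => k (lform (- c) 1 p)).
    apply: (measurableT_comp (cc_smooth_measurable ck)).
    by apply: measurable_funD; apply: measurable_funM.
  have m1 : measurable_fun setT (fun p : P => F p * (h' p.1 * k (lform (- c) 1 p))).
    apply: measurable_funM => //; apply: measurable_funM => //.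
    exact: (measurableT_comp (cc_smooth_measurable ch')).
  have m2 : measurable_fun setT (fun p : P => g p * (h p.1 * k (lform (- c) 1 p))).
    apply: measurable_funM => //; apply: measurable_funM => //.
    exact: (measurableT_comp (cc_smooth_measurable ch)).
  rewrite (eq_Rintegral mu2 (g := fun p : P => F p * (h' p.1 * k (lform (- c) 1 p)))); last first.
    by move=> p _; rewrite (derive_tensor c p ck.1 dh).
  rewrite -(mpreserving_integral (mpreserving_sh c) measurableT m1) -(mpreserving_integral (mpreserving_sh c) measurableT m2).
  rewrite !preimage_setT => E.
  have e (p : P) : lform (- c) 1 (sh c p) = p.2 by rewrite /lform /sh /=; ring.
  transitivity (\int[mu2]_p (F (sh c p) * (h' (sh c p).1 * k (lform (- c) 1 (sh c p))))).
    by apply: eq_Rintegral => p _; rewrite e.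
  by rewrite E; congr (- _); apply: eq_Rintegral => p _; rewrite e.
exists C => //; apply: ae_mono (mpreserving_ae (mpreserving_sh (- c)) hC) => p h Tp.
have := h Tp; rewrite /= shNK => ->; congr (C _ + _); first by rewrite /sh /= mulNr.
by rewrite /Vc opprK.
Qed.

(** Extension by 0 outside the slab turns [f] and its derivative into square-integrable functions on
    the plane; test functions supported in the slab do not see it. *)
Lemma H1_2_direction (T c : R) (f : P -> R) : H1_2 (slab T) f ->
  L2i mu2 (f \_ (slab T)) /\ exists2 g : P -> R, L2i mu2 g &
  forall phi, test_function (slab T) phi ->
    \int[mu2]_p ((f \_ (slab T)) p * 'D_((1, c) : R * R) phi p) = - \int[mu2]_p (g p * phi p).
Proof.
move=> [/L2iP Lf hd]; split=> //.
have [gt /L2iP Lt ht] := hd dt (or_introl erefl); have [gx /L2iP Lx hx] := hd dx (or_intror erefl).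
exists (fun p => (gt \_ (slab T)) p + c * (gx \_ (slab T)) p); first exact: L2iD.
move=> phi tp; have tv v := test_function_derive v hausdorff_plane tp.
have LD U (psi : R * R -> R) : test_function U psi -> L2i mu2 psi by exact: test_function_L2i.
have pE (u : P -> R) (psi : R * R -> R) : test_function (slab T) psi ->
    \int[mu2]_(p in slab T) (u p * psi p) = \int[mu2]_p ((u \_ (slab T)) p * psi p).
  by move=> ts; rewrite (Rintegral_test _ ts) Rintegral_patch_test.
have := ht _ tp; have := hx _ tp; rewrite !pE// => ex et.
have [sp _ _] := tp.
have -> : \int[mu2]_p ((f \_ (slab T)) p * 'D_((1, c) : R * R) phi p) =
    \int[mu2]_p ((f \_ (slab T)) p * 'D_dt phi p) + c * \int[mu2]_p ((f \_ (slab T)) p * 'D_dx phi p).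
  have i1 := L2iM Lf (LD _ _ (tv dt)); have i2 := L2iM Lf (LD _ _ (tv dx)).
  rewrite -RintegralZl// -RintegralD//; last exact: intgZ.
  apply: eq_Rintegral => p _; rewrite derive_plane; first by ring.
  exact: smooth_differentiable.
rewrite ex et mulrN -opprD; congr (- _).
have i1 := L2iM Lt (LD _ _ tp); have i2 := L2iM Lx (LD _ _ tp).
rewrite -RintegralZl// -RintegralD//; last exact: intgZ.
by apply: eq_Rintegral => p _; ring.
Qed.

Lemma abs_oint_ge0 (f : R -> R) (t : R) : locint f -> (forall s, 0 <= f s) -> t != 0 ->
  (`|oint f t|%:E = \int[mu]_(s in seg t) (f s)%:E)%E.
Proof.
move=> lf f0 t0; rewrite /oint normrM normr_sg t0 mul1r ger0_norm; last exact: Rintegral_ge0.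
by rewrite /Rintegral fineK//; apply: integrable_fin_num (locint_seg t lf); exact: measurable_seg.
Qed.

(** The right side does not depend on $t$; one of its two terms covers positive times and the other
    negative ones. *)
Lemma oint_le (f : R -> R) (t T : R) : locint f -> 0 < T -> `|t| <= T ->
  `|oint f t| <= `|oint (fun s => `|f s|) T| + `|oint (fun s => `|f s|) (- T)|.
Proof.
move=> lf T0 tT; have ln := locint_norm lf; have [mf _] := lf; have [mn _] := ln.
have sub t' : t' != 0 -> seg t `<=` seg t' -> `|oint f t| <= `|oint (fun s => `|f s|) t'|.
  move=> t0 ss; rewrite -lee_fin (abs_oint_ge0 (t := t') ln)//; apply: le_trans (oint_bound t mf) _.
  apply: ge0_subset_integral => //; try exact: measurable_seg.
  by apply/measurable_EFinP; exact: measurable_funTS.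
move: tT; rewrite ler_norml => /andP[h1 h2]; have [t0|/ltW t0] := leP 0 t.
  apply: (le_trans (sub T _ _)); [by rewrite gt_eqF| |by rewrite lerDl].
  by rewrite !seg_ge0 ?(ltW T0)// => s; rewrite /= !in_itv/= => /andP[s0 s1]; rewrite s0; exact: le_trans h2.
apply: (le_trans (sub (- T) _ _)); [by rewrite oppr_eq0 gt_eqF| |by rewrite lerDr].
rewrite !seg_le0 ?oppr_le0 ?(ltW T0)// => s; rewrite /= !in_itv/= => /andP[s0 s1].
by rewrite s1 andbT; exact: le_trans s0.
Qed.

Lemma Vc_wnorm_fin (c T : R) (g : P -> R) : 0 < T -> L2i mu2 g ->
  (wnorm 0 T (Vc c g) < +oo)%E.
Proof.
move=> T0 [mg /integrableP[_ ig]].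
apply: (le_lt_trans (wnorm0_le T (@ler01 R) (measurable_Vc c mg))).
apply: lte_mul_pinfty; rewrite ?lee_fin ?expR_ge0//.
apply: (le_lt_trans (wnorm_Vc c ltr01 T0 mg)).
apply: lte_mul_pinfty; rewrite ?lee_fin//; first by rewrite divr1 mulr_ge0// ltW.
apply: (le_lt_trans (wnorm_le0 T (@ler01 R) mg)).
rewrite wnorm_patch; apply: le_lt_trans ig.
have mp : measurable_fun setT (g \_ (slab T)).
  by apply/(measurable_restrictT g (measurable_slab T)); exact: measurable_funTS.
apply: ge0_le_integral => //.
- by move=> p _; rewrite lee_fin sqr_ge0.
- by apply/measurable_EFinP; exact: measurable_funX.
- by apply: measurableT_comp => //; apply/measurable_EFinP; exact: measurable_funX.
- move=> p _; rewrite patchE /= ger0_norm ?sqr_ge0// lee_fin; case: ifP => // _.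
  by rewrite expr0n sqr_ge0.
Qed.

Lemma oint_L2i (g : P -> R) (t : R) : L2i mu2 g -> L2i mu (fun x => oint (fun s => `|g (s, x)|) t).
Proof.
move=> [mg ig].
have mn : measurable_fun setT (fun p => `|g p|) by exact: measurableT_comp.
have mo : measurable_fun (setT : set mR) (fun x => oint (fun s => `|g (s, x)|) t).
  exact: (measurableT_comp (measurable_vert mn) (pair1_measurable t)).
split=> //; apply/integrableP; split.
  by apply/measurable_EFinP; exact: measurable_funX.
under eq_integral => x _ do rewrite /= ger0_norm ?sqr_ge0//.
have mz : measurable_fun (setT : set mR) (fun=> 0 : R) by exact: measurable_cst.
have := oint_shift_slice t mn mz.
under [in X in (X <= _)%E -> _]eq_integral => x _ do rewrite /= addr0.
move=> /le_lt_trans; apply; apply: lte_mul_pinfty; rewrite ?lee_fin//.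
have /integrableP[_] := ig; apply: le_lt_trans.
rewrite [X in (_ <= X)%E](_ : _ = \int[mu]_s \int[mu]_x (`|g (s, x)| ^+ 2)%:E)%E.
  apply: ge0_subset_integral => //; first exact: measurable_seg.
    exact: (measurable_slice_sq mn).
  by move=> s _; apply: integral_ge0 => x _; rewrite lee_fin sqr_ge0.
rewrite /leb2/= fubini_tonelli1; last 2 first.
- by have /integrableP[mi _] := ig; exact: (measurableT_comp (@abse_measurable _ setT) mi).
- by move=> p; rewrite lee_fin normr_ge0.
by apply: eq_integral => s _; apply: eq_integral => x _; rewrite /= ger0_norm ?sqr_ge0// real_normK ?num_real.
Qed.

Lemma L2i_norm d (X : measurableType d) (m : {measure set X -> \bar R}) (f : X -> R) :
  L2i m f -> L2i m (fun x => `|f x|).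
Proof.
move=> lf; have [mf _] := lf; apply: (L2i_le _ _ lf); first exact: measurableT_comp.
by move=> x; rewrite normr_id.
Qed.

(** The majorant adds to $|C|$ the integrals of $|g|$ over the two halves of the line inside the
    slab, which no longer depend on the position on the line. *)
Lemma H1_2_line_bound (T c : R) (f : P -> R) : 0 < T -> H1_2 (slab T) f ->
  exists2 A : R -> R, L2i mu A &
    {ae mu2, forall p, slab T p -> `|f p| <= A (p.2 - c * p.1)}.
Proof.
move=> T0 /(H1_2_direction c)[Lf [g Lg hg]].
have [C lC hC] := directional_slicing T0 (L2i_locint2 Lf) (L2i_locint2 Lg) hg.
have [mf _] := Lf; have [mg _] := Lg; have [mC _] := lC.
have mV := measurable_Vc (- c) mg.
(* On the slab [C] along the lines is [f] minus the integral of [g], and both are in $L^2$ there. A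
   function of $x-ct$ has on the slab $2T$ times its squared norm on the line. *)
have LC : L2i mu C.
  apply: (wnorm_lty_L2i T0 mC).
  have mC2 : measurable_fun setT (fun p : P => C p.2) by exact: measurableT_comp.
  rewrite -(wnorm_sh _ _ (- c) mC2).
  pose D p := (f \_ (slab T)) p + (-1) * Vc (- c) g p.
  have mD : measurable_fun setT D by apply: measurable_funD => //; exact: measurable_funM.
  apply: (@le_lt_trans _ _ (wnorm 0 T D)).
    apply: ae_le_wnorm => //.
      by apply: (measurableT_comp mC2); exact: measurable_sh.
    apply: ae_mono hC => p hp Tp; rewrite /D hp// mulN1r addrK.
    by rewrite /sh /= mulNr.
  apply: le_lt_trans (wnormD _ _ _ _) _ => //; first exact: measurable_funM.
  rewrite wnormZ//; apply: lte_add_pinfty; apply: lte_mul_pinfty; rewrite ?lee_fin//.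
    rewrite (_ : wnorm _ _ _ = \int[mu2]_p (((f \_ (slab T)) p) ^+ 2)%:E)%E; first exact: L2i_lty.
    by rewrite wnorm_patch; apply: eq_integral => p _; rewrite !patchE; case: ifP => // ->.
  apply: lte_mul_pinfty; rewrite ?lee_fin ?sqr_ge0//; exact: Vc_wnorm_fin.
pose G : P -> R := g \o sh c.
have LG : L2i mu2 G.
  split; first exact: (measurableT_comp mg (measurable_sh c)).
  have [_ ig] := Lg; have mg2 : measurable_fun setT (fun p => g p ^+ 2) by exact: measurable_funX.
  have := mpreserving_integrable (mpreserving_sh c) measurableT mg2 ig.
  by rewrite preimage_setT.
pose A x := `|C x| + 1 * (`|oint (fun s => `|G (s, x)|) T| + 1 * `|oint (fun s => `|G (s, x)|) (- T)|).
exists A.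
  by apply: L2iD; [exact: L2i_norm|apply: L2iD; apply: L2i_norm; exact: oint_L2i].
have hs : {ae mu2, forall p : P, locint (fun s => G (s, p.2 - c * p.1))}.
  have h1 := ae_of_snd (locint2_section (L2i_locint2 LG)).
  apply: ae_mono (mpreserving_ae (mpreserving_sh (- c)) h1) => p /=.
  by rewrite /sh /= mulNr.
apply: ae_mono2 hC hs => p hp lp Tp.
have := hp Tp; rewrite patchE mem_set// => ->; rewrite /A !mul1r.
apply: (le_trans (ler_normD _ _)); rewrite lerD2l.
have -> : Vc (- c) g p = oint (fun s => G (s, p.2 - c * p.1)) p.1.
  by rewrite VcE; apply: eq_oint => s _; rewrite /G /sh /=; congr (g (_, _)); ring.
by apply: oint_le => //; apply: ltW; rewrite ltr_norml.
Qed.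

Lemma mpreserving_reflect (a : R) : mpreserving mu mu (fun s : mR => (a - s : mR)).
Proof.
have [m1 h1] := mpreserving_translate a; have [m2 h2] := @mpreserving_opp R.
split; first exact: measurable_funB.
move=> A mA.
have mA' : measurable ((fun s : mR => (s + a : mR)) @^-1` A).
  by rewrite -[X in measurable X]setTI; apply: m1.
rewrite -(h1 A mA) -(h2 _ mA').
by congr (mu _); apply/seteqP; split=> s /=; rewrite addrC.
Qed.

(** For fixed $x$ the reflection $t\mapsto x-t$ preserves measure, so that the double integral
    factors into the two squared norms. *)
Lemma product_lines_L2i (A B : R -> R) : L2i mu A -> L2i mu B ->
  L2i mu2 (fun p : P => A p.2 * B (p.2 - p.1)).
Proof.
move=> LA LB; have [mA iA] := LA; have [mB iB] := LB.
have mm : measurable_fun setT (fun p : P => A p.2 * B (p.2 - p.1)).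
  apply: measurable_funM; first exact: measurableT_comp.
  by apply: (measurableT_comp mB); exact: measurable_funB.
split=> //; apply/integrableP; split.
  by apply/measurable_EFinP; exact: measurable_funX.
have mB2 : measurable_fun (setT : set mR) (fun x => (B x ^+ 2)%:E).
  by apply/measurable_EFinP; exact: measurable_funX.
under eq_integral => p _ do rewrite /= ger0_norm ?sqr_ge0//.
rewrite /leb2/= fubini_tonelli2; last 2 first.
- by apply/measurable_EFinP; exact: measurable_funX.
- by move=> p; rewrite lee_fin sqr_ge0.
rewrite /fubini_G /=.
apply: (@le_lt_trans _ _ (\int[mu]_x (\int[mu]_t (B t ^+ 2)%:E * (A x ^+ 2)%:E)))%E.
  rewrite le_eqVlt; apply/orP; left; apply/eqP; apply: eq_integral => x _; rewrite muleC -ge0_integralZl_EFin ?sqr_ge0//; last first.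
    by move=> t _; rewrite lee_fin sqr_ge0.
  have mB3 : measurable_fun (setT : set mR) (fun t => ((A x ^+ 2)%:E * (B t ^+ 2)%:E)%E).
    exact: emeasurable_funM.
  rewrite -(mpreserving_ge0_integral (mpreserving_reflect x) measurableT mB3); last first.
    by move=> t; rewrite -EFinM lee_fin mulr_ge0 ?sqr_ge0.
  by rewrite preimage_setT; apply: eq_integral => t _; rewrite -EFinM exprMn.
have B0 : (0 <= \int[mu]_t (B t ^+ 2)%:E)%E by apply: integral_ge0 => t _; rewrite lee_fin sqr_ge0.
have Bf := L2i_lty LB.
rewrite -(fineK (x := (\int[mu]_t (B t ^+ 2)%:E)%E)) ?ge0_fin_numE//.
rewrite ge0_integralZl_EFin ?fine_ge0//; last first.
- by apply/measurable_EFinP; exact: measurable_funX.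
- by move=> x _; rewrite lee_fin sqr_ge0.
by apply: lte_mul_pinfty; rewrite ?lee_fin ?fine_ge0//; exact: L2i_lty.
Qed.

(* H^1 functions of the plane are locally in L^4: they are bounded by an L^2
   function of the transversal coordinate in every direction. *)
Lemma H1_2_sq (T : R) (f : P -> R) : 0 < T -> H1_2 (slab T) f ->
  L2i mu2 (fun p => (f \_ (slab T)) p ^+ 2).
Proof.
move=> T0 hf; have [A LA hA] := H1_2_line_bound 0 T0 hf; have [B LB hB] := H1_2_line_bound 1 T0 hf.
have [[mf _] _] := H1_2_direction 0 hf.
pose h (p : P) := A p.2 * B (p.2 - p.1).
pose q (p : P) := (f \_ (slab T)) p ^+ 2.
have mq : measurable_fun setT q by exact: measurable_funX.
have Lh : L2i mu2 h := product_lines_L2i LA LB; have [mh ih] := Lh.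
split=> //; have /integrableP[_ hfin] := ih; apply/integrableP; split.
  by apply/measurable_EFinP; exact: measurable_funX.
apply: le_lt_trans hfin; apply: ae_ge0_le_integral => //.
- by apply: measurableT_comp => //; apply/measurable_EFinP; exact: measurable_funX.
- by apply: measurableT_comp => //; apply/measurable_EFinP; exact: measurable_funX.
apply: ae_mono2 hA hB => p; rewrite mul0r subr0 mul1r => h1 h2 _.
rewrite /= !ger0_norm ?sqr_ge0// lee_fin /q patchE.
case: (boolP (p \in slab T)) => [/set_mem Tp|_]; last by rewrite !expr0n sqr_ge0.
have := h1 Tp; have := h2 Tp; rewrite /h => a b.
rewrite -[f p ^+ 2]real_normK ?num_real// lerXn2r ?nnegrE ?sqr_ge0//.
  by apply: mulr_ge0; [exact: le_trans b|exact: le_trans a].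
by rewrite expr2; apply: ler_pM.
Qed.

Lemma H1_2_measurable (f : P -> R) : (forall T, 0 < T -> H1_2 (slab T) f) ->
  measurable_fun setT f.
Proof.
move=> hf; apply: (@measurable_fun_cvg _ _ _ _ (fun n p => (f \_ (slab n.+1%:R)) p)).
  by move=> n; have [[mf _] _] := H1_2_direction 0 (hf n.+1%:R (ltr0n _ _)).
move=> p _; apply: cvg_near_cst; near=> n; rewrite patchE mem_set//.
rewrite /slab /= -ltr_norml; apply: (lt_trans (archi_boundP (normr_ge0 p.1))).
rewrite ltr_nat ltnS; near: n; exact: nbhs_infty_ge.
Unshelve. all: by end_near. Qed.

End Directional.

(** * Uniqueness for the chiral system *)

Section Uniqueness.
Context {R : realType} (lam kap : R).
Notation mu := (@lebesgue_measure R).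
Notation mR := (measurableTypeR R).
Notation mu2 := (leb2 R).
Notation P := (mR * mR)%type.
Notation I := (bool * bool)%type.

Lemma integrable_locint2 (f : P -> R) : measurable_fun setT f ->
  mu2.-integrable setT (EFin \o f) -> locint2 f.
Proof. by move=> mf fi; split=> // r; apply: integrableS fi => //; exact: measurable_sq. Qed.

(** Each cubic monomial is the square of one component times another component; the square is in
    $L^2$ by [H1_2_sq], so the product is integrable. *)
Lemma force_slab_locint2 (T : R) (f : I -> P -> R) j : 0 < T -> (forall k, H1_2 (slab T) (f k)) ->
  locint2 ((fun p => force lam kap j (fun k => f k p)) \_ (slab T)).
Proof.
move=> T0 hf; pose fs k := f k \_ (slab T).
have Lfs k : L2i mu2 (fs k) by have [] := H1_2_direction 0 (hf k).
have Lq k : L2i mu2 (fun p => fs k p ^+ 2) by exact: H1_2_sq.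
have cub k l : locint2 (fun p => fs k p ^+ 2 * fs l p).
  have [m1 _] := Lq k; have [m2 _] := Lfs l.
  by apply: integrable_locint2; [exact: measurable_funM|exact: L2iM].
rewrite (_ : _ \_ _ = (fun p => psign j * (lam * fs (cross j) p +
   kap * (fs (cross j) p ^+ 2 * fs (other j) p + fs (chir j) p ^+ 2 * fs (other j) p)))).
  by apply: locint2Z; apply: locint2D; apply: locint2Z; [exact: L2i_locint2|exact: locint2D].
apply/funext => p; rewrite /fs !patchE /force; case: ifP => _; first by ring.
by rewrite -[point]/(0 : R) !mulr0 addr0 mulr0 addr0 mulr0.
Qed.

(** By Fubini's theorem the integrands agree almost everywhere on almost every characteristic. The
    exceptional set is expressed through the measurable functions [vert], as [ae_section_inv]
    demands. *)
Lemma Vc_ae (c T : R) (g h : P -> R) : measurable_fun setT g -> measurable_fun setT h ->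
  {ae mu2, forall p, slab T p -> g p = h p} ->
  {ae mu2, forall p, slab T p -> Vc c g p = Vc c h p}.
Proof.
move=> mg mh gh; pose g' := g \o sh (- c); pose h' := h \o sh (- c).
have mg' : measurable_fun setT g' by exact: (measurableT_comp mg (measurable_sh _)).
have mh' : measurable_fun setT h' by exact: (measurableT_comp mh (measurable_sh _)).
have mv := measurable_vert mg'; have mv' := measurable_vert mh'.
have gh' := ae_section (mpreserving_ae (mpreserving_sh (- c)) gh).
suff H : {ae mu2, forall p, slab T p -> vert g' p = vert h' p}.
  by apply: ae_mono (mpreserving_ae (mpreserving_sh c) H) => p hp Tp; exact: hp.
apply: (@ae_section_inv _ _ (slab T `&` [set p | vert g' p - vert h' p != 0])).
- apply: measurableI; first exact: measurable_slab.
  have md : measurable_fun setT (fun p => vert g' p - vert h' p) by exact: measurable_funB.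
  rewrite (_ : [set p | _] = (fun p => vert g' p - vert h' p) @^-1` [set~ 0]).
    by rewrite -[X in measurable X]setTI; apply: md => //; apply: measurableC.
  by apply/seteqP; split=> p /= /eqP.
- move=> p np Tp; apply/eqP; rewrite -subr_eq0; apply/negPn/negP => h0; exact: np.
apply: ae_mono gh' => x hx; apply: ae_all => t [Tt] /=; apply/negP; rewrite negbK subr_eq0.
apply/eqP; rewrite /vert /oint /=; congr (_ * _).
have ms := @measurable_seg R t.
rewrite /Rintegral; congr fine; apply: ae_eq_integral => //.
- apply/measurable_EFinP; apply: measurable_funTS; exact: (measurableT_comp mg' (pair2_measurable x)).
- apply/measurable_EFinP; apply: measurable_funTS; exact: (measurableT_comp mh' (pair2_measurable x)).
- apply: ae_mono hx => s hs st /=; congr EFin; apply: hs.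
  rewrite /slab /= -ltr_norml; apply: le_lt_trans (seg_norm st) _; rewrite ltr_norml; exact: Tt.
Qed.

Context (f0 g0 : I -> R -> R) (M : R) (f fp : I -> P -> R).
Hypothesis acf : forall j, abscont (f0 j) (g0 j).
Hypothesis L2f : forall j, L2i mu (f0 j).
Hypothesis L2g : forall j, L2i mu (g0 j).
Hypothesis dM : forall j x, `|f0 j x| <= M.
Hypothesis bf : forall j, slab_bounded (f j).
Hypothesis fE : forall j p, f j p = free_wave speed f0 j p +
  Vc (speed j) (fun q => force lam kap j (fun k => f k q)) p.
Hypothesis ffin : forall T, 0 < T -> forall j, (wnorm 0 T (f j) < +oo)%E.
Hypothesis hH : forall T j, 0 < T -> H1_2 (slab T) (fp j).
Hypothesis hW : forall j phi, test_function setT phi ->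
  \int[mu2]_p (fp j p * 'D_((1, - speed j) : R * R) phi p) =
  - \int[mu2]_p (force lam kap j (fun k => fp k p) * phi p).
Hypothesis hI : forall j (eps : R), 0 < eps -> exists2 delta : R, 0 < delta &
  {ae mu, forall t, `|t| < delta -> (\int[mu]_x ((fp j (t, x) - f0 j x) ^+ 2)%:E < eps%:E)%E}.

Let mfp j : measurable_fun setT (fp j).
Proof. by apply: H1_2_measurable => T T0; exact: hH. Qed.

(** Extension by 0 gives a locally integrable function on the plane; a characteristic followed from
    time 0 to a time within the slab only meets the original force. *)
Let tau T j : P -> R := (fun p => force lam kap j (fun k => fp k p)) \_ (slab T).

Let ltau T j : 0 < T -> locint2 (tau T j).
Proof. by move=> T0; apply: force_slab_locint2 => // k; exact: hH. Qed.

Let characteristics T j : 0 < T -> exists2 C : R -> R, locint C &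
  {ae mu2, forall p, slab T p -> fp j p = C (p.2 + speed j * p.1) + Vc (speed j) (tau T j) p}.
Proof.
move=> T0; have [Lf _] := H1_2_direction 0 (hH j T0).
have [|C lC hC] := directional_slicing (c := - speed j) T0 (L2i_locint2 Lf) (ltau j T0).
  move=> phi tp; have tD := test_function_derive ((1, - speed j) : R * R) hausdorff_plane tp.
  by rewrite (Rintegral_patch_test _ tD) (Rintegral_patch_test _ tp) hW//; exact: test_functionW tp.
exists C => //; apply: ae_mono hC => p hp Tp; have := hp Tp.
by rewrite patchE mem_set// mulNr !opprK.
Qed.

(** Along good times $t_n\to0$ the values of [fp] on almost every characteristic tend to [C] by
    continuity of the integral, while in $L^2$ they stay close to the data. Fatou's lemma combines
    the two limits. *)
Let initial_trace T j (C : R -> R) : 0 < T -> locint C ->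
  {ae mu2, forall p, slab T p -> fp j p = C (p.2 + speed j * p.1) + Vc (speed j) (tau T j) p} ->
  {ae mu, forall x, C x = f0 j x}.
Proof.
move=> T0 lC hC; pose c : R := speed j; pose k := tau T j \o sh (- c); rewrite -/c in hC.
have lk : locint2 k := locint2_sh (- c) (ltau j T0).
have [mC _] := lC; have mf0 : measurable_fun (setT : set mR) (f0 j) by case: (L2f j).
pose G := (\int[mu]_x (g0 j x ^+ 2)%:E)%E.
have G0 : (0 <= G)%E by apply: integral_ge0 => x _; rewrite lee_fin sqr_ge0.
have Gf : (G < +oo)%E by exact: L2i_lty.
pose g := fine G; have GE : G = g%:E by rewrite /g fineK// ge0_fin_numE.
have g_ge0 : 0 <= g by exact: fine_ge0.
have mD : measurable_fun (setT : set mR) (fun x => ((C x - f0 j x) ^+ 2)%:E).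
  by apply/measurable_EFinP; apply: measurable_funX; exact: measurable_funB.
have small (e : R) : 0 < e -> (\int[mu]_x ((C x - f0 j x) ^+ 2)%:E <= e%:E)%E.
  move=> e0; have e4 : 0 < e / 4 by lra.
  have [d0 d00 hd0] := hI j e4.
  have k0 : 0 < 4 * (g + 1) by lra.
  (* With $t\le1$ and $t\le e/(4(g+1))$ the translation of the data costs $2gt^2\le e/2$; the
     initial condition costs the other $2\cdot e/4$. *)
  pose d := Num.min (Num.min d0 T) (Num.min 1 (e / (4 * (g + 1)))).
  have dpos : 0 < d by rewrite !lt_min d00 T0 ltr01 divr_gt0.
  (* The initial condition and the representation along characteristics hold only for almost every
     time, so suitable times are picked from shrinking intervals. *)
  have good (n : nat) : exists t, [/\ 0 < t < n.+1%:R^-1, `|t| < d,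
      (\int[mu]_x ((fp j (t, x) - f0 j x) ^+ 2)%:E < (e / 4)%:E)%E &
      {ae mu, forall x, slab T (t, x) -> fp j (t, x) = C (x + c * t) + Vc c (tau T j) (t, x)}].
    have [|t /andP[t0]] := ae_exists (a := 0) (b := Num.min d n.+1%:R^-1) _
      (ae_mono2 (fun t a b => conj a b) hd0 (ae_section_fst hC)).
      by rewrite lt_min dpos invr_gt0 ltr0n.
    rewrite lt_min => /andP[td tn] [h1 h2]; exists t; split.
    - by rewrite t0.
    - by rewrite gtr0_norm.
    - by apply: h1; rewrite gtr0_norm//; move: td; rewrite !lt_min => /andP[/andP[]].
    - exact: h2.
  have [t ht] := choice good.
  pose fn (n : nat) (a : R) := ((fp j (t n, a - c * t n) - f0 j a) ^+ 2)%:E : \bar R.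
  have mline n : measurable_fun (setT : set mR) (fun a => fp j (t n, a - c * t n)).
    apply: (measurableT_comp (mfp j)); apply/measurable_fun_pairP; split => /=; first exact: measurable_cst.
    exact: measurable_funB.
  have mfn n : measurable_fun (setT : set mR) (fn n).
    by apply/measurable_EFinP; apply: measurable_funX; exact: measurable_funB.
  have fn_le n : (\int[mu]_a fn n a <= e%:E)%E.
    have [/andP[t0 _] td hI1 _] := ht n.
    have msh : measurable_fun (setT : set mR) (fun x => f0 j (x + c * t n) - f0 j x).
      apply: measurable_funB => //; apply: (measurableT_comp mf0); exact: measurable_funD.
    have mfps : measurable_fun (setT : set mR) (fun x => fp j (t n, x)).
      exact: (measurableT_comp (mfp j) (pair1_measurable (t n))).
    have mrhs : measurable_fun (setT : set mR) (fun x => ((fp j (t n, x) - f0 j (x + c * t n)) ^+ 2)%:E).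
      apply/measurable_EFinP; apply: measurable_funX; apply: measurable_funB => //.
      apply: (measurableT_comp mf0); exact: measurable_funD.
    have -> : (\int[mu]_a fn n a = \int[mu]_x ((fp j (t n, x) - f0 j (x + c * t n)) ^+ 2)%:E)%E.
      rewrite -(mpreserving_ge0_integral (mpreserving_translate (- (c * t n))) measurableT mrhs); last first.
        by move=> x; rewrite lee_fin sqr_ge0.
      by rewrite preimage_setT; apply: eq_integral => x _; rewrite /fn subrK.
    apply: (@le_trans _ _ (\int[mu]_x (2%:E * ((fp j (t n, x) - f0 j x) ^+ 2)%:E +
       2%:E * ((f0 j (x + c * t n) - f0 j x) ^+ 2)%:E))%E).
      apply: ge0_le_integral => //.
      - by move=> x _; rewrite lee_fin sqr_ge0.
      - apply: emeasurable_funD; apply: emeasurable_funM => //; apply/measurable_EFinP;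
          apply: measurable_funX => //; exact: measurable_funB.
      - move=> x _; rewrite -!EFinM -EFinD lee_fin.
        set u := fp j _; set v := f0 j x; set z := f0 j _.
        by have := sqr_ge0 (u - v + (z - v)); nra.
    rewrite ge0_integralD//; last 4 first.
    - by move=> x _; rewrite -EFinM lee_fin mulr_ge0// sqr_ge0.
    - by apply: emeasurable_funM => //; apply/measurable_EFinP; apply: measurable_funX; exact: measurable_funB.
    - by move=> x _; rewrite -EFinM lee_fin mulr_ge0// sqr_ge0.
    - by apply: emeasurable_funM => //; apply/measurable_EFinP; exact: measurable_funX.
    rewrite !ge0_integralZl_EFin//; last 4 first.
    - by move=> x _; rewrite lee_fin sqr_ge0.
    - by apply/measurable_EFinP; exact: measurable_funX.
    - by move=> x _; rewrite lee_fin sqr_ge0.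
    - by apply/measurable_EFinP; apply: measurable_funX; exact: measurable_funB.
    apply: (@le_trans _ _ (2%:E * (e / 4)%:E + 2%:E * (((c * t n) ^+ 2)%:E * G))%E).
      apply: leeD; apply: lee_wpmul2l => //; first exact: ltW.
      exact: translation_L2.
    rewrite GE -!EFinM -EFinD lee_fin.
    have -> : (c * t n) ^+ 2 = t n * t n by rewrite exprMn /c /speed; case: ifP => _; ring.
    move: td; rewrite (gtr0_norm t0) !lt_min => /andP[_ /andP[t1]].
    rewrite ltr_pdivlMr// => te.
    have h1 : t n * t n <= t n by rewrite -[X in _ <= X]mulr1 ler_wpM2l// ltW.
    have := ler_wpM2l g_ge0 h1; lra.
  have fn_cvg : {ae mu, forall a, fn n a @[n --> \oo] --> ((C a - f0 j a) ^+ 2)%:E}.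
    have h1 n : {ae mu, forall a, fp j (t n, a - c * t n) = C a + oint (fun s => k (s, a)) (t n)}.
      have [/andP[t0 _] td _ hx] := ht n.
      apply: ae_mono (mpreserving_ae (mpreserving_translate (- (c * t n))) hx) => a ha.
      rewrite ha; last first.
        rewrite /slab /= -ltr_norml; apply: lt_le_trans td _.
        by rewrite /d !ge_min lexx orbT.
      rewrite subrK VcE /=; congr (_ + _); apply: eq_oint => s _.
      by rewrite /k /sh /= subrK mulNr.
    apply: ae_mono2 (ae_countable h1) (locint2_section lk) => a ha la.
    apply: cvg_EFin; first exact: nearW.
    rewrite (_ : fine \o _ = (fun n => (C a + oint (fun s => k (s, a)) (t n) - f0 j a) ^+ 2)); last first.
      by apply/funext => n; rewrite /fn /= ha.
    have co := abscont_continuous (abscont_oint la).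
    have tn0 : t n @[n --> \oo] --> (0 : R).
      apply: (squeeze_cvgr (f := fun=> 0) (h := fun n => n.+1%:R^-1)).
      - by apply: nearW => n; have [/andP[a0 b0] _ _ _] := ht n; rewrite !ltW.
      - exact: cvg_cst.
      - exact: cvg_harmonic.
    have o0 : oint (fun s => k (s, a)) (t n) @[n --> \oo] --> (0 : R).
      by have := cvg_comp _ _ tn0 (co 0); rewrite oint0.
    rewrite (_ : C a - f0 j a = C a + 0 - f0 j a); last by rewrite addr0.
    by rewrite expr2; apply: cvgM; (apply: cvgB; [apply: cvgD => //; exact: cvg_cst|exact: cvg_cst]).
  have -> : (\int[mu]_x ((C x - f0 j x) ^+ 2)%:E = \int[mu]_x limn_einf (fn ^~ x))%E.
    apply: ae_eq_integral => //.
      have mN n : measurable_fun (setT : set mR) (fun a => (- fn n a)%E).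
        exact: (measurableT_comp (@oppe_measurable R setT) (mfn n)).
      have ms := measurable_fun_limn_esup mN.
      have := measurableT_comp (@oppe_measurable R setT) ms.
      by congr (measurable_fun _ _); apply/funext => a /=; rewrite limn_esupN oppeK.
    apply: ae_mono fn_cvg => a ha _; apply/esym; rewrite is_cvg_limn_einfE.
      exact: cvg_lim.
    by apply/cvg_ex; eexists; exact: ha.
  apply: (le_trans (fatou _ _ _ _)) => //.
    by move=> n x _; rewrite lee_fin sqr_ge0.
  rewrite limn_einf_lim; apply: lime_le; first exact: is_cvg_einfs.
  apply: nearW => n; apply: le_trans (fn_le n).
  by apply: ereal_inf_lbound; exists n => /=.
have z : (\int[mu]_x `|((C x - f0 j x) ^+ 2)%:E| = 0)%E.
  apply/eqP; rewrite eq_le integral_ge0// andbT.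
  under eq_integral => x _ do rewrite gee0_abs ?lee_fin ?sqr_ge0//.
  by apply/lee_addgt0Pr => e e0; rewrite add0e; exact: small.
move/(ae_eq_integral_abs mu measurableT mD).1 : z; apply: ae_mono => x /(_ Logic.I) [] /eqP.
by rewrite sqrf_eq0 subr_eq0 => /eqP.
Qed.

Let duhamel T j : 0 < T -> {ae mu2, forall p, slab T p ->
  fp j p = free_wave speed f0 j p + Vc (speed j) (tau T j) p}.
Proof.
move=> T0; have [C lC hC] := characteristics j T0.
have hx := ae_of_snd (initial_trace T0 lC hC).
apply: ae_mono2 hC (mpreserving_ae (mpreserving_sh (speed j)) hx) => p h1 h2 Tp.
by rewrite h1//; congr (_ + _); exact: h2.
Qed.

Let force_gauge j (y : I -> R) :
  y j * force lam kap j y + y (other j) * force lam kap (other j) y =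
  psign j * lam * (y j * y (cross j) - y (other j) * y (chir j)).
Proof.
by case: j => b1 b2; rewrite /force /other /cross /chir /psign /= !negbK; case: b2 => /=; ring.
Qed.

(* Along a characteristic the charge of one chirality grows at most by the
   integral of all charges, and these are dominated by integrable functions of
   the space variable alone. *)
Let essentially_bounded T : 0 < T -> exists2 B : R, 0 <= B &
  forall j, {ae mu2, forall p, slab T p -> `|fp j p| <= B}.
Proof.
move=> T0.
have /choice[A hA] : forall k, exists A : R -> R, L2i mu A /\
    {ae mu2, forall p, slab T p -> `|fp k p| <= A p.2}.
  move=> k; have [A LA hA] := H1_2_line_bound 0 T0 (hH k T0); exists A; split=> //.
  by apply: ae_mono hA => p; rewrite mul0r subr0.
pose S x := \sum_k A k x ^+ 2.
have mA k : measurable_fun (setT : set mR) (A k) by case: (hA k) => -[].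
have iS : mu.-integrable setT (EFin \o S).
  rewrite (_ : EFin \o S = (fun x => \sum_k (A k x ^+ 2)%:E)%E); last first.
    by apply/funext => x; rewrite /S /= sumEFin.
  by apply: integrable_sum => // k; case: (hA k) => -[].
have S0 x : 0 <= S x by apply: sumr_ge0 => k _; exact: sqr_ge0.
have mS : measurable_fun (setT : set mR) S.
  by apply: measurable_sum => k; exact: measurable_funX.
(* A bound for the charge of one chirality: its value in the data, and all that the mass term can
   add along a characteristic. *)
pose B2 := 2 * M ^+ 2 + `|lam| * \int[mu]_x S x.
have B20 : 0 <= B2.
  apply: addr_ge0; apply: mulr_ge0 => //; first exact: sqr_ge0.
  by apply: Rintegral_ge0 => x _; exact: S0.
exists (B2 + 1); first by lra.
move=> j; pose c : R := speed j.
have co : speed (other j) = c by [].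
pose kk i a s := tau T i (s, a - c * s).
have facts i : speed i = c -> {ae mu, forall a, {ae mu, forall t, slab T (t, a) ->
    fp i (t, a - c * t) = f0 i a + oint (kk i a) t}}.
  move=> ic; apply: (ae_section (Q := fun p => slab T p -> fp i (p.1, p.2 - c * p.1) = f0 i p.2 + oint (kk i p.2) p.1)).
  apply: ae_mono (mpreserving_ae (mpreserving_sh (- c)) (duhamel i T0)) => p hp Tp.
  have := hp Tp; rewrite /sh /= mulNr => ->; rewrite /free_wave VcE ic /= subrK; congr (_ + _).
have factA i : {ae mu, forall a, {ae mu, forall t, slab T (t, a) ->
    `|fp i (t, a - c * t)| <= A i (a - c * t)}}.
  apply: (ae_section (Q := fun p => slab T p -> `|fp i (p.1, p.2 - c * p.1)| <= A i (p.2 - c * p.1))).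
  have [_ hi] := hA i; apply: ae_mono (mpreserving_ae (mpreserving_sh (- c)) hi) => p hp Tp.
  by have := hp Tp; rewrite /sh /= mulNr.
have likk i : {ae mu, forall a, locint (kk i a)}.
  apply: ae_mono (locint2_section (locint2_sh (- c) (ltau i T0))) => a.
  by congr locint; apply/funext => s; rewrite /kk /sh /= mulNr.
have mc : mpreserving mu mu (fun s : mR => (0 - s : mR)) := mpreserving_reflect 0.
(* As the speed is $\pm1$, integration along a whole characteristic is integration over $x$. *)
have lineS a : (\int[mu]_s (S (a - c * s))%:E = \int[mu]_x (S x)%:E)%E.
  have mS' : measurable_fun (setT : set mR) (fun x => (S x)%:E) by apply/measurable_EFinP.
  rewrite /c /speed; case: ifP => _.
    rewrite -(mpreserving_ge0_integral (mpreserving_reflect a) measurableT mS'); last by move=> x; rewrite lee_fin.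
    by rewrite preimage_setT; apply: eq_integral => s _; rewrite mul1r.
  rewrite -(mpreserving_ge0_integral (mpreserving_translate a) measurableT mS'); last by move=> x; rewrite lee_fin.
  by rewrite preimage_setT; apply: eq_integral => s _; rewrite mulN1r opprK addrC.
have key : {ae mu, forall a, {ae mu, forall t, slab T (t, a) -> `|fp j (t, a - c * t)| <= B2 + 1}}.
  (* The null sets of the finitely many components are united through the enumeration of [I]. *)
  have aeA : {ae mu, forall a, forall i, {ae mu, forall t, slab T (t, a) ->
      `|fp i (t, a - c * t)| <= A i (a - c * t)}}.
    have h (n : nat) : {ae mu, forall a, forall i, unpickle n = Some i ->
        {ae mu, forall t, slab T (t, a) -> `|fp i (t, a - c * t)| <= A i (a - c * t)}}.
      case: (unpickle n : option I) => [i|]; last by apply: ae_all.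
      by apply: ae_mono (factA i) => a ha k [<-].
    by apply: ae_mono (ae_countable h) => a ha i; apply: (ha (pickle i)); exact: pickleK.
  have l1 := ae_mono2 (fun a h h' => conj h h') (likk j) (likk (other j)).
  have l2 := ae_mono2 (fun a h h' => conj h h') (facts j erefl) (facts (other j) co).
  have l3 := ae_mono2 (fun a h h' => conj h h') l1 l2.
  apply: ae_mono2 l3 aeA => a [[lj lo] [hj ho]] hAa.
  pose Gj t := f0 j a + oint (kk j a) t; pose Go t := f0 (other j) a + oint (kk (other j) a) t.
  have acG i : locint (kk i a) -> abscont (fun t => f0 i a + oint (kk i a) t) (kk i a).
    by move=> locint_i; split=> // x y xy; rewrite -(abscont_oint locint_i).2//; ring.
  pose y' s := kk j a s * Gj s + kk j a s * Gj s + (kk (other j) a s * Go s + kk (other j) a s * Go s).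
  have acY : abscont (fun t => Gj t * Gj t + Go t * Go t) y' :=
    abscontD (abscont_mul (acG j lj) (acG j lj)) (abscont_mul (acG _ lo) (acG _ lo)).
  have [my _] := acY.1.
  have hall : {ae mu, forall t, slab T (t, a) -> forall i, `|fp i (t, a - c * t)| <= A i (a - c * t)}.
    have h (n : nat) : {ae mu, forall t, forall i, unpickle n = Some i ->
        slab T (t, a) -> `|fp i (t, a - c * t)| <= A i (a - c * t)}.
      case: (unpickle n : option I) => [i|]; last by apply: ae_all.
      by apply: ae_mono (hAa i) => t ht k [<-].
    by apply: ae_mono (ae_countable h) => t ht Tt i; apply: (ht (pickle i)) => //; exact: pickleK.
  (* The density of the charge along the characteristic: the gauge identity removes the cubic term,
     and the sum of the squared majorants controls the rest. *)
  have yb : {ae mu, forall s, slab T (s, a) -> `|y' s| <= `|lam| * S (a - c * s)}.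
    apply: ae_mono2 (ae_mono2 (fun t h h' => conj h h') hj ho) hall => s [h1 h2] h3 Ts.
    have e1 := h1 Ts; have e2 := h2 Ts; have e3 := h3 Ts.
    pose q : P := (s, a - c * s).
    have kE i : kk i a s = force lam kap i (fun k => fp k q).
      by rewrite /kk /tau patchE mem_set.
    rewrite /y' /Gj /Go -e1 -e2 !kE -/q.
    have -> : force lam kap j (fun k => fp k q) * fp j q + force lam kap j (fun k => fp k q) * fp j q +
       (force lam kap (other j) (fun k => fp k q) * fp (other j) q +
        force lam kap (other j) (fun k => fp k q) * fp (other j) q) =
       2 * (psign j * lam * (fp j q * fp (cross j) q - fp (other j) q * fp (chir j) q)).
      rewrite -(force_gauge j (fun k => fp k q)); ring.
    rewrite 2!normrM (normrM _ lam) (_ : `|psign j| = 1) ?mul1r; last first.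
      by rewrite /psign; case: ifP; rewrite ?normrN normr1.
    rewrite (ger0_norm (x := 2))// mulrCA ler_wpM2l//.
    apply: (@le_trans _ _ (\sum_k fp k q ^+ 2)); last first.
      apply: ler_sum => k _; rewrite -[fp k q ^+ 2]real_normK ?num_real// lerXn2r ?nnegrE//.
      exact: le_trans (normr_ge0 _) (e3 k).
    have -> : \sum_k fp k q ^+ 2 = fp j q ^+ 2 + fp (other j) q ^+ 2 + (fp (cross j) q ^+ 2 + fp (chir j) q ^+ 2).
      rewrite (eq_bigr (fun k : I => fp (k.1, k.2) q ^+ 2)); last by case.
      rewrite -(pair_bigA _ (fun b1 b2 : bool => fp (b1, b2) q ^+ 2)) /= !big_bool /=.
      by case: (j) => -[] [] /=; rewrite /other /cross /chir /=; ring.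
    have q1 := addr_ge0 (sqr_ge0 (fp j q - fp (cross j) q)) (sqr_ge0 (fp (other j) q + fp (chir j) q)).
    have q2 := addr_ge0 (sqr_ge0 (fp j q + fp (cross j) q)) (sqr_ge0 (fp (other j) q - fp (chir j) q)).
    by rewrite -ler_pdivlMl// ler_norml; apply/andP; split; nra.
  apply: ae_mono hj => t ht Tt; rewrite ht//.
  have yt : `|oint y' t| <= `|lam| * \int[mu]_x S x.
    rewrite -lee_fin; apply: le_trans (oint_bound t my) _.
    have mline : measurable_fun (setT : set mR) (fun s => (`|lam| * S (a - c * s))%:E).
      apply/measurable_EFinP; apply: measurable_funM => //; apply: (measurableT_comp mS).
      by apply: measurable_funB => //; exact: measurable_funM.
    have ms := @measurable_seg R t.
    apply: (@le_trans _ _ (\int[mu]_(s in seg t) (`|lam| * S (a - c * s))%:E)%E).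
      apply: ae_ge0_le_integral => //.
      - by apply/measurable_EFinP; apply: measurable_funTS; exact: measurableT_comp.
      - by move=> s _; rewrite lee_fin mulr_ge0.
      - exact: measurable_funTS.
      - apply: ae_mono yb => s hs st; rewrite lee_fin; apply: hs.
        rewrite /slab /= -ltr_norml; apply: le_lt_trans (seg_norm st) _; rewrite ltr_norml; exact: Tt.
    apply: (@le_trans _ _ (\int[mu]_s (`|lam| * S (a - c * s))%:E)%E).
      by apply: ge0_subset_integral => // s _; rewrite lee_fin mulr_ge0.
    under eq_integral => s _ do rewrite EFinM.
    rewrite ge0_integralZl_EFin//; last 2 first.
    - by move=> s _; rewrite lee_fin.
    - apply/measurable_EFinP; apply: (measurableT_comp mS).
      by apply: measurable_funB => //; exact: measurable_funM.
    rewrite lineS EFinM /Rintegral fineK//; exact: integrable_fin_num iS.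
  have := abscont_ointE t acY; rewrite /Gj /Go !oint0 !addr0 => Yt.
  have hd i : f0 i a * f0 i a <= M ^+ 2.
    rewrite -expr2 -[f0 i a ^+ 2]real_normK ?num_real// lerXn2r ?nnegrE//.
    exact: le_trans (normr_ge0 _) (dM i a).
  set z := f0 j a + oint (kk j a) t in Yt *; set z' := f0 (other j) a + _ in Yt.
  have zB : z * z <= B2.
    have := hd j; have := hd (other j); have := sqr_ge0 z'; rewrite expr2.
    move: yt Yt; rewrite ler_norml /B2 => /andP[_ ].
    move: (z * z) (z' * z') (oint y' t) (`|lam| * _) (f0 j a * _) (f0 (other j) a * _) (M ^+ 2).
    by move=> x1 x2 x3 x4 x5 x6 x7; lra.
  (* From $z^2\le B_2$ one has $|z|\le B_2+1$ without a square root. *)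
  move: zB; clearbody z; move: (B2) B20 => b b0 zb.
  by rewrite ler_norml; apply/andP; split; nra.
apply: ae_mono (mpreserving_ae (mpreserving_sh c) (_ : {ae mu2, forall p : P, slab T p -> `|fp j (sh (- c) p)| <= B2 + 1})).
  by move=> p hp Tp; have := hp Tp; rewrite shK.
apply: (@ae_section_inv _ _ (slab T `&` [set p | B2 + 1 < `|fp j (sh (- c) p)|])).
- apply: measurableI; first exact: measurable_slab.
  have mn : measurable_fun setT (fun p => `|fp j (sh (- c) p)|).
    by apply: measurableT_comp => //; exact: (measurableT_comp (mfp j) (measurable_sh (- c))).
  rewrite (_ : [set p | _] = (fun p => `|fp j (sh (- c) p)|) @^-1` `]B2 + 1, +oo[%classic).
    by rewrite -[X in measurable X]setTI; apply: mn => //; exact: measurable_itv.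
  by apply/seteqP; split=> p /=; rewrite in_itv/= andbT.
- by move=> p np Tp; rewrite leNgt; apply/negP => h; exact: np.
apply: ae_mono key => a ha; apply: ae_mono ha => t ht [Tt] /=; rewrite /sh /= mulNr.
by apply/negP; rewrite -leNgt; exact: ht.
Qed.

(** Both solutions obey Duhamel's formula with the same data, so their difference satisfies a
    Volterra inequality with source 0, and [wnorm_gronwall] makes it vanish on each slab. *)
Lemma real_system_unique j : {ae mu2, forall p, fp j p = f j p}.
Proof.
apply: (@ae_natP _ _ _ mu2 fst) => T.
have [T0|T0] := ltP 0 T; last first.
  by apply: ae_all => p pT; have := lt_le_trans (le_lt_trans (normr_ge0 _) pT) T0; rewrite ltxx.
have [B B0 hB] := essentially_bounded T0.
pose E k : set P := slab T `&` [set p | `|fp k p| <= B].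
have mE k : measurable (E k).
  apply: measurableI; first exact: measurable_slab.
  have mn : measurable_fun setT (fun p => `|fp k p|) by exact: measurableT_comp.
  rewrite (_ : [set p | _] = (fun p => `|fp k p|) @^-1` `]-oo, B]%classic).
    by rewrite -[X in measurable X]setTI; apply: mn => //; exact: measurable_itv.
  by apply/seteqP; split=> p /=; rewrite in_itv.
(* Set to 0 where it exceeds its essential bound, the solution is bounded everywhere while it
   changes on a null set of the slab only; the pointwise estimates for [Vc] and the force then
   apply. *)
pose fq k := fp k \_ (E k).
have mfq k : measurable_fun setT (fq k).
  by apply/(measurable_restrictT _ (mE k)); exact: measurable_funTS.
have fqB k p : `|fq k p| <= B.
  rewrite /fq patchE; case: ifP => [|_]; last by rewrite normr0.
  by move=> /set_mem[].
have bq k : slab_bounded (fq k) by split=> // T'; exists B => p _.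
have fqE : {ae mu2, forall p, slab T p -> forall k, fq k p = fp k p}.
  have h (n : nat) : {ae mu2, forall p, forall k, unpickle n = Some k -> slab T p -> fq k p = fp k p}.
    case: (unpickle n : option I) => [i|]; last by apply: ae_all.
    by apply: ae_mono (hB i) => p hp k [<-] Tp; rewrite /fq patchE mem_set//; split=> //; exact: hp.
  by apply: ae_mono (ae_countable h) => p hp Tp k; apply: (hp (pickle k)) => //; exact: pickleK.
pose Fq k q : R := force lam kap k (fun i => fq i q).
pose Ff k q : R := force lam kap k (fun i => f i q).
have bFq k : slab_bounded (Fq k) by exact: slab_bounded_force.
have bFf k : slab_bounded (Ff k) by exact: slab_bounded_force.
pose w k (p : P) := fq k p - f k p.
have [D D0 hD] := slab_bounded_family bf T.
pose N := B + D; set K := trunc_lip lam kap (2 * N).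
have mf k : measurable_fun setT (f k) by case: (bf k).
have mw k : measurable_fun setT (w k) by exact: measurable_funB.
have bw k : slab_bounded (w k).
  split=> // T'; have [D' _ hD'] := slab_bounded_family bf T'; exists (B + D') => p pT.
  by apply: (le_trans (ler_normB _ _)); apply: lerD => //; exact: hD'.
have hw k : {ae mu2, forall p, slab T p ->
    `|w k p| <= `|(fun=> 0 : R) p| + `|Vc (speed k) (fun q => K * \sum_i `|w i q|) p|}.
  have hV : {ae mu2, forall p, slab T p -> Vc (speed k) (tau T k) p = Vc (speed k) (Fq k) p}.
    apply: Vc_ae; [by case: (ltau k T0)|by case: (bFq k)|].
    apply: ae_mono fqE => p hp Tp; rewrite /tau patchE mem_set// /Fq.
    by congr (force _ _ _ _); apply/funext => i; rewrite hp.
  apply: ae_mono2 (ae_mono2 (fun p h h' => conj h h') fqE hV) (duhamel k T0) => p [h1 h2] h3 Tp.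
  have pT : `|p.1| <= T by apply: ltW; rewrite ltr_norml.
  rewrite normr0 add0r /w h1// h3// h2// fE -/(Ff k).
  have -> : free_wave speed f0 k p + Vc (speed k) (Fq k) p - (free_wave speed f0 k p + Vc (speed k) (Ff k) p) =
     Vc (speed k) (fun q => Fq k q - Ff k q) p by rewrite VcB//; ring.
  apply: le_Vc; last first.
  - move=> q qp; have qT := le_trans qp pT; apply: force_lipschitz.
    + exact: addr_ge0.
    + by move=> i; apply: (le_trans (fqB i q)); rewrite lerDl.
    + by move=> i; apply: (le_trans (hD i q qT)); rewrite lerDr.
  - exact: slab_bounded_sum_norm.
  - have [m1 b1] := bFq k; have [m2 b2] := bFf k; split; first exact: measurable_funB.
    move=> T'; have [D1 h1'] := b1 T'; have [D2 h2'] := b2 T'; exists (D1 + D2) => q qT.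
    by apply: (le_trans (ler_normB _ _)); apply: lerD; [exact: h1'|exact: h2'].
have wfin k : (wnorm 0 T (w k) < +oo)%E.
  have -> : w k = (fun p => fq k p + (-1) * f k p) by apply/funext => p; rewrite mulN1r.
  apply: le_lt_trans (wnormD _ _ _ _) _ => //; first exact: measurable_funM.
  rewrite wnormZ//; apply: lte_add_pinfty; apply: lte_mul_pinfty; rewrite ?lee_fin//; last first.
    by apply: lte_mul_pinfty; rewrite ?lee_fin ?sqr_ge0//; exact: ffin.
  have [Lfp _] := H1_2_direction 0 (hH k T0).
  apply: (@le_lt_trans _ _ (wnorm 0 T (fp k))).
    apply: ae_le_wnorm => //; apply: ae_all => p _; rewrite /fq patchE.
    by case: ifP => //; rewrite normr0.
  by rewrite wnorm_patch; exact: L2i_lty.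
have := wnorm_gronwall (c := speed) (K := K) (r := fun _ _ => 0) T0 mw (fun k => measurable_cst _) hw wfin.
have z : wnorm 0 T (fun=> 0 : R) = 0%E.
  by apply: integral0_eq => p _; rewrite expr0n mulr0.
rewrite [X in (_ <= _ * X)%E]big1 ?mule0; last by move=> k _.
move=> le0; have w0 : wnorm 0 T (w j) = 0%E.
  apply/eqP; rewrite eq_le wnorm_ge0 andbT; apply: le_trans le0.
  by rewrite (bigD1 j)//= leeDl// sume_ge0// => k _; exact: wnorm_ge0.
have mp : measurable_fun setT (w j \_ (slab T)).
  by apply/(measurable_restrictT _ (measurable_slab T)); exact: measurable_funTS.
have mp2 : measurable_fun setT (fun p => (((w j \_ (slab T)) p) ^+ 2)%:E).
  by apply/measurable_EFinP; exact: measurable_funX.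
have : (\int[mu2]_p `|(((w j \_ (slab T)) p) ^+ 2)%:E| = 0)%E.
  under eq_integral => p _ do rewrite gee0_abs ?lee_fin ?sqr_ge0//.
  by rewrite -wnorm_patch.
move=> /(ae_eq_integral_abs mu2 measurableT mp2).1 h.
apply: ae_mono2 h fqE => p /(_ Logic.I) [] /eqP; rewrite sqrf_eq0 patchE => wp hp pT.
have Tp : slab T p by rewrite /slab /= -ltr_norml.
by move: wp; rewrite mem_set// /w hp// subr_eq0 => /eqP.
Qed.

End Uniqueness.

(** * Spinors in a chiral frame *)

Section ChiralFrame.
Context {R : realType} (S : spinorStructure R).
Local Open Scope complex_scope.
Notation C := R[i].
Notation I := (bool * bool)%type.
Notation gt := (cmul S dt).
Notation gx := (cmul S dx).
Implicit Types (xi psi chi : spinor R) (a : C).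

Lemma cmulD X xi psi : cmul S X (xi + psi) = cmul S X xi + cmul S X psi.
Proof. by have := cmul_linear S X 1 xi psi; rewrite !scale1r. Qed.

Lemma cmul0 X : cmul S X 0 = 0.
Proof. by have /eqP := cmulD X 0 0; rewrite addr0 -subr_eq0 opprD addNKr oppr_eq0 => /eqP. Qed.

Lemma cmulZ X a xi : cmul S X (a *: xi) = a *: cmul S X xi.
Proof. by have := cmul_linear S X a xi 0; rewrite !addr0 cmul0 addr0. Qed.

Lemma cmulN X xi : cmul S X (- xi) = - cmul S X xi.
Proof. by rewrite -scaleN1r cmulZ scaleN1r. Qed.

Lemma sprodDl xi psi chi : sprod S (xi + psi) chi = sprod S xi chi + sprod S psi chi.
Proof. by have := sprod_linear S 1 xi psi chi; rewrite scale1r mul1r. Qed.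

Lemma sprod0l chi : sprod S 0 chi = 0.
Proof. by have /eqP := sprodDl 0 0 chi; rewrite addr0 -subr_eq0 opprD addNKr oppr_eq0 => /eqP. Qed.

Lemma sprodZl a xi chi : sprod S (a *: xi) chi = a * sprod S xi chi.
Proof. by have := sprod_linear S a xi 0 chi; rewrite addr0 sprod0l addr0. Qed.

Lemma sprodNl xi chi : sprod S (- xi) chi = - sprod S xi chi.
Proof. by rewrite -scaleN1r sprodZl mulN1r. Qed.

Lemma sprodDr xi psi chi : sprod S chi (xi + psi) = sprod S chi xi + sprod S chi psi.
Proof. by rewrite sprod_herm sprodDl rmorphD /= -!sprod_herm. Qed.

Lemma sprodZr a xi chi : sprod S chi (a *: xi) = a^* * sprod S chi xi.
Proof. by rewrite sprod_herm sprodZl rmorphM /= -sprod_herm. Qed.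

Let two_inj (x y : spinor R) : x + x = y + y -> x = y.
Proof.
move=> h; apply: (scalerI (a := 2%:R : C)); first by rewrite pnatr_eq0.
by rewrite !scaler_nat !mulr2n.
Qed.

Lemma cmul_dt_dt psi : gt (gt psi) = psi.
Proof.
apply: two_inj; rewrite cmul_clifford /lorentz /= !mulr1 mulr0 subr0.
have -> : psi + psi = (2%:R : C) *: psi by rewrite scaler_nat mulr2n.
congr (_ *: _).
by apply/eqP; rewrite eq_complex /=; apply/andP; split; apply/eqP; ring.
Qed.

Lemma cmul_dx_dx psi : gx (gx psi) = - psi.
Proof.
apply: two_inj; rewrite cmul_clifford /lorentz /= !mulr1 mulr0 sub0r.
have -> : - psi + - psi = (- 2%:R : C) *: psi by rewrite scaleNr scaler_nat mulr2n opprD.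
congr (_ *: _); rewrite mulrN1.
by apply/eqP; rewrite eq_complex /= addr0 oppr0 !eqxx.
Qed.

Lemma cmul_dt_dx psi : gt (gx psi) = - gx (gt psi).
Proof.
apply/eqP; rewrite -addr_eq0 cmul_clifford /lorentz /= mul0r mulr0 subr0 mulr0.
by rewrite (_ : 0%:C = 0) ?scale0r.
Qed.

(* Eigenvectors of the chirality operator dt.dx., exchanged by dt. *)
Lemma chiral_frame : exists (ep em : spinor R) (n : R),
  [/\ 0 < n, gt ep = em, gx ep = em, gt em = ep & gx em = - ep] /\
  [/\ sprod S ep ep = 0, sprod S em em = 0, sprod S ep em = n%:C & sprod S em ep = n%:C].
Proof.
pose xi : spinor R := const_mx 1.
have xi0 : xi != 0.
  by apply/eqP => /matrixP /(_ 0 0); rewrite !mxE => /eqP; rewrite oner_eq0.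
(* The chirality operator is an involution, so adding to [xi] its image projects onto the eigenvalue
   1. If the result is 0, then [xi] has eigenvalue $-1$, and multiplication by [dt], which
   anticommutes with the operator, changes the sign. *)
have [ep ep0 hep] : exists2 ep, ep != 0 & gt (gx ep) = ep.
  have [h|h] := eqVneq (xi + gt (gx xi)) 0; last first.
    exists (xi + gt (gx xi)) => //; rewrite !cmulD.
    rewrite [X in _ + X](_ : _ = xi); first by rewrite addrC.
    have -> : gx (gt (gx xi)) = gt xi.
      by rewrite -[LHS]opprK -cmul_dt_dx cmul_dx_dx cmulN opprK.
    by rewrite cmul_dt_dt.
  exists (gt xi).
    by apply/eqP => g0; move/eqP: xi0; apply; rewrite -[xi]cmul_dt_dt g0 cmul0.
  have e : gx xi = - gt xi.
    rewrite -[LHS]cmul_dt_dt; move/eqP: h; rewrite addrC addr_eq0 => /eqP ->.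
    by rewrite cmulN.
  by rewrite -[gx (gt xi)]opprK -cmul_dt_dx cmulN cmul_dt_dt e opprK.
pose em := gt ep.
have e1 : gx ep = em by rewrite -[LHS]cmul_dt_dt hep.
have e2 : gt em = ep by exact: cmul_dt_dt.
have e3 : gx em = - ep by rewrite /em -[LHS]opprK -cmul_dt_dx hep.
have pos := sprod_dt_gt0 S ep0; rewrite -/em in pos.
pose n := complex.Re (sprod S em ep).
have nE : sprod S em ep = n%:C.
  move: pos; rewrite ltcE /= => /andP[/eqP im _].
  by apply/eqP; rewrite eq_complex /= im !eqxx.
have n0 : 0 < n by move: pos; rewrite ltcE => /andP[].
(* Symmetry of [dt] makes the two squares equal and symmetry of [dx] makes them opposite, so both
   eigenvectors are null. *)
have s1 : sprod S ep ep = sprod S em em by rewrite -{1}e2 cmul_sym.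
have s2 : - sprod S ep ep = sprod S em em by rewrite -sprodNl -e3 cmul_sym e1.
have s0 : sprod S ep ep = 0.
  have /eqP : sprod S ep ep + sprod S ep ep = 0 by rewrite {2}s1 -s2 subrr.
  by rewrite -mulr2n mulrn_eq0 => /eqP.
exists ep, em, n; split; split=> //; first by rewrite -s1.
by rewrite sprod_herm nE; apply/eqP; rewrite eq_complex /= oppr0 !eqxx.
Qed.

Section Coordinates.
Context (ep em : spinor R) (n : R).
Hypothesis n0 : 0 < n.
Hypothesis gt_ep : gt ep = em.
Hypothesis gx_ep : gx ep = em.
Hypothesis gt_em : gt em = ep.
Hypothesis gx_em : gx em = - ep.
Hypothesis sp_pp : sprod S ep ep = 0.
Hypothesis sp_mm : sprod S em em = 0.
Hypothesis sp_pm : sprod S ep em = n%:C.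
Hypothesis sp_mp : sprod S em ep = n%:C.

Let nC0 : n%:C != 0.
Proof. by rewrite eq_complex /= eqxx andbT gt_eqF. Qed.

(** As [ep] and [em] are null vectors, the coefficient along one of them is the scalar product with
    the other, divided by [n]. *)
Definition coord (j : I) psi : R :=
  if j.2 then complex.Im (sprod S psi (if j.1 then em else ep) / n%:C)
  else complex.Re (sprod S psi (if j.1 then em else ep) / n%:C).

Definition spinor_of (y : I -> R) : spinor R :=
  (y (true, false) +i* y (true, true)) *: ep +
  (y (false, false) +i* y (false, true)) *: em.

Lemma coord_spinor_of y j : coord j (spinor_of y) = y j.
Proof.
by case: j => [[] []]; rewrite /coord /spinor_of /= sprodDl !sprodZl
  ?sp_pp ?sp_mm ?sp_pm ?sp_mp mulr0 ?addr0 ?add0r mulfK.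
Qed.

(** Pairing a vanishing combination of [ep] and [em] with either vector isolates one coefficient;
    they are therefore independent, hence a basis of $\mathbb{C}^2$. *)
Lemma spinor_ofK psi : spinor_of (coord ^~ psi) = psi.
Proof.
pose B : 'M[C]_2 := \matrix_(i, j) (if i == 0 then ep j 0 else em j 0).
have dB : \det B != 0.
  apply/negP => /det0P [v v0 vB].
  have e : v 0 0 *: ep + v 0 1 *: em = 0.
    apply/matrixP => i j; rewrite ord1 !mxE; move/matrixP: vB => /(_ 0 i).
    rewrite !mxE big_ord_recl big_ord1 !mxE /= (_ : lift ord0 ord0 = 1) //.
    exact: val_inj.
  have e0 : v 0 0 = 0.
    have := congr1 (sprod S ^~ em) e; rewrite sprodDl !sprodZl sp_mm sp_pm sprod0l mulr0 addr0.
    by move/eqP; rewrite mulf_eq0 (negPf nC0) orbF => /eqP.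
  have e1 : v 0 1 = 0.
    have := congr1 (sprod S ^~ ep) e; rewrite sprodDl !sprodZl sp_mp sp_pp sprod0l mulr0 add0r.
    by move/eqP; rewrite mulf_eq0 (negPf nC0) orbF => /eqP.
  move/eqP: v0; apply; apply/matrixP => i j; rewrite ord1 mxE.
  case: j => -[|[|//]] hj.
    by rewrite (_ : Ordinal hj = 0) //; apply: val_inj.
  by rewrite (_ : Ordinal hj = 1) //; apply: val_inj.
have uB : B \in unitmx by rewrite unitmxE unitfE.
pose v := psi^T *m invmx B.
have e : psi = v 0 0 *: ep + v 0 1 *: em.
  have := mulmxKV uB psi^T; rewrite -/v => /matrixP h.
  apply/matrixP => i j; rewrite ord1; have := h 0 i; rewrite !mxE => <-.
  rewrite big_ord_recl big_ord1 !mxE /= (_ : lift ord0 ord0 = 1) //.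
  exact: val_inj.
pose y (j : I) := if j.1 then (if j.2 then complex.Im (v 0 0) else complex.Re (v 0 0))
  else (if j.2 then complex.Im (v 0 1) else complex.Re (v 0 1)).
have -> : psi = spinor_of y.
  by rewrite e /spinor_of /y /=; case: (v 0 0) (v 0 1) => a b [c d].
by congr spinor_of; apply/funext => j; exact: coord_spinor_of.
Qed.

Lemma coordD psi chi j : coord j (psi + chi) = coord j psi + coord j chi.
Proof. by rewrite /coord sprodDl mulrDl; case: j.2; rewrite raddfD. Qed.

Lemma coordZ (k : R) psi j : coord j (k%:C *: psi) = k * coord j psi.
Proof.
rewrite /coord sprodZl -mulrA; case: (_ / n%:C) => a b.
by case: j.2 => /=; rewrite mul0r ?subr0 ?addr0.
Qed.

Lemma coordB psi chi j : coord j (psi - chi) = coord j psi - coord j chi.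
Proof.
rewrite coordD; congr (_ + _); rewrite -[RHS]mulN1r -coordZ; congr coord.
rewrite -scaleN1r; congr (_ *: _).
by apply/eqP; rewrite eq_complex /= oppr0 !eqxx.
Qed.

Let expand psi : exists y, psi = spinor_of y.
Proof. by exists (coord ^~ psi); rewrite spinor_ofK. Qed.

Let sprod_frame a b a' b' : sprod S (a *: ep + b *: em) (a' *: ep + b' *: em) =
  n%:C * (a * b'^* + b * a'^*).
Proof. by rewrite sprodDl !sprodZl !sprodDr !sprodZr sp_pp sp_mm sp_pm sp_mp; ring. Qed.

Lemma betanorm2_coord psi : betanorm2 S psi = n * \sum_j coord j psi ^+ 2.
Proof.
rewrite (eq_bigr (fun k : I => coord (k.1, k.2) psi ^+ 2)); last by case.
rewrite -(pair_bigA _ (fun b1 b2 : bool => coord (b1, b2) psi ^+ 2)) /= !big_bool /=.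
have [y ->] := expand psi; rewrite !coord_spinor_of /betanorm2 /spinor_of.
rewrite cmulD !cmulZ gt_ep gt_em !sprodDl !sprodZl !sprodDr !sprodZr sp_pp sp_mm sp_pm sp_mp /=.
ring.
Qed.

(** For [alpha] and [beta] the derivatives of a spinor field in $t$ and $x$, the number [a j] is the
    derivative of its coordinate in the characteristic direction $(1,-\mathrm{speed}\,j)$. *)
Lemma sprod_dirac psi alpha beta :
  let a j := coord j alpha - speed j * coord j beta in let y j := coord j psi in
  sprod S psi ('i%C *: (gt alpha - gx beta)) =
  (n * (y (true, true) * a (true, false) - y (true, false) * a (true, true) +
        (y (false, true) * a (false, false) - y (false, false) * a (false, true)))) +i*
  (- (n * (y (true, false) * a (true, false) + y (true, true) * a (true, true) +
        (y (false, false) * a (false, false) + y (false, true) * a (false, true))))).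
Proof.
have [y ->] := expand psi; have [u ->] := expand alpha; have [v ->] := expand beta.
move=> a y'; have aE j : a j = u j - speed j * v j by rewrite /a (coord_spinor_of u) (coord_spinor_of v).
have yE j : y' j = y j by exact: coord_spinor_of.
move: a y' aE yE => a y' aE yE; rewrite !aE !yE /speed /=.
have -> : gt (spinor_of u) - gx (spinor_of v) =
    (u (false, false) +i* u (false, true) + (v (false, false) +i* v (false, true))) *: ep +
    (u (true, false) +i* u (true, true) - (v (true, false) +i* v (true, true))) *: em.
  rewrite /spinor_of !cmulD !cmulZ gt_ep gt_em gx_ep gx_em.
  by apply/matrixP => k l; rewrite !mxE; ring.
rewrite scalerDr !scalerA sprod_frame.
by apply/eqP; rewrite eq_complex /=; apply/andP; split; apply/eqP; ring.
Qed.

(** The two scalar products in the cubic term are $n(|u|^2\pm|v|^2)$; their sum and difference leave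
    $2n|u|^2$ and $2n|v|^2$, whence the coupling constant $2\kappa n$. *)
Lemma sprod_rhs (lambda kappa : R) psi chi :
  let F j := force lambda (2 * kappa * n) j (coord ^~ psi) in let c j := coord j chi in
  sprod S (thirring_rhs S lambda kappa psi) chi =
  (n * (- (F (true, true) * c (true, false)) + F (true, false) * c (true, true) +
        (- (F (false, true) * c (false, false)) + F (false, false) * c (false, true)))) +i*
  (n * (F (true, false) * c (true, false) + F (true, true) * c (true, true) +
        (F (false, false) * c (false, false) + F (false, true) * c (false, true)))).
Proof.
have [y ->] := expand psi; have [z ->] := expand chi.
have yE : coord ^~ (spinor_of y) = y by apply/funext => j; exact: coord_spinor_of.
move=> F c; have cE j : c j = z j by exact: coord_spinor_of.
move: c cE => c cE; rewrite /F yE !cE /force /psign /cross /chir /other /= /thirring_rhs.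
have gtE : gt (spinor_of y) = (y (false, false) +i* y (false, true)) *: ep +
    (y (true, false) +i* y (true, true)) *: em.
  by rewrite /spinor_of cmulD !cmulZ gt_ep gt_em addrC.
have gxE : gx (spinor_of y) = (- (y (false, false) +i* y (false, true))) *: ep +
    (y (true, false) +i* y (true, true)) *: em.
  by rewrite /spinor_of cmulD !cmulZ gx_ep gx_em addrC scalerN scaleNr.
rewrite gtE gxE /spinor_of !sprod_frame.
set a := y _ +i* y _; set b := y _ +i* y _; set k1 := _ * _; set k2 := _ * _.
rewrite [X in sprod S X _](_ : _ = (lambda%:C * a + kappa%:C * (k1 + k2) * b) *: ep +
   (lambda%:C * b + kappa%:C * (k1 - k2) * a) *: em); last first.
  by apply/matrixP => i j; rewrite !mxE; ring.
rewrite sprod_frame /k1 /k2.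
have -> : kappa%:C * (n%:C * (a * a^* + b * b^*) + n%:C * (a * a^* + b * (- b)^*)) =
    (2 * kappa * n * (y (true, false) ^+ 2 + y (true, true) ^+ 2))%:C.
  by apply/eqP; rewrite eq_complex /=; apply/andP; split; apply/eqP; ring.
have -> : kappa%:C * (n%:C * (a * a^* + b * b^*) - n%:C * (a * a^* + b * (- b)^*)) =
    (2 * kappa * n * (y (false, false) ^+ 2 + y (false, true) ^+ 2))%:C.
  by apply/eqP; rewrite eq_complex /=; apply/andP; split; apply/eqP; ring.
by apply/eqP; rewrite eq_complex /=; apply/andP; split; apply/eqP; ring.
Qed.

End Coordinates.

End ChiralFrame.

(** * Classes of functions stable under real linear combinations *)

Section LinearClasses.
Context {R : realType}.

Section Sums.
Context {V : Type} (Pr : (V -> R) -> Prop).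
Hypothesis Pr0 : Pr (fun=> 0).
Hypothesis PrD : forall f g k, Pr f -> Pr g -> Pr (fun x => f x + k * g x).

Lemma linear_class_sum (J : Type) (s : seq J) (c : J -> R) (f : J -> V -> R) :
  (forall i, Pr (f i)) -> Pr (fun x => \sum_(i <- s) c i * f i x).
Proof.
move=> Pf; elim: s => [|i s IH].
  by rewrite (_ : (fun x => _) = fun=> 0)//; apply/funext => x; rewrite big_nil.
rewrite (_ : (fun x => _) = (fun x => (\sum_(i <- s) c i * f i x) + c i * f i x)); first exact: PrD.
by apply/funext => x; rewrite big_cons addrC.
Qed.

End Sums.

Lemma derive_lincomb {V : normedModType R} (J : Type) (s : seq J) (c : J -> R)
    (f : J -> V -> R) (v x : V) : (forall i, differentiable (f i) x) ->
  'D_v (fun y => \sum_(i <- s) c i * f i y) x = \sum_(i <- s) c i * 'D_v (f i) x.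
Proof.
move=> df; have ds : forall s : seq J, differentiable (fun y => \sum_(i <- s) c i * f i y) x.
  elim=> [|i s' IH].
    rewrite (_ : (fun y => _) = fun=> 0); first exact: differentiable_cst.
    by apply/funext => y; rewrite big_nil.
  rewrite (_ : (fun y => _) = (fun y => (\sum_(i <- s') c i * f i y) + c i * f i y)).
    by apply: differentiableD => //; exact: differentiableZ.
  by apply/funext => y; rewrite big_cons addrC.
elim: s => [|i s IH].
  rewrite big_nil (_ : (fun y => _) = fun=> 0); first by rewrite derive_cst.
  by apply/funext => y; rewrite big_nil.
rewrite big_cons -IH addrC -derive_combine//; congr ('D_v _ x).
by apply/funext => y; rewrite big_cons addrC.
Qed.

Notation mu := (@lebesgue_measure R).
Notation mR := (measurableTypeR R).
Notation mu2 := (leb2 R).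
Notation P := (mR * mR)%type.

Lemma patch_combine (X : Type) (U : set X) (f g : X -> R) (k : R) :
  (fun x => f x + k * g x) \_ U = (fun x => (f \_ U) x + k * (g \_ U) x).
Proof.
apply/funext => x; rewrite !patchE; case: ifP => // _.
by rewrite -[point]/(0 : R) mulr0 addr0.
Qed.

Lemma H1_2_combine T (f g : P -> R) k : H1_2 (slab T) f -> H1_2 (slab T) g ->
  H1_2 (slab T) (fun p => f p + k * g p).
Proof.
move=> [/L2iP Lf hf] [/L2iP Lg hg]; split.
  by apply/L2iP; rewrite patch_combine; exact: L2iD.
have intE (u : P -> R) (psi : R * R -> R) : test_function (slab T) psi ->
    \int[mu2]_(p in slab T) (u p * psi p) = \int[mu2]_p ((u \_ (slab T)) p * psi p).
  by move=> ts; rewrite (Rintegral_test _ ts) Rintegral_patch_test.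
have lin (u w : P -> R) (psi : R * R -> R) : L2i mu2 (u \_ (slab T)) -> L2i mu2 (w \_ (slab T)) ->
    test_function (slab T) psi ->
    \int[mu2]_(p in slab T) ((u p + k * w p) * psi p) =
    \int[mu2]_(p in slab T) (u p * psi p) + k * \int[mu2]_(p in slab T) (w p * psi p).
  move=> Lu Lw tp; rewrite (intE (fun p => u p + k * w p))// !intE// patch_combine.
  have Lp := test_function_L2i tp; have i1 := L2iM Lu Lp; have i2 := L2iM Lw Lp.
  rewrite -RintegralZl// -RintegralD//; last exact: intgZ.
  by apply: eq_Rintegral => p _; ring.
move=> v hv; have [gf Lgf wf] := hf v hv; have [gg Lgg wg] := hg v hv.
have Lgf' := (L2iP _ _).1 Lgf; have Lgg' := (L2iP _ _).1 Lgg.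
exists (fun p => gf p + k * gg p).
  by apply/L2iP; rewrite patch_combine; exact: L2iD.
move=> phi tp; have tD := test_function_derive v hausdorff_plane tp.
by rewrite !lin// wf// wg//; ring.
Qed.

(** The conclusion of [H1_1_abscont] as a class stable under linear combinations, which lets it pass
    from the components of a spinor to its chiral coordinates. *)
Definition H1_line (u : R -> R) : Prop := exists F g : R -> R,
  [/\ abscont F g, L2i mu F, L2i mu g, {ae mu, forall x, u x = F x} &
      exists M, forall x, `|F x| <= M].

Lemma H1_line0 : H1_line (fun=> 0).
Proof.
have L0 : L2i mu (fun=> 0 : R).
  split; first exact: measurable_cst.
  by rewrite (_ : EFin \o _ = cst 0%E); [exact: integrable0|apply/funext => x; rewrite /= expr0n].
exists (fun=> 0), (fun=> 0); split=> //.
- split; first exact: L2i_locint.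
  by move=> a b _; rewrite subrr /Rintegral integral0_eq.
- exact: ae_all.
- by exists 0 => x; rewrite normr0.
Qed.

Lemma H1_line_combine u w k : H1_line u -> H1_line w -> H1_line (fun x => u x + k * w x).
Proof.
move=> [F [f [aF LF Lf uF [M hM]]]] [G [g [aG LG Lg wG [N hN]]]].
exists (fun x => F x + k * G x), (fun x => f x + k * g x); split.
- by apply: abscontD => //; exact: abscontZ.
- exact: L2iD.
- exact: L2iD.
- by apply: ae_mono2 uF wG => x -> ->.
- exists (M + `|k| * N) => x; apply: (le_trans (ler_normD _ _)).
  by rewrite lerD// normrM ler_wpM2l.
Qed.

Lemma test_function_slab (phi : R * R -> R) : test_function setT phi ->
  exists2 T : R, 0 < T & test_function (slab T) phi.
Proof.
move=> tp; have [sp cK _] := tp; have [M [Mr MP]] := compact_bounded cK.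
exists (`|M| + 2); first by have := normr_ge0 M; lra.
split=> // p hp; have := MP (`|M| + 1) _ p hp; rewrite /= prod_normE.
have -> : M < `|M| + 1 by have := ler_norm M; lra.
by move=> /(_ isT); rewrite ge_max => /andP[h1 _]; rewrite /slab /= -ltr_norml; lra.
Qed.

End LinearClasses.

(** * Standard components and chiral coordinates *)

Section Components.
Context {R : realType} (S : spinorStructure R) (ep em : spinor R) (n : R).
Notation I := (bool * bool)%type.
Local Open Scope complex_scope.

Let basis_expand (psi : spinor R) : psi =
  \sum_(i : 'I_2) ((complex.Re (psi i 0))%:C *: delta_mx i 0 +
    (complex.Im (psi i 0))%:C *: ('i%C *: delta_mx i 0)).
Proof.
apply/matrixP => k l; rewrite ord1 summxE (bigD1 k)//= big1 ?addr0.
  rewrite !mxE !eqxx mulr1; case: (psi k 0) => a b.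
  by apply/eqP; rewrite eq_complex /=; apply/andP; split; apply/eqP; ring.
by move=> i ik; rewrite !mxE eq_sym (negPf ik) /= !mulr0 addr0.
Qed.

(** The coordinates are real-linear in the real and imaginary parts of the components. The factor
    [1 *] gives the sum the shape of the stability hypotheses. *)
Lemma coord_components j : exists al be : 'I_2 -> R, forall psi : spinor R,
  coord S ep em n j psi = \sum_(i <- index_enum 'I_2) al i * complex.Re (psi i 0) +
    1 * \sum_(i <- index_enum 'I_2) be i * complex.Im (psi i 0).
Proof.
exists (fun i => coord S ep em n j (delta_mx i 0)), (fun i => coord S ep em n j ('i%C *: delta_mx i 0)) => psi.
rewrite {1}(basis_expand psi) mul1r -big_split /=.
have c0 : coord S ep em n j 0 = 0.
  by have := coordZ S ep em n 0 0 j; rewrite scaler0 mul0r.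
rewrite (big_morph (coord S ep em n j) (fun x y => coordD S ep em n x y j) c0).
by apply: eq_bigr => i _; rewrite coordD !coordZ; ring.
Qed.

Lemma components_coord (V : normedModType R) (Pr : (V -> R) -> Prop) (psi : V -> spinor R) :
  Pr (fun=> 0) -> (forall f g k, Pr f -> Pr g -> Pr (fun x => f x + k * g x)) ->
  components Pr psi -> forall j, Pr (fun x => coord S ep em n j (psi x)).
Proof.
move=> Pr0 PrD cp j; have [al [be h]] := coord_components j.
rewrite (_ : (fun x => _) = (fun x => \sum_(i <- index_enum 'I_2) al i * complex.Re (psi x i 0) +
    1 * \sum_(i <- index_enum 'I_2) be i * complex.Im (psi x i 0))); last first.
  by apply/funext => x; rewrite h.
by apply: (PrD); apply: (linear_class_sum Pr0 PrD) => i; case: (cp i).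
Qed.

Lemma coord_components_of (V : normedModType R) (Pr : (V -> R) -> Prop) (y : I -> V -> R) :
  Pr (fun=> 0) -> (forall f g k, Pr f -> Pr g -> Pr (fun x => f x + k * g x)) ->
  (forall j, Pr (y j)) -> components Pr (fun x => spinor_of ep em (fun j => y j x)).
Proof.
move=> Pr0 PrD Py i.
pose cR (j : I) : R := if j.1 then (if j.2 then - complex.Im (ep i 0) else complex.Re (ep i 0))
  else (if j.2 then - complex.Im (em i 0) else complex.Re (em i 0)).
pose cI (j : I) : R := if j.1 then (if j.2 then complex.Re (ep i 0) else complex.Im (ep i 0))
  else (if j.2 then complex.Re (em i 0) else complex.Im (em i 0)).
have sumE (c : I -> R) (x : V) : \sum_(j <- index_enum I) c j * y j x =
   c (true, true) * y (true, true) x + c (true, false) * y (true, false) x +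
   (c (false, true) * y (false, true) x + c (false, false) * y (false, false) x).
  rewrite (eq_bigr (fun k : I => c (k.1, k.2) * y (k.1, k.2) x)); last by case.
  by rewrite -(pair_bigA _ (fun b1 b2 : bool => c (b1, b2) * y (b1, b2) x)) /= !big_bool.
split.
- rewrite (_ : (fun x => _) = (fun x => \sum_(j <- index_enum I) cR j * y j x)).
    exact: linear_class_sum.
  apply/funext => x; rewrite sumE /cR /spinor_of !mxE /=.
  by case: (ep i 0) (em i 0) => a b [c d] /=; ring.
- rewrite (_ : (fun x => _) = (fun x => \sum_(j <- index_enum I) cI j * y j x)).
    exact: linear_class_sum.
  apply/funext => x; rewrite sumE /cI /spinor_of !mxE /=.
  by case: (ep i 0) (em i 0) => a b [c d] /=; ring.
Qed.

Lemma coord_derive (V : normedModType R) U (eta : V -> spinor R) v x j :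
  components (test_function U) eta ->
  coord S ep em n j (spinor_derive v eta x) = 'D_v (fun y => coord S ep em n j (eta y)) x.
Proof.
move=> te; have [al [be h]] := coord_components j.
have dR i : differentiable (fun y => complex.Re (eta y i 0)) x.
  by apply: smooth_differentiable; case: (te i) => -[].
have dI i : differentiable (fun y => complex.Im (eta y i 0)) x.
  by apply: smooth_differentiable; case: (te i) => _ -[].
have dsum (c : 'I_2 -> R) (f : 'I_2 -> V -> R) : (forall i, differentiable (f i) x) ->
    differentiable (fun y => \sum_(i <- index_enum 'I_2) c i * f i y) x.
  move=> df; have d0 : differentiable (fun=> 0 : R) x by exact: differentiable_cst.
  have dD (f1 f2 : V -> R) (k : R) : differentiable f1 x -> differentiable f2 x ->
      differentiable (fun y => f1 y + k * f2 y) x.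
    by move=> d1 d2; apply: differentiableD => //; exact: differentiableZ.
  exact: (linear_class_sum (Pr := fun f => differentiable f x) d0 dD).
rewrite (_ : (fun y => _) = (fun y => \sum_(i <- index_enum 'I_2) al i * complex.Re (eta y i 0) +
    1 * \sum_(i <- index_enum 'I_2) be i * complex.Im (eta y i 0))); last first.
  by apply/funext => y; rewrite h.
rewrite derive_combine; [|exact: dsum|exact: dsum].
rewrite !derive_lincomb// h; congr (_ + 1 * _); apply: eq_bigr => i _; by rewrite mxE.
Qed.

End Components.

(** * The weak equation in chiral coordinates *)

Section WeakFormulation.
Context {R : realType} (S : spinorStructure R) (ep em : spinor R) (n : R).
Notation mu := (@lebesgue_measure R).
Notation mR := (measurableTypeR R).
Notation mu2 := (leb2 R).
Notation P := (mR * mR)%type.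
Notation I := (bool * bool)%type.
Hypothesis n0 : 0 < n.
Hypothesis gt_ep : cmul S dt ep = em.
Hypothesis gx_ep : cmul S dx ep = em.
Hypothesis gt_em : cmul S dt em = ep.
Hypothesis gx_em : cmul S dx em = - ep.
Hypothesis sp_pp : sprod S ep ep = 0.
Hypothesis sp_mm : sprod S em em = 0.
Hypothesis sp_pm : sprod S ep em = n%:C%C.
Hypothesis sp_mp : sprod S em ep = n%:C%C.
Context (lambda kappa : R).
Let k := 2 * kappa * n.
Let co := coord S ep em n.

Let sprod_diracE := sprod_dirac n0 gt_ep gx_ep gt_em gx_em sp_pp sp_mm sp_pm sp_mp.
Let sprod_rhsE := sprod_rhs n0 gt_ep gx_ep gt_em gx_em sp_pp sp_mm sp_pm sp_mp.

Let transport (eta : R * R -> spinor R) j p : components (test_function setT) eta ->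
  co j (spinor_derive dt eta p) - speed j * co j (spinor_derive dx eta p) =
  'D_((1, - speed j) : R * R) (fun q => co j (eta q)) p.
Proof.
move=> te; rewrite /co !(coord_derive S ep em n _ _ _ te) [RHS]derive_plane; first by ring.
apply: smooth_differentiable.
have [//] : test_function setT (fun q => coord S ep em n j (eta q)).
apply: components_coord => //; first exact: test_function0.
by move=> f g c; apply: test_function_combine; exact: hausdorff_plane.
Qed.

(** The imaginary part of the scalar products pairs equal coordinates of the solution and of the
    test spinor, so that a test spinor with a single nonzero coordinate isolates one equation. *)
Lemma weak_thirring_coord (psi : R * R -> spinor R) :
  (forall T, 0 < T -> forall j, H1_2 (slab T) (fun p => co j (psi p))) ->
  weak_thirring S lambda kappa psi -> forall j phi, test_function setT phi ->
  \int[mu2]_p (co j (psi p) * 'D_((1, - speed j) : R * R) phi p) =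
  - \int[mu2]_p (force lambda k j (fun i => co i (psi p)) * phi p).
Proof.
move=> hH wt j phi tp.
(* The factor $-1/n$ cancels the $-n$ of [sprod_dirac]; the form [0 + _] is that of
   [test_function_combine]. *)
pose y (i : I) (p : R * R) : R := if i == j then 0 + - n^-1 * phi p else 0.
have ty i : test_function setT (y i).
  rewrite /y; case: (i == j); last exact: test_function0.
  by apply: test_function_combine => //; do ?[exact: hausdorff_plane|exact: test_function0].
have te : components (test_function setT) (fun p => spinor_of ep em (fun i => y i p)).
  apply: coord_components_of => //; first exact: test_function0.
  by move=> f g c; apply: test_function_combine; exact: hausdorff_plane.
have [sphi _ _] := tp.
have yE i p : co i (spinor_of ep em (fun i => y i p)) = y i p.
  by rewrite /co (coord_spinor_of n0 sp_pp sp_mm sp_pm sp_mp).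
have DyE i p : 'D_((1, - speed i) : R * R) (y i) p =
    if i == j then - n^-1 * 'D_((1, - speed j) : R * R) phi p else 0.
  rewrite /y; case: eqP => [->|_]; last exact: derive_cst.
  rewrite derive_combine; first by rewrite derive_cst add0r.
    exact: differentiable_cst.
  exact: smooth_differentiable.
have tE i p : co i (spinor_derive dt (fun p => spinor_of ep em (fun i => y i p)) p) -
    speed i * co i (spinor_derive dx (fun p => spinor_of ep em (fun i => y i p)) p) =
    if i == j then - n^-1 * 'D_((1, - speed j) : R * R) phi p else 0.
  rewrite transport// -DyE; congr ('D_ _ _ p).
  by apply/funext => q; exact: yE.
have := congr1 (@complex.Im R) (wt _ te); rewrite /cintegral2 /=.
rewrite (eq_Rintegral mu2 (g := fun p => co j (psi p) * 'D_((1, - speed j) : R * R) phi p)); last first.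
  move=> p _; rewrite /dirac sprod_diracE /= -!/(co _) !tE.
  have nn : n * n^-1 = 1 by rewrite divff// gt_eqF.
  transitivity ((n * n^-1) * (co j (psi p) * 'D_((1, - speed j) : R * R) phi p)); last by rewrite nn mul1r.
  by case: (j) => [[] []] /=; ring.
move=> ->; rewrite (eq_Rintegral mu2 (g := fun p => (-1) * (force lambda k j (fun i => co i (psi p)) * phi p))); last first.
  move=> p _; rewrite sprod_rhsE /= -!/(co _) !yE -/k.
  have nn : n * n^-1 = 1 by rewrite divff// gt_eqF.
  transitivity ((n * n^-1) * ((-1) * (force lambda k j (fun i => co i (psi p)) * phi p))); last by rewrite nn mul1r.
  by rewrite /y; case: (j) => [[] []] /=; ring.
have [T T0 ts] := test_function_slab tp.
rewrite RintegralZl ?mulN1r//.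
have := locint2_test_integrable (force_slab_locint2 lambda k j T0 (hH T T0)) ts.
apply: eq_integrable => // p _; rewrite /= patchE.
case: (boolP (p \in slab T)) => // /negP np.
by rewrite (test_function_out ts) ?mulr0// => Tp; apply: np; rewrite inE.
Qed.

Let Rintegral4 (a b c d : R) (f1 f2 f3 f4 : P -> R) :
  mu2.-integrable setT (EFin \o f1) -> mu2.-integrable setT (EFin \o f2) ->
  mu2.-integrable setT (EFin \o f3) -> mu2.-integrable setT (EFin \o f4) ->
  \int[mu2]_p (a * f1 p + b * f2 p + (c * f3 p + d * f4 p)) =
  a * \int[mu2]_p f1 p + b * \int[mu2]_p f2 p + (c * \int[mu2]_p f3 p + d * \int[mu2]_p f4 p).
Proof.
move=> i1 i2 i3 i4; have z1 := intgZ measurableT a i1; have z2 := intgZ measurableT b i2.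
have z3 := intgZ measurableT c i3; have z4 := intgZ measurableT d i4.
rewrite -!RintegralZl// -!RintegralD//; exact: intgD.
Qed.

(** In the real part, [j] is paired with [other j]. Both coordinates have the same speed, so that
    the equation of one may be tested with the derivative of the other. *)
Lemma weak_thirring_of_coord (f : I -> P -> R) :
  (forall j, locint2 (f j)) -> (forall j, locint2 (fun p => force lambda k j (fun i => f i p))) ->
  (forall j phi, test_function setT phi ->
    \int[mu2]_p (f j p * 'D_((1, - speed j) : R * R) phi p) =
    - \int[mu2]_p (force lambda k j (fun i => f i p) * phi p)) ->
  weak_thirring S lambda kappa (fun p => spinor_of ep em (fun j => f j p)).
Proof.
move=> lf lF H eta te.
pose c j (p : R * R) := co j (eta p).
have tc j : test_function setT (c j).
  apply: components_coord => //; first exact: test_function0.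
  by move=> u w b; apply: test_function_combine; exact: hausdorff_plane.
pose D j : R * R -> R := 'D_((1, - speed j) : R * R) (c j).
have tD j : test_function setT (D j) by apply: test_function_derive => //; exact: hausdorff_plane.
have fE p j : co j (spinor_of ep em (fun j => f j p)) = f j p.
  by rewrite /co (coord_spinor_of n0 sp_pp sp_mm sp_pm sp_mp).
have fE' p : co^~ (spinor_of ep em (fun j => f j p)) = (fun j => f j p).
  by apply/funext => j; exact: fE.
have i1 i j := locint2_test_integrable (lf i) (tD j).
have i2 i j := locint2_test_integrable (lF i) (tc j).
pose X i j := \int[mu2]_p (f i p * D j p).
pose Y i j := \int[mu2]_p (force lambda k i (fun l => f l p) * c j p).
have XY i j : speed i = speed j :> R -> X i j = - Y i j.
  by move=> e; rewrite /X /D -e H.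
rewrite /cintegral2.
congr (_ +i* _)%C.
- rewrite (eq_Rintegral mu2 (g := fun p => n * (f (true, true) p * D (true, false) p) +
      (- n) * (f (true, false) p * D (true, true) p) +
      (n * (f (false, true) p * D (false, false) p) +
      (- n) * (f (false, false) p * D (false, true) p)))); last first.
    move=> p _; rewrite /dirac sprod_diracE /= -!/(co _) !transport// !fE /D /c; ring.
  rewrite [RHS](eq_Rintegral mu2 (g := fun p =>
      (- n) * (force lambda k (true, true) (fun l => f l p) * c (true, false) p) +
      n * (force lambda k (true, false) (fun l => f l p) * c (true, true) p) +
      ((- n) * (force lambda k (false, true) (fun l => f l p) * c (false, false) p) +
      n * (force lambda k (false, false) (fun l => f l p) * c (false, true) p)))); last first.
    move=> p _; rewrite sprod_rhsE /= -!/(co _) fE' -/k /c; ring.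
  by rewrite !Rintegral4// -!/(X _ _) -!/(Y _ _) !XY//; ring.
- rewrite (eq_Rintegral mu2 (g := fun p => (- n) * (f (true, false) p * D (true, false) p) +
      (- n) * (f (true, true) p * D (true, true) p) +
      ((- n) * (f (false, false) p * D (false, false) p) +
      (- n) * (f (false, true) p * D (false, true) p)))); last first.
    move=> p _; rewrite /dirac sprod_diracE /= -!/(co _) !transport// !fE /D /c; ring.
  rewrite [RHS](eq_Rintegral mu2 (g := fun p =>
      n * (force lambda k (true, false) (fun l => f l p) * c (true, false) p) +
      n * (force lambda k (true, true) (fun l => f l p) * c (true, true) p) +
      (n * (force lambda k (false, false) (fun l => f l p) * c (false, false) p) +
      n * (force lambda k (false, true) (fun l => f l p) * c (false, true) p)))); last first.
    move=> p _; rewrite sprod_rhsE /= -!/(co _) fE' -/k /c; ring.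
  by rewrite !Rintegral4// -!/(X _ _) -!/(Y _ _) !XY//; ring.
Qed.

End WeakFormulation.

(** * Global well-posedness for data in H^1 *)

Theorem theorem3p7 (R : realType) (S : spinorStructure R) (lambda kappa : R)
    (psi0 : R -> spinor R) (hpsi0 : components (H1_1 setT) psi0) :
  exists2 psi : R * R -> spinor R,
    global_weak_solution S lambda kappa psi0 psi &
    forall psi' : R * R -> spinor R,
      global_weak_solution S lambda kappa psi0 psi' ->
      {ae leb2 R, forall p, psi' p = psi p}.
Proof.
pose mu := @lebesgue_measure R; pose mR := measurableTypeR R.
have [ep [em [n [[n0 gt_ep gx_ep gt_em gx_em] [sp_pp sp_mm sp_pm sp_mp]]]]] := chiral_frame S.
pose co := coord S ep em n.
have coK (y : (bool * bool)%type -> R) j : co j (spinor_of ep em y) = y j.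
  exact: (coord_spinor_of n0 sp_pp sp_mm sp_pm sp_mp).
have Kco psi : spinor_of ep em (co ^~ psi) = psi.
  exact: (spinor_ofK n0 sp_pp sp_mm sp_pm sp_mp).
have betaE psi : betanorm2 S psi = n * \sum_j co j psi ^+ 2.
  exact: (betanorm2_coord n0 gt_ep gt_em sp_pp sp_mm sp_pm sp_mp).
have hline : components (@H1_line R) psi0.
  by move=> i; have [h1 h2] := hpsi0 i; split; exact: H1_1_abscont.
have /choice[F0 /choice[G0 hF]] : forall j, exists F g : R -> R,
  [/\ abscont F g, L2i mu F, L2i mu g, {ae mu, forall x, co j (psi0 x) = F x} &
      exists M, forall x, `|F x| <= M].
  by move=> j; apply: (components_coord S ep em n (@H1_line0 R) (@H1_line_combine R) hline).
have acF j : abscont (F0 j) (G0 j) by case: (hF j).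
have LF j : L2i mu (F0 j) by case: (hF j).
have LG j : L2i mu (G0 j) by case: (hF j).
have psi0E j : {ae mu, forall x, co j (psi0 x) = F0 j x} by case: (hF j).
have [M dM] : exists M, forall j x, `|F0 j x| <= M.
  have /choice[B hB] : forall j, exists M, forall x, `|F0 j x| <= M by move=> j; case: (hF j).
  exists (\sum_j `|B j|) => j x; apply: (le_trans (hB j x)); apply: (le_trans (ler_norm _)).
  by rewrite (bigD1 j)//= lerDl sumr_ge0.
have mF0 j : measurable_fun (setT : set mR) (F0 j) by case: (LF j).
(* The coupling constant of the real system, as it comes out of [sprod_rhs]. *)
set k := 2 * kappa * n.
have [f [bf fE ffin0]] := real_system_solution lambda k mF0 dM.
have ffin T : 0 < T -> forall j, (wnorm 0 T (f j) < +oo)%E.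
  move=> T0; apply: ffin0 => // j; rewrite wnorm_free//.
  apply: lte_mul_pinfty; rewrite ?lee_fin//; first by rewrite mulr_ge0// ltW.
  exact: L2i_lty.
have fH T j : 0 < T -> H1_2 (slab T) (f j).
  by move=> T0; exact: (solution_H1 acF LF LG bf fE ffin j T0).
pose psi (p : R * R) := spinor_of ep em (fun j => f j p).
have bforce j := slab_bounded_force lambda k bf j.
have mpsi0 j : measurable_fun (setT : set mR) (fun x => co j (psi0 x)).
  apply: (components_coord S ep em n (Pr := fun u : R -> R => measurable_fun (setT : set mR) u)) => //.
    by move=> u v c mu' mv; apply: measurable_funD => //; exact: measurable_funM.
  move=> i; have [[/L2iP L1 _] [/L2iP L2' _]] := hpsi0 i.
  have pT (u : R -> R) : u \_ (setT : set mR) = u by apply/funext => x; rewrite patchE in_setT.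
  by rewrite !pT in L1 L2'; split; [case: L1|case: L2'].
(* The absolutely continuous [F0 j] agrees with the coordinate of [psi0] almost everywhere only, a
   difference that the $L^2$ distance does not see. *)
have initE (g : R * R -> spinor R) j t : measurable_fun (setT : set mR) (fun x => co j (g (t, x))) ->
    (\int[mu]_x ((co j (g (t, x)) - F0 j x) ^+ 2)%:E =
     \int[mu]_x ((co j (g (t, x)) - co j (psi0 x)) ^+ 2)%:E)%E.
  move=> mg; apply: ae_eq_integral => //.
  - by apply/measurable_EFinP; apply: measurable_funX; exact: measurable_funB.
  - by apply/measurable_EFinP; apply: measurable_funX; exact: measurable_funB.
  - by apply: ae_mono (psi0E j) => x -> _.
have sumE (g : R * R -> spinor R) t : (forall j, measurable_fun (setT : set mR) (fun x => co j (g (t, x)))) ->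
    (\int[mu]_x (betanorm2 S (g (t, x) - psi0 x))%:E =
     n%:E * \sum_j \int[mu]_x ((co j (g (t, x)) - F0 j x) ^+ 2)%:E)%E.
  move=> mg.
  under eq_integral => x _ do rewrite betaE EFinM -sumEFin.
  rewrite ge0_integralZl_EFin ?(ltW n0)//; last 2 first.
  - by move=> x _; apply: sume_ge0 => j _; rewrite lee_fin sqr_ge0.
  - apply: emeasurable_sum => j; apply/measurable_EFinP; apply: measurable_funX.
    rewrite (_ : (fun x => _) = (fun x => co j (g (t, x)) - co j (psi0 x))); first exact: measurable_funB.
    by apply/funext => x; exact: coordB.
  congr (_ * _)%E; rewrite ge0_integral_sum//.
  - by apply: eq_bigr => j _; rewrite initE//; apply: eq_integral => x _; rewrite /co coordB.
  - move=> j; apply/measurable_EFinP; apply: measurable_funX.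
    rewrite (_ : (fun x => _) = (fun x => co j (g (t, x)) - co j (psi0 x))); first exact: measurable_funB.
    by apply/funext => x; exact: coordB.
  - by move=> j x _; rewrite lee_fin sqr_ge0.
have slices (g : R * R -> R) t : measurable_fun setT (g : mR * mR -> R) ->
    measurable_fun (setT : set mR) (fun x => g (t, x)).
  by move=> mg; exact: (measurableT_comp mg (pair1_measurable t)).
exists psi.
  split.
  (* The zero function is obtained as the difference of a component with itself. *)
  - move=> T T0; have H0 : H1_2 (slab T) (fun=> 0).
      have := H1_2_combine (-1) (fH T (true, true) T0) (fH T (true, true) T0).
      by congr H1_2; apply/funext => p; rewrite mulN1r subrr.
    apply: coord_components_of => //; first by move=> u w c; exact: H1_2_combine.
    by move=> j; exact: fH.
  - apply: (weak_thirring_of_coord n0 gt_ep gx_ep gt_em gx_em sp_pp sp_mm sp_pm sp_mp).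
    + by move=> j; exact: slab_bounded_locint2.
    + by move=> j; exact: slab_bounded_locint2 (bforce j).
    + by move=> j phi tp; exact: weak_transport (bf j) (bforce j) (fE j) tp.
  (* The squared norm is $n$ times the sum of four squares, so each coordinate is granted the share
     $\varepsilon/(4n)$. *)
  - move=> eps e0; have e4 : 0 < eps / (4 * n) by rewrite divr_gt0// mulr_gt0.
    have /choice[d hd] : forall j, exists d : R, 0 < d /\ forall t, `|t| < d ->
        (\int[mu]_x ((f j (t, x) - F0 j x) ^+ 2)%:E < (eps / (4 * n))%:E)%E.
      by move=> j; have [d d0 hd] := solution_initial acF LF LG bf fE ffin j e4; exists d.
    pose m := Num.min (Num.min (d (true, true)) (d (true, false))) (Num.min (d (false, true)) (d (false, false))).
    exists m; first by rewrite !lt_min !(fun j => (hd j).1).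
    apply: ae_all => t; rewrite !lt_min => /andP[/andP[t1 t2] /andP[t3 t4]].
    have td j : `|t| < d j by case: j => [[] []].
    rewrite sumE; last first.
      move=> j; rewrite (_ : (fun x => _) = (fun x => f j (t, x))); last first.
        by apply/funext => x; exact: coK.
      by apply: slices; case: (bf j).
    have lt j : (\int[mu]_x ((co j (psi (t, x)) - F0 j x) ^+ 2)%:E < (eps / (4 * n))%:E)%E.
      by under eq_integral => x _ do rewrite coK; exact: (hd j).2.
    have ge j : (0 <= \int[mu]_x ((co j (psi (t, x)) - F0 j x) ^+ 2)%:E)%E.
      by apply: integral_ge0 => x _; rewrite lee_fin sqr_ge0.
    pose q j := fine (\int[mu]_x ((co j (psi (t, x)) - F0 j x) ^+ 2)%:E)%E.
    have qE j : (\int[mu]_x ((co j (psi (t, x)) - F0 j x) ^+ 2)%:E = (q j)%:E)%E.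
      by rewrite /q fineK// ge0_fin_numE//; exact: lt_trans (lt j) (ltry _).
    under eq_bigr do rewrite qE.
    rewrite sumEFin -EFinM lte_fin.
    have ql j : q j < eps / (4 * n) by rewrite -lte_fin -qE.
    rewrite (eq_bigr (fun k : bool * bool => q (k.1, k.2))); last by case.
    rewrite -(pair_bigA _ (fun b1 b2 : bool => q (b1, b2))) /= !big_bool /= mulrC -ltr_pdivlMr//.
    have -> : eps / n = 4 * (eps / (4 * n)) by field; rewrite gt_eqF.
    have := ql (true, true); have := ql (true, false); have := ql (false, true).
    by have := ql (false, false); lra.
move=> psi' [hH hW hI].
pose fp j (p : R * R) := co j (psi' p).
have fpH T j : 0 < T -> H1_2 (slab T) (fp j).
  move=> T0; have H0 : H1_2 (slab T) (fun=> 0).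
    have := H1_2_combine (-1) (fH T (true, true) T0) (fH T (true, true) T0).
    by congr H1_2; apply/funext => p; rewrite mulN1r subrr.
  apply: (components_coord S ep em n (Pr := H1_2 (slab T))) => //; last exact: hH.
  by move=> u w c; exact: H1_2_combine.
have mfp j : measurable_fun setT (fp j : mR * mR -> R).
  by apply: H1_2_measurable => T T0; exact: fpH.
have fpW := weak_thirring_coord n0 gt_ep gx_ep gt_em gx_em sp_pp sp_mm sp_pm sp_mp
  (fun T T0 j => fpH T j T0) hW.
have fpI j (eps : R) : 0 < eps -> exists2 delta : R, 0 < delta &
  {ae mu, forall t, `|t| < delta -> (\int[mu]_x ((fp j (t, x) - F0 j x) ^+ 2)%:E < eps%:E)%E}.
  (* The factor $n$ of the squared norm cancels, and a single coordinate is bounded by the sum of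
     all four. *)
  move=> e0; have [d d0 hd] := hI (n * eps) (mulr_gt0 n0 e0); exists d => //.
  apply: ae_mono hd => t ht td; have := ht td.
  rewrite sumE; last by move=> i; apply: (slices (fp i)); exact: mfp.
  rewrite EFinM lte_pmul2l ?lte_fin//; apply: le_lt_trans.
  rewrite (bigD1 j)//= leeDl// sume_ge0// => i _.
  by apply: integral_ge0 => x _; rewrite lee_fin sqr_ge0.
have uniq j := real_system_unique acF LF LG dM bf fE ffin fpH fpW fpI j.
(* The four null sets are united through the enumeration of the index type. *)
have h (i : nat) : {ae leb2 R, forall p, forall j, unpickle i = Some j -> fp j p = f j p}.
  case: (unpickle i : option (bool * bool)) => [j|]; last by apply: ae_all.
  by apply: ae_mono (uniq j) => p hp l [<-].
apply: ae_mono (ae_countable h) => p hp; rewrite -[psi' p]Kco /psi; congr spinor_of.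
by apply/funext => j; apply: (hp (pickle j)); exact: pickleK.
Qed.
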